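(* Let $\mu>0$, $h(x)=\mu+x$, and let $\varphi:[0,\infty)\to[0,\infty)$ be locally square integrable with $\Lambda=\int_0^\infty\varphi(s)\,ds<1$. For each $N\ge1$, let $(Z^{N,1}_t,\dots,Z^{N,N}_t)_{t\ge0}$ be the mean-field Hawkes process with $N$ particles associated with $(h,\varphi)$ (defined in the context). Let $(m_t)_{t\ge0}$ be the unique non-decreasing locally bounded solution to $$m_t=\int_0^t h\Big(\int_0^s\varphi(s-u)\,dm_u\Big)ds,\qquad t\ge0.$$ 1. We have $m_t\sim a_0t$ as $t\to\infty$, where $a_0=\mu/(1-\Lambda)$. 2. For any fixed $i\ge1$, $Z^{N,i}_t/m_t$ tends to $1$ in probability as $t\to\infty$, uniformly in $N$. More precisely, $\mathbb E[|Z^{N,i}_t/m_t-1|]\le C m_t^{-1/2}$ for some constant $C$. 3. For any fixed $\ell\ge1$, $\big(m_t^{1/2}(Z^{N,i}_t/m_t-1)\big)_{i=1,\dots,\ell}$ goes in law to $\mathcal N(0,I_\ell)$ as $(t,N)\to(\infty,\infty)$ (without condition on the regime).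
   Context: The mean-field Hawkes process with $N$ particles associated with $(h,\varphi)$ is the pathwise unique family $(Z^{N,i}_t)_{i=1,\dots,N,\,t\ge0}$ of càdlàg adapted processes with $\mathbb E[Z^{N,i}_t]<\infty$ for all $i,t$, such that a.s. for all $i=1,\dots,N$ and $t\ge0$, $$Z^{N,i}_t=\int_0^t\int_0^\infty\mathbf 1_{\{z\le h(N^{-1}\sum_{j=1}^N\int_0^{s-}\varphi(s-u)\,dZ^{N,j}_u)\}}\,\pi^i(ds\,dz),$$ where $(\pi^i(ds\,dz))_{i\ge1}$ are i.i.d. Poisson measures on $[0,\infty)\times[0,\infty)$ with intensity measure $ds\,dz$ (with respect to the underlying filtration). $I_\ell$ is the $\ell\times\ell$ identity matrix. The notation $f(t)\sim g(t)$ means $f(t)/g(t)\to1$. *)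

(* Defs.v *)
From HB Require Import structures.
From mathcomp Require Import all_boot all_order all_algebra finmap.
From mathcomp Require Import all_classical all_reals all_analysis.
From mathcomp Require Import measurable_realfun.

Set Implicit Arguments.
Unset Strict Implicit.
Unset Printing Implicit Defensive.

Import Order.TTheory GRing.Theory Num.Theory.
Import numFieldNormedType.Exports.

Local Open Scope classical_set_scope.
Local Open Scope ring_scope.

Section stieltjes.
Context {R : realType}.

(* Functions of time live on R but only their values on [0, +oo[ matter; the
   extension by f 0 on the negative half-line puts no mass on {0}, which is
   harmless since all integrators below vanish at 0. *)
Definition extend0 (f : R -> R) : R -> R := fun t => f (Num.max 0 t).

Definition is_cumulative (f : R -> R) : Prop :=
  nondecreasing (extend0 f) /\ right_continuous (extend0 f).

Definition cumulative_of (f : R -> R) (fP : is_cumulative f) :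
    cumulative R R :=
  HB.pack_for (cumulative R R) (extend0 f)
    (isCumulative.Build R _ R (extend0 f) fP.1 fP.2).

(* The measure df on [0, +oo[. The default value 0 plays no role below: the
   equations force the integrators to be nondecreasing and right-continuous,
   almost surely when they are random. *)
Definition stieltjes (f : R -> R) :
    {measure set (measurableTypeR R) -> \bar R} :=
  match pselect (is_cumulative f) with
  | left fP => lebesgue_stieltjes_measure (cumulative_of fP)
  | right _ => mzero
  end.

End stieltjes.

Section independence.
Context d (Omega : measurableType d) {R : realType} (P : probability Omega R).

Definition mutually_independent (I : choiceType)
    (G : I -> set (set Omega)) : Prop :=
  forall (J : {fset I}) (E : I -> set Omega),
    (forall i, i \in J -> G i (E i)) ->
    P (\bigcap_(i in [set` J]) E i) = (\prod_(i <- J) P (E i))%E.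

Definition independent2 (G H : set (set Omega)) : Prop :=
  forall A B, G A -> H B -> P (A `&` B) = (P A * P B)%E.

End independence.

Section poisson_random_measure.
Context d (Omega : measurableType d) {R : realType} (P : probability Omega R).

Definition quadrant : set (R * R) := `[0, +oo[ `*` `[0, +oo[.

Definition filtration (F : R -> set (set Omega)) : Prop :=
  [/\ forall t : R, 0 <= t -> sigma_algebra setT (F t),
      forall t : R, 0 <= t -> F t `<=` measurable
    & forall s t : R, 0 <= s -> s <= t -> F s `<=` F t].

Definition sigma_restr (xi : R.-ker Omega ~> (R * R)%type)
    (D : set (R * R)) : set (set Omega) :=
  <<s \bigcup_(A in [set A | measurable A /\ A `<=` D])
        preimage_set_system setT (fun w => xi w A)
          (measurable : set (set (\bar R))) >>.

(* Poisson random measure on the quadrant with intensity ds dz. The second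
   argument of poisson_prob is not used by its definition; poisson_prob 0 is
   the Dirac mass at 0. *)
Definition poisson_measure (xi : R.-ker Omega ~> (R * R)%type) : Prop :=
  (forall A : set (R * R), measurable A -> A `<=` quadrant ->
     ((lebesgue_measure \x lebesgue_measure) A < +oo)%E ->
     forall k : nat,
       P [set w | xi w A = k%:R%:E] =
       poisson_prob (fine ((lebesgue_measure \x lebesgue_measure)%E A)) 0%N
         [set k]) /\
  (forall A : nat -> set (R * R), (forall k, measurable (A k)) ->
     (forall k, A k `<=` quadrant) -> trivIset setT A ->
     mutually_independent P
       (fun k => preimage_set_system setT (fun w => xi w (A k))
          (measurable : set (set (\bar R))))).

Definition adapted_poisson_measure (F : R -> set (set Omega))
    (xi : R.-ker Omega ~> (R * R)%type) : Prop :=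
  [/\ poisson_measure xi,
      forall t : R, 0 <= t -> sigma_restr xi (`[0, t] `*` `[0, +oo[) `<=` F t
    & forall t : R, 0 <= t ->
        independent2 P (F t) (sigma_restr xi (`]t, +oo[ `*` `[0, +oo[))].

Definition iid_poisson_measures (F : R -> set (set Omega))
    (pi : nat -> R.-ker Omega ~> (R * R)%type) : Prop :=
  (forall i, adapted_poisson_measure F (pi i)) /\
  mutually_independent P (fun i => sigma_restr (pi i) quadrant).

End poisson_random_measure.

Section hawkes.
Context d (Omega : measurableType d) {R : realType} (P : probability Omega R).

Definition cadlag (f : R -> R) : Prop :=
  (forall t : R, 0 <= t -> f u @[u --> t^'+] --> f t) /\
  (forall t : R, 0 < t -> cvg (f u @[u --> t^'-])).

Definition adapted (F : R -> set (set Omega)) (X : R -> Omega -> R) : Prop :=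
  forall t : R, 0 <= t -> preimage_set_system setT (X t) measurable `<=` F t.

Definition intensity (h phi : R -> R) (N : nat) (Z : nat -> R -> Omega -> R)
    (w : Omega) (s : R) : R :=
  h (N%:R^-1 *
     \sum_(j < N) \int[stieltjes (fun u => Z j u w)]_(u in `[0, s[) phi (s - u)).

(* Particles are numbered from 0, so that the N particles are the Z i, i < N;
   the values Z i for i >= N are irrelevant. *)
Definition mean_field_hawkes (F : R -> set (set Omega))
    (pi : nat -> R.-ker Omega ~> (R * R)%type) (h phi : R -> R) (N : nat)
    (Z : nat -> R -> Omega -> R) : Prop :=
  [/\ forall i : nat, (i < N)%N -> forall w, cadlag (fun t => Z i t w),
      forall i : nat, (i < N)%N -> adapted F (Z i),
      forall (i : nat) (t : R), (i < N)%N -> 0 <= t -> ('E_P[Z i t] < +oo)%E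
    & {ae P, forall w, forall (i : nat) (t : R), (i < N)%N -> 0 <= t ->
        (Z i t w)%:E =
        (\int[pi i w]_(p in `[0%R, t] `*` `[0%R, +oo[)
           (\1_[set q : R * R | (q.2 <= intensity h phi N Z w q.1)%R] p)%:E)%E}].

End hawkes.

Definition mean_field_limit {R : realType} (h phi m : R -> R) : Prop :=
  [/\ forall s t : R, 0 <= s -> s <= t -> m s <= m t,
      forall T : R, 0 <= T ->
        exists B : R, forall t : R, 0 <= t <= T -> `|m t| <= B
    & forall t : R, 0 <= t ->
        (m t)%:E =
        (\int[lebesgue_measure]_(s in `[0%R, t])
           (h (\int[stieltjes m]_(u in `[0, s]) phi (s - u))%R)%:E)%E].

Section convergence_in_law.
Context {R : realType}.

Definition tcons n (p : measurableTypeR R * n.-tuple R) : n.+1.-tuple R :=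
  [tuple of p.1 :: p.2].

Lemma measurable_tcons n : measurable_fun setT (@tcons n).
Proof. exact: measurable_cons. Qed.

HB.instance Definition _ n :=
  isMeasurableFun.Build _ _ _ _ (@tcons n) (@measurable_tcons n).

(* N(0, I_n), the n-fold product of N(0, 1), on the type of n-tuples, which
   unlike 'rV_n carries the product sigma-algebra in the library. *)
Fixpoint std_normal (n : nat) : probability (n.-tuple R) R :=
  match n with
  | 0 => dirac [tuple]
  | n'.+1 => distribution (normal_prob 0 1 \x std_normal n')%E (@tcons n')
  end.

Definition cvg_in_law d (Omega : measurableType d) (P : probability Omega R)
    (I : Type) (F : set_system I) (n : nat) (X : I -> Omega -> 'rV[R]_n)
    (nu : probability (n.-tuple R) R) : Prop :=
  forall f : 'rV[R]_n -> R, continuous f ->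
    (exists M : R, forall x, `|f x| <= M) ->
    ('E_P[f \o X i])%E @[i --> F] -->
    (\int[nu]_x (f (\row_(j < n) tnth x j))%:E)%E.

End convergence_in_law.

(* Main.v *)
(** Each particle is compared with the Poisson variable obtained by counting, in
    the same Poisson measure, the points below the deterministic limit rate
    lambda = mu + phi * dm; its mean is m_t, so that the central limit theorem
    for Poisson laws and the independence of the Poisson measures give part 3 as
    soon as E|Z^i_t - pi^i({z <= lambda})| = o(sqrt t), uniformly in N large.

    Let A be the cumulated intensity. Every predictable region has compensated
    mass of variance equal to the mean of its area, and compensated masses for
    different particles are orthogonal. Hence E|N^-1 sum Z^j - A| is of order
    sqrt (t / N), the convolution equations give E|A_t - m_t| = O(sqrt (t / N))
    because Lambda < 1, and E|Z^i_t - A_t| = O(sqrt t): this is part 2. For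
    part 3 the difference of the two counts lives on the region between the
    random rate and lambda, whose mean area is E int |rate - lambda|. Splitting
    phi into a step function and a remainder rho of small mass, the step part is
    again a sum of compensated masses, of order t / sqrt N, and the remainder
    contributes at most rho t, so this area is o(t) and its square root o(sqrt t).

    The evolution equation only holds almost surely, so the analysis is made on
    an everywhere well-behaved version of the system, modified on a null set,
    with the filtration completed accordingly. *)

From HB Require Import structures.
Require Import Defs.
From mathcomp Require Import all_boot all_order all_algebra finmap.
From mathcomp Require Import all_classical all_reals all_analysis.
From mathcomp Require Import measurable_realfun.
From mathcomp Require Import ring lra.

Set SsrOldRewriteGoalsOrder.
Set Implicit Arguments.
Unset Strict Implicit.
Unset Printing Implicit Defensive.

Import Order.TTheory GRing.Theory Num.Theory.
Import numFieldNormedType.Exports.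

Local Open Scope classical_set_scope.
Local Open Scope ring_scope.

(** The hypotheses make the future of each single Poisson measure independent of [F t], and distinct
    Poisson measures independent of each other, but they do not say that two of them have jointly a
    future independent of [F t]. Orthogonality of the compensated masses of two particles is
    therefore not a product formula: it is obtained by bisecting time, where the mixed terms vanish
    one particle at a time and the diagonal terms are quadratic in the mesh. Second moments are
    available only after truncating the height. They serve to bound first moments, through |x| <= (e
    x^2 + 1/e) / 2, a bound that survives the removal of the truncation; tuning e recovers
    Cauchy-Schwarz. In part 3 the threshold on N must not depend on t, so the bounds on the rates
    are kept linear in t, with a coefficient made small by the splitting of phi and then by N. The
    Poisson central limit theorem compares point masses with the Gaussian density up to a factor
    that is identified by total mass, so neither Stirling's formula nor characteristic functions
    enter. *)

Section independence_integral.
Local Open Scope ereal_scope.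
Context d (T : measurableType d) (R : realType) (P : probability T R).

(** Independence says that the law of the pair is the product of the laws, and Tonelli on that
    product separates the factors. *)
Lemma ge0_integral_indep (X Y : T -> \bar R) :
  measurable_fun setT X -> measurable_fun setT Y ->
  (forall w, 0 <= X w) -> (forall w, 0 <= Y w) ->
  (forall A B, measurable A -> measurable B ->
    P (X @^-1` A `&` Y @^-1` B) = P (X @^-1` A) * P (Y @^-1` B)) ->
  \int[P]_w (X w * Y w) = \int[P]_w X w * \int[P]_w Y w.
Proof.
move=> mX mY X0 Y0 XY.
pose X' : {mfun T >-> \bar R} := HB.pack X (isMeasurableFun.Build _ _ _ _ X mX).
pose Y' : {mfun T >-> \bar R} := HB.pack Y (isMeasurableFun.Build _ _ _ _ Y mY).
have mXY : measurable_fun setT (fun w => (X w, Y w)) by exact/measurable_fun_pair.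
pose XY' : {mfun T >-> (\bar R * \bar R)%type} :=
  HB.pack (fun w => (X w, Y w)) (isMeasurableFun.Build _ _ _ _ _ mXY).
(* The positive parts make the integrand nonnegative on the whole plane, as Tonelli requires; on the
   values of [X] and [Y] they change nothing. *)
pose f (z : \bar R * \bar R) := maxe 0 z.1 * maxe 0 z.2.
have mf : measurable_fun setT f.
  by apply: emeasurable_funM; apply: measurable_maxe => //.
have f0 z : 0 <= f z by rewrite mule_ge0// le_max lexx.
have maxX w : maxe 0 (X w) = X w by rewrite max_r.
have maxY w : maxe 0 (Y w) = Y w by rewrite max_r.
transitivity (\int[distribution P XY']_z f z).
  rewrite ge0_integral_distribution//; apply: eq_integral => w _.
  by rewrite /f/= maxX maxY.
rewrite (eq_measure_integral (distribution P X' \x distribution P Y')); last first.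
  move=> A mA _; apply/esym; apply: product_measure_unique => //.
rewrite fubini_tonelli1//=.
have intY x : \int[distribution P Y']_y f (x, y) = maxe 0 x * \int[P]_w Y w.
  rewrite /f/= ge0_integralZl//; last 3 first.
  - by apply: measurable_maxe => //.
  - by move=> y _; rewrite le_max lexx.
  - by rewrite le_max lexx.
  rewrite ge0_integral_distribution//; last 2 first.
  - by apply: measurable_maxe => //.
  - by move=> y; rewrite le_max lexx.
  by congr (_ * _); apply: eq_integral => w _ /=; rewrite maxY.
rewrite /fubini_F; under eq_integral do rewrite intY.
rewrite ge0_integralZr//; last 3 first.
- by apply: measurable_maxe => //.
- by move=> y _; rewrite le_max lexx.
- exact: integral_ge0.
rewrite ge0_integral_distribution//; last 2 first.
- by apply: measurable_maxe => //.
- by move=> y; rewrite le_max lexx.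
by congr (_ * _); apply: eq_integral => w _ /=; rewrite maxX.
Qed.

End independence_integral.

Section section_mass.
Context d d' (T : measurableType d) (U : measurableType d') (R : realType).
Implicit Types C D : set (T * U).
Variables (k : R.-ker T ~> U) (B : set U).
Hypotheses (mB : measurable B) (kB : forall w, (k w B < +oo)%E).

Definition section_mass (C : set (T * U)) (w : T) : R :=
  fine (k w (xsection C w `&` B)).

Let mCB C w : measurable C -> d'.-measurable (xsection C w `&` B).
Proof. by move=> mC; apply: measurableI => //; exact: measurable_xsection. Qed.

Let fin C w : measurable C -> (k w (xsection C w `&` B) < +oo)%E.
Proof.
move=> mC; apply: le_lt_trans (kB w); apply: le_measure; rewrite ?inE//.
exact: mCB.
Qed.

Lemma section_massE C w : measurable C ->
  (section_mass C w)%:E = k w (xsection C w `&` B).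
Proof. by move=> mC; rewrite fineK// ge0_fin_numE// fin. Qed.

Lemma measurable_section_mass C : measurable C ->
  measurable_fun setT (section_mass C).
Proof.
move=> mC; apply/measurable_EFinP.
(* Measurability in w of the mass of sections rests on a monotone class argument that needs a finite
   bound on the kernel at each w; the restriction to [B] provides one. *)
have h : forall w, exists M, forall X, measurable X -> (mrestr (k w) mB X < M%:E)%E.
  move=> w; exists (fine (k w B) + 1) => X mX.
  rewrite EFinD fineK ?ge0_fin_numE//.
  apply: (@le_lt_trans _ _ (k w B)).
    by apply: le_measure; rewrite ?inE//; exact: measurableI.
  by rewrite lteDl ?ge0_fin_numE// lte01.
have [_] := measurable_prod_subset_xsection_kernel h mC.
apply: eq_measurable_fun => w _.
by rewrite /= section_massE.
Qed.

Lemma section_mass_ge0 C w : 0 <= section_mass C w.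
Proof. by rewrite fine_ge0. Qed.

Lemma le_section_mass C D w : measurable C -> measurable D -> C `<=` D ->
  section_mass C w <= section_mass D w.
Proof.
move=> mC mD CD; rewrite -lee_fin !section_massE//.
apply: le_measure; rewrite ?inE//; try exact: mCB.
by apply: setSI; exact: le_xsection.
Qed.

Lemma section_massT w : section_mass setT w = fine (k w B).
Proof. by rewrite /section_mass -setXTT in_xsectionX ?setTI// inE. Qed.

Lemma section_massU C D w : measurable C -> measurable D -> C `&` D = set0 ->
  section_mass (C `|` D) w = section_mass C w + section_mass D w.
Proof.
move=> mC mD CD; apply: EFin_inj.
rewrite EFinD !section_massE//; last exact: measurableU.
rewrite xsectionE preimage_setU -!xsectionE setIUl measureU//; try exact: mCB.
by rewrite setIACA -xsectionI CD xsection0 set0I.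
Qed.

Lemma section_massD C D w : measurable C -> measurable D -> D `<=` C ->
  section_mass (C `\` D) w = section_mass C w - section_mass D w.
Proof.
move=> mC mD CD; apply/eqP; rewrite eq_sym subr_eq; apply/eqP.
rewrite -section_massU//; first by rewrite setUC setDUK.
- exact: measurableD.
- by rewrite setDE -setIA setICl setI0.
Qed.

Lemma section_mass_cvg (C : (set (T * U))^nat) w :
  (forall n, measurable (C n)) -> nondecreasing_seq C ->
  section_mass (C n) w @[n --> \oo] --> section_mass (\bigcup_n C n) w.
Proof.
move=> mC ndC; apply/fine_cvg; rewrite section_massE; last exact: bigcup_measurable.
rewrite xsection_bigcup setI_bigcupl; apply: nondecreasing_cvg_mu.
- by move=> n; exact: mCB.
- by apply: bigcup_measurable => n _; exact: mCB.
- move=> n m nm; apply/subsetPset; apply: setSI; apply: le_xsection.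
  by apply/subsetPset; exact: ndC.
Qed.

End section_mass.

Lemma monotone_integral_cvg d (T : measurableType d) (R : realType)
    (mu : {measure set T -> \bar R}) (g : (T -> \bar R)^nat) (f : T -> \bar R) :
  (forall n, measurable_fun setT (g n)) -> (forall n w, 0 <= g n w)%E ->
  (forall w n m, (n <= m)%N -> (g n w <= g m w)%E) ->
  (forall w, g n w @[n --> \oo] --> f w) ->
  (\int[mu]_w g n w)%E @[n --> \oo] --> (\int[mu]_w f w)%E.
Proof.
move=> mg g0 nd gf.
rewrite [X in _ --> X](_ : _ = (\int[mu]_w (limn (g^~ w)))%E); last first.
  by apply: eq_integral => w _; exact/esym/cvg_lim.
apply: (cvg_monotone_convergence measurableT mg) => // w _ n m nm; exact: nd.
Qed.

Lemma cvgn_sum (R : realType) (I : Type) (s : seq I) (f : I -> nat -> R) (l : I -> R) :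
  (forall k, f k n @[n --> \oo] --> l k) ->
  \sum_(k <- s) f k n @[n --> \oo] --> \sum_(k <- s) l k.
Proof.
move=> fl; elim: s => [|k s IH].
  by under eq_fun do rewrite big_nil; rewrite big_nil; exact: cvg_cst.
under eq_fun do rewrite big_cons.
by rewrite big_cons; apply: cvgD.
Qed.

Section measurable_gt.
Context d (T : measurableType d) (R : realType).

Lemma measurable_fun_gt (f : T -> R) :
  (forall r, measurable [set x | r < f x]) -> measurable_fun setT f.
Proof.
move=> mf mD; apply: (measurability _ (RGenOInfty.measurableE R)) => //.
move=> _ [_ [x ->] <-]; rewrite setTI.
rewrite (_ : f @^-1` `]x, +oo[ = [set y | x < f y]); first exact: mf.
by apply/seteqP; split => y /=; rewrite in_itv/= andbT.
Qed.

Lemma emeasurable_fun_gt (f : T -> \bar R) : (forall x, 0 <= f x)%E ->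
  (forall r, 0 <= r -> measurable [set x | (r%:E < f x)%E]) -> measurable_fun setT f.
Proof.
move=> f0 mf mD; apply: (measurability _ (ErealGenOInfty.measurableE R)) => //.
move=> _ [_ [x ->] <-]; rewrite setTI.
rewrite (_ : f @^-1` _ = [set y | (x%:E < f y)%E]); last first.
  by apply/seteqP; split => y /=; rewrite in_itv/= andbT.
have [x0|x0] := leP 0 x; first exact: mf.
rewrite (_ : [set y | _] = setT)//; apply/seteqP; split => // y _ /=.
by rewrite (lt_le_trans _ (f0 y))// lte_fin.
Qed.

End measurable_gt.

(** * Expectation and integrable variables *)

HB.lock Definition Ex d (T : measurableType d) (R : realType)
  (P : probability T R) (f : T -> R) : R := \int[P]_w f w.

Section integrable_rv.
Context d (T : measurableType d) (R : realType) (P : probability T R).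
Implicit Types f g : T -> R.

Local Notation Ex := (@Ex d T R P).

Definition L1 f := P.-integrable setT (EFin \o f).
Definition L2 f := measurable_fun setT f /\ L1 (fun w => f w ^+ 2).

Lemma L1_measurable f : L1 f -> measurable_fun setT f.
Proof. by move=> /measurable_int/measurable_EFinP. Qed.

Lemma L1_le g f : measurable_fun setT f -> (forall w, `|f w| <= g w) ->
  L1 g -> L1 f.
Proof.
move=> mf fg; apply: le_integrable => //; first exact/measurable_EFinP.
by move=> w _; rewrite /= lee_fin (le_trans (fg w))// ler_norm.
Qed.

Lemma L1_cst (c : R) : L1 (fun=> c).
Proof. exact: finite_measure_integrable_cst. Qed.

Lemma L1D f g : L1 f -> L1 g -> L1 (fun w => f w + g w).
Proof. by move=> f1 g1; exact: (integrableD measurableT f1 g1). Qed.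

Lemma L1B f g : L1 f -> L1 g -> L1 (fun w => f w - g w).
Proof. by move=> f1 g1; exact: (integrableB measurableT f1 g1). Qed.

Lemma L1Zl c f : L1 f -> L1 (fun w => c * f w).
Proof. by move=> f1; exact: (integrableZl measurableT c f1). Qed.

Lemma L1_norm f : L1 f -> L1 (fun w => `|f w|).
Proof. by move=> f1; exact: integrable_norm f1. Qed.

Lemma L1_sum (I : Type) (s : seq I) (F : I -> T -> R) :
  (forall i, L1 (F i)) -> L1 (fun w => \sum_(i <- s) F i w).
Proof.
move=> F1; elim: s => [|i s IH].
  by under eq_fun do rewrite big_nil; exact: L1_cst.
by under eq_fun do rewrite big_cons; exact: L1D.
Qed.

Lemma L2_le g f : measurable_fun setT f -> (forall w, `|f w| <= g w) ->
  L2 g -> L2 f.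
Proof.
move=> mf fg [mg g2]; split => //; apply: (L1_le _ _ g2); first exact: measurable_funX.
move=> w; rewrite normrX ler_pXn2r// ?nnegrE//.
by rewrite (le_trans _ (fg w)).
Qed.

Lemma L2_mul f g : L2 f -> L2 g -> L1 (fun w => f w * g w).
Proof.
move=> [mf f2] [mg g2]; apply: (L1_le _ _ (L1D f2 g2)).
  exact: measurable_funM.
move=> w; rewrite normrM -(real_normK (num_real (f w))) -(real_normK (num_real (g w))).
rewrite -subr_ge0; have := sqr_ge0 (`|f w| - `|g w|).
have := normr_ge0 (f w); have := normr_ge0 (g w).
by move: `|f w| `|g w| => x y; nra.
Qed.

Lemma L2_cst (c : R) : L2 (fun=> c).
Proof. by split; [exact: measurable_cst|exact: L1_cst]. Qed.

Lemma L2_L1 f : L2 f -> L1 f.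
Proof.
move=> f2; have := L2_mul f2 (L2_cst 1).
by under eq_fun do rewrite mulr1.
Qed.

Lemma L2D f g : L2 f -> L2 g -> L2 (fun w => f w + g w).
Proof.
move=> f2 g2; split; first by apply: measurable_funD; [case: f2|case: g2].
have h := L1D (L1D f2.2 g2.2) (L1Zl 2 (L2_mul f2 g2)).
apply: eq_integrable h => // w _ /=; congr EFin.
by move: (f w) (g w) => x y; ring.
Qed.

Lemma L2Zl c f : L2 f -> L2 (fun w => c * f w).
Proof.
move=> f2; split; first by apply: measurable_funM => //; case: f2.
by under eq_fun do rewrite exprMn; exact: L1Zl f2.2.
Qed.

Lemma L2B f g : L2 f -> L2 g -> L2 (fun w => f w - g w).
Proof.
move=> f2 g2; have := L2D f2 (L2Zl (-1) g2).
by under eq_fun do rewrite mulN1r.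
Qed.

Lemma L2_norm f : L2 f -> L2 (fun w => `|f w|).
Proof.
move=> f2; split; first by apply: measurableT_comp => //; case: f2.
by under eq_fun do rewrite real_normK ?num_real//; exact: f2.2.
Qed.

Lemma L2_indic A f : measurable A -> L2 f -> L2 (fun w => \1_A w * f w).
Proof.
move=> mA f2; apply: (@L2_le (fun w => `|f w|)).
- by apply: measurable_funM; [exact: measurable_indic|case: f2].
- by move=> w; rewrite normrM indicE ger0_norm// ler_piMl// lern1 leq_b1.
- exact: L2_norm.
Qed.

Lemma ExE f : L1 f -> (Ex f)%:E = (\int[P]_w (f w)%:E)%E.
Proof. by move=> f1; rewrite Ex.unlock fineK//; exact: integrable_fin_num. Qed.

Lemma ExD f g : L1 f -> L1 g -> Ex (fun w => f w + g w) = Ex f + Ex g.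
Proof. by move=> f1 g1; rewrite Ex.unlock; exact: RintegralD. Qed.

Lemma ExB f g : L1 f -> L1 g -> Ex (fun w => f w - g w) = Ex f - Ex g.
Proof. by move=> f1 g1; rewrite Ex.unlock; exact: RintegralB. Qed.

Lemma ExZl c f : L1 f -> Ex (fun w => c * f w) = c * Ex f.
Proof. by move=> f1; rewrite Ex.unlock; exact: RintegralZl. Qed.

Lemma Ex_cst c : Ex (fun=> c) = c.
Proof. by rewrite Ex.unlock Rintegral_cst// -[X in _ * X]/(fine (P setT)) probability_setT mulr1. Qed.

Lemma Ex_sum (I : Type) (s : seq I) (F : I -> T -> R) :
  (forall i, L1 (F i)) -> Ex (fun w => \sum_(i <- s) F i w) = \sum_(i <- s) Ex (F i).
Proof.
move=> F1; elim: s => [|i s IH].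
  rewrite big_nil -[RHS]Ex_cst Ex.unlock; apply: eq_Rintegral => w _; exact: big_nil.
rewrite big_cons -IH -ExD//; last exact: L1_sum.
by rewrite Ex.unlock; apply: eq_Rintegral => w _; rewrite big_cons.
Qed.

Lemma le_Ex f g : L1 f -> L1 g -> (forall w, f w <= g w) -> Ex f <= Ex g.
Proof. by move=> f1 g1 fg; rewrite Ex.unlock; apply: le_Rintegral. Qed.

Lemma Ex_ge0 f : (forall w, 0 <= f w) -> 0 <= Ex f.
Proof. by move=> f0; rewrite Ex.unlock; exact: Rintegral_ge0. Qed.

Lemma norm_Ex f : L1 f -> `|Ex f| <= Ex (fun w => `|f w|).
Proof. by move=> f1; rewrite Ex.unlock; exact: le_normr_Rintegral. Qed.

Lemma eq_Ex f g : f =1 g -> Ex f = Ex g.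
Proof. by move=> fg; rewrite Ex.unlock; apply: eq_Rintegral => w _; exact: fg. Qed.

Lemma Ex_indic A : measurable A -> Ex \1_A = fine (P A).
Proof. by move=> mA; rewrite Ex.unlock /Rintegral integral_indic// setIT. Qed.

Lemma Ex_cvg (F : nat -> T -> R) f g : (forall n, measurable_fun setT (F n)) ->
  (forall w, F n w @[n --> \oo] --> f w) -> L1 g ->
  (forall n w, `|F n w| <= g w) -> Ex (F n) @[n --> \oo] --> Ex f.
Proof.
move=> mF Ff g1 Fg; rewrite Ex.unlock; apply/fine_cvg.
have mf : measurable_fun setT f.
  by apply: (@measurable_fun_cvg _ _ _ _ F) => // w _; exact: Ff.
have f1 : L1 f.
  apply: (L1_le mf _ g1) => w.
  apply: (cvgr_to_le (cvg_norm (Ff w))).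
  by apply: nearW => n; exact: Fg.
rewrite fineK; last exact: integrable_fin_num.
apply: (@dominated_cvg _ _ _ _ _ _ _ _ (EFin \o g)) => //.
- by move=> n; exact/measurable_EFinP.
- move=> w _; apply: cvg_EFin; last exact: Ff.
  exact: nearW.
all: by move=> n w _; rewrite lee_fin.
Qed.

End integrable_rv.

(** * Compensated Poisson masses of predictable regions *)

Section const_kernel.
Context d d' (T : measurableType d) (U : measurableType d') (R : realType).
Variable m : {measure set U -> \bar R}.

Definition const_kernel (_ : T) : {measure set U -> \bar R} := m.

Let measurable_const_kernel B : measurable B ->
  measurable_fun setT (const_kernel ^~ B).
Proof. by move=> mB; exact: measurable_cst. Qed.

HB.instance Definition _ :=
  isKernel.Build d d' T U R const_kernel measurable_const_kernel.

End const_kernel.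

Section plane_area.
Context {R : realType}.

Definition area (A : set (R * R)) : \bar R := (lebesgue_measure \x lebesgue_measure)%E A.

Let area0 : area set0 = 0%E. Proof. exact: measure0. Qed.

Let area_ge0 A : (0 <= area A)%E. Proof. exact: measure_ge0. Qed.

Let area_semi_sigma_additive : semi_sigma_additive area.
Proof.
exact: (@measure_semi_sigma_additive _ _ _
  (product_measure1 (@lebesgue_measure R) (@lebesgue_measure R))).
Qed.

HB.instance Definition _ := isMeasure.Build _ (R * R)%type R area
  area0 area_ge0 area_semi_sigma_additive.

End plane_area.

(** Time 0 is left out, so that half-open strips over []a, b]] tile the box. *)
Definition time_box {R : realType} (T K : R) : set (R * R) :=
  `]0, T] `*` `[0, K].

Section poisson_data.
Context d (Omega : measurableType d) (R : realType) (P : probability Omega R).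
Local Open Scope ereal_scope.

(** What the analysis retains of the Poisson measures. Apart from [pd_box], these are statements
    about probabilities, which survive a modification on a null set provided that the filtration is
    completed accordingly; [pd_box], finiteness at every w, is what the modification buys. *)
Record poisson_data (G : R -> set (set Omega))
    (kap : nat -> R.-ker Omega ~> (R * R)%type) : Prop := {
  pd_filtration : filtration G ;
  pd_box : forall i w T K, kap i w (time_box T K) < +oo ;
  pd_past : forall i t (U : set (R * R)) B, (0 <= t)%R -> measurable U ->
    U `<=` `]0%R, t] `*` `[0%R, +oo[ -> measurable B ->
    G t ((kap i ^~ U) @^-1` B) ;
  pd_future : forall i t (U : set (R * R)) A B, (0 <= t)%R -> measurable U ->
    U `<=` `]t, +oo[ `*` `[0%R, +oo[ -> G t A -> measurable B ->
    P (A `&` (kap i ^~ U) @^-1` B) = P A * P ((kap i ^~ U) @^-1` B) ;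
  pd_indep : forall i j (U V : set (R * R)) A B, i != j ->
    measurable U -> U `<=` quadrant -> measurable V -> V `<=` quadrant ->
    measurable A -> measurable B ->
    P ((kap i ^~ U) @^-1` A `&` (kap j ^~ V) @^-1` B) =
    P ((kap i ^~ U) @^-1` A) * P ((kap j ^~ V) @^-1` B) ;
  pd_mean : forall i (U : set (R * R)), measurable U -> U `<=` quadrant ->
    area U < +oo -> \int[P]_w kap i w U = area U ;
  pd_sqr : forall i (U : set (R * R)), measurable U -> U `<=` quadrant ->
    area U < +oo ->
    \int[P]_w (kap i w U * kap i w U) = area U + area U * area U
}.

End poisson_data.

Section predictable.
Context d (Omega : measurableType d) (R : realType).
Variable G : R -> set (set Omega).

Definition predictable_rectangle : set (set (Omega * (R * R))) :=
  [set C | exists a b A B, [/\ 0 <= a, G a A, measurable B &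
    C = A `*` (`]a, b] `*` B)]].

Definition predictable : set (set (Omega * (R * R))) :=
  <<s predictable_rectangle >>.

Hypothesis filG : filtration G.

Lemma filtrationI t A B : 0 <= t -> G t A -> G t B -> G t (A `&` B).
Proof.
case: filG => + _ _ t0 => /(_ t t0)/sigma_algebraP => /(_ (fun _ _ => @subsetT _ _)).
by case=> _ _ _; exact.
Qed.

Lemma filtrationT t : 0 <= t -> G t setT.
Proof.
case: filG => + _ _ t0 => /(_ t t0)/sigma_algebraP => /(_ (fun _ _ => @subsetT _ _)).
by case.
Qed.

Lemma predictable_rectangleI : setI_closed predictable_rectangle.
Proof.
move=> _ _ [a [b [A [B [a0 GA mB ->]]]]] [a' [b' [A' [B' [a'0 GA' mB' ->]]]]].
exists (Num.max a a'), (Num.min b b'), (A `&` A'), (B `&` B').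
have [sG _ mon] := filG.
have m0 : 0 <= Num.max a a' by rewrite le_max a0.
split => //.
- apply: filtrationI => //; first by apply: mon GA => //; rewrite le_max lexx.
  by apply: mon GA' => //; rewrite le_max lexx orbT.
- exact: measurableI.
- rewrite -!setXI; congr (_ `*` (_ `*` _)).
  apply/seteqP; split => x /=; rewrite !in_itv/= gt_max le_min.
    by move=> [/andP[-> ->] /andP[-> ->]].
  by move=> /andP[/andP[-> ->] /andP[-> ->]].
Qed.

Lemma measurable_predictable C : predictable C -> measurable C.
Proof.
suff : predictable_rectangle `<=` measurable.
  by move=> /(smallest_sub (@sigma_algebra_measurable _ _)); exact.
move=> _ [a [b [A [B [a0 GA mB ->]]]]].
apply: measurableX; last exact: measurableX.
by have [_ sub _] := filG; exact: sub GA.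
Qed.

End predictable.

HB.lock Definition mass d (Omega : measurableType d) (R : realType)
  (kap : nat -> R.-ker Omega ~> (R * R)%type) i U w : R := fine (kap i w U).

HB.lock Definition cmass d (Omega : measurableType d) (R : realType)
  (kap : nat -> R.-ker Omega ~> (R * R)%type) i U w : R :=
  mass kap i U w - fine (area U).

Section compensated_mass.
Context d (Omega : measurableType d) (R : realType) (P : probability Omega R).
Variables (G : R -> set (set Omega)) (kap : nat -> R.-ker Omega ~> (R * R)%type).
Hypothesis pd : poisson_data P G kap.
Variables T K : R.

Let box := time_box T K.
Local Notation mass := (mass kap).
Local Notation cmass := (cmass kap).

Lemma measurable_time_box : measurable box.
Proof. by apply: measurableX; exact: measurable_itv. Qed.

Lemma area_time_box : (area box < +oo)%E.
Proof.
rewrite /box/time_box /area product_measure1E//= !lebesgue_measure_itv/= !lte_fin.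
by case: ifPn => _; case: ifPn => _; rewrite ?mule0 ?mul0e// -EFinB -EFinM ltry.
Qed.

Lemma time_box_quadrant : box `<=` quadrant.
Proof.
move=> [s z] [/=]; rewrite !in_itv/= => /andP[s0 _] /andP[z0 _].
by split; rewrite /= in_itv/= ?z0 ?(ltW s0).
Qed.

Let bset (U : set (R * R)) := measurable U /\ U `<=` box.

Let quad U : bset U -> U `<=` quadrant.
Proof. by move=> [_ Ub]; exact: subset_trans Ub time_box_quadrant. Qed.

Let areafin U : bset U -> (area U < +oo)%E.
Proof.
move=> [mU Ub]; apply: le_lt_trans area_time_box; apply: le_measure; rewrite ?inE//.
exact: measurable_time_box.
Qed.

Lemma mass_ge0 i U w : 0 <= mass i U w.
Proof. by rewrite mass.unlock fine_ge0. Qed.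

Lemma massE i U w : bset U -> (mass i U w)%:E = kap i w U.
Proof.
move=> [mU Ub]; rewrite mass.unlock fineK// ge0_fin_numE//.
apply: le_lt_trans (pd_box pd i w T K); apply: le_measure; rewrite ?inE//.
exact: measurable_time_box.
Qed.

Let areaE U : bset U -> (fine (area U))%:E = area U.
Proof. by move=> Ub; rewrite fineK// ge0_fin_numE// areafin. Qed.

Lemma measurable_mass i U : bset U -> measurable_fun setT (mass i U).
Proof.
move=> Ub; apply/measurable_EFinP.
apply: eq_measurable_fun (measurable_kernel (kap i) U Ub.1) => w _.
by rewrite /= massE.
Qed.

Lemma mass_L2 i U : bset U -> L2 P (mass i U).
Proof.
move=> Ub; split; first exact: measurable_mass.
apply/integrableP; split.
  by apply/measurable_EFinP; apply: measurable_funX; exact: measurable_mass.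
under eq_integral => w _ do
  rewrite /= ger0_norm ?sqr_ge0// expr2 EFinM !massE//.
rewrite (pd_sqr pd) ?areafin//; first by rewrite -areaE// -EFinM -EFinD ltry.
- by case: Ub.
- exact: quad.
Qed.

Lemma Ex_mass i U : bset U -> Ex P (mass i U) = fine (area U).
Proof.
move=> Ub; rewrite Ex.unlock /Rintegral; congr fine.
under eq_integral => w _ do rewrite massE//.
by rewrite (pd_mean pd)// ?areafin//; [case: Ub|exact: quad].
Qed.

Lemma cmass_L2 i U : bset U -> L2 P (cmass i U).
Proof. by move=> Ub; rewrite cmass.unlock; apply: L2B; [exact: mass_L2|exact: L2_cst]. Qed.

Lemma cmassU i U V w : bset U -> bset V -> U `&` V = set0 ->
  cmass i (U `|` V) w = cmass i U w + cmass i V w.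
Proof.
move=> Ub Vb UV.
have UVb : bset (U `|` V).
  split; first by apply: measurableU; [case: Ub|case: Vb].
  by rewrite subUset; split; [case: Ub|case: Vb].
have aD : fine (area (U `|` V)) = fine (area U) + fine (area V).
  apply: EFin_inj; rewrite EFinD !areaE// measureU//; [by case: Ub|by case: Vb].
have mD : mass i (U `|` V) w = mass i U w + mass i V w.
  apply: EFin_inj; rewrite EFinD !massE// measureU//; [by case: Ub|by case: Vb].
rewrite cmass.unlock aD mD; move: (fine _) (fine _) (mass _ _ _) (mass _ _ _) => x y z t.
by ring.
Qed.

Lemma cmass0 i w : cmass i set0 w = 0.
Proof. by rewrite cmass.unlock mass.unlock !measure0 subrr. Qed.

(** A mass strictly after t is independent of [G t], hence of [Y]. Taking [Y] nonnegative gives the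
    product formula before the product is known to be integrable. *)
Lemma Ex_future t i (Y : Omega -> R) U : 0 <= t -> bset U ->
  U `<=` `]t, +oo[ `*` `[0, +oo[ ->
  (forall w, 0 <= Y w) -> (forall B, measurable B -> G t (Y @^-1` B)) ->
  L1 P Y ->
  L1 P (fun w => Y w * mass i U w) /\
  Ex P (fun w => Y w * mass i U w) = Ex P Y * fine (area U).
Proof.
move=> t0 Ub Ut Y0 GY Y1.
have E : (\int[P]_w (Y w * mass i U w)%:E = (Ex P Y * fine (area U))%:E)%E.
  under eq_integral => w _ do rewrite EFinM massE//.
  rewrite ge0_integral_indep//.
  - by rewrite EFinM ExE// areaE// (pd_mean pd)// ?areafin//;
      [case: Ub|exact: quad].
  - by apply/measurable_EFinP; exact: L1_measurable Y1.
  - by apply: measurable_kernel; case: Ub.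
  - move=> A B mA mB; apply: (pd_future pd _ t0) => //; first by case: Ub.
      apply: (GY (EFin @^-1` A)); rewrite -[X in measurable X]setTI.
    exact: (@EFin_measurable _ setT).
have I1 : L1 P (fun w => Y w * mass i U w).
  apply/integrableP; split.
    apply/measurable_EFinP; apply: measurable_funM; first exact: L1_measurable Y1.
    exact: measurable_mass.
  under eq_integral => w _ do rewrite /= ger0_norm ?mulr_ge0 ?mass_ge0//.
  by rewrite E ltry.
by split => //; apply: EFin_inj; rewrite ExE.
Qed.

Lemma filtration_measurableP t (f : Omega -> R) : 0 <= t ->
  @measurable_fun _ _ (g_sigma_algebraType (G t)) R setT f <->
  forall B, measurable B -> G t (f @^-1` B).
Proof.
move=> t0; have [sG _ _] := pd_filtration pd.
have E : <<s G t >> = G t by apply: sigma_algebra_id; exact: sG.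
split=> [mf B mB|GfB].
  by have := mf measurableT B mB; rewrite setTI/measurable/= E.
by move=> _ B mB; rewrite setTI /measurable/= E; exact: GfB.
Qed.

Lemma filtration_measurable_indicM t (f : Omega -> R) A : 0 <= t -> G t A ->
  (forall B, measurable B -> G t (f @^-1` B)) ->
  forall B, measurable B -> G t ((fun w => \1_A w * f w) @^-1` B).
Proof.
move=> t0 GA /(filtration_measurableP _ t0) mf; apply/(filtration_measurableP _ t0).
apply: measurable_funM => //; apply: measurable_indic.
exact: sub_sigma_algebra.
Qed.

Let measurableG t A : 0 <= t -> G t A -> measurable A.
Proof. by move=> t0; case: (pd_filtration pd) => _ + _ => /(_ t t0); exact. Qed.

(** The event [A] and the mass of [U] are known at time t, while the compensated mass of [V] is
    centred and independent of that past. As [Ex_future] takes nonnegative factors, the past factor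
    is split into its mass and its area. *)
Lemma Ex_cmass_cross t i j A U V : 0 <= t -> G t A ->
  bset U -> U `<=` `]0, t] `*` `[0, +oo[ ->
  bset V -> V `<=` `]t, +oo[ `*` `[0, +oo[ ->
  Ex P (fun w => \1_A w * (cmass i U w * cmass j V w)) = 0.
Proof.
move=> t0 GA Ub Ut Vb Vt.
have mA := measurableG t0 GA.
have indic0 w : 0 <= \1_A w :> R by rewrite indicE.
pose Y1 w : R := \1_A w * mass i U w.
have GY1 B : measurable B -> G t (Y1 @^-1` B).
  apply: filtration_measurable_indicM => // C mC.
  rewrite (_ : mass i U = fine \o kap i ^~ U); last by rewrite mass.unlock.
  apply: (pd_past pd i t0 Ub.1 Ut (B := fine @^-1` C)).
  by rewrite -[X in measurable X]setTI; exact: fine_measurable.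
have GY0 B : measurable B -> G t ((\1_A : Omega -> R) @^-1` B).
  move: B; apply/(filtration_measurableP _ t0); apply: measurable_indic.
  exact: sub_sigma_algebra.
have L0 : L1 P (\1_A : Omega -> R).
  by apply: L2_L1; have := L2_indic mA (L2_cst P 1); under eq_fun do rewrite mulr1.
have L1' : L1 P Y1 by apply: L2_L1; apply: L2_indic => //; exact: mass_L2.
have [I1 E1] := Ex_future j t0 Vb Vt (fun w => mulr_ge0 (indic0 w) (mass_ge0 i U w)) GY1 L1'.
have [I0 E0] := Ex_future j t0 Vb Vt indic0 GY0 L0.
pose u := fine (area U); pose v := fine (area V).
transitivity (Ex P (fun w => (Y1 w * mass j V w - v * Y1 w) -
    u * (\1_A w * mass j V w - v * \1_A w))).
  by apply: eq_Ex => w; rewrite cmass.unlock /Y1 -/u -/v; ring.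
have J1 := L1B I1 (L1Zl v L1').
have J0 := L1B I0 (L1Zl v L0).
rewrite ExB//; last exact: L1Zl.
rewrite ExZl// !ExB// ?ExZl//; try exact: L1Zl.
by rewrite E1 E0 -/v; ring.
Qed.

(** The Poisson variance settles the case of a single set. Expanding the square over a disjoint
    union then gives 0 for disjoint sets, and the general case follows by cutting [U] and [V] along
    their intersection. *)
Lemma Ex_cmass_same t i A U V : 0 <= t -> G t A ->
  bset U -> U `<=` `]t, +oo[ `*` `[0, +oo[ ->
  bset V -> V `<=` `]t, +oo[ `*` `[0, +oo[ ->
  Ex P (fun w => \1_A w * (cmass i U w * cmass i V w)) =
  Ex P \1_A * fine (area (U `&` V)).
Proof.
move=> t0 GA Ub Ut Vb Vt.
have mA := measurableG t0 GA.
have indic0 w : 0 <= \1_A w :> R by rewrite indicE.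
have GY0 B : measurable B -> G t ((\1_A : Omega -> R) @^-1` B).
  move: B; apply/(filtration_measurableP _ t0); apply: measurable_indic.
  exact: sub_sigma_algebra.
have L0 : L1 P (\1_A : Omega -> R).
  by apply: L2_L1; have := L2_indic mA (L2_cst P 1); under eq_fun do rewrite mulr1.
have bil W W' : bset W -> bset W' ->
    L1 P (fun w => \1_A w * (cmass i W w * cmass i W' w)).
  move=> Wb Wb'; under eq_fun do rewrite mulrA.
  apply: L2_mul; last exact: cmass_L2.
  by apply: L2_indic => //; exact: cmass_L2.
have sq W : bset W -> W `<=` `]t, +oo[ `*` `[0, +oo[ ->
    Ex P (fun w => \1_A w * (cmass i W w * cmass i W w)) = Ex P \1_A * fine (area W).
  move=> Wb Wt; have [I0 E0] := Ex_future i t0 Wb Wt indic0 GY0 L0.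
  have I2 : L1 P (fun w => \1_A w * (mass i W w * mass i W w)).
    under eq_fun do rewrite mulrA.
    by apply: L2_mul; [apply: L2_indic => //|]; exact: mass_L2.
  have E2 : Ex P (fun w => \1_A w * (mass i W w * mass i W w)) =
      Ex P \1_A * (fine (area W) + fine (area W) ^+ 2).
    apply: EFin_inj; rewrite ExE//.
    under eq_integral => w _ do rewrite EFinM EFinM massE//.
    have mk : measurable_fun setT (fun w => kap i w W * kap i w W)%E.
      by apply: emeasurable_funM; apply: measurable_kernel; case: Wb.
    rewrite ge0_integral_indep//.
    - rewrite EFinM ExE// (pd_sqr pd) ?areafin//; [|by case: Wb|exact: quad].
      by rewrite EFinD expr2 EFinM areaE.
    - by apply/measurable_EFinP; exact: L1_measurable L0.
    - move=> B C mB mC.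
      rewrite (_ : (fun w => (kap i w W * kap i w W)%E) @^-1` C =
        (kap i ^~ W) @^-1` ((fun x : \bar R => x * x)%E @^-1` C))//.
      apply: (pd_future pd _ t0) => //; first by case: Wb.
        apply: (GY0 (EFin @^-1` B)); rewrite -[X in measurable X]setTI.
        exact: (@EFin_measurable _ setT).
      rewrite -[X in measurable X]setTI.
      by apply: emeasurable_funM.
  pose u := fine (area W).
  transitivity (Ex P (fun w => (\1_A w * (mass i W w * mass i W w) -
      (2 * u) * (\1_A w * mass i W w)) + u ^+ 2 * \1_A w)).
    by apply: eq_Ex => w; rewrite cmass.unlock -/u; ring.
  rewrite ExD; [|by apply: L1B => //; exact: L1Zl|exact: L1Zl].
  rewrite ExB//; last exact: L1Zl.
  by rewrite !ExZl// E2 E0 -/u; ring.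
have disj W W' : bset W -> W `<=` `]t, +oo[ `*` `[0, +oo[ ->
    bset W' -> W' `<=` `]t, +oo[ `*` `[0, +oo[ -> W `&` W' = set0 ->
    Ex P (fun w => \1_A w * (cmass i W w * cmass i W' w)) = 0.
  move=> Wb Wt Wb' Wt' WW'.
  have WWb : bset (W `|` W').
    split; first by apply: measurableU; [case: Wb|case: Wb'].
    by rewrite subUset; split; [case: Wb|case: Wb'].
  have := sq _ WWb; rewrite subUset => /(_ (conj Wt Wt')).
  have -> : fine (area (W `|` W')) = fine (area W) + fine (area W').
    by apply: EFin_inj; rewrite EFinD !areaE// measureU//; [by case: Wb|by case: Wb'].
  have -> : Ex P (fun w => \1_A w * (cmass i (W `|` W') w * cmass i (W `|` W') w)) =
      Ex P (fun w => (\1_A w * (cmass i W w * cmass i W w) +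
        2 * (\1_A w * (cmass i W w * cmass i W' w))) +
        \1_A w * (cmass i W' w * cmass i W' w)).
    apply: eq_Ex => w; rewrite cmassU//.
    by move: (cmass i W w) (cmass i W' w) => x y; ring.
  rewrite ExD; [|by apply: L1D; [exact: bil|exact/L1Zl/bil]|exact: bil].
  rewrite ExD; [|exact: bil|exact/L1Zl/bil].
  rewrite ExZl; last exact: bil.
  rewrite (sq W)// (sq W')// mulrDr.
  move: (Ex P _ * fine _) => x; move: (Ex P _ * fine _) => y.
  by move: (Ex P _) => z; lra.
pose W1 := U `\` V; pose W2 := U `&` V; pose W3 := V `\` U.
have b1 : bset W1.
  split; first by apply: measurableD; [exact: Ub.1|exact: Vb.1].
  by apply: subset_trans Ub.2; exact: subDsetl.
have b2 : bset W2.
  split; first by apply: measurableI; [exact: Ub.1|exact: Vb.1].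
  by apply: subset_trans Ub.2; exact: subIsetl.
have b3 : bset W3.
  split; first by apply: measurableD; [exact: Vb.1|exact: Ub.1].
  by apply: subset_trans Vb.2; exact: subDsetl.
have t1 : W1 `<=` `]t, +oo[ `*` `[0, +oo[ by apply: subset_trans Ut; exact: subDsetl.
have t2 : W2 `<=` `]t, +oo[ `*` `[0, +oo[ by apply: subset_trans Ut; exact: subIsetl.
have t3 : W3 `<=` `]t, +oo[ `*` `[0, +oo[ by apply: subset_trans Vt; exact: subDsetl.
have d12 : W1 `&` W2 = set0 by apply/seteqP; split => // x [[_ nV] [_ V']].
have d23 : W2 `&` W3 = set0 by apply/seteqP; split => // x [[U' _] [_ nU]].
have d13 : W1 `&` W3 = set0 by apply/seteqP; split => // x [[_ nV] [V' _]].
transitivity (Ex P (fun w => (\1_A w * (cmass i W1 w * cmass i W2 w) +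
   \1_A w * (cmass i W1 w * cmass i W3 w)) +
   (\1_A w * (cmass i W2 w * cmass i W2 w) +
   \1_A w * (cmass i W2 w * cmass i W3 w)))).
  apply: eq_Ex => w.
  have -> : U = W1 `|` W2.
    by apply/seteqP; split => x; rewrite /W1 /W2 /=; have := EM (V x); tauto.
  have -> : V = W2 `|` W3.
    by apply/seteqP; split => x; rewrite /W2 /W3 /=; have := EM (U x); tauto.
  by rewrite !cmassU//; ring.
rewrite !ExD; try exact: bil; try (by apply: L1D; exact: bil).
by rewrite (disj W1 W2)// (disj W1 W3)// (disj W2 W3)// sq// !add0r addr0.
Qed.

Definition strip a b (B : set R) : set (R * R) := (`]a, b] `*` B) `&` box.

Lemma strip_bset a b B : measurable B -> bset (strip a b B).
Proof.
move=> mB; split; last exact: subIsetr.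
by apply: measurableI; [apply: measurableX|exact: measurable_time_box].
Qed.

Lemma strip_past a b B : strip a b B `<=` `]0, b] `*` `[0, +oo[.
Proof.
move=> [s z] [[/= + _] [/= + +]]; rewrite !in_itv/=.
by move=> /andP[_ ->] /andP[-> _] /andP[-> _].
Qed.

Lemma strip_future t a b B : t <= a -> strip a b B `<=` `]t, +oo[ `*` `[0, +oo[.
Proof.
move=> ta [s z] [[/= + _] [/= _ +]]; rewrite !in_itv/=.
by move=> /andP[/(le_lt_trans ta) -> _] /andP[-> _].
Qed.

Lemma strip0 a b B : b <= a -> strip a b B = set0.
Proof.
move=> ba; apply/seteqP; split => // -[s z] [[/= + _] _].
by rewrite in_itv/= => /andP[/lt_le_trans h /h]; rewrite ltNge ba.
Qed.

Lemma strip_cat a b c B : a <= b -> b <= c -> strip a c B = strip a b B `|` strip b c B.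
Proof.
move=> ab bc; rewrite /strip -setIUl; congr (_ `&` _).
apply/seteqP; split => [[s z] [/= + Bz]|[s z] [|] [/= + Bz]]; rewrite /= !in_itv/=.
- move=> /andP[a_s sc]; have [sb|bs] := leP s b; [left|right].
    by rewrite a_s.
  by rewrite ?bs sc.
- by move=> /andP[a_s sb]; rewrite a_s (le_trans sb).
- by move=> /andP[bs sc]; rewrite sc (le_lt_trans ab).
Qed.

Lemma stripI0 a b c e B B' : b <= c -> strip a b B `&` strip c e B' = set0.
Proof.
move=> bc; apply/seteqP; split => // -[s z] [[[/= + _] _] [[/= + _] _]].
rewrite /= !in_itv/= => /andP[_ sb] /andP[cs _].
by have := lt_le_trans cs (le_trans sb bc); rewrite ltxx.
Qed.

Lemma cmass_strip_cat i a b c B w : measurable B -> a <= b -> b <= c ->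
  cmass i (strip a c B) w = cmass i (strip a b B) w + cmass i (strip b c B) w.
Proof.
move=> mB ab bc; rewrite (strip_cat _ ab bc) cmassU//; try exact: strip_bset.
exact: stripI0.
Qed.

Lemma area_strip a b B : measurable B -> a <= b ->
  fine (area (strip a b B)) <= (b - a) * Num.max 0 K.
Proof.
move=> mB ab; rewrite -lee_fin areaE; last exact: strip_bset.
apply: (@le_trans _ _ (area (`]a, b] `*` `[0, K]))).
  apply: le_measure; rewrite ?inE.
  - by apply: (strip_bset _ _ _).1.
  - by apply: measurableX.
  - by move=> [s z] [[/= sab _] [/= _ zK]].
rewrite /area product_measure1E//= !lebesgue_measure_itv/= !lte_fin.
case: ifPn => ab'; last by rewrite mul0e lee_fin mulr_ge0 ?subr_ge0// le_max lexx.
case: ifPn => K0; last by rewrite mule0 lee_fin mulr_ge0 ?subr_ge0// le_max lexx.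
by rewrite oppr0 adde0 -EFinB -EFinM lee_fin (max_r (ltW K0)).
Qed.

Let bil A i j U V : measurable A -> bset U -> bset V ->
  L1 P (fun w => \1_A w * (cmass i U w * cmass j V w)).
Proof.
move=> mA Ub Vb; under eq_fun do rewrite mulrA.
by apply: L2_mul; [apply: L2_indic => //|]; exact: cmass_L2.
Qed.

(** A size estimate without cancellation: the product is at most (mass of U + area of U) (mass of V
    + area of V), whose mean is four times the product of the areas. *)
Let Ex_cmass_le i j A U V : i != j -> measurable A -> bset U -> bset V ->
  `|Ex P (fun w => \1_A w * (cmass i U w * cmass j V w))| <=
  4 * (fine (area U) * fine (area V)).
Proof.
move=> ij mA Ub Vb.
have mm : Ex P (fun w => mass i U w * mass j V w) = fine (area U) * fine (area V).
  apply: EFin_inj; rewrite ExE; last by apply: L2_mul; exact: mass_L2.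
  under eq_integral => w _ do rewrite EFinM !massE//.
  rewrite ge0_integral_indep//.
  - rewrite !(pd_mean pd) ?areafin//; [|exact: Vb.1|exact: quad|exact: Ub.1|exact: quad].
    by rewrite EFinM !areaE.
  - by apply: measurable_kernel; exact: Ub.1.
  - by apply: measurable_kernel; exact: Vb.1.
  - move=> B C mB mC; apply: (pd_indep pd) => //; try exact: quad.
      exact: Ub.1.
    exact: Vb.1.
have IU : L1 P (mass i U) by exact/L2_L1/mass_L2.
have IV : L1 P (mass j V) by exact/L2_L1/mass_L2.
have IUV : L1 P (fun w => mass i U w * mass j V w) by apply: L2_mul; exact: mass_L2.
pose u := fine (area U); pose v := fine (area V).
have u0 : 0 <= u by rewrite fine_ge0.
have v0 : 0 <= v by rewrite fine_ge0.
have I1 : L1 P (fun w => mass i U w * mass j V w + v * mass i U w).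
  by apply: L1D => //; exact: L1Zl.
have I2 : L1 P (fun w => u * mass j V w + u * v).
  by apply: L1D; [exact: L1Zl|exact: L1_cst].
rewrite (le_trans (norm_Ex (bil i j mA Ub Vb)))//.
apply: (@le_trans _ _ (Ex P (fun w => (mass i U w * mass j V w + v * mass i U w) +
    (u * mass j V w + u * v)))).
  apply: le_Ex; [by apply: L1_norm; exact: bil|by apply: L1D|move=> w].
  rewrite normrM indicE (ger0_norm (ler0n _ _)).
  apply: (@le_trans _ _ `|cmass i U w * cmass j V w|).
    by rewrite ler_piMl// lern1 leq_b1.
  rewrite normrM (_ : _ + _ = (mass i U w + u) * (mass j V w + v)); last by ring.
  apply: ler_pM => //; rewrite cmass.unlock (le_trans (ler_normB _ _))// lerD//;
    by rewrite ger0_norm// mass_ge0.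
rewrite ExD// !ExD ?ExZl ?Ex_cst//; try exact: L1Zl; try exact: L1_cst.
by rewrite mm !Ex_mass// -/u -/v; lra.
Qed.

(** The two masses are not known to be jointly independent of [G t], so [A] cannot be factored out.
    Halving the time interval removes the mixed terms, because the earlier factor is known at the
    midpoint. Two terms of the same kind remain; a quadratic bound loses a factor 4 on each half, so
    their sum loses a factor 2 at each generation. *)
Lemma Ex_cmass_indep i j t a b A B B' : i != j -> 0 <= t -> G t A ->
  measurable B -> measurable B' -> t <= a -> a <= b ->
  Ex P (fun w => \1_A w * (cmass i (strip a b B) w * cmass j (strip a b B') w)) = 0.
Proof.
move=> ij t0 GA mB mB' ta ab.
have mA := measurableG t0 GA.
pose M := Num.max 0 K; have M0 : 0 <= M by rewrite le_max lexx.
suff h n : forall a b, t <= a -> a <= b ->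
    `|Ex P (fun w => \1_A w * (cmass i (strip a b B) w * cmass j (strip a b B') w))| <=
    4 * M ^+ 2 * (b - a) ^+ 2 / 2 ^+ n.
  have lim0 : 4 * M ^+ 2 * (b - a) ^+ 2 / 2 ^+ n @[n --> \oo] --> (0 : R).
    rewrite -(mulr0 (4 * M ^+ 2 * (b - a) ^+ 2)); apply: cvgMr.
    under eq_fun do rewrite -exprVn.
    by apply: cvg_expr; rewrite ger0_norm// invf_lt1// ltr1n.
  apply/eqP; rewrite -normr_le0; apply: (cvgr_to_ge lim0).
  by apply: nearW => n; exact: h.
elim: n => [|n IH] {ta ab}a {}b ta ab.
  rewrite expr0 divr1; have := Ex_cmass_le ij mA (strip_bset a b mB) (strip_bset a b mB').
  move=> /le_trans; apply.
  rewrite -mulrA ler_pM2l// -exprMn expr2.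
  by apply: ler_pM; rewrite ?fine_ge0// mulrC area_strip.
pose c := (a + b) / 2.
have ac : a <= c by rewrite /c; lra.
have cb : c <= b by rewrite /c; lra.
have -> : Ex P (fun w => \1_A w * (cmass i (strip a b B) w * cmass j (strip a b B') w)) =
  Ex P (fun w => (\1_A w * (cmass i (strip a c B) w * cmass j (strip a c B') w) +
    \1_A w * (cmass i (strip a c B) w * cmass j (strip c b B') w)) +
    (\1_A w * (cmass j (strip a c B') w * cmass i (strip c b B) w) +
    \1_A w * (cmass i (strip c b B) w * cmass j (strip c b B') w))).
  apply: eq_Ex => w; rewrite (cmass_strip_cat i _ mB ac cb).
  by rewrite (cmass_strip_cat j _ mB' ac cb); ring.
have L i' j' a1 b1 a2 b2 B1 B2 : measurable B1 -> measurable B2 ->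
    L1 P (fun w => \1_A w * (cmass i' (strip a1 b1 B1) w * cmass j' (strip a2 b2 B2) w)).
  by move=> mB1 mB2; apply: bil => //; exact: strip_bset.
rewrite ExD; [|by apply: L1D; exact: L|by apply: L1D; exact: L].
rewrite !ExD; try exact: L.
have GcA : G c A.
  case: (pd_filtration pd) => _ _ mon; apply: mon GA => //.
  exact: le_trans ac.
have c0 : 0 <= c by exact: le_trans (le_trans ta ac).
rewrite (Ex_cmass_cross i j c0 GcA (strip_bset a c mB) (@strip_past a c B)
  (strip_bset c b mB') (@strip_future c c b B' (lexx c))).
rewrite (Ex_cmass_cross j i c0 GcA (strip_bset a c mB') (@strip_past a c B')
  (strip_bset c b mB) (@strip_future c c b B (lexx c))).
rewrite addr0 add0r (le_trans (ler_normD _ _))//.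
apply: le_trans (lerD (IH _ _ ta ac) (IH _ _ (le_trans ta ac) cb)) _.
rewrite [2 ^+ n.+1]exprS /c le_eqVlt; apply/orP; left; apply/eqP; field.
by rewrite expf_neq0.
Qed.

End compensated_mass.

(** * Covariances of compensated masses of predictable sets *)

Section predictable_covariance.
Context d (Omega : measurableType d) (R : realType) (P : probability Omega R).
Variables (G : R -> set (set Omega)) (kap : nat -> R.-ker Omega ~> (R * R)%type).
Hypothesis pd : poisson_data P G kap.
Variables T K : R.

Let box := time_box T K.
Local Notation mass := (mass kap).
Local Notation cmass := (cmass kap).
Local Notation strip := (strip T K).

Let mbox : measurable box. Proof. exact: measurable_time_box. Qed.

Let kbox i w : (kap i w box < +oo)%E. Proof. exact: (pd_box pd). Qed.

Let area_kernel : R.-ker Omega ~> (R * R)%type :=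
  @const_kernel _ _ Omega (R * R)%type R (@area R).

Let areabox (w : Omega) : (area_kernel w box < +oo)%E.
Proof. exact: area_time_box. Qed.

Definition area_in (C : set (Omega * (R * R))) w : R :=
  section_mass area_kernel box C w.

Definition cmass_in i (C : set (Omega * (R * R))) w : R :=
  section_mass (kap i) box C w - area_in C w.

(** Beyond the end of the shorter strip, the longer one is a future increment and contributes
    nothing; two strips over the same time interval remain. *)
Let strip_same t i j b b' A B B' : 0 <= t -> G t A -> measurable B -> measurable B' ->
  b <= b' ->
  Ex P (fun w => \1_A w * (cmass i (strip t b B) w * cmass j (strip t b' B') w)) =
  (i == j)%:R * (Ex P \1_A * fine (area (strip t b B `&` strip t b' B'))).
Proof.
move=> t0 GA mB mB' bb'.
have [tb|bt] := leP t b; last first.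
  rewrite strip0 ?(ltW bt)// set0I measure0 !mulr0.
  by rewrite -[RHS](Ex_cst P); apply: eq_Ex => w; rewrite cmass0 mul0r mulr0.
have mA : measurable A.
  by case: (pd_filtration pd) => _ + _ => /(_ t t0); exact.
have L b1 b2 b3 : L1 P (fun w => \1_A w * (cmass i (strip t b1 B) w * cmass j (strip b2 b3 B') w)).
  under eq_fun do rewrite mulrA.
  apply: L2_mul; last by apply: (cmass_L2 pd); exact: strip_bset.
  by apply: L2_indic => //; apply: (cmass_L2 pd); exact: strip_bset.
transitivity (Ex P (fun w => \1_A w * (cmass i (strip t b B) w * cmass j (strip t b B') w) +
    \1_A w * (cmass i (strip t b B) w * cmass j (strip b b' B') w))).
  apply: eq_Ex => w; rewrite (cmass_strip_cat pd T K j w mB' tb bb').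
  by rewrite mulrDr mulrDr.
rewrite ExD//.
rewrite (Ex_cmass_cross pd i j (le_trans t0 tb) (_ : G b A) (strip_bset T K t b mB) (@strip_past _ T K t b B)
  (strip_bset T K b b' mB') (@strip_future _ T K b b b' B' (lexx b))); last first.
  by case: (pd_filtration pd) => _ _ mon; apply: mon GA.
rewrite addr0.
have -> : strip t b B `&` strip t b' B' = strip t b B `&` strip t b B'.
  rewrite (strip_cat T K _ tb bb') setIUr [X in _ `|` X]stripI0// setU0//.
have [<-|ij] := eqVneq i j.
  rewrite mul1r; exact: (Ex_cmass_same pd i t0 GA (strip_bset T K t b mB)
    (@strip_future _ T K t t b B (lexx t)) (strip_bset T K t b mB')
    (@strip_future _ T K t t b B' (lexx t))).
by rewrite mul0r (Ex_cmass_indep pd T K ij t0 GA).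
Qed.

Let strip_start t i j b b' A B B' : 0 <= t -> G t A -> measurable B -> measurable B' ->
  Ex P (fun w => \1_A w * (cmass i (strip t b B) w * cmass j (strip t b' B') w)) =
  (i == j)%:R * (Ex P \1_A * fine (area (strip t b B `&` strip t b' B'))).
Proof.
move=> t0 GA mB mB'; have [bb'|/ltW b'b] := leP b b'; first exact: strip_same.
rewrite setIC eq_sym -strip_same//.
by apply: eq_Ex => w; rewrite [X in _ * X]mulrC.
Qed.

(** The part of the first strip before a' lies in the past of the second one and drops out, so both
    may be started at a'. *)
Let strip_le i j a b A B a' b' A' B' : 0 <= a -> a <= a' -> G a A -> G a' A' ->
  measurable B -> measurable B' ->
  Ex P (fun w => \1_(A `&` A') w * (cmass i (strip a b B) w * cmass j (strip a' b' B') w)) =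
  (i == j)%:R * (Ex P \1_(A `&` A') * fine (area (strip a b B `&` strip a' b' B'))).
Proof.
move=> a0 aa' GA GA' mB mB'.
have a'0 := le_trans a0 aa'.
have GAA : G a' (A `&` A').
  apply: (filtrationI (pd_filtration pd)) => //.
  by case: (pd_filtration pd) => _ _ mon; apply: mon GA.
have mAA : measurable (A `&` A').
  by case: (pd_filtration pd) => _ + _ => /(_ a' a'0); exact.
have cross c : c <= a' -> Ex P (fun w => \1_(A `&` A') w *
    (cmass i (strip a c B) w * cmass j (strip a' b' B') w)) = 0.
  move=> ca'; apply: (Ex_cmass_cross pd i j a'0 GAA); try exact: strip_bset.
    apply: subset_trans (@strip_past _ T K a c B) _ => -[s z] [/= + z0].
    rewrite !in_itv/= => /andP[s0 sc]; split => //.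
    by rewrite /= s0 (le_trans sc).
  exact: strip_future.
have [ba'|/ltW a'b] := leP b a'.
  by rewrite cross// stripI0// measure0 !mulr0.
have L b1 b2 : L1 P (fun w => \1_(A `&` A') w * (cmass i (strip b1 b2 B) w * cmass j (strip a' b' B') w)).
  under eq_fun do rewrite mulrA.
  apply: L2_mul; last by apply: (cmass_L2 pd); exact: strip_bset.
  by apply: L2_indic => //; apply: (cmass_L2 pd); exact: strip_bset.
transitivity (Ex P (fun w => \1_(A `&` A') w * (cmass i (strip a a' B) w * cmass j (strip a' b' B') w) +
    \1_(A `&` A') w * (cmass i (strip a' b B) w * cmass j (strip a' b' B') w))).
  apply: eq_Ex => w; rewrite (cmass_strip_cat pd T K i w mB aa' a'b).
  by rewrite mulrDl mulrDr.
rewrite ExD; [|exact: L|exact: L].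
rewrite (cross a' (lexx a')) add0r (strip_start i j b b' a'0 GAA mB mB').
congr (_ * (_ * fine (area _))).
rewrite (strip_cat T K _ aa' a'b) setIUl [X in X `|` _]stripI0// set0U//.
Qed.

Let strip_rect i j a b A B a' b' A' B' : 0 <= a -> 0 <= a' -> G a A -> G a' A' ->
  measurable B -> measurable B' ->
  Ex P (fun w => \1_(A `&` A') w * (cmass i (strip a b B) w * cmass j (strip a' b' B') w)) =
  (i == j)%:R * (Ex P \1_(A `&` A') * fine (area (strip a b B `&` strip a' b' B'))).
Proof.
move=> a0 a'0 GA GA' mB mB'; have [aa'|/ltW a'a] := leP a a'; first exact: strip_le.
rewrite setIC eq_sym [X in area X]setIC.
rewrite -(strip_le j i b' b a'0 a'a GA' GA mB' mB).
by apply: eq_Ex => w; rewrite [X in _ * X]mulrC.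
Qed.

Let xsection_rect (a b : R) (A : set Omega) (B : set R) w :
  xsection (A `*` (`]a, b] `*` B)) w `&` box =
  if w \in A then strip a b B else set0.
Proof.
case: ifPn => wA; first by rewrite in_xsectionX.
by rewrite notin_xsectionX// set0I.
Qed.

Let cmass_in_rect i (a b : R) A (B : set R) w :
  cmass_in i (A `*` (`]a, b] `*` B)) w = \1_A w * cmass i (strip a b B) w.
Proof.
rewrite /cmass_in /area_in /section_mass !xsection_rect indicE cmass.unlock mass.unlock.
case: ifPn => wA; rewrite ?mul1r// !measure0 mul0r subrr//.
Qed.

Let area_in_rect (a b : R) A (B : set R) a' b' A' (B' : set R) w :
  area_in ((A `*` (`]a, b] `*` B)) `&` (A' `*` (`]a', b'] `*` B'))) w =
  fine (area (strip a b B `&` strip a' b' B')) * \1_(A `&` A') w.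
Proof.
rewrite /area_in /section_mass xsectionI indicE in_setI.
rewrite (_ : _ `&` _ `&` box =
  (xsection (A `*` (`]a, b] `*` B)) w `&` box) `&`
  (xsection (A' `*` (`]a', b'] `*` B')) w `&` box)); last first.
  by apply/seteqP; split => x /=; tauto.
rewrite !xsection_rect.
by case: ifPn => wA; case: ifPn => wA'; rewrite ?set0I ?setI0 ?measure0/= ?mulr1 ?mulr0.
Qed.

Lemma measurable_area_in C : measurable C -> measurable_fun setT (area_in C).
Proof. exact: measurable_section_mass. Qed.

Lemma measurable_cmass_in i C : measurable C -> measurable_fun setT (cmass_in i C).
Proof.
move=> mC; apply: measurable_funB; last exact: measurable_area_in.
exact: measurable_section_mass.
Qed.

Let bound i w : R := mass i box w + fine (area box).

Let bound_L2 i : L2 P (bound i).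
Proof.
apply: L2D; last exact: L2_cst.
exact: (@mass_L2 _ _ _ _ _ _ pd T K i box (conj mbox (@subset_refl _ box))).
Qed.

Let cmass_in_le i C w : measurable C -> `|cmass_in i C w| <= bound i w.
Proof.
move=> mC; rewrite (le_trans (ler_normB _ _))// /bound mass.unlock.
rewrite !ger0_norm ?section_mass_ge0//.
apply: lerD.
  rewrite -(section_massT (kap i) box); exact: le_section_mass.
rewrite -(section_massT area_kernel box w).
exact: le_section_mass.
Qed.

Lemma cmass_in_L2 i C : measurable C -> L2 P (cmass_in i C).
Proof.
move=> mC; apply: L2_le (bound_L2 i); first exact: measurable_cmass_in.
by move=> w; exact: cmass_in_le.
Qed.

Lemma area_in_le C w : measurable C -> area_in C w <= fine (area box).
Proof.
move=> mC; rewrite -(section_massT area_kernel box w).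
exact: le_section_mass.
Qed.

Lemma area_in_L1 C : measurable C -> L1 P (area_in C).
Proof.
move=> mC; apply: (L1_le _ _ (L1_cst P (fine (area box)))).
  exact: measurable_area_in.
by move=> w; rewrite ger0_norm ?section_mass_ge0// area_in_le.
Qed.

(** With one factor [Y] frozen, both sides are additive in [C] and continuous along increasing
    sequences, so the identity spreads from the rectangles, which are stable under intersection, to
    all predictable sets. The scalar [r] is the Kronecker symbol of two particles, or 0 for the
    mean. *)
Lemma Ex_cmass_in_dynkin (Y : Omega -> R) i r D : L2 P Y -> measurable D ->
  (forall C, predictable_rectangle G C ->
    Ex P (fun w => Y w * cmass_in i C w) = r * Ex P (area_in (C `&` D))) ->
  forall C, predictable G C ->
    Ex P (fun w => Y w * cmass_in i C w) = r * Ex P (area_in (C `&` D)).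
Proof.
move=> Y2 mD HR.
pose H := [set C | measurable C /\
  Ex P (fun w => Y w * cmass_in i C w) = r * Ex P (area_in (C `&` D))].
have L C : measurable C -> L1 P (fun w => Y w * cmass_in i C w).
  by move=> mC; apply: L2_mul => //; exact: cmass_in_L2.
suff : predictable G `<=` H by move=> + C => /[apply] -[].
have fil := pd_filtration pd.
apply: lambda_system_subset => //; first exact: predictable_rectangleI.
- split; first by move=> *; exact: subsetT.
  + split; first exact: measurableT.
    (* The full space is not a rectangle, but within the box its sections are those of the rectangle
       over []0, T]] and [[0, K]]. *)
    pose rT : set (Omega * (R * R)) := setT `*` (`]0, T] `*` `[0, K]).
    have TE w : xsection setT w `&` box = xsection rT w `&` box.
      by apply/seteqP; split => x [/xsectionP xw bx]; split => //; apply/xsectionP.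
    have -> : area_in (setT `&` D) = area_in (rT `&` D).
      apply/funext => w; rewrite /area_in /section_mass.
      suff -> : xsection (setT `&` D) w `&` box = xsection (rT `&` D) w `&` box by [].
      have XI C : xsection (C `&` D) w `&` box = xsection C w `&` box `&` xsection D w.
        by rewrite xsectionI setIAC.
      by rewrite !XI TE.
    rewrite -HR; last first.
      exists 0, T, setT, `[0, K]%classic; split => //.
      exact: (filtrationT fil).
    by apply: eq_Ex => w; rewrite /cmass_in /area_in /section_mass TE.
  + move=> A B BA [mA HA] [mB HB]; split; first exact: measurableD.
    have E1 : (fun w => Y w * cmass_in i (A `\` B) w) =
        (fun w => Y w * cmass_in i A w - Y w * cmass_in i B w).
      apply/funext => w; rewrite /cmass_in /area_in !section_massD//.
      by move: (section_mass _ _ _ _) => x; ring.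
    have -> : area_in ((A `\` B) `&` D) = (fun w => area_in (A `&` D) w - area_in (B `&` D) w).
      apply/funext => w; rewrite /area_in -section_massD//; try exact: measurableI.
        by congr (section_mass _ _ _ w); apply/seteqP; split => x /=; tauto.
      exact: setSI.
    rewrite E1 (ExB (L _ mA) (L _ mB)) HA HB -mulrBr -ExB//;
      by apply: area_in_L1; exact: measurableI.
  + move=> F ndF HF; have mF n : measurable (F n) by case: (HF n).
    split; first exact: bigcup_measurable.
    have mU : measurable (\bigcup_n F n) by exact: bigcup_measurable.
    have c1 : Ex P (fun w => Y w * cmass_in i (F n) w) @[n --> \oo] -->
        Ex P (fun w => Y w * cmass_in i (\bigcup_n F n) w).
      apply: (@Ex_cvg _ _ _ _ _ _ (fun w => `|Y w| * bound i w)).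
      * by move=> n; exact: L1_measurable (L _ (mF n)).
      * move=> w; apply: cvgMr; apply: cvgB; exact: section_mass_cvg.
      * by apply: L2_mul => //; exact: L2_norm.
      * by move=> n w; rewrite normrM ler_wpM2l// cmass_in_le.
    have c2 : r * Ex P (area_in (F n `&` D)) @[n --> \oo] -->
        r * Ex P (area_in ((\bigcup_n F n) `&` D)).
      apply: cvgMr; apply: (@Ex_cvg _ _ _ _ _ _ (fun w => fine (area box))).
      * by move=> n; apply: measurable_area_in; exact: measurableI.
      * move=> w; rewrite setI_bigcupl; apply: section_mass_cvg => //.
          by move=> n; exact: measurableI.
        by move=> n m nm; apply/subsetPset; apply: setSI; apply/subsetPset; exact: ndF.
      * exact: L1_cst.
      * move=> n w; rewrite ger0_norm ?section_mass_ge0// area_in_le//.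
        exact: measurableI.
    have E : (fun n => Ex P (fun w => Y w * cmass_in i (F n) w)) =
        (fun n => r * Ex P (area_in (F n `&` D))).
      by apply/funext => n; exact: (HF n).2.
    rewrite E in c1; exact: (cvg_unique (@Rhausdorff R) c1 c2).
- move=> C RC; split; last exact: HR.
  by apply: (measurable_predictable fil); exact: sub_sigma_algebra.
Qed.

(** The extension from rectangles is applied twice, each time freezing the compensated mass of the
    other set. *)
Lemma Ex_cmass_in i j C D : predictable G C -> predictable G D ->
  Ex P (fun w => cmass_in i C w * cmass_in j D w) =
  (i == j)%:R * Ex P (area_in (C `&` D)).
Proof.
have fil := pd_filtration pd.
have mR C' : predictable_rectangle G C' -> measurable C'.
  by move=> RC; apply: (measurable_predictable fil); exact: sub_sigma_algebra.
move=> pC pD; have mC := measurable_predictable fil pC.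
rewrite setIC eq_sym; apply: Ex_cmass_in_dynkin => //; first exact: cmass_in_L2.
move=> {pD}D RD; rewrite eq_sym setIC; have mD := mR _ RD.
rewrite (_ : (fun w => _) = (fun w => cmass_in j D w * cmass_in i C w)); last first.
  by apply/funext => w; rewrite mulrC.
apply: Ex_cmass_in_dynkin => //; first exact: cmass_in_L2.
move=> {pC mC}C [a [b [A [B [a0 GA mB ->]]]]].
case: RD => a' [b' [A' [B' [a'0 GA' mB' ->]]]].
transitivity (Ex P (fun w => \1_(A `&` A') w * (cmass i (strip a b B) w * cmass j (strip a' b' B') w))).
  by apply: eq_Ex => w; rewrite !cmass_in_rect indicI/=; ring.
rewrite strip_rect//; congr (_ * _).
transitivity (Ex P (fun w => fine (area (strip a b B `&` strip a' b' B')) * \1_(A `&` A') w)).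
  rewrite ExZl; first by rewrite mulrC.
  have mAA : measurable (A `&` A').
    case: fil => _ sub _; apply: measurableI; first exact: sub GA.
    exact: sub GA'.
  by apply: L2_L1; have := L2_indic mAA (L2_cst P 1); under eq_fun do rewrite mulr1.
by apply: eq_Ex => w; rewrite area_in_rect.
Qed.

Lemma Ex_cmass_in0 i C : predictable G C -> Ex P (cmass_in i C) = 0.
Proof.
have fil := pd_filtration pd.
move=> pC.
transitivity (Ex P (fun w => 1 * cmass_in i C w)).
  by apply: eq_Ex => w; rewrite mul1r.
rewrite (@Ex_cmass_in_dynkin _ i 0 setT) ?mul0r//; first exact: L2_cst.
move=> {pC}C [a [b [A [B [a0 GA mB ->]]]]]; rewrite mul0r.
transitivity (Ex P (fun w => \1_A w * mass i (strip a b B) w -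
    fine (area (strip a b B)) * \1_A w)).
  by apply: eq_Ex => w; rewrite cmass_in_rect cmass.unlock mul1r; ring.
have mA : measurable A by case: fil => _ sub _; exact: sub GA.
have L0 : L1 P (\1_A : Omega -> R).
  by apply: L2_L1; have := L2_indic mA (L2_cst P 1); under eq_fun do rewrite mulr1.
have GY0 B' : measurable B' -> G a ((\1_A : Omega -> R) @^-1` B').
  move: B'; apply/(filtration_measurableP pd _ a0); apply: measurable_indic.
  exact: sub_sigma_algebra.
have i0 w : 0 <= \1_A w :> R by rewrite indicE.
have [I E] := Ex_future pd i a0 (strip_bset T K a b mB)
  (@strip_future _ T K a a b B (lexx a)) i0 GY0 L0.
rewrite ExB// ?ExZl//; last exact: L1Zl.
by rewrite E mulrC subrr.
Qed.

End predictable_covariance.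

HB.lock Definition sec_mass d (Omega : measurableType d) (R : realType)
  (kap : nat -> R.-ker Omega ~> (R * R)%type) i (C : set (Omega * (R * R))) w : R :=
  fine (kap i w (xsection C w)).

HB.lock Definition sec_area d (Omega : measurableType d) (R : realType)
  (C : set (Omega * (R * R))) w : R := fine (area (xsection C w)).

(** * First-moment bounds for regions of unbounded height *)

Section compensated_bound.
Context d (Omega : measurableType d) (R : realType) (P : probability Omega R).
Variables (G : R -> set (set Omega)) (kap : nat -> R.-ker Omega ~> (R * R)%type).
Hypothesis pd : poisson_data P G kap.
Variable T : R.

Local Notation cmass_in := (cmass_in kap T).
Local Notation sec_mass := (sec_mass kap).

Let fil := pd_filtration pd.

Let box (n : nat) := time_box T n%:R.

Let mbox n : measurable (box n). Proof. exact: measurable_time_box. Qed.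

(** A region under a random rate has no height bound. Finiteness is asked at each w so that [fine]
    returns the true values, and in mean for the area so that the boxes can be let grow. *)
Record admissible i (C : set (Omega * (R * R))) : Prop := {
  adm_predictable : predictable G C ;
  adm_sub : C `<=` setT `*` (`]0, T] `*` `[0, +oo[) ;
  adm_mass : forall w, (kap i w (xsection C w) < +oo)%E ;
  adm_area : forall w, (area (xsection C w) < +oo)%E ;
  adm_mean : (\int[P]_w area (xsection C w) < +oo)%E }.

Section one_set.
Variables (i : nat) (C : set (Omega * (R * R))).
Hypothesis aC : admissible i C.

Let mC : measurable C.
Proof. exact: (measurable_predictable fil (adm_predictable aC)). Qed.

Let mxC w : measurable (xsection C w). Proof. exact: measurable_xsection. Qed.

Lemma sec_massE w : (sec_mass i C w)%:E = kap i w (xsection C w).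
Proof. by rewrite sec_mass.unlock fineK// ge0_fin_numE// adm_mass. Qed.

Lemma sec_areaE w : (sec_area C w)%:E = area (xsection C w).
Proof. by rewrite sec_area.unlock fineK// ge0_fin_numE// (adm_area aC). Qed.

Lemma sec_mass_ge0 w : 0 <= sec_mass i C w.
Proof. by rewrite sec_mass.unlock fine_ge0. Qed.

Lemma sec_area_ge0 w : 0 <= sec_area C w.
Proof. by rewrite sec_area.unlock fine_ge0. Qed.

Let bigcup_box w : \bigcup_n (xsection C w `&` box n) = xsection C w.
Proof.
apply/seteqP; split => [p [n _ []]//|[s z] Cw].
have /adm_sub := (iffLR (xsectionP _ _ _) Cw); move=> /(_ _ aC)[_ [/= s0 z0]].
move: z0; rewrite /= in_itv/= andbT => z0.
exists (Num.trunc z).+1 => //; split => //; split => //=.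
by rewrite in_itv/= z0 ltW// truncnS_gt.
Qed.

Let mass_cvg (m : {measure set (R * R)%type -> \bar R}) w :
  m (xsection C w `&` box n) @[n --> \oo] --> m (xsection C w).
Proof.
rewrite -[X in _ --> m X]bigcup_box; apply: nondecreasing_cvg_mu.
- by move=> n; apply: measurableI.
- by apply: bigcup_measurable => n _; apply: measurableI.
- move=> n k nk; apply/subsetPset; apply: setIS => -[s z] [/= s0].
  rewrite !in_itv/= => /andP[z0 zn]; split => //=.
  by rewrite in_itv/= z0 (le_trans zn)// ler_nat.
Qed.

Let mass_le (m : {measure set (R * R)%type -> \bar R}) w n :
  (m (xsection C w `&` box n) <= m (xsection C w))%E.
Proof. by apply: le_measure; rewrite ?inE//; exact: measurableI. Qed.

Let area_in_cvg w : area_in T n%:R C w @[n --> \oo] --> sec_area C w.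
Proof.
by apply/fine_cvg; rewrite sec_areaE; exact: (@mass_cvg (@area R) w).
Qed.

Let cmass_in_cvg w : cmass_in n%:R i C w @[n --> \oo] --> sec_mass i C w - sec_area C w.
Proof.
apply: cvgB; last exact: area_in_cvg.
apply/fine_cvg; rewrite sec_massE; exact: mass_cvg.
Qed.

Lemma measurable_sec_area : measurable_fun setT (sec_area C).
Proof.
apply: (@measurable_fun_cvg _ _ _ _ (fun n => area_in T n%:R C)).
  by move=> n; exact: measurable_area_in.
by move=> w _; exact: area_in_cvg.
Qed.

Let measurable_sec_diff : measurable_fun setT (fun w => sec_mass i C w - sec_area C w).
Proof.
apply: (@measurable_fun_cvg _ _ _ _ (fun n => cmass_in n%:R i C)).
  by move=> n; exact: (measurable_cmass_in pd).
by move=> w _; exact: cmass_in_cvg.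
Qed.

Lemma measurable_sec_mass : measurable_fun setT (sec_mass i C).
Proof.
have := measurable_funD measurable_sec_diff measurable_sec_area.
by apply: eq_measurable_fun => w _ /=; rewrite subrK.
Qed.

Lemma sec_area_L1 : L1 P (sec_area C).
Proof.
apply/integrableP; split; first exact/measurable_EFinP/measurable_sec_area.
under eq_integral => w _ do rewrite /= ger0_norm ?sec_area_ge0// sec_areaE.
exact: adm_mean aC.
Qed.

Let cmass_mean n : Ex P (fun w => cmass_in n%:R i C w + area_in T n%:R C w) =
  Ex P (area_in T n%:R C).
Proof.
rewrite ExD; first by rewrite (Ex_cmass_in0 pd T n%:R i (adm_predictable aC)) add0r.
- exact/L2_L1/(cmass_in_L2 pd).
- exact: area_in_L1.
Qed.

Let mass_in_ge0 n w : 0 <= cmass_in n%:R i C w + area_in T n%:R C w.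
Proof. by rewrite subrK section_mass_ge0. Qed.

(** In each box the mean mass equals the mean area, and both increase with the box: monotone
    convergence gives the equality before the mass is known to be integrable. *)
Lemma integral_sec_mass :
  (\int[P]_w (sec_mass i C w)%:E = \int[P]_w (sec_area C w)%:E)%E.
Proof.
have nd (m : {measure set (R * R)%type -> \bar R}) w n k : (n <= k)%N ->
    (m (xsection C w `&` box n) <= m (xsection C w `&` box k))%E.
  move=> nk; apply: le_measure; rewrite ?inE//; try exact: measurableI.
  apply: setIS => -[s z] [/= s0].
  rewrite !in_itv/= => /andP[z0 zn]; split => //=.
  by rewrite in_itv/= z0 (le_trans zn)// ler_nat.
have kE n w : (cmass_in n%:R i C w + area_in T n%:R C w)%:E = kap i w (xsection C w `&` box n).
  rewrite subrK section_massE//; first exact: mbox.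
  by move=> w'; exact: (pd_box pd).
have aE n w : (area_in T n%:R C w)%:E = area (xsection C w `&` box n).
  rewrite /area_in section_massE//; first exact: mbox.
  by move=> w'; exact: area_time_box.
have c1 : (\int[P]_w (cmass_in n%:R i C w + area_in T n%:R C w)%:E)%E @[n --> \oo] -->
    (\int[P]_w (sec_mass i C w)%:E)%E.
  apply: monotone_integral_cvg.
  - move=> n; apply/measurable_EFinP; apply: measurable_funD.
      exact: (measurable_cmass_in pd).
    exact: measurable_area_in.
  - by move=> n w; rewrite lee_fin.
  - by move=> w n k nk; rewrite !kE nd.
  - move=> w; rewrite sec_massE; under eq_fun do rewrite kE; exact: mass_cvg.
have c2 : (\int[P]_w (area_in T n%:R C w)%:E)%E @[n --> \oo] -->
    (\int[P]_w (sec_area C w)%:E)%E.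
  apply: monotone_integral_cvg.
  - by move=> n; apply/measurable_EFinP; exact: measurable_area_in.
  - by move=> n w; rewrite lee_fin section_mass_ge0.
  - by move=> w n k nk; rewrite !aE (nd (@area R)).
  - move=> w; rewrite sec_areaE; under eq_fun do rewrite aE; exact: (@mass_cvg (@area R) w).
have E : (fun n => \int[P]_w (cmass_in n%:R i C w + area_in T n%:R C w)%:E)%E =
    (fun n => \int[P]_w (area_in T n%:R C w)%:E)%E.
  apply/funext => n; have La : L1 P (area_in T n%:R C) by exact: area_in_L1.
  have Lc : L1 P (cmass_in n%:R i C) by exact/L2_L1/(cmass_in_L2 pd).
  by rewrite -(ExE La) -(ExE (L1D Lc La)) cmass_mean.
rewrite E in c1; exact: (cvg_unique (@ereal_hausdorff R) c1 c2).
Qed.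

Lemma sec_mass_L1 : L1 P (sec_mass i C).
Proof.
apply/integrableP; split; first exact/measurable_EFinP/measurable_sec_mass.
under eq_integral => w _ do rewrite /= ger0_norm ?sec_mass_ge0//.
rewrite integral_sec_mass; under eq_integral => w _ do rewrite sec_areaE.
exact: adm_mean aC.
Qed.

Lemma Ex_sec_mass : Ex P (sec_mass i C) = Ex P (sec_area C).
Proof.
by apply: EFin_inj; rewrite (ExE sec_mass_L1) (ExE sec_area_L1) integral_sec_mass.
Qed.

Let area_in_le_sec n w : area_in T n%:R C w <= sec_area C w.
Proof.
rewrite -lee_fin sec_areaE /area_in section_massE//; first exact: (@mass_le (@area R)).
  exact: mbox.
by move=> w'; exact: area_time_box.
Qed.

(** The domination is by an integrable variable, so the truncation can be removed in first moments
    but not in second ones. *)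
Lemma cmass_in_approx :
  [/\ forall n, L2 P (cmass_in n%:R i C),
      forall w, cmass_in n%:R i C w @[n --> \oo] --> sec_mass i C w - sec_area C w,
      forall n w, `|cmass_in n%:R i C w| <= sec_mass i C w + sec_area C w
    & forall n, Ex P (area_in T n%:R C) <= Ex P (sec_area C)].
Proof.
split => //.
- by move=> n; exact: (cmass_in_L2 pd).
- move=> n w; rewrite (le_trans (ler_normB _ _))// !ger0_norm ?section_mass_ge0//.
  apply: lerD => //.
  rewrite -lee_fin sec_massE section_massE//; first exact: mass_le.
    exact: mbox.
  by move=> w'; exact: (pd_box pd).
- move=> n; apply: le_Ex => //; [exact: area_in_L1|exact: sec_area_L1].
Qed.

End one_set.

(** In a box, orthogonality leaves the diagonal terms of the square, and |x| <= (e x^2 + 1/e) / 2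
    turns this second moment into a bound on the first moment, which converges as the box grows.
    With e the inverse of the standard deviation this is the Cauchy-Schwarz bound. Orthogonality
    comes either from distinct particles or from disjoint regions. *)
Lemma Ex_norm_compensated (I : finType) (i : I -> nat) (a : I -> R)
    (C : I -> set (Omega * (R * R))) (e : R) :
  (forall k, admissible (i k) (C k)) ->
  (forall k l, k != l -> i k != i l \/ C k `&` C l = set0) -> 0 < e ->
  Ex P (fun w => `|\sum_k a k * (sec_mass (i k) (C k) w - sec_area (C k) w)|) <=
  (e * (\sum_k a k ^+ 2 * Ex P (sec_area (C k))) + e^-1) / 2.
Proof.
move=> aC orth e0.
have app k := cmass_in_approx (aC k).
have pC k : predictable G (C k) by exact: adm_predictable (aC k).
pose f n w := \sum_k a k * cmass_in n%:R (i k) (C k) w.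
have f2 n : L2 P (f n).
  rewrite /f; elim: (index_enum I) => [|k s IH].
    by under eq_fun do rewrite big_nil; exact: L2_cst.
  under eq_fun do rewrite big_cons.
  by apply: L2D => //; apply: L2Zl; case: (app k).
have c1 : Ex P (fun w => `|f n w|) @[n --> \oo] -->
    Ex P (fun w => `|\sum_k a k * (sec_mass (i k) (C k) w - sec_area (C k) w)|).
  apply: (@Ex_cvg _ _ _ _ _ _ (fun w =>
      \sum_k `|a k| * (sec_mass (i k) (C k) w + sec_area (C k) w))).
  - by move=> n; apply: measurableT_comp => //; case: (f2 n).
  - move=> w; apply: cvg_norm; rewrite /f.
    apply: (@cvgn_sum R I _ (fun k n => a k * cmass_in n%:R (i k) (C k) w)) => k.
    by apply: cvgMr; case: (app k) => _ + _ _; exact.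
  - apply: L1_sum => k; apply: L1Zl; apply: L1D; [exact: sec_mass_L1|exact: sec_area_L1 (aC k)].
  - move=> n w; rewrite normr_id; apply: le_trans (ler_norm_sum _ _ _) _.
    apply: ler_sum => k _; rewrite normrM; apply: ler_wpM2l => //.
    by case: (app k).
apply: (cvgr_to_le c1); apply: nearW => n.
have fsq : Ex P (fun w => f n w ^+ 2) <= \sum_k a k ^+ 2 * Ex P (sec_area (C k)).
  have -> : Ex P (fun w => f n w ^+ 2) = \sum_k \sum_l (a k * a l) *
      Ex P (fun w => cmass_in n%:R (i k) (C k) w * cmass_in n%:R (i l) (C l) w).
    have L k l : L1 P (fun w => cmass_in n%:R (i k) (C k) w * cmass_in n%:R (i l) (C l) w).
      by apply: L2_mul; [case: (app k)|case: (app l)].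
    transitivity (Ex P (fun w => \sum_k \sum_l (a k * a l) *
        (cmass_in n%:R (i k) (C k) w * cmass_in n%:R (i l) (C l) w))).
      apply: eq_Ex => w; rewrite expr2 /f big_distrlr/=.
      apply: eq_bigr => k _; apply: eq_bigr => l _.
      by move: (cmass_in _ _ _ _) (cmass_in _ _ _ _) => x y; ring.
    rewrite Ex_sum; last by move=> k; apply: L1_sum => l; exact: L1Zl.
    apply: eq_bigr => k _; rewrite Ex_sum; last by move=> l; exact: L1Zl.
    by apply: eq_bigr => l _; exact: ExZl.
  apply: ler_sum => k _; rewrite (bigD1 k)//= big1 ?addr0.
    rewrite (Ex_cmass_in pd) // eqxx mul1r setIid -expr2.
    by apply: ler_wpM2l; [exact: sqr_ge0|case: (app k)].
  move=> l lk; rewrite (Ex_cmass_in pd)//.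
  have kl : k != l by rewrite eq_sym.
  have [h|h] := orth k l kl.
    by rewrite (negbTE h) mul0r mulr0.
  rewrite h (_ : Ex P _ = 0) ?mulr0//.
  rewrite -[RHS](Ex_cst P); apply: eq_Ex => w.
  by rewrite /area_in /section_mass xsection0 set0I measure0.
apply: (@le_trans _ _ (Ex P (fun w => (e / 2) * f n w ^+ 2 + e^-1 / 2))).
  apply: le_Ex.
  - exact/L1_norm/L2_L1.
  - by apply: L1D; [apply: L1Zl; case: (f2 n)|exact: L1_cst].
  - move=> w; rewrite -[f n w ^+ 2]real_normK ?num_real//.
    have := sqr_ge0 (e * `|f n w| - 1); move: `|f n w| => x h.
    rewrite -subr_ge0 (_ : _ - x = (e * x - 1) ^+ 2 / (2 * e)).
      by rewrite divr_ge0// mulr_ge0// ltW.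
    by field; rewrite gt_eqF.
have Lf : L1 P (fun w => f n w ^+ 2) by case: (f2 n).
rewrite (ExD (L1Zl (e / 2) Lf) (L1_cst P _)) (ExZl _ Lf) Ex_cst.
rewrite mulrDl lerD2r mulrAC ler_wpM2r// ler_wpM2l// ltW//.
Qed.

End compensated_bound.

(** * Moments of the Poisson law *)

Section poisson_moments.
Context (R : realType).
Implicit Types a : R.
Local Open Scope ereal_scope.

Local Notation q a k := (poisson_prob a 0%N [set k%N]).

Lemma poisson_prob_pmf a k : (0 < a)%R -> q a k = (poisson_pmf a k)%:E.
Proof.
move=> a0; rewrite /poisson_prob a0 esum_set1// lee_fin poisson_pmf_ge0//.
Qed.

(** The recurrence that lowers the order of a moment by one. It also covers parameter 0, where the
    law is the Dirac mass at 0. *)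
Lemma poisson_probS a k : (0 <= a)%R -> k.+1%:R%:E * q a k.+1 = a%:E * q a k.
Proof.
rewrite le_eqVlt => /predU1P[<-|a0].
  by rewrite mul0e /poisson_prob ltxx diracE memNset// mule0.
rewrite !poisson_prob_pmf// -!EFinM /poisson_pmf a0 factS natrM invfM exprS.
by congr EFin; field; rewrite pnatr_eq0 -lt0n fact_gt0/= addrC natr1 pnatr_eq0.
Qed.

Lemma poisson_prob_sum a : \sum_(0 <= k <oo) q a k = 1.
Proof.
rewrite -(@probability_setT _ _ _ (poisson_prob a 0%N)).
rewrite (_ : setT = \bigcup_k [set k]); last first.
  by apply/seteqP; split => // k _; exists k.
rewrite measure_bigcup//.
  by apply: eq_eseriesl => k; rewrite in_setT.
by apply/trivIsetP => i j _ _ ij; apply/seteqP; split => // k [/= ->] /eqP; rewrite (negbTE ij).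
Qed.

Lemma poisson_prob_ge0 a k : 0 <= q a k.
Proof. exact: measure_ge0. Qed.

Let natge0 k : 0 <= k%:R%:E :> \bar R. Proof. by rewrite lee_fin. Qed.

Lemma poisson_mean a : (0 <= a)%R -> \sum_(0 <= k <oo) k%:R%:E * q a k = a%:E.
Proof.
move=> a0; rewrite nneseries_recl//; last first.
  by move=> k _; rewrite mule_ge0// poisson_prob_ge0.
rewrite mul0e add0e -(@nneseries_addn _ (fun k => k%:R%:E * q a k) 1); last first.
  by move=> k; rewrite mule_ge0// poisson_prob_ge0.
under eq_eseriesr do rewrite addn1 poisson_probS//.
rewrite nneseriesZl; last by move=> *; exact: poisson_prob_ge0.
by rewrite poisson_prob_sum mule1.
Qed.

Lemma poisson_second_moment a : (0 <= a)%R ->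
  \sum_(0 <= k <oo) (k%:R%:E * k%:R%:E) * q a k = a%:E + a%:E * a%:E.
Proof.
move=> a0; have aE : 0 <= a%:E by rewrite lee_fin.
have ge0 k : 0 <= (k%:R%:E * k%:R%:E) * q a k.
  by rewrite !mule_ge0// poisson_prob_ge0.
rewrite nneseries_recl//.
rewrite !mul0e add0e -(@nneseries_addn _ (fun k => (k%:R%:E * k%:R%:E) * q a k) 1)//.
under eq_eseriesr => k _.
  rewrite addn1 -muleA poisson_probS// muleCA -natr1 EFinD ge0_muleDl//.
  rewrite mul1e; over.
rewrite nneseriesZl; last first.
  by move=> k _; rewrite adde_ge0// ?mule_ge0// poisson_prob_ge0.
rewrite nneseriesD; last 2 first.
- by move=> k _ _; rewrite mule_ge0// poisson_prob_ge0.
- by move=> k _ _; rewrite poisson_prob_ge0.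
rewrite poisson_mean// poisson_prob_sum ge0_muleDr//.
by rewrite mule1 addeC.
Qed.

Context d (Omega : measurableType d) (P : probability Omega R).

(** Only the probabilities of the integer values are given. As they sum to 1, [X] is almost surely
    an integer, and the values of [f] elsewhere do not count. *)
Lemma integral_poisson a (X : Omega -> \bar R) (f : \bar R -> \bar R) :
  (0 <= a)%R -> measurable_fun setT X -> measurable_fun setT f ->
  (forall x, 0 <= x -> 0 <= f x) -> (forall w, 0 <= X w) ->
  (forall k : nat, P [set w | X w = k%:R%:E] = q a k) ->
  \int[P]_w f (X w) = \sum_(0 <= k <oo) f k%:R%:E * q a k.
Proof.
move=> a0 mX mf f0 X0 PX.
pose N k := [set w | X w = k%:R%:E].
have mN k : measurable (N k).
  rewrite (_ : N k = X @^-1` [set k%:R%:E])//.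
  by rewrite -[X in measurable X]setTI; exact: mX.
have tN : trivIset setT N.
  apply/trivIsetP => i j _ _ ij; apply/seteqP; split => // w [/= Xi].
  by rewrite /N/= Xi => -[] /eqP; rewrite eqr_nat (negbTE ij).
pose D := \bigcup_k N k; have mD : measurable D by exact: bigcup_measurable.
have PD : P D = 1.
  rewrite measure_bigcup// -(poisson_prob_sum a).
  by rewrite (@eq_eseriesl _ _ xpredT) => [|k]; [apply: eq_eseriesr => k _; exact: PX|rewrite in_setT].
have PDC : P (~` D) = 0 by rewrite probability_setC// PD subee.
have mfX : measurable_fun setT (f \o X) by exact: measurableT_comp.
rewrite (_ : [set: Omega] = D `|` ~` D); last by rewrite setUv.
rewrite ge0_integral_setU//=; last 4 first.
- exact: measurableC.
- by rewrite setUv.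
- by move=> w _; exact/f0/X0.
- by apply/disj_setPCl.
rewrite [X in _ + X]null_set_integral//; last 2 first.
- exact: measurableC.
- exact: measurable_funTS.
rewrite adde0 ge0_integral_bigcup//; last 2 first.
- exact: measurable_funTS.
- by move=> w _; exact/f0/X0.
apply: eq_eseriesr => k _.
rewrite (@eq_integral _ _ _ _ _ (cst (f k%:R%:E))); last first.
  by move=> w /[!inE] /= ->.
rewrite integral_cst//; congr (_ * _); exact: PX.
Qed.

End poisson_moments.

(** * Modification on a null set and completed filtration *)

Section completed_filtration.
Context d (Omega : measurableType d) (R : realType) (P : probability Omega R).

Definition null_symdiff (A B : set Omega) : Prop :=
  P.-negligible ((A `\` B) `|` (B `\` A)).

Lemma null_symdiff_refl A : null_symdiff A A.
Proof.
by rewrite /null_symdiff setDv setU0; exact: negligible_set0.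
Qed.

Lemma null_symdiff_measure A B : measurable A -> measurable B ->
  null_symdiff A B -> P A = P B.
Proof.
move=> mA mB; rewrite /null_symdiff => AB.
have AB0 : P (A `\` B) = 0%E.
  apply: measure_negligible; first exact: measurableD.
  by apply: negligibleS AB; exact: subsetUl.
have BA0 : P (B `\` A) = 0%E.
  apply: measure_negligible; first exact: measurableD.
  by apply: negligibleS AB; exact: subsetUr.
have -> : P A = (P (A `\` B) + P (A `&` B))%E by exact: measureDI.
have -> : P B = (P (B `\` A) + P (B `&` A))%E by exact: measureDI.
by rewrite AB0 BA0 !add0e setIC.
Qed.

Lemma null_symdiffI A A' B B' : null_symdiff A A' -> null_symdiff B B' ->
  null_symdiff (A `&` B) (A' `&` B').
Proof.
move=> h k; apply: negligibleS (negligibleU h k) => w /=.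
have := EM (A' w); have := EM (B' w); have := EM (A w); have := EM (B w); tauto.
Qed.

(** Asking the event itself to be measurable keeps the completed filtration inside the given
    sigma-algebra, on which [P] need not be complete. *)
Definition completed (F : R -> set (set Omega)) (t : R) : set (set Omega) :=
  [set A | measurable A /\ exists2 B, F t B & null_symdiff A B].

Lemma completed_filtration F : filtration F -> filtration (completed F).
Proof.
move=> [sF mF monF]; split.
- move=> t t0; have [F0 FC FU] := sF t t0; split.
  + split; first exact: measurable0.
    by exists set0 => //; exact: null_symdiff_refl.
  + move=> A [mA [B FB AB]]; split; first exact: measurableD.
    exists (setT `\` B); first exact: FC.
    apply: negligibleS AB => w /=.
    by have := EM (A w); have := EM (B w); tauto.
  + move=> A hA; split; first by apply: bigcup_measurable => n _; case: (hA n).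
    have /choice[B hB] : forall n, exists B, F t B /\ null_symdiff (A n) B.
      by move=> n; case: (hA n) => _ [B]; exists B.
    exists (\bigcup_n B n); first by apply: FU => n; case: (hB n).
    apply: negligibleS (negligible_bigcup (fun n => (hB n).2)) => w /=.
    move=> [[[n _ An] nB]|[[n _ Bn] nA]]; exists n => //; [left|right]; split => //.
      by move=> Bn; apply: nB; exists n.
    by move=> An; apply: nA; exists n.
- by move=> t t0 A [].
- move=> s t s0 st A [mA [B FB AB]]; split => //; exists B => //.
  exact: monF FB.
Qed.

End completed_filtration.

Section good_kernel.
Context d (Omega : measurableType d) (R : realType) (P : probability Omega R).
Variables (F : R -> set (set Omega)) (pi : nat -> R.-ker Omega ~> (R * R)%type).
Hypotheses (hF : filtration F) (hpi : iid_poisson_measures P F pi).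
Variable good : set Omega.
Hypotheses (mgood : measurable good) (Pgood : P (~` good) = 0%E).
Hypothesis good_box : forall i w T K, good w -> (pi i w (time_box T K) < +oo)%E.

(** The zero measure off [good] gives boxes a finite mass at every w. *)
Definition good_kernel i (w : Omega) : {measure set (R * R)%type -> \bar R} :=
  if w \in good then pi i w else mzero.

Let measurable_good_kernel i U : measurable U ->
  measurable_fun setT (good_kernel i ^~ U).
Proof.
move=> mU.
rewrite (_ : good_kernel i ^~ U = (fun w => pi i w U * (\1_good w)%:E)%E).
  apply: emeasurable_funM; first exact: measurable_kernel.
  by apply/measurable_EFinP; exact: measurable_indic.
by apply/funext => w; rewrite /good_kernel indicE; case: ifPn => _; rewrite ?mule1 ?mule0.
Qed.

HB.instance Definition _ i :=
  isKernel.Build d _ Omega (R * R)%type R (good_kernel i) (measurable_good_kernel i).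

Lemma good_kernelE i w : good w -> good_kernel i w = pi i w.
Proof. by move=> gw; rewrite /good_kernel mem_set. Qed.

Let event_null i U B : null_symdiff P ((good_kernel i ^~ U) @^-1` B) ((pi i ^~ U) @^-1` B).
Proof.
exists (~` good); split => //; first exact: measurableC.
move=> w /= + gw; rewrite /good_kernel mem_set//; tauto.
Qed.

Let measurable_event (k : R.-ker Omega ~> (R * R)%type) U B : measurable U ->
  measurable B -> measurable ((k ^~ U) @^-1` B).
Proof.
by move=> mU mB; rewrite -[X in measurable X]setTI; exact: measurable_kernel.
Qed.

Let restr_event i U (D : set (R * R)) B : measurable U -> U `<=` D -> measurable B ->
  sigma_restr (pi i) D ((pi i ^~ U) @^-1` B).
Proof.
move=> mU UD mB; apply: sub_sigma_algebra; exists U => //.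
by exists B => //; rewrite setTI.
Qed.

Lemma poisson_independent2 i j (U V : set (R * R)) A B : i != j ->
  measurable U -> U `<=` quadrant -> measurable V -> V `<=` quadrant ->
  measurable A -> measurable B ->
  P ((pi i ^~ U) @^-1` A `&` (pi j ^~ V) @^-1` B) =
  (P ((pi i ^~ U) @^-1` A) * P ((pi j ^~ V) @^-1` B))%E.
Proof.
move=> ij mU Uq mV Vq mA mB; have [_ ind] := hpi.
pose E k := if k == i then (pi i ^~ U) @^-1` A else (pi j ^~ V) @^-1` B.
have := ind [fset i; j]%fset E.
have -> : \bigcap_(k in [set` [fset i; j]%fset]) E k =
    (pi i ^~ U) @^-1` A `&` (pi j ^~ V) @^-1` B.
  apply/seteqP; split => w.
    move=> h; split.
      by have := h i; rewrite /= /E eqxx !inE eqxx/=; apply.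
    by have := h j; rewrite /= /E eq_sym (negbTE ij) !inE eqxx orbT/=; apply.
  move=> [wA wB] k; rewrite /= !inE => /orP[/eqP->|/eqP->]; rewrite /E ?eqxx//.
  by rewrite eq_sym (negbTE ij).
move=> ->.
  rewrite big_fsetU1/=; last by rewrite inE.
  by rewrite big_seq_fset1 /E eqxx eq_sym (negbTE ij).
move=> k; rewrite !inE => /orP[/eqP->|/eqP->]; rewrite /E.
  by rewrite eqxx; exact: restr_event.
by rewrite eq_sym (negbTE ij); exact: restr_event.
Qed.

Let law i U k : measurable U -> U `<=` quadrant -> (area U < +oo)%E ->
  P [set w | pi i w U = k%:R%:E] = poisson_prob (fine (area U)) 0%N [set k].
Proof.
move=> mU Uq Ufin; have [/(_ i)[[law _] _ _] _] := hpi.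
exact: law.
Qed.

Let areaE (U : set (R * R)) : (area U < +oo)%E -> (fine (area U))%:E = area U.
Proof. by move=> Uf; rewrite fineK// ge0_fin_numE. Qed.

Lemma poisson_measure_mean i U : measurable U -> U `<=` quadrant ->
  (area U < +oo)%E -> (\int[P]_w pi i w U = area U)%E.
Proof.
move=> mU Uq Uf.
rewrite (@integral_poisson _ _ _ P (fine (area U)) _ id)//.
- by rewrite poisson_mean ?areaE// fine_ge0.
- by rewrite fine_ge0.
- exact: measurable_kernel.
- by move=> k; exact: law.
Qed.

Lemma poisson_measure_sqr i U : measurable U -> U `<=` quadrant ->
  (area U < +oo)%E ->
  (\int[P]_w (pi i w U * pi i w U) = area U + area U * area U)%E.
Proof.
move=> mU Uq Uf.
rewrite (@integral_poisson _ _ _ P (fine (area U)) _ (fun x => x * x)%E)//.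
- by rewrite poisson_second_moment ?areaE// fine_ge0.
- by rewrite fine_ge0.
- exact: measurable_kernel.
- by apply: emeasurable_funM.
- by move=> x x0; rewrite mule_ge0.
- by move=> k; exact: law.
Qed.

Let good_integral (f : \bar R -> \bar R) i U : measurable U -> measurable_fun setT f ->
  (forall x, 0 <= x -> 0 <= f x)%E ->
  (\int[P]_w f (good_kernel i w U) = \int[P]_w f (pi i w U))%E.
Proof.
move=> mU mf f0; apply: ge0_ae_eq_integral => //.
- exact: (measurableT_comp mf (measurable_good_kernel i mU)).
- exact: (measurableT_comp mf (measurable_kernel (pi i) U mU)).
- by move=> w _; exact: f0.
- by move=> w _; exact: f0.
- exists (~` good); split => //; first exact: measurableC.
  by move=> w /= + gw; rewrite good_kernelE//; tauto.
Qed.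

(** An event of the modified kernel agrees on [good] with the corresponding event of [pi], so
    probabilities of intersections and integrals are unchanged, and past events become members of
    the completed filtration. *)
Lemma good_poisson_data : poisson_data P (completed P F) good_kernel.
Proof.
have [adp _] := hpi.
split.
- exact: completed_filtration.
- move=> i w T K; have [gw|ngw] := EM (good w).
    by rewrite /= good_kernelE//; exact: good_box.
  by rewrite /= /good_kernel memNset//= /mzero ltry.
- move=> i t U B t0 mU Ut mB; split; first exact: measurable_event.
  exists ((pi i ^~ U) @^-1` B); last exact: event_null.
  have [_ past _] := adp i; apply: (past t t0); apply: restr_event => //.
  apply: subset_trans Ut _ => -[s z] [/= + z0]; rewrite in_itv/= => /andP[s0 st].
  by split => //=; rewrite in_itv/= (ltW s0).
- move=> i t U A B t0 mU Ut [mA [A' FA' AA']] mB.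
  have mE := measurable_event (good_kernel i) mU mB.
  have mE' := measurable_event (pi i) mU mB.
  have mA' : measurable A' by case: hF => _ /(_ t t0) + _; exact.
  rewrite (null_symdiff_measure mA mA' AA') (null_symdiff_measure mE mE' (event_null _ _ _)).
  rewrite (null_symdiff_measure _ _ (null_symdiffI AA' (event_null i U B)));
    try exact: measurableI.
  have [_ _ fut] := adp i; apply: (fut t t0) => //.
  exact: restr_event.
- move=> i j U V A B ij mU Uq mV Vq mA mB.
  have mE := measurable_event (good_kernel i) mU mA.
  have mE' := measurable_event (pi i) mU mA.
  have mD := measurable_event (good_kernel j) mV mB.
  have mD' := measurable_event (pi j) mV mB.
  rewrite (null_symdiff_measure _ _ (null_symdiffI (event_null i U A) (event_null j V B)));
    try exact: measurableI.
  rewrite (null_symdiff_measure mE mE' (event_null _ _ _)).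
  rewrite (null_symdiff_measure mD mD' (event_null _ _ _)).
  exact: poisson_independent2.
- move=> i U mU Uq Uf; rewrite (good_integral (f := id))//.
  exact: poisson_measure_mean.
- move=> i U mU Uq Uf; rewrite (good_integral (f := fun x => x * x)%E)//.
  + exact: poisson_measure_sqr.
  + exact: emeasurable_funM.
  + by move=> x x0; rewrite mule_ge0.
Qed.

End good_kernel.

Lemma ge0_integral_mrestr d (T : measurableType d) (R : realType)
    (mu : {measure set T -> \bar R}) (D : set T) (mD : measurable D) (f : T -> \bar R) :
  measurable_fun setT f -> (forall x, 0 <= f x)%E ->
  (\int[mrestr mu mD]_x f x = \int[mu]_(x in D) f x)%E.
Proof.
move=> mf f0; rewrite -(setUv D) ge0_integral_setU//=; last 3 first.
- exact: measurableC.
- by rewrite setUv.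
- exact/disj_setPCl.
rewrite [X in (_ + X)%E]null_set_integral//; last 3 first.
- exact: measurableC.
- exact: measurable_funTS.
- by rewrite /= /mrestr setICl measure0.
by rewrite adde0; apply: eq_measure_integral => A mA AD; rewrite /= /mrestr setIidl.
Qed.

(** * Stieltjes measures on the half-line *)

Section stieltjes_facts.
Context {R : realType}.

Lemma lebesgue_stieltjes_measure_itv (g : cumulative R R) (a b : R) : a <= b ->
  lebesgue_stieltjes_measure g `]a, b]%classic = (g b - g a)%:E.
Proof.
move=> ab; rewrite /lebesgue_stieltjes_measure /measure_extension/=.
by rewrite measurable_mu_extE/= ?wlength_itv_bnd//; exact: is_ocitv.
Qed.

Lemma stieltjes_itv (f : R -> R) (a b : R) : is_cumulative f -> a <= b ->
  stieltjes f `]a, b]%classic = (extend0 f b - extend0 f a)%:E.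
Proof.
move=> fP ab; rewrite /stieltjes; case: pselect => // {}fP.
exact: (lebesgue_stieltjes_measure_itv (cumulative_of fP)).
Qed.

Lemma stieltjes_unique (f : R -> R) (nu : {measure set (measurableTypeR R) -> \bar R}) :
  is_cumulative f ->
  (forall a b, a <= b -> nu `]a, b]%classic = (extend0 f b - extend0 f a)%:E) ->
  forall A, measurable A -> stieltjes f A = nu A.
Proof.
move=> fP nuE A mA.
have E X : ocitv X -> stieltjes f X = nu X.
  move=> [[a b] _ <-]/=; have [ab|ba] := leP a b.
    by rewrite stieltjes_itv// nuE.
  by rewrite set_itv_ge ?measure0// -leNgt bnd_simp ltW.
move: E; rewrite /stieltjes; case: pselect => // {}fP E.
exact: lebesgue_stieltjes_measure_unique.
Qed.

(** [extend0 f] is constant up to and including 0, so bounded intervals ending at 0 have no mass,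
    the atom at 0 included; they exhaust the half-line. *)
Lemma stieltjes_le0 (f : R -> R) : is_cumulative f -> stieltjes f `]-oo, 0]%classic = 0%E.
Proof.
move=> fP.
have E : `]-oo, 0]%classic = \bigcup_n `](- n%:R : R), 0]%classic.
  apply/seteqP; split => x /=.
    rewrite in_itv/= => x0; exists (Num.trunc (- x)).+1 => //=.
    by rewrite in_itv/= x0 andbT ltrNl truncnS_gt.
  by move=> [n _]/=; rewrite !in_itv/= => /andP[].
rewrite E.
apply/eqP; rewrite eq_le measure_ge0 andbT.
pose F n := `](- n%:R : R), 0]%classic : set (measurableTypeR R).
have mF n : measurable (F n) by exact: measurable_itv.
have mU : measurable (\bigcup_n F n) by exact: bigcup_measurable.
apply: le_trans (measure_sigma_subadditive (stieltjes f) mF mU (@subset_refl _ _)) _.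
rewrite eseries0// => n _ _; rewrite /F.
rewrite stieltjes_itv ?oppr_le0// /extend0 maxxx max_l ?subrr// oppr_le0//.
Qed.

Lemma stieltjes_ray (f : R -> R) (b : R) : is_cumulative f -> 0 <= b ->
  stieltjes f `]-oo, b]%classic = (f b - f 0)%:E.
Proof.
move=> fP b0.
have -> : `]-oo, b]%classic = `]-oo, 0]%classic `|` `]0, b]%classic :> set R.
  by rewrite -itv_bndbnd_setU// bnd_simp.
pose I0 : set R := `]-oo, 0]%classic.
have -> : (stieltjes f (I0 `|` `]0%R, b]%classic) =
    stieltjes f I0 + stieltjes f `]0%R, b]%classic)%E.
  apply: measureU; [exact: measurable_itv|exact: measurable_itv|].
  apply/seteqP; split => // x [+ +]; rewrite /I0/= !in_itv/= => x0 /andP[].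
  by rewrite ltNge x0.
by rewrite /I0 stieltjes_le0// stieltjes_itv// add0e /extend0 maxxx max_r.
Qed.

End stieltjes_facts.

(** * Predictability of the past of adapted processes *)

Section predictable_sets.
Context d (Omega : measurableType d) (R : realType).
Variable G : R -> set (set Omega).
Hypothesis filG : filtration G.

Local Notation TP := (g_sigma_algebraType (predictable_rectangle G)).

Lemma predictable_after (q : R) A (B : set R) : 0 <= q -> G q A -> measurable B ->
  measurable ([set p | [/\ A p.1, q < p.2.1 & B p.2.2]] : set TP).
Proof.
move=> q0 GA mB.
rewrite (_ : mkset _ = \bigcup_n (A `*` (`]q, q + n.+1%:R] `*` B)) :> set TP).
  apply: bigcup_measurable => n _; apply: sub_sigma_algebra.
  by exists q, (q + n.+1%:R), A, B.
apply/seteqP; split => [[w [s z]] /= [Aw qs Bz]|[w [s z]] [n _ [/= Aw [/= + Bz]]]].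
  exists (Num.trunc (s - q)) => //=; split => //=; split => //=.
  by rewrite in_itv/= qs/= -lerBlDl ltW// truncnS_gt.
by rewrite /= in_itv/= => /andP[qs _].
Qed.

(** Every predictable rectangle lies over positive times. The coordinates are therefore made
    constant at the other times before being shown predictable. *)
Lemma measurable_predictable_time :
  measurable_fun setT (fun p : TP => Num.max 0 p.2.1).
Proof.
apply: measurable_fun_gt => r; have [r0|r0] := leP 0 r.
  rewrite (_ : mkset _ = [set p | [/\ setT p.1, r < p.2.1 & setT p.2.2]]).
    by apply: predictable_after => //; exact: filtrationT.
  by apply/seteqP; split => p /=; rewrite lt_max ltNge r0/=; [split|case].
rewrite (_ : mkset _ = setT)//; apply/seteqP; split => // p _ /=.
by rewrite lt_max r0.
Qed.

Lemma measurable_predictable_height :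
  measurable_fun setT (fun p : TP => if 0 < p.2.1 then p.2.2 else 0).
Proof.
apply: measurable_fun_gt => r.
have h : measurable ([set p | [/\ setT p.1, 0 < p.2.1 & `]r, +oo[%classic p.2.2]] : set TP).
  by apply: predictable_after => //; exact: filtrationT.
have [r0|r0] := leP 0 r.
  rewrite (_ : mkset _ = [set p | [/\ setT p.1, 0 < p.2.1 & `]r, +oo[%classic p.2.2]])//.
  apply/seteqP; split => p /=; rewrite in_itv/= andbT; case: ifPn => // _.
  - by rewrite ltNge r0.
  - by case.
  - by case.
have k : measurable ([set p | [/\ setT p.1, 0 < p.2.1 & setT p.2.2]] : set TP).
  by apply: predictable_after => //; exact: filtrationT.
rewrite (_ : mkset _ = [set p | [/\ setT p.1, 0 < p.2.1 & `]r, +oo[%classic p.2.2]] `|`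
  ~` [set p | [/\ setT p.1, 0 < p.2.1 & setT p.2.2]]).
  by apply: measurableU => //; exact: measurableC.
apply/seteqP; split => p /=; rewrite in_itv/= andbT; case: ifPn => s0.
- by left.
- by move=> _; right => -[].
- by case=> [[]//|]; case.
- by [].
Qed.

Lemma predictable_time_set (U : set (R * R)) : measurable U ->
  measurable ([set p | 0 < p.2.1 /\ U p.2] : set TP).
Proof.
move=> mU.
have k : measurable ([set p | [/\ setT p.1, 0 < p.2.1 & setT p.2.2]] : set TP).
  by apply: predictable_after => //; exact: filtrationT.
have mq : measurable_fun setT (fun p : TP => (Num.max 0 p.2.1,
    if 0 < p.2.1 then p.2.2 else 0)).
  apply/measurable_fun_pair; first exact: measurable_predictable_time.
  exact: measurable_predictable_height.
have := measurableI _ _ k (mq measurableT _ mU); rewrite setTI.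
congr measurable; apply/seteqP; split => -[w [s z]] /=.
  by case=> -[_ s0 _]; rewrite s0 max_r// ltW.
by case=> s0 Usz; rewrite s0 max_r// ltW.
Qed.

End predictable_sets.

Section past_law.
Context {R : realType}.
Variables (nu : {measure set (measurableTypeR R) -> \bar R}) (s : R).

(** The law of the lag s - u when u < s is distributed as [nu]. It writes a convolution as the
    integral of a fixed function against a kernel in (w, s), whose measurability can be tested on
    rays. *)
Definition past_law (A : set (measurableTypeR R)) : \bar R := nu (`]-oo, s[ `&` [set u | A (s - u)]).

Let mshift : measurable_fun setT ((fun u => s - u) : measurableTypeR R -> measurableTypeR R).
Proof. by apply: measurable_funB => //; exact: measurable_id. Qed.

Let mrefl (A : set (measurableTypeR R)) : measurable A ->
  measurable ([set u | A (s - u)] : set (measurableTypeR R)).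
Proof. by move=> mA; have := mshift measurableT mA; rewrite setTI. Qed.

Let past_law0 : past_law set0 = 0%E.
Proof. by rewrite /past_law (_ : [set u | set0 (s - u)] = set0)// setI0 measure0. Qed.

Let past_law_ge0 A : (0 <= past_law A)%E. Proof. exact: measure_ge0. Qed.

Let past_law_semi_sigma_additive :
  @semi_sigma_additive _ (measurableTypeR R) R past_law.
Proof.
move=> F mF tF mUF; rewrite /past_law.
have -> : `]-oo, s[ `&` [set u | (\bigcup_n F n) (s - u)] =
    \bigcup_n (`]-oo, s[ `&` [set u | F n (s - u)]).
  by rewrite -setI_bigcupr; congr (_ `&` _).
apply: measure_semi_sigma_additive.
- by move=> n; apply: measurableI; [exact: measurable_itv|exact (mrefl (mF n))].
- apply/trivIsetP => i j _ _ ij; apply/seteqP; split => // u [[_ /= Fi] [_ /= Fj]].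
  by move/trivIsetP : tF => /(_ i j Logic.I Logic.I ij) E; rewrite -[False]/(set0 (s - u)) -E.
- by apply: bigcup_measurable => n _; apply: measurableI; [exact: measurable_itv|exact (mrefl (mF n))].
Qed.

HB.instance Definition _ := isMeasure.Build _ (measurableTypeR R) R past_law
  past_law0 past_law_ge0 past_law_semi_sigma_additive.

Lemma ge0_integral_past_law (f : R -> \bar R) : measurable_fun setT f ->
  (forall x, 0 <= f x)%E ->
  (\int[past_law]_v f v = \int[nu]_(u in `]-oo, s[) f (s - u)%R)%E.
Proof.
move=> mf f0.
pose phi : {mfun measurableTypeR R >-> measurableTypeR R} :=
  HB.pack (fun u : R => s - u) (isMeasurableFun.Build _ _ _ _ _ mshift).
have mI : measurable (`]-oo, s[%classic : set (measurableTypeR R)) by exact: measurable_itv.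
transitivity (\int[pushforward (mrestr nu mI) phi]_v f v)%E.
  by apply: eq_measure_integral => A mA _; congr (nu _); exact: setIC.
rewrite ge0_integral_pushforward//= preimage_setT ge0_integral_mrestr//.
exact: measurableT_comp.
Qed.

End past_law.

Section predictable_convolution.
Context d (Omega : measurableType d) (R : realType).
Variable G : R -> set (set Omega).
Hypothesis filG : filtration G.
Variable X : R -> Omega -> R.
Hypothesis adaptX : forall t, 0 <= t -> forall B, measurable B -> G t (X t @^-1` B).
Hypothesis cumX : forall w, is_cumulative (X ^~ w).

Local Notation TP := (g_sigma_algebraType (predictable_rectangle G)).

Let zeta w : {measure set (measurableTypeR R) -> \bar R} := stieltjes (X ^~ w).

Let ray_mono w (x y : R) : x <= y -> (zeta w `]-oo, x]%classic <= zeta w `]-oo, y]%classic)%E.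
Proof.
move=> xy; apply: le_measure; rewrite ?inE; try exact: measurable_itv.
by apply: subset_itvl; rewrite bnd_simp.
Qed.

(** The mass strictly before x is a left limit, and a nondecreasing path exceeds a level before x
    exactly when it does so at some rational time before x. This countable description uses only the
    strict past of x. *)
Let ray_lt w (x r : R) : 0 <= r -> (r%:E < zeta w `]-oo, x[%classic)%E <->
  exists q : rat, [/\ 0 <= ratr q :> R, ratr q < x & r < X (ratr q) w - X 0 w].
Proof.
move=> r0; split => [rx|[q [q0 qx rq]]]; last first.
  apply: (@lt_le_trans _ _ (zeta w `]-oo, ratr q]%classic)).
    by rewrite stieltjes_ray// lte_fin.
  apply: le_measure; rewrite ?inE; try exact: measurable_itv.
  by apply: subset_itvl; rewrite bnd_simp.
have x0 : 0 < x.
  rewrite ltNge; apply/negP => x0; move: rx; rewrite ltNge => /negP; apply.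
  apply: (@le_trans _ _ (zeta w `]-oo, 0]%classic)).
    apply: le_measure; rewrite ?inE; try exact: measurable_itv.
    by apply: subset_itvl; rewrite bnd_simp.
  by rewrite /zeta stieltjes_le0// lee_fin.
pose F n := `]-oo, x - n.+1%:R^-1]%classic : set (measurableTypeR R).
have FE : `]-oo, x[%classic = \bigcup_n F n.
  apply/seteqP; split => y /=; rewrite in_itv/=.
    rewrite -subr_gt0 => /ltr_add_invr[n]; rewrite add0r => ny.
    by exists n => //; rewrite /F/= in_itv/= lerBrDr addrC -lerBrDr ltW.
  move=> [n _]; rewrite /F/= in_itv/= => /le_lt_trans; apply.
  by rewrite ltrBlDr ltrDl.
have cv : zeta w (F n) @[n --> \oo] --> zeta w `]-oo, x[%classic.
  rewrite FE; apply: nondecreasing_cvg_mu.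
  - by move=> n; exact: measurable_itv.
  - by apply: bigcup_measurable => n _; exact: measurable_itv.
  - move=> n m nm; apply/subsetPset; apply: subset_itvl; rewrite bnd_simp.
    by rewrite lerB// lef_pV2 ?posrE// ler_nat.
have [n rn] : exists n, (r%:E < zeta w (F n))%E.
  apply: contrapT => /forallNP h; move: rx; rewrite ltNge => /negP; apply.
  apply: (cvge_to_le cv); apply: nearW => n; rewrite leNgt; apply/negP; exact: h.
have yx : Num.max 0 (x - n.+1%:R^-1) < x by rewrite gt_max x0/= ltrBlDr ltrDl.
have /rat_in_itvoo[q] := yx; rewrite in_itv/= gt_max => /andP[/andP[q0 nq] qx].
exists q; split => //; first exact: ltW.
rewrite -lte_fin -(stieltjes_ray (cumX w))//; last exact: ltW.
by apply: lt_le_trans rn _; apply: ray_mono; exact: ltW.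
Qed.

Let ray_fin w (x : R) : (zeta w `]-oo, x[%classic < +oo)%E.
Proof.
apply: (@le_lt_trans _ _ (zeta w `]-oo, Num.max 0 x]%classic)).
  apply: le_measure; rewrite ?inE; try exact: measurable_itv.
  by apply: subset_itvl; rewrite bnd_simp le_max lexx orbT.
by rewrite /zeta stieltjes_ray ?le_max ?lexx// ltry.
Qed.

(** Each rational q with q + a < s contributes a set of the form treated in [predictable_after],
    because the event on the path at time q is already known at q + a. *)
Let measurable_ray (a : R) : 0 <= a ->
  measurable_fun setT (fun p : TP => zeta p.1 `]-oo, p.2.1 - a[%classic).
Proof.
move=> a0; apply: emeasurable_fun_gt => [//|r r0].
pose E (q : rat) : set TP := if 0 <= ratr q :> R then
  [set p | [/\ r < X (ratr q) p.1 - X 0 p.1, ratr q + a < p.2.1 & setT p.2.2]] else set0.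
rewrite (_ : mkset _ = \bigcup_q E q).
  apply: bigcupT_measurable_rat => q; rewrite /E; case: ifPn => [q0|_]; last exact: measurable0.
  have qa : 0 <= ratr q + a by exact: addr_ge0.
  suff GA : G (ratr q + a) [set w | r < X (ratr q) w - X 0 w].
    have mT : measurable (setT : set R) by exact: measurableT.
    exact: (predictable_after qa GA mT).
  have [sG mG monG] := filG.
  apply: (monG (ratr q) _ q0); first by rewrite lerDl.
  have mq t : 0 <= t -> t <= ratr q ->
      @measurable_fun _ _ (g_sigma_algebraType (G (ratr q))) R setT (X t).
    move=> t0 tq _ B mB; rewrite setTI; apply: sub_sigma_algebra.
    by apply: monG (adaptX t0 mB).
  have := measurable_funB (mq _ q0 (lexx _)) (mq 0 (lexx _) q0).
  move=> /(_ measurableT `]r, +oo[%classic (measurable_itv _)); rewrite setTI /measurable/=.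
  rewrite (sigma_algebra_id (sG _ q0)).
  congr (G _ _); apply/seteqP; split => w /=; rewrite in_itv/= andbT//.
apply/seteqP; split => p /=.
  move=> /(ray_lt _ _ r0)[q [q0 qx rq]]; exists q => //; rewrite /E q0/=; split => //.
  by rewrite -ltrBrDr.
move=> [q _]; rewrite /E; case: ifPn => // q0 [rq qs _]; apply/(ray_lt _ _ r0).
by exists q; split => //; rewrite ltrBrDr.
Qed.

(** For the ray of lags above a, the past law is the mass before s - max(0, a), already known to be
    predictable. Such rays are stable under intersection, and a Dynkin class argument, with finite
    masses for the differences, reaches all measurable sets. *)
Lemma measurable_past_law (B : set (measurableTypeR R)) : measurable B ->
  measurable_fun setT (fun p : TP => past_law (zeta p.1) p.2.1 B).
Proof.
have mI (s : R) (C : set (measurableTypeR R)) : measurable C ->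
    measurable (`]-oo, s[ `&` [set u | C (s - u)] : set (measurableTypeR R)).
  move=> mC; apply: measurableI; first exact: measurable_itv.
  have mf : measurable_fun setT ((fun u => s - u) : measurableTypeR R -> measurableTypeR R).
    by apply: measurable_funB => //; exact: measurable_id.
  by have := mf measurableT _ mC; rewrite setTI.
have fin w s C : measurable C -> (past_law (zeta w) s C < +oo)%E.
  move=> mC; apply: le_lt_trans (ray_fin w s); apply: le_measure; rewrite ?inE.
  - exact: mI.
  - exact: measurable_itv.
  - exact: subIsetl.
have ray a : measurable_fun setT (fun p : TP => past_law (zeta p.1) p.2.1 `]a, +oo[%classic).
  have h : measurable_fun setT (fun p : TP => zeta p.1 `]-oo, p.2.1 - Num.max 0 a[%classic).
    by apply: measurable_ray; rewrite le_max lexx.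
  apply: eq_measurable_fun h => p _; congr (zeta _ _).
  have E u : (u < p.2.1 - Num.max 0 a) = (u < p.2.1) && (a < p.2.1 - u).
    by rewrite ltrBrDr -ltrBrDl gt_max subr_gt0.
  apply/seteqP; split => u /=; rewrite !in_itv/= andbT E; first by move/andP.
  by move=> [-> ->].
pose H := [set B : set (measurableTypeR R) | measurable B /\
  measurable_fun setT (fun p : TP => past_law (zeta p.1) p.2.1 B)].
suff : @measurable _ (measurableTypeR R) `<=` H by move=> /(_ B) h /h[].
rewrite (RGenOInfty.measurableE R).
apply: lambda_system_subset => //.
- move=> _ _ [a ->] [b ->]; exists (Num.max a b).
  apply/seteqP; split => x /=; rewrite !in_itv/= !andbT gt_max.
    by move=> [-> ->].
  by move=> /andP[].
- split.
  + by move=> *; exact: subsetT.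
  + split; first exact: measurableT.
    have := @measurable_ray 0 (lexx 0); apply: eq_measurable_fun => p _.
    by rewrite subr0 /past_law; congr (zeta _ _); apply/seteqP; split => u //= -[].
  + move=> C D DC [mC hC] [mD hD]; split; first exact: measurableD.
    have := emeasurable_funB hC hD; apply: eq_measurable_fun => p _ /=.
    rewrite [RHS](_ : _ = past_law (zeta p.1) p.2.1 C - past_law (zeta p.1) p.2.1 (C `&` D))%E.
      by rewrite setIidr.
    exact: (measureD (mu := past_law (zeta p.1) p.2.1) mC mD (fin _ _ _ mC)).
  + move=> F ndF HF; have mF n : measurable (F n) by case: (HF n).
    split; first exact: bigcup_measurable.
    apply: (@emeasurable_fun_cvg _ _ _ _ (fun n (p : TP) => past_law (zeta p.1) p.2.1 (F n))).
      by move=> n; case: (HF n).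
    move=> p _; apply: (nondecreasing_cvg_mu (mu := past_law (zeta p.1) p.2.1)) => //.
    exact: bigcup_measurable.
- move=> _ [a ->]; split; [exact: measurable_itv|exact: ray].
Qed.

Lemma measurable_predictable_convolution (f : R -> R) : measurable_fun setT f ->
  (forall x, 0 <= f x) ->
  measurable_fun setT (fun p : TP =>
    (\int[zeta p.1]_(u in `]-oo, p.2.1[) (f (p.2.1 - u))%:E)%E).
Proof.
move=> mf f0.
have := @measurable_fun_integral_kernel _ _ TP (measurableTypeR R) R
  (fun p => past_law (zeta p.1) p.2.1) measurable_past_law (EFin \o f).
have f0' z : (0 <= (EFin \o f) z)%E by rewrite lee_fin.
have mf' : measurable_fun setT (EFin \o f) by exact/measurable_EFinP.
move=> /(_ f0' mf'); apply: eq_measurable_fun => p _.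
by rewrite ge0_integral_past_law.
Qed.

End predictable_convolution.

(** * Stieltjes convolutions and the limit equation *)

Section translation.
Context {R : realType}.
Local Notation leb := (@lebesgue_measure R).

Lemma ge0_integral_translate (F : R -> \bar R) (c : R) : measurable_fun setT F ->
  (forall x, 0 <= F x)%E -> (\int[leb]_s F (s - c)%R = \int[leb]_v F v)%E.
Proof.
move=> mF F0.
have mf : measurable_fun setT ((fun x => x - c) : measurableTypeR R -> measurableTypeR R).
  by apply: measurable_funB => //; exact: measurable_id.
pose phi : {mfun measurableTypeR R >-> measurableTypeR R} :=
  HB.pack (fun x : R => x - c) (isMeasurableFun.Build _ _ _ _ _ mf).
transitivity (\int[pushforward leb phi]_v F v)%E.
  by rewrite ge0_integral_pushforward//= preimage_setT.
apply: eq_measure_integral => A mA _; apply/esym; apply: lebesgue_measure_unique => //.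
move=> _ [[a b] _ <-]/=; rewrite /pushforward/=.
rewrite (_ : _ @^-1` _ = `]a + c, b + c]%classic); last first.
  by apply/seteqP; split => x /=; rewrite !in_itv/= ltrBrDr lerBlDr.
rewrite !lebesgue_measure_itv/= !lte_fin ltrD2r; case: ifPn => // _.
by rewrite -!EFinB; congr EFin; ring.
Qed.

End translation.

Section convolution.
Context {R : realType}.
Local Notation leb := (@lebesgue_measure R).
Local Open Scope ereal_scope.

(** The integral runs over the whole line: the restriction to the past is carried by [f], which will
    vanish at negative lags. *)
Definition convolution (f : R -> R) (nu : {measure set (measurableTypeR R) -> \bar R})
  (s : R) : \bar R := \int[nu]_u (f (s - u))%:E.

Variable f : R -> R.
Hypotheses (mf : measurable_fun setT f) (f0 : forall v, (0 <= f v)%R).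

Let msub : measurable_fun setT (fun p : measurableTypeR R * measurableTypeR R => (p.1 - p.2)%R).
Proof. by apply: measurable_funB; [exact: measurable_fst|exact: measurable_snd]. Qed.

Let msub_f : measurable_fun setT (fun p : measurableTypeR R * measurableTypeR R => f (p.1 - p.2)%R).
Proof. exact: (measurableT_comp mf msub). Qed.

Lemma convolution_ge0 nu s : 0 <= convolution f nu s.
Proof. by apply: integral_ge0 => u _; rewrite lee_fin. Qed.

Lemma measurable_convolution (nu : {sigma_finite_measure set (measurableTypeR R) -> \bar R}) :
  measurable_fun setT (convolution f nu).
Proof.
have h : measurable_fun setT (fun p : measurableTypeR R * measurableTypeR R => (f (p.1 - p.2)%R)%:E).
  exact/measurable_EFinP.
apply: (measurable_fun_fubini_tonelli_F (m2 := nu)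
  (fun p : measurableTypeR R * measurableTypeR R => (f (p.1 - p.2)%R)%:E) h) => p.
by rewrite lee_fin.
Qed.

(** After Tonelli and the translation v = s - u, the condition 0 < s <= t becomes - v < u <= t - v.
    For v >= 0 the lower end may be removed, since [nu] does not charge the nonpositive
    half-line. *)
Lemma convolution_fubini (nu : {sigma_finite_measure set (measurableTypeR R) -> \bar R}) (t : R) :
  nu `]-oo, 0%R]%classic = 0 -> (forall v, (v < 0)%R -> f v = 0%R) ->
  \int[leb]_(s in `]0%R, t]) convolution f nu s =
  \int[leb]_v ((f v)%:E * nu `]-oo, (t - v)%R]%classic).
Proof.
move=> nu0 fneg.
have mI (x : R) : measurable (`]-oo, x]%classic : set (measurableTypeR R)) by exact: measurable_itv.
pose I : set (measurableTypeR R) := `]0%R, t]%classic.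
have mI' : measurable I by exact: measurable_itv.
pose F (p : measurableTypeR R * measurableTypeR R) : \bar R := (f (p.1 - p.2) * \1_I p.1)%:E.
have F0 p : 0 <= F p by rewrite lee_fin mulr_ge0// indicE.
have mF : measurable_fun setT F.
  apply/measurable_EFinP; apply: measurable_funM => //.
  apply: (measurableT_comp (measurable_indic mI')); exact: measurable_fst.
transitivity (\int[leb]_s \int[nu]_u F (s, u)).
  rewrite integral_mkcond; apply: eq_integral => s _; rewrite /patch /F/=.
  rewrite indicE; case: ifPn => sI.
    by rewrite /convolution; apply: eq_integral => u _; rewrite mulr1.
  by rewrite integral0_eq// => u _; rewrite mulr0.
rewrite (@fubini_tonelli _ _ _ _ R leb nu F mF F0).
pose H (p : measurableTypeR R * measurableTypeR R) : \bar R := (f p.1 * \1_I (p.1 + p.2)%R)%:E.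
have H0 p : 0 <= H p by rewrite lee_fin mulr_ge0// indicE.
have mH : measurable_fun setT H.
  apply/measurable_EFinP; apply: measurable_funM.
    exact: (measurableT_comp mf (@measurable_fst _ _ (measurableTypeR R) (measurableTypeR R))).
  apply: (measurableT_comp (measurable_indic mI')).
  by apply: measurable_funD; [exact: measurable_fst|exact: measurable_snd].
transitivity (\int[nu]_u \int[leb]_v H (v, u)).
  apply: eq_integral => u _; rewrite /fubini_G/=.
  rewrite -(@ge0_integral_translate R (fun v => H (v, u)) u).
  - by apply: eq_integral => s _; rewrite /F /H/= subrK.
  - by apply: measurableT_comp => //; exact: measurable_pair2.
  - by [].
rewrite -(@fubini_tonelli _ _ _ _ R leb nu H mH H0).
apply: eq_integral => v _; rewrite /fubini_F/=.
have [v0|v0] := ltP v 0%R.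
  rewrite fneg// mul0e integral0_eq// => u _.
  by rewrite /H/= fneg// mul0r.
have E u : H (v, u) = (f v)%:E * (\1_(`](- v)%R, (t - v)%R]%classic) u)%:E.
  rewrite /H/= EFinM; congr (_ * (_ )%:E).
  rewrite !indicE; congr (_ %:R); congr nat_of_bool.
  by apply/idP/idP; rewrite !inE /I/= !in_itv/= => /andP[h1 h2]; apply/andP; split; lra.
under eq_integral do rewrite E.
have mJ : measurable (`](- v)%R, (t - v)%R]%classic : set (measurableTypeR R)) by exact: measurable_itv.
rewrite ge0_integralZl//; last 2 first.
- by apply/measurable_EFinP; exact: measurable_indic.
- by rewrite lee_fin.
rewrite integral_indic// setIT; congr (_ * _).
have nuv : nu `]-oo, (- v)%R]%classic = 0.
  apply/eqP; rewrite eq_le measure_ge0 andbT -nu0.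
  apply: le_measure; rewrite ?inE//; apply: subset_itvl.
  by rewrite bnd_simp oppr_le0.
apply/eqP; rewrite eq_le; apply/andP; split.
  by apply: le_measure; rewrite ?inE//; apply: subset_itvr; rewrite bnd_simp.
apply: (@le_trans _ _ (nu (`]-oo, (- v)%R]%classic `|` `](- v)%R, (t - v)%R]%classic))).
  apply: le_measure; rewrite ?inE//; first exact: measurableU.
  move=> x /=; rewrite !in_itv/= => xt; have [h|h] := leP x (- v)%R; first by left.
  by right; rewrite xt.
apply: (le_trans (measureU2 _ _ _)) => //.
by rewrite [X in X + _](_ : _ = 0) ?add0e//.
Qed.

End convolution.

Section nonnegative_integrals.
Context d (T : measurableType d) (R : realType) (nu : {measure set T -> \bar R}).
Local Open Scope ereal_scope.

Lemma ge0_integral_fine (D : set T) (f : T -> \bar R) : measurable D ->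
  measurable_fun D f -> (forall x, 0 <= f x) -> \int[nu]_(x in D) f x < +oo ->
  \int[nu]_(x in D) (fine (f x))%:E = \int[nu]_(x in D) f x.
Proof.
move=> mD mf f0 fi.
have i : nu.-integrable D f.
  by apply/integrableP; split => //; under eq_integral do rewrite gee0_abs//.
apply: ge0_ae_eq_integral => //.
- by apply/measurable_EFinP; apply: measurableT_comp.
- by move=> x _; rewrite lee_fin fine_ge0.
- by apply: filterS (integrable_ae mD i) => x h Dx; rewrite fineK// h.
Qed.

(* Unlike [ge0_le_integral], this requires no measurability. *)
Lemma ge0_le_integral_any (D : set T) (f g : T -> \bar R) : (forall x, D x -> 0 <= f x) ->
  (forall x, D x -> f x <= g x) ->
  \int[nu]_(x in D) f x <= \int[nu]_(x in D) g x.
Proof.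
move=> f0 fg; rewrite (integral_mkcond D f) (integral_mkcond D g).
have h x : 0 <= (f \_ D) x <= (g \_ D) x.
  rewrite /patch; case: ifPn => [|_]; last by rewrite !lexx.
  by rewrite inE => Dx; rewrite f0//= fg.
rewrite !ge0_integralTE => [|x|x]; last 2 first.
- by case/andP: (h x) => /le_trans; exact.
- by case/andP: (h x).
apply: le_ereal_sup => _ [k kf <-]; exists k => // x.
by apply: (le_trans (kf x)); case/andP: (h x).
Qed.

End nonnegative_integrals.

Section contraction.
Context {R : realType}.

(** Plays the role of Gronwall's lemma. A finite a priori bound [B] improves under b -> c + q b, and
    the iterates converge to the fixed point c / (1 - q), whatever the size of [B]. *)
Lemma contraction_bound (K : R -> R) (t B c q : R) : 0 <= q < 1 -> 0 <= c -> 0 <= B ->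
  (forall b, 0 <= b -> (forall y, 0 <= y <= t -> K y <= b) ->
     forall x, 0 <= x <= t -> K x <= c + q * b) ->
  (forall x, 0 <= x <= t -> K x <= B) ->
  forall x, 0 <= x <= t -> K x <= c / (1 - q).
Proof.
move=> /andP[q0 q1] c0 B0 step KB.
have q1' : 0 < 1 - q by rewrite subr_gt0.
have c1 : 0 <= c / (1 - q) by rewrite divr_ge0// ltW.
have H n x : 0 <= x <= t -> K x <= c / (1 - q) + q ^+ n * B.
  elim: n x => [|n IH] x xt; first by rewrite expr0 mul1r ler_wpDl// KB.
  apply: (le_trans (step _ _ IH _ xt)); first by rewrite addr_ge0// mulr_ge0// exprn_ge0.
  rewrite mulrDr [q * (_ ^+ _ * _)]mulrA -exprS addrA lerD2r.
  by rewrite le_eqVlt; apply/orP; left; apply/eqP; field; rewrite gt_eqF.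
move=> x xt.
have cv : c / (1 - q) + q ^+ n * B @[n --> \oo] --> c / (1 - q).
  rewrite -[X in _ --> X]addr0; apply: cvgD; first exact: cvg_cst.
  rewrite -(mul0r B); apply: cvgM; last exact: cvg_cst.
  by apply: cvg_expr; rewrite ger0_norm.
by apply: (cvgr_to_ge cv); apply: nearW => n; exact: H.
Qed.

End contraction.

Section stieltjes_convolution.
Context {R : realType}.
Local Notation leb := (@lebesgue_measure R).
Local Open Scope ereal_scope.

(** Lets the integrals over [[0, s]] and [[0, s[] of the two equations be read on the whole line,
    the domain being carried by the kernel. *)
Lemma integral_stieltjes_positive (nu : {measure set (measurableTypeR R) -> \bar R})
    (D : set (measurableTypeR R)) (f : R -> \bar R) :
  nu `]-oo, 0%R]%classic = 0 -> measurable D -> measurable_fun setT f ->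
  (forall u, 0 <= f u) -> (forall u, (0 < u)%R -> ~ D u -> f u = 0) ->
  \int[nu]_(u in D) f u = \int[nu]_u f u.
Proof.
move=> nu0 mD mf f0 fD.
have mN : measurable (`]-oo, 0%R]%classic : set (measurableTypeR R)) by exact: measurable_itv.
rewrite (ge0_negligible_integral mN)//; last exact: measurable_funTS.
rewrite [RHS](ge0_negligible_integral mN)//.
rewrite integral_mkcond [RHS]integral_mkcond; apply: eq_integral => u _.
rewrite /patch; case: ifPn => [|uD]; first by rewrite inE => -[_ uN]; rewrite mem_set.
case: ifPn => //; rewrite inE => -[_ uN]; rewrite fD//.
  by rewrite ltNge; apply/negP => u0; apply: uN; rewrite /= in_itv.
by move=> Du; move: uD; rewrite notin_setE; apply; split.
Qed.

Lemma stieltjes_sigma_finite (Y : R -> R) : is_cumulative Y ->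
  exists nu : {sigma_finite_measure set (measurableTypeR R) -> \bar R},
    stieltjes Y = nu :> {measure set (measurableTypeR R) -> \bar R}.
Proof.
move=> h; rewrite /stieltjes; case: pselect => // {}h.
by exists (lebesgue_stieltjes_measure (cumulative_of h)).
Qed.

Lemma extend0_ge0 (Y : R -> R) x : is_cumulative Y -> Y 0%R = 0%R -> (0 <= extend0 Y x)%R.
Proof.
move=> [h _] Y0; rewrite -Y0 -[Y 0%R]/(Y 0%R).
have -> : Y 0%R = extend0 Y (Num.min 0 x)%R.
  by rewrite /extend0; congr Y; apply/esym/max_idPl; rewrite ge_min lexx.
by apply: h; rewrite ge_min lexx orbT.
Qed.

Lemma stieltjes_rayE (Y : R -> R) x : is_cumulative Y -> Y 0%R = 0%R ->
  stieltjes Y `]-oo, x]%classic = (extend0 Y x)%:E.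
Proof.
move=> YP Y0; have [x0|x0] := leP 0%R x.
  by rewrite stieltjes_ray// Y0 subr0 /extend0 (max_idPr x0).
rewrite /extend0 (max_idPl (ltW x0)) Y0; apply/eqP; rewrite eq_le measure_ge0 andbT.
apply: (@le_trans _ _ (stieltjes Y `]-oo, 0%R]%classic)); last by rewrite stieltjes_le0.
apply: le_measure; rewrite ?inE; try exact: measurable_itv.
by apply: subset_itvl; rewrite bnd_simp ltW.
Qed.

Variables (f : R -> R) (Lam : R).
Hypotheses (mf : measurable_fun setT f) (f0 : forall v, (0 <= f v)%R).
Hypothesis (fneg : forall v, (v < 0)%R -> f v = 0%R).
Hypothesis (fL : \int[leb]_v (f v)%:E = Lam%:E).

Lemma kernel_mass_ge0 : (0 <= Lam)%R.
Proof. by rewrite -lee_fin -fL; apply: integral_ge0 => v _; rewrite lee_fin. Qed.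

Lemma measurable_convolution_stieltjes Y : is_cumulative Y ->
  measurable_fun setT (convolution f (stieltjes Y)).
Proof.
by move=> /stieltjes_sigma_finite[nu E]; rewrite /convolution E; exact: measurable_convolution.
Qed.

Lemma integral_convolution_stieltjes Y t : is_cumulative Y -> Y 0%R = 0%R ->
  \int[leb]_(s in `]0%R, t]) convolution f (stieltjes Y) s =
  \int[leb]_v ((f v)%:E * (extend0 Y (t - v))%:E).
Proof.
move=> YP Y0; have [nu E] := stieltjes_sigma_finite YP.
have E' X : nu X = stieltjes Y X by rewrite E.
rewrite /convolution E (convolution_fubini mf f0)//.
  by apply: eq_integral => v _; rewrite E' stieltjes_rayE.
by rewrite E' stieltjes_le0.
Qed.

Lemma measurable_extend0 (Y : R -> R) : is_cumulative Y -> measurable_fun setT (extend0 Y).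
Proof. by move=> [h _]; apply: nondecreasing_measurable. Qed.

Lemma convolution_stieltjes_le (Y : R -> R) t b : (0 <= b)%R ->
  (forall x, (0 <= x <= t)%R -> (0 <= extend0 Y x <= b)%R) -> Y 0%R = 0%R ->
  \int[leb]_v ((f v)%:E * (extend0 Y (t - v))%:E) <= (Lam * b)%:E.
Proof.
move=> b0 Yb Y0.
rewrite EFinM -fL muleC -ge0_integralZl//; last 2 first.
- exact/measurable_EFinP.
- by move=> v _; rewrite lee_fin.
have H v : (0 <= v)%R -> (0 <= extend0 Y (t - v) <= b)%R.
  move=> v0; have [tv|tv] := leP 0%R (t - v)%R; first by rewrite Yb// tv gerBl.
  by rewrite /extend0 (max_idPl (ltW tv)) Y0 lexx.
apply: ge0_le_integral_any => v _; have [v0|v0] := ltP v 0%R.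
- by rewrite fneg// mul0e.
- by have /andP[h _] := H v v0; rewrite mule_ge0// lee_fin.
- by rewrite fneg// mul0e mule0.
- by have /andP[_ h] := H v v0; rewrite muleC -!EFinM lee_fin ler_wpM2r.
Qed.

Lemma integral_convolution_lty Y t : is_cumulative Y -> Y 0%R = 0%R ->
  \int[leb]_(s in `]0%R, t]) convolution f (stieltjes Y) s < +oo.
Proof.
move=> YP Y0; rewrite integral_convolution_stieltjes//.
apply: (@le_lt_trans _ _ (Lam * extend0 Y t)%:E); last by rewrite ltry.
apply: convolution_stieltjes_le => // [|x /andP[x0 xt]]; first exact: extend0_ge0.
by rewrite extend0_ge0//=; apply: YP.1.
Qed.

(** The convolution has a finite integral, hence is finite for almost every s, and [fine] changes
    nothing under the integral. *)
Lemma integral_fine_convolution Y t : is_cumulative Y -> Y 0%R = 0%R ->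
  \int[leb]_(s in `]0%R, t]) (fine (convolution f (stieltjes Y) s))%:E =
  \int[leb]_v ((f v)%:E * (extend0 Y (t - v))%:E).
Proof.
move=> YP Y0; rewrite -integral_convolution_stieltjes//.
apply: ge0_integral_fine => //.
- by apply: measurable_funTS; exact: measurable_convolution_stieltjes.
- by move=> s; exact: convolution_ge0.
- exact: integral_convolution_lty.
Qed.

End stieltjes_convolution.

Section causal_kernel.
Context {R : realType}.
Local Notation leb := (@lebesgue_measure R).

(* [causal phi] is the kernel of the intensities, which exclude a jump at the
   current time; [causal_le phi] is that of the limit equation. *)
Definition causal (phi : R -> R) (v : R) : R := if 0 < v then phi v else 0.
Definition causal_le (phi : R -> R) (v : R) : R := if 0 <= v then phi v else 0.

Variables (phi : R -> R) (Lam : R).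
Hypotheses (phi_ge0 : forall s, 0 <= s -> 0 <= phi s)
  (phi_meas : measurable_fun (`[0, +oo[ : set R) phi)
  (phi_int : (\int[leb]_(s in `[0%R, +oo[) (phi s)%:E)%E = Lam%:E).

Lemma causal_ge0 v : 0 <= causal phi v.
Proof. by rewrite /causal; case: ifPn => // v0; rewrite phi_ge0// ltW. Qed.

Lemma causal_le_ge0 v : 0 <= causal_le phi v.
Proof. by rewrite /causal_le; case: ifPn => // v0; rewrite phi_ge0. Qed.

Lemma measurable_causal : measurable_fun setT (causal phi).
Proof.
rewrite (_ : causal phi = phi \_ `]0, +oo[).
  apply/(measurable_restrict _ _ _) => //; rewrite setTI.
  by apply: measurable_funS phi_meas => //; apply: subset_itvr; rewrite bnd_simp.
apply/funext => v; rewrite /causal /patch; case: ifPn => v0.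
  by rewrite mem_set//= in_itv/= v0.
by rewrite memNset//= in_itv/= andbT; apply/negP.
Qed.

Lemma measurable_causal_le : measurable_fun setT (causal_le phi).
Proof.
rewrite (_ : causal_le phi = phi \_ `[0, +oo[).
  by apply/(measurable_restrict _ _ _) => //; rewrite setTI.
apply/funext => v; rewrite /causal_le /patch; case: ifPn => v0.
  by rewrite mem_set//= in_itv/= v0.
by rewrite memNset//= in_itv/= andbT; apply/negP.
Qed.

Lemma causal_le_neg v : v < 0 -> causal_le phi v = 0.
Proof. by move=> v0; rewrite /causal_le leNgt v0. Qed.

Lemma causal_neg v : v < 0 -> causal phi v = 0.
Proof. by move=> v0; rewrite /causal ltNge ltW. Qed.

Lemma integral_causal_le : (\int[leb]_v (causal_le phi v)%:E)%E = Lam%:E.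
Proof.
rewrite -phi_int [RHS]integral_mkcond; apply: eq_integral => v _.
rewrite /causal_le /patch; case: ifPn => v0.
  by rewrite mem_set//= in_itv/= v0.
by rewrite memNset//= in_itv/= andbT; apply/negP.
Qed.

Lemma causal_ae (g : R -> R) : measurable_fun setT g -> (forall v, 0 <= g v) ->
  (\int[leb]_v ((causal_le phi v)%:E * (g v)%:E) =
   \int[leb]_v ((causal phi v)%:E * (g v)%:E))%E.
Proof.
move=> mg g0; apply: ge0_ae_eq_integral => //.
- by apply/measurable_EFinP; apply: measurable_funM => //; exact: measurable_causal_le.
- by apply/measurable_EFinP; apply: measurable_funM => //; exact: measurable_causal.
- by move=> v _; rewrite lee_fin mulr_ge0// causal_le_ge0.
- by move=> v _; rewrite lee_fin mulr_ge0// causal_ge0.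
exists [set 0]; split => //; first exact: lebesgue_measure_set1.
move=> v /= h; apply: contrapT => v0; apply: h => _.
rewrite /causal /causal_le le_eqVlt; case: eqP => // e; by case: v0.
Qed.

Lemma integral_causal : (\int[leb]_v (causal phi v)%:E)%E = Lam%:E.
Proof.
have := @causal_ae (fun=> 1) (measurable_cst _) (fun=> ler01).
under eq_integral do rewrite mule1.
by under [in RHS]eq_integral do rewrite mule1; rewrite integral_causal_le.
Qed.

End causal_kernel.

Section limit_equation.
Context {R : realType}.
Local Notation leb := (@lebesgue_measure R).
Variables (mu Lam : R) (h phi m : R -> R).
Hypotheses (hmu : 0 < mu) (hh : forall x, h x = mu + x)
  (phi_ge0 : forall s, 0 <= s -> 0 <= phi s)
  (phi_meas : measurable_fun (`[0, +oo[ : set R) phi)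
  (phi_int : (\int[leb]_(s in `[0%R, +oo[) (phi s)%:E)%E = Lam%:E)
  (Lam_lt1 : Lam < 1) (hm : mean_field_limit h phi m).

Local Notation f := (causal phi).
Let mf := measurable_causal phi_meas.
Let f0 := causal_ge0 phi_ge0.
Let fneg := @causal_neg _ phi.
Let fL := integral_causal phi_ge0 phi_meas phi_int.

Lemma integral_cst_itv (c t : R) : 0 <= t ->
  (\int[leb]_(s in `]0%R, t]) c%:E)%E = (c * t)%:E.
Proof.
move=> t0; rewrite integral_cst//.
rewrite [X in (_ * X)%E = _](_ : _ = leb `]0, t]%classic)// lebesgue_measure_itv/= lte_fin; case: ltP => [_|t0'].
  by rewrite sube0.
by have /eqP -> : t == 0 by rewrite eq_le t0 t0'. 
Qed.

Let limit_eq := let: And3 _ _ e := hm in e.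

(** If [m] were not cumulative, its Stieltjes measure would be the default zero measure and the
    equation would read m t = mu t; but this function is cumulative. *)
Lemma limit_cumulative : is_cumulative m.
Proof.
have lin : is_cumulative (fun t => mu * t).
  split => [x y xy|x]; first by rewrite /extend0 ler_pM2l// ge_max !le_max lexx xy orbT.
  apply: cvgM; first exact: cvg_cst.
  apply: cvg_at_right_filter.
  have c1 : continuous (fun _ : R => 0 : R) by move=> ?; exact: cvg_cst.
  have c2 : continuous (fun x : R => x) by move=> ?; exact: cvg_id.
  exact: (max_fun_continuous c1 c2).
have [//|nm] := pselect (is_cumulative m).
suff E : extend0 m = extend0 (fun t => mu * t) by rewrite /is_cumulative E.
apply/funext => t; rewrite /extend0; set s := Num.max 0 t.
have s0 : 0 <= s by rewrite le_max lexx.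
apply: EFin_inj; rewrite limit_eq// -integral_cst_itv//.
rewrite integral_itv_obnd_cbnd//.
apply: eq_integral => u _; rewrite hh.
rewrite /stieltjes; case: pselect => // _.
by rewrite /Rintegral integral_measure_zero addr0.
Qed.

Let mP := limit_cumulative.

Lemma limit0 : m 0 = 0.
Proof.
apply: EFin_inj; rewrite limit_eq// set_itv1 integral_set1//.
Qed.

Let f1_ge0 := causal_le_ge0 phi_ge0.
Let mf1 := measurable_causal_le phi_meas.
Let f1neg := @causal_le_neg _ phi.
Let f1L := integral_causal_le phi_int.

(** Integrated in time, the rate equation becomes a renewal equation in the values of [m]. There the
    kernel at the single lag 0 does not count, so the closed kernel of the limit is exchanged for
    the open one of the particles. *)
Lemma limit_convolution t : 0 <= t ->
  ((m t)%:E = (mu * t)%:E + \int[leb]_v ((f v)%:E * (extend0 m (t - v))%:E))%E.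
Proof.
move=> t0; rewrite limit_eq//.
have mc := measurable_convolution_stieltjes mf1 f1_ge0 mP.
transitivity (\int[leb]_(s in `[0%R, t])
    (mu%:E + (fine (convolution (causal_le phi) (stieltjes m) s))%:E))%E.
  apply: eq_integral => s; rewrite inE/= in_itv/= => /andP[s0 st].
  rewrite hh EFinD; congr (_ + (fine _)%:E)%E.
  transitivity (\int[stieltjes m]_(u in `[0%R, s]) (causal_le phi (s - u))%:E)%E.
    apply: eq_integral => u; rewrite inE/= in_itv/= => /andP[u0 us].
    by rewrite /causal_le subr_ge0 us.
  apply: (integral_stieltjes_positive (stieltjes_le0 mP)).
  - exact: measurable_itv.
  - apply/measurable_EFinP; apply: measurableT_comp => //.
    by apply: measurable_funB => //.
  - by move=> u; rewrite lee_fin.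
  - move=> u u0 /= /negP; rewrite in_itv/= negb_and -!ltNge => /orP[us|su].
      by have := lt_trans u0 us; rewrite ltxx.
    by rewrite causal_le_neg// subr_lt0.
rewrite -integral_itv_obnd_cbnd; last first.
  by apply: measurable_funTS; apply: emeasurable_funD => //; apply/measurable_EFinP;
    exact: measurableT_comp.
rewrite ge0_integralD//; last 3 first.
- by move=> s _; rewrite lee_fin ltW.
- by move=> s _; rewrite lee_fin fine_ge0// convolution_ge0.
- by apply/measurable_EFinP; apply: measurable_funTS; exact: measurableT_comp.
rewrite integral_cst_itv// (integral_fine_convolution mf1 f1_ge0 f1neg f1L _ mP limit0).
congr (_ + _)%E; apply: (causal_ae phi_ge0 phi_meas) => [|v].
  apply: measurableT_comp; first exact: measurable_extend0.
  by apply: measurable_funB.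
by apply: extend0_ge0 => //; exact: limit0.
Qed.

Lemma limit_ge t : 0 <= t -> mu * t <= m t.
Proof.
move=> t0; rewrite -lee_fin limit_convolution// leeDl// integral_ge0// => v _.
by rewrite mule_ge0// lee_fin ?f0// extend0_ge0// limit0.
Qed.

Lemma extend0E t : 0 <= t -> extend0 m t = m t.
Proof. by move=> t0; rewrite /extend0 (max_idPr t0). Qed.

Lemma limit_ge0 t : 0 <= t -> 0 <= m t.
Proof. by move=> t0; apply: le_trans (limit_ge t0); rewrite mulr_ge0// ltW. Qed.

Lemma limit_le_mono s t : 0 <= s -> s <= t -> m s <= m t.
Proof. by case: hm => + _ _; apply. Qed.

(** By monotonicity the delayed term is at most Lam m t, and the resulting inequality is solved for
    m t. *)
Lemma limit_le t : 0 <= t -> m t <= mu / (1 - Lam) * t.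
Proof.
move=> t0; suff mt : m t <= mu * t + Lam * m t.
  by rewrite mulrAC ler_pdivlMr ?subr_gt0//; lra.
rewrite -lee_fin limit_convolution// EFinD leeD2l//.
apply: (convolution_stieltjes_le mf f0 fneg fL) => [|x /andP[x0 xt]|].
- exact: limit_ge0.
- by rewrite extend0E// limit_ge0//= limit_le_mono.
- exact: limit0.
Qed.

End limit_equation.

(** * Estimates for systems of particles *)

Section area_integral.
Context {R : realType}.
Local Notation leb := (@lebesgue_measure R).

(* [area] lives on the default sigma-algebra of [R * R], the product measure on
   that of [measurableTypeR R]. *)
Lemma ge0_integral_area (F : measurableTypeR R * measurableTypeR R -> \bar R) :
  measurable_fun setT F -> (forall p, 0 <= F p)%E ->
  (\int[area]_p F p = \int[leb \x leb]_p F p)%E.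
Proof.
move=> mF F0.
have mid : @measurable_fun _ _ (R * R)%type (measurableTypeR R * measurableTypeR R)%type
    setT (fun p => p).
  by move=> _ A mA; rewrite setTI; exact: mA.
pose idm : {mfun (R * R)%type >-> (measurableTypeR R * measurableTypeR R)%type} :=
  HB.pack (fun p : R * R => p) (isMeasurableFun.Build _ _ _ _ _ mid).
transitivity (\int[pushforward area idm]_p F p)%E.
  by rewrite ge0_integral_pushforward//= preimage_setT.
by apply: eq_measure_integral => A mA _.
Qed.

End area_integral.

Section subgraph.
Context {R : realType}.
Local Notation leb := (@lebesgue_measure R).

Definition subgraph (g : R -> R) (t : R) : set (R * R) :=
  [set p | 0 < p.1 <= t /\ 0 <= p.2 <= g p.1].

Variable g : R -> R.
Hypothesis mg : measurable_fun setT g.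

Lemma measurable_subgraph t : measurable (subgraph g t).
Proof.
have m1 : measurable_fun setT (fun p : R * R => p.1) by exact: measurable_fst.
have m2 : measurable_fun setT (fun p : R * R => p.2) by exact: measurable_snd.
have m3 : measurable_fun setT (fun p : R * R => g p.1 - p.2).
  by apply: measurable_funB => //; exact: (measurableT_comp mg m1).
have i1 := m1 measurableT _ (measurable_itv `]0, t]).
have i2 := m2 measurableT _ (measurable_itv `[0, +oo[).
have i3 := m3 measurableT _ (measurable_itv `[0, +oo[).
rewrite (_ : subgraph g t = (setT `&` (fun p : R * R => p.1) @^-1` `]0, t]) `&`
  ((setT `&` (fun p : R * R => p.2) @^-1` `[0, +oo[) `&`
   (setT `&` (fun p : R * R => g p.1 - p.2) @^-1` `[0, +oo[))).
  by apply: measurableI => //; exact: measurableI.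
apply/seteqP; split => p; rewrite /subgraph /= !in_itv/= !andbT subr_ge0.
  by move=> [-> /andP[-> ->]].
by move=> [[_ ->] [[_ ->] [_ ->]]].
Qed.

Hypothesis g0 : forall s, 0 <= g s.

Lemma integral_subgraph (F : R -> \bar R) t : measurable_fun setT F ->
  (forall u, 0 <= F u)%E ->
  (\int[area]_(p in subgraph g t) F p.1 =
   \int[leb]_(u in `]0%R, t]) (F u * (g u)%:E))%E.
Proof.
move=> mF F0; have mS := measurable_subgraph t.
have mH : measurable_fun setT
    (fun p : measurableTypeR R * measurableTypeR R => (F p.1 * (\1_(subgraph g t) p)%:E)%E).
  apply: emeasurable_funM.
    exact: (measurableT_comp mF (@measurable_fst _ _ (measurableTypeR R) (measurableTypeR R))).
  by apply/measurable_EFinP; exact: measurable_indic.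
have H0 (p : R * R) : (0 <= F p.1 * (\1_(subgraph g t) p)%:E)%E.
  by rewrite mule_ge0// lee_fin.
transitivity (\int[leb \x leb]_p (F p.1 * (\1_(subgraph g t) p)%:E))%E.
  rewrite integral_mkcond; transitivity (\int[area]_p (F p.1 * (\1_(subgraph g t) p)%:E))%E.
    apply: eq_integral => p _; rewrite /patch indicE.
    by case: ifPn => _; rewrite ?mule1 ?mule0.
  exact: (@ge0_integral_area R _ mH H0).
rewrite (fubini_tonelli1 _ mH)//.
rewrite [RHS]integral_mkcond; apply: eq_integral => u _; rewrite /fubini_F/= /patch.
case: ifPn => [|ut].
  rewrite inE/= in_itv/= => ut.
  rewrite ge0_integralZl//; last first.
    have h := @measurable_pair1 _ _ (measurableTypeR R) (measurableTypeR R) u.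
    apply/measurable_EFinP; apply: measurableT_comp h.
    exact: measurable_indic.
  congr (_ * _)%E.
  transitivity (\int[leb]_z (\1_(`[0, g u]%classic) z)%:E)%E.
    apply: eq_integral => z _; rewrite !indicE; congr (_%:R%:E).
    congr nat_of_bool; apply/idP/idP; rewrite !inE /subgraph/= in_itv/= ut; first by case.
    by [].
  rewrite integral_indic//= setIT lebesgue_measure_itv/= lte_fin.
  case: ltP => [_|gu]; first by rewrite oppr0 addr0.
  by have /eqP -> : g u == 0 by rewrite eq_le gu g0.
rewrite integral0_eq// => z _.
rewrite indicE memNset ?mule0//; move=> [ /= h _]; move: ut.
by rewrite notin_setE/= in_itv/= h.
Qed.

Lemma area_subgraph t : (area (subgraph g t) = \int[leb]_(u in `]0%R, t]) (g u)%:E)%E.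
Proof.
have := @integral_subgraph (fun=> 1%E) t (measurable_cst _) (fun=> lee01).
under [in RHS]eq_integral do rewrite mul1e.
move=> <-; rewrite integral_cst ?mul1e//; exact: measurable_subgraph.
Qed.

End subgraph.

Section stieltjes_of_random_measure.
Context {R : realType}.
Variables (kappa : {measure set (R * R)%type -> \bar R}) (S : set (R * R)) (Y : R -> R).
Hypotheses (mS : measurable S) (S0 : forall p, S p -> 0 < p.1) (YP : is_cumulative Y)
  (YS : forall t, 0 <= t -> (Y t)%:E = kappa (S `&` [set p | p.1 <= t])).

Let mle (t : R) : measurable ([set p : R * R | p.1 <= t]).
Proof.
have := (@measurable_fst _ _ R R) measurableT _ (measurable_itv `]-oo, t]).
rewrite setTI; congr (measurable _); apply/seteqP; split => p /=; by rewrite in_itv.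
Qed.

Let extendS t : (extend0 Y t)%:E = kappa (S `&` [set p | p.1 <= t]).
Proof.
rewrite /extend0; have [t0|t0] := leP 0 t; first by rewrite YS.
rewrite YS//; congr (kappa _); apply/seteqP; split => p [/[dup]/S0 p0 Sp /= pt]; split => //=.
  by move: (lt_le_trans p0 pt); rewrite ltxx.
by rewrite (le_trans pt)// ltW.
Qed.

(** dY is the image of [kappa], restricted to [S], under the projection on time: the two measures
    agree on half-open intervals. *)
Lemma ge0_integral_stieltjes (F : R -> \bar R) : measurable_fun setT F ->
  (forall u, 0 <= F u)%E ->
  (\int[stieltjes Y]_u F u = \int[kappa]_(p in S) F p.1)%E.
Proof.
move=> mF F0.
have mf : measurable_fun setT ((fun p => p.1) : R * R -> measurableTypeR R).
  exact: measurable_fst.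
pose pr : {mfun (R * R)%type >-> measurableTypeR R} :=
  HB.pack (fun p : R * R => p.1) (isMeasurableFun.Build _ _ _ _ _ mf).
transitivity (\int[pushforward (mrestr kappa mS) pr]_u F u)%E.
  apply: eq_measure_integral => A mA _.
  apply: stieltjes_unique => // a b ab; rewrite EFinB !extendS.
  transitivity (kappa ((S `&` [set p | p.1 <= b]) `\` (S `&` [set p | p.1 <= a]))).
    rewrite /= /pushforward /mrestr; congr (kappa _); apply/seteqP; split => p /=; rewrite in_itv/=.
      by move=> [/andP[ap pb] Sp]; split => // -[_]; rewrite leNgt ap.
    move=> [[Sp pb] nap]; split => //; rewrite pb andbT ltNge; apply/negP => pa.
    exact: nap.
  have m1 := measurableI _ _ mS (mle b); have m2 := measurableI _ _ mS (mle a).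
  have -> : kappa ((S `&` [set p | p.1 <= b]) `\` (S `&` [set p | p.1 <= a])) =
      (kappa (S `&` [set p | p.1 <= b]%R) -
       kappa ((S `&` [set p | p.1 <= b]%R) `&` (S `&` [set p | p.1 <= a]%R)))%E.
    by apply: measureD => //; apply: (@le_lt_trans _ _ (extend0 Y b)%:E); rewrite ?ltry// extendS.
  congr (_ - kappa _)%E; apply/seteqP; split => p /=; first tauto.
  by move=> [Sp pa]; split => //; split => //; exact: le_trans pa ab.
rewrite ge0_integral_pushforward//= preimage_setT ge0_integral_mrestr//.
exact: (measurableT_comp mF mf).
Qed.

End stieltjes_of_random_measure.

Section convolution_density.
Context {R : realType}.
Local Notation leb := (@lebesgue_measure R).
Local Open Scope ereal_scope.
Variables (f : R -> R) (Lam : R).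
Hypotheses (mf : measurable_fun setT f) (f0 : forall v, (0 <= f v)%R).
Hypothesis (fL : \int[leb]_v (f v)%:E = Lam%:E).

Lemma integral_convolution_density (g : R -> \bar R) : measurable_fun setT g ->
  (forall u, 0 <= g u) ->
  \int[leb]_s \int[leb]_u ((f (s - u))%:E * g u) = Lam%:E * \int[leb]_u g u.
Proof.
move=> mg g0.
have L0 : 0 <= Lam%:E by rewrite -fL; apply: integral_ge0 => v _; rewrite lee_fin.
have mm : measurable_fun setT (fun p : measurableTypeR R * measurableTypeR R =>
    (f (p.1 - p.2)%R)%:E * g p.2).
  apply: emeasurable_funM.
    apply/measurable_EFinP; apply: (measurableT_comp mf).
    by apply: measurable_funB; [exact: measurable_fst|exact: measurable_snd].
  exact: (measurableT_comp mg (@measurable_snd _ _ (measurableTypeR R) (measurableTypeR R))).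
rewrite (@fubini_tonelli _ _ _ _ R leb leb _ mm); last first.
  by move=> p; rewrite mule_ge0// lee_fin.
rewrite -ge0_integralZl//; apply: eq_integral => u _ /=.
under eq_integral do rewrite muleC.
rewrite ge0_integralZl//; last 2 first.
- apply/measurable_EFinP; apply: (measurableT_comp mf).
  by apply: measurable_funB => //; exact: measurable_id.
- by move=> s _; rewrite lee_fin.
rewrite (@ge0_integral_translate _ (fun v => (f v)%:E) u) ?fL 1?muleC//.
exact/measurable_EFinP.
Qed.

End convolution_density.

Section subgraph_integrals.
Context {R : realType}.
Local Notation leb := (@lebesgue_measure R).
Variable kappa : {measure set (R * R)%type -> \bar R}.
Variable g : R -> R.
Hypothesis mg : measurable_fun setT g.

Let mS t := measurable_subgraph mg t.

Lemma measurable_past_set (B : set R) (s : R) : measurable B ->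
  measurable [set p : R * R | B (s - p.1)].
Proof.
move=> mB; have ms : measurable_fun setT (fun p : R * R => s - p.1).
  by apply: measurable_funB => //; exact: measurable_fst.
by have := ms measurableT _ mB; rewrite setTI.
Qed.

(** As [F] vanishes at nonpositive lags, only the points before s count, so one horizon t serves for
    all s <= t. *)
Lemma convolution_subgraph (Y F : R -> R) s t : is_cumulative Y ->
  (forall x, 0 <= x -> (Y x)%:E = kappa (subgraph g x)) ->
  measurable_fun setT F -> (forall v, 0 <= F v) -> (forall v, v <= 0 -> F v = 0) -> s <= t ->
  (convolution F (stieltjes Y) s = \int[kappa]_(p in subgraph g t) (F (s - p.1))%:E)%E.
Proof.
move=> YP Yk mF F0 Fneg st.
pose S := [set p : R * R | 0 < p.1 /\ 0 <= p.2 <= g p.1].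
have SE : S = \bigcup_n subgraph g n%:R.
  apply/seteqP; split => p; last by move=> [n _] [/andP[p0 _] pg].
  move=> [p0 pg]; exists (Num.trunc p.1).+1 => //; split => //.
  by rewrite p0 ltW// truncnS_gt.
have mS' : measurable S by rewrite SE; exact: bigcup_measurable.
have mFs : measurable_fun setT (fun u : R => (F (s - u))%:E).
  by apply/measurable_EFinP; apply: measurableT_comp => //; exact: measurable_funB.
rewrite /convolution (@ge0_integral_stieltjes _ kappa S)//.
- rewrite integral_mkcond [RHS]integral_mkcond; apply: eq_integral => p _.
  rewrite /patch; have [Sp|nSp] := pselect (S p).
    rewrite mem_set//; case: ifPn => //; rewrite notin_setE => nS.
    rewrite Fneg// subr_le0 leNgt; apply/negP => ps; apply: nS.
    by case: Sp => p0 pg; split => //; rewrite p0 (le_trans (ltW ps)).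
  by rewrite !memNset// => -[/andP[p0 _] pg]; exact: nSp.
- by move=> p [].
- move=> x x0; rewrite Yk//; congr (kappa _); apply/seteqP; split => p /=.
    by move=> [/andP[p0 px] pg].
  by move=> [[p0 pg] px]; split => //; rewrite p0.
- by move=> u; rewrite lee_fin.
Qed.

Lemma integral_indic_past (B : set R) s t : measurable B ->
  (\int[kappa]_(p in subgraph g t) (\1_B (s - p.1))%:E =
   kappa (subgraph g t `&` [set p : R * R | B (s - p.1)%R]))%E.
Proof.
move=> mB; have mP := measurable_past_set s mB.
transitivity (\int[kappa]_(p in subgraph g t) (\1_[set p : R * R | B (s - p.1)%R] p)%:E)%E.
  exact: eq_integral.
by rewrite integral_indic// setIC.
Qed.

Lemma integral_step_past n (c : 'I_n -> R) (B : 'I_n -> set R) s t :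
  (forall k, 0 <= c k) -> (forall k, measurable (B k)) -> (kappa (subgraph g t) < +oo)%E ->
  (\int[kappa]_(p in subgraph g t) (\sum_k c k * \1_(B k) (s - p.1))%:E =
   (\sum_k c k * fine (kappa (subgraph g t `&` [set p | B k (s - p.1)])))%:E)%E.
Proof.
move=> c0 mB kf.
have mP k := measurable_past_set s (mB k).
have mi k : measurable_fun (subgraph g t) (fun p => (\1_[set p : R * R | B k (s - p.1)] p)%:E).
  by apply/measurable_EFinP; apply: measurable_funTS; exact: measurable_indic.
transitivity (\int[kappa]_(p in subgraph g t)
    (\sum_k (c k)%:E * (\1_[set p : R * R | B k (s - p.1)] p)%:E))%E.
  by apply: eq_integral => p _; rewrite -sumEFin.
rewrite ge0_integral_sum//; last 2 first.
- by move=> k; apply: emeasurable_funM => //; exact: mi.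
- by move=> k p _; rewrite mule_ge0// lee_fin.
rewrite -sumEFin; apply: eq_bigr => k _.
rewrite ge0_integralZl; [|exact: mS|exact: mi|by move=> p _; rewrite lee_fin|by rewrite lee_fin].
rewrite integral_indic// EFinM setIC; congr (_ * _)%E.
have lt : (kappa (subgraph g t `&` [set p : R * R | B k (s - p.1)%R]) < +oo)%E.
  apply: le_lt_trans kf; apply: le_measure; rewrite ?inE; [|exact: mS|exact: subIsetl].
  by apply: measurableI; [exact: mS|exact: mP].
by rewrite fineK// ge0_fin_numE.
Qed.

End subgraph_integrals.

(** Bookkeeping for the comparison of rates: [l] and [g] are the random and the limit convolutions;
    [p1] and [p2] are the step part of the kernel against the points and against their intensity,
    [cr] and [dr] the remainder against the same; [da] and [dl] are the kernel against the random
    and the limit rate, and [df] against their distance. *)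
Lemma two_sided_bound {R : realType} (l g dv p1 p2 : R) (cr dr df dl da : \bar R) :
  (l%:E = p1%:E + cr -> g%:E = dl -> da = p2%:E + dr -> da <= dl + df -> dl <= da + df ->
   0 <= cr -> 0 <= dr -> 0 <= df -> (p1 <= p2 + dv)%R -> (p2 <= p1 + dv)%R ->
   `|l - g|%:E <= dv%:E + cr + dr + df)%E.
Proof.
move=> lE gE aE d1 d2 n1 n2 n3 q1 q2.
have k1 : (l%:E <= g%:E + (dv%:E + cr + dr + df))%E.
  rewrite lE gE; apply: (@le_trans _ _ (p2%:E + dv%:E + cr)%E).
    by rewrite leeD2r// -EFinD lee_fin.
  apply: (@le_trans _ _ (da + dv%:E + cr)%E).
    by rewrite leeD2r// leeD2r// aE leeDl.
  apply: (@le_trans _ _ (dl + df + dv%:E + cr)%E).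
    by rewrite leeD2r// leeD2r.
  have -> : (dl + df + dv%:E + cr = dl + (dv%:E + cr + df))%E.
    by rewrite -!addeA; congr (_ + _)%E; rewrite addeC -addeA.
  by rewrite leeD2l// leeD2r// leeDl.
have k2 : (g%:E <= l%:E + (dv%:E + cr + dr + df))%E.
  rewrite gE; apply: (le_trans d2); rewrite aE lE.
  apply: (@le_trans _ _ (p1%:E + dv%:E + dr + df)%E).
    by rewrite leeD2r// leeD2r// -EFinD lee_fin.
  have -> : (p1%:E + dv%:E + dr + df = p1%:E + (dv%:E + dr + df))%E by rewrite -!addeA.
  apply: leeD; first by rewrite leeDl.
  by rewrite leeD2r// leeD2r// leeDl.
have [gl|lg] := leP g l.
  by rewrite ger0_norm ?subr_ge0// EFinB leeBlDl.
by rewrite ltr0_norm ?subr_lt0// opprB EFinB leeBlDl.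
Qed.

Lemma cvgr_sum (R : realType) (T : Type) (F : set_system T) {FF : Filter F} (I : Type)
    (s : seq I) (f : I -> T -> R) (l : I -> R) :
  (forall k, f k x @[x --> F] --> l k) ->
  \sum_(k <- s) f k x @[x --> F] --> \sum_(k <- s) l k.
Proof.
move=> fl; elim: s => [|k s IH].
  by under eq_cvg do rewrite big_nil; rewrite big_nil; exact: cvg_cst.
by under eq_cvg do rewrite big_cons; rewrite big_cons; exact: cvgD.
Qed.

Section joint_measurability.
Context d (Omega : measurableType d) (R : realType).

(** By right-continuity and monotonicity, the value at x is below a level exactly when the value at
    some rational q > x is. This writes the sublevel sets as countable unions of rectangles. *)
Lemma measurable_cumulative_process (X : R -> Omega -> R) :
  (forall w, is_cumulative (X ^~ w)) -> (forall t, 0 <= t -> measurable_fun setT (X t)) ->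
  measurable_fun setT (fun p : Omega * measurableTypeR R => extend0 (X ^~ p.1) p.2).
Proof.
move=> Xc mX.
suff h : measurable_fun setT (fun p : Omega * measurableTypeR R => - extend0 (X ^~ p.1) p.2).
  by have := measurable_funN h; apply: eq_measurable_fun => p _ /=; rewrite opprK.
apply: measurable_fun_gt => r.
rewrite (_ : mkset _ = \bigcup_(q : rat) ([set w | extend0 (X ^~ w) (ratr q) < - r] `*`
    (`]-oo, ratr q[%classic : set (measurableTypeR R)))).
  apply: bigcupT_measurable_rat => q; apply: measurableX; last exact: measurable_itv.
  have m0 : 0 <= Num.max 0 (ratr q : R) by rewrite le_max lexx.
  have := mX _ m0 measurableT _ (measurable_itv `]-oo, (- r)[); rewrite setTI.
  by congr (measurable _); apply/seteqP; split => w /=; rewrite in_itv.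
apply/seteqP; split => [[w x]|[w x] [q _]]/=.
  rewrite ltrNr => xr; have [_ /(_ x)] := Xc w; move=> /cvgr_lt/(_ _ xr) h.
  have : \forall y \near x^'+, x < y /\ extend0 (X ^~ w) y < - r.
    by near=> y; split; near: y => //; exact: nbhs_right_gt.
  move=> [e /= e0 he].
  have /rat_in_itvoo[q] : x < x + e by rewrite ltrDl.
  rewrite in_itv/= => /andP[xq qe]; exists q => //=; rewrite in_itv/= xq; split => //.
  have [] // := he (ratr q); rewrite /ball_ /= ltr0_norm ?subr_lt0// opprB.
  by rewrite ltrBlDl.
rewrite in_itv/= => -[xr xq]; rewrite ltrNr; apply: le_lt_trans xr.
by apply: (Xc w).1; exact: ltW.
Unshelve. all: by end_near.
Qed.

End joint_measurability.

(** * Deviations of the counts from their limit *)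

Section hawkes_system.
Context d (Omega : measurableType d) (R : realType) (P : probability Omega R).
Local Notation leb := (@lebesgue_measure R).
Variables (G : R -> set (set Omega)) (kap : nat -> R.-ker Omega ~> (R * R)%type).
Variables (mu Lam : R) (f : R -> R) (N : nat) (Y : nat -> R -> Omega -> R).

Definition rate w (s : R) : R :=
  mu + N%:R^-1 * \sum_(j < N) fine (convolution f (stieltjes (Y j ^~ w)) s).

(** A version of the system in which monotone paths, finite masses and the evolution equation hold
    at every w, so that the pathwise arguments below carry no exceptional set. *)
Record hawkes_system : Prop := {
  hs_data : poisson_data P G kap ;
  hs_cumulative : forall j w, is_cumulative (Y j ^~ w) ;
  hs_0 : forall j w, Y j 0 w = 0 ;
  hs_adapted : forall j, adapted G (Y j) ;
  hs_L1 : forall j t, 0 <= t -> L1 P (Y j t) ;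
  hs_count : forall j w t, (j < N)%N -> 0 <= t ->
    (Y j t w)%:E = kap j w (subgraph (rate w) t) }.

Hypothesis hs : hawkes_system.
Hypotheses (hmu : 0 < mu) (hN : (0 < N)%N)
  (mf : measurable_fun setT f) (f0 : forall v, 0 <= f v)
  (fneg : forall v, v <= 0 -> f v = 0)
  (fL : (\int[leb]_v (f v)%:E = Lam%:E)%E) (Lam_lt1 : Lam < 1).

Let fneg' v : v < 0 -> f v = 0. Proof. by move=> /ltW/fneg. Qed.

Let Ni : 0 < N%:R^-1 :> R. Proof. by rewrite invr_gt0 ltr0n. Qed.

Let pd := hs_data hs.
Let fil := pd_filtration pd.

Lemma rate_ge w s : mu <= rate w s.
Proof.
rewrite lerDl mulr_ge0 ?(ltW Ni)// sumr_ge0// => j _.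
by rewrite fine_ge0// convolution_ge0.
Qed.

Lemma rate_ge0 w s : 0 <= rate w s.
Proof. by apply: le_trans (rate_ge w s); exact: ltW. Qed.

Lemma measurable_rate w : measurable_fun setT (rate w).
Proof.
apply: measurable_funD => //; apply: measurable_funM => //.
apply: measurable_sum => j; apply: measurableT_comp => //.
by apply: measurable_convolution_stieltjes => //; exact: hs_cumulative.
Qed.

Definition mean_count t w := N%:R^-1 * \sum_(j < N) Y j t w.

Lemma extend0_mean_count w x :
  extend0 (mean_count ^~ w) x = N%:R^-1 * \sum_(j < N) extend0 (Y j ^~ w) x.
Proof. by []. Qed.

Lemma mean_count_cumulative w : is_cumulative (mean_count ^~ w).
Proof.
split => [x y xy|x].
  rewrite !extend0_mean_count ler_pM2l// ler_sum// => j _.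
  exact: (hs_cumulative hs j w).1.
have h : (\sum_(j < N) extend0 (Y j ^~ w) u) @[u --> x^'+] -->
    (\sum_(j < N) extend0 (Y j ^~ w) x).
  apply: cvgr_sum => j.
  exact: (hs_cumulative hs j w).2.
exact: (cvgM (cvg_cst _) h).
Qed.

Lemma mean_count0 w : mean_count 0 w = 0.
Proof. by rewrite /mean_count big1 ?mulr0// => j _; exact: hs_0. Qed.

Lemma mean_count_L1 t : 0 <= t -> L1 P (mean_count t).
Proof. by move=> t0; apply: L1Zl; apply: L1_sum => j; exact: hs_L1. Qed.

(** The renewal form of the cumulated intensity. The particles enter only through their mean, which
    is the source of the gain in N. *)
Lemma integral_rate w t : 0 <= t ->
  (\int[leb]_(s in `]0%R, t]) (rate w s)%:E = (mu * t)%:E +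
   \int[leb]_v ((f v)%:E * (extend0 (mean_count ^~ w) (t - v))%:E))%E.
Proof.
move=> t0; under eq_integral do rewrite EFinD.
rewrite ge0_integralD//; last 3 first.
- by move=> s _; rewrite lee_fin ltW.
- move=> s _; rewrite lee_fin mulr_ge0 ?(ltW Ni)// sumr_ge0// => j _.
  by rewrite fine_ge0// convolution_ge0.
- apply/measurable_EFinP; apply: measurable_funM => //; apply: measurable_sum => j.
  apply: measurable_funTS; apply: measurableT_comp => //.
  by apply: measurable_convolution_stieltjes => //; exact: hs_cumulative.
rewrite integral_cst_itv//; congr (_ + _)%E.
have me j : measurable_fun setT (fun v => f v * extend0 (Y j ^~ w) (t - v)).
  apply: measurable_funM => //; apply: measurableT_comp.
    exact: (measurable_extend0 (hs_cumulative hs j w)).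
  exact: measurable_funB.
transitivity (\int[leb]_v ((N%:R^-1)%:E * \sum_(j < N) (f v * extend0 (Y j ^~ w) (t - v))%:E))%E;
    last first.
  apply: eq_integral => v _; rewrite extend0_mean_count sumEFin -!EFinM; congr EFin.
  by rewrite -mulr_sumr mulrCA.
rewrite ge0_integralZl//; last 2 first.
- by apply: emeasurable_sum => j; apply/measurable_EFinP; exact: me.
- move=> v _; apply: sume_ge0 => j _; rewrite lee_fin mulr_ge0//.
  by apply: extend0_ge0; [exact: hs_cumulative|exact: hs_0].
under eq_integral do rewrite EFinM -sumEFin.
rewrite ge0_integralZl//; last 2 first.
- apply: emeasurable_sum => j; apply/measurable_EFinP.
  apply: measurable_funTS; apply: measurableT_comp => //.
  by apply: measurable_convolution_stieltjes => //; exact: hs_cumulative.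
- by move=> s _; apply: sume_ge0 => j _; rewrite lee_fin fine_ge0// convolution_ge0.
congr (_ * _)%E; rewrite !ge0_integral_sum//; last 4 first.
- by move=> j; apply/measurable_EFinP; exact: me.
- move=> j v _; rewrite lee_fin mulr_ge0//.
  by apply: extend0_ge0; [exact: hs_cumulative|exact: hs_0].
- move=> j; apply/measurable_EFinP; apply: measurable_funTS; apply: measurableT_comp => //.
  by apply: measurable_convolution_stieltjes => //; exact: hs_cumulative.
- by move=> j s _; rewrite lee_fin fine_ge0// convolution_ge0.
apply: eq_bigr => j _.
rewrite (integral_fine_convolution mf f0 fneg' fL _ (hs_cumulative hs j w) (hs_0 hs j w)).
by apply: eq_integral => v _; rewrite EFinM.
Qed.

Definition region t : set (Omega * (R * R)) :=
  [set p | subgraph (rate p.1) t p.2].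

Lemma xsection_region t w : xsection (region t) w = subgraph (rate w) t.
Proof. by apply/seteqP; split => p; rewrite /xsection/= inE. Qed.

Local Notation TP := (g_sigma_algebraType (predictable_rectangle G)).

Lemma predictable_convolution_path (g : R -> R) j : measurable_fun setT g ->
  (forall v, 0 <= g v) -> (forall v, v <= 0 -> g v = 0) ->
  measurable_fun setT (fun p : TP => convolution g (stieltjes (Y j ^~ p.1)) p.2.1).
Proof.
move=> mg g0 gneg.
have ad t : 0 <= t -> forall B : set R, measurable B -> G t (Y j t @^-1` B).
  by move=> t0 B mB; apply: (hs_adapted hs t0); exists B => //; rewrite setTI.
have := measurable_predictable_convolution fil ad (hs_cumulative hs j) mg g0.
apply: eq_measurable_fun => p _; rewrite /convolution integral_mkcond.
apply: eq_integral => u _; rewrite /patch; case: ifPn => //.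
by rewrite notin_setE/= in_itv/= => /negP; rewrite -leNgt => su; rewrite gneg// subr_le0.
Qed.

Lemma predictable_rate : measurable_fun setT (fun p : TP => rate p.1 p.2.1).
Proof.
apply: measurable_funD => //; apply: measurable_funM => //.
apply: measurable_sum => j; apply: measurableT_comp => //.
exact: predictable_convolution_path.
Qed.

(** The region is cut out by three conditions on predictable functions. On positive times, the only
    ones in [subgraph], the truncated coordinates are the true ones. *)
Lemma predictable_region t : 0 <= t -> predictable G (region t).
Proof.
move=> t0.
have m1 := measurable_predictable_time fil measurableT (measurable_itv `]0, t]).
have m2 := measurable_predictable_height fil measurableT (measurable_itv `[0, +oo[).
have m3 := measurable_funB predictable_rate (measurable_predictable_height fil) measurableT
  (measurable_itv `[0, +oo[).
have := measurableI _ _ m1 (measurableI _ _ m2 m3); rewrite !setTI.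
congr (predictable G _); apply/seteqP; split => p; rewrite /region /subgraph/= !in_itv/= !andbT lt_max ltxx/=.
  move=> [/andP[p0 pt] []]; rewrite p0 => -> /=; rewrite subr_ge0 => ->; split => //.
  by move: pt; rewrite ge_max => /andP[].
move=> [/andP[p0 pt]] /andP[z0 zr]; rewrite p0/= subr_ge0; split => //.
by rewrite ge_max pt ltW// (lt_le_trans p0).
Qed.

Lemma area_region_lty t w : 0 <= t -> (area (subgraph (rate w) t) <=
  (mu * t)%:E + (Lam * mean_count t w)%:E)%E.
Proof.
move=> t0; rewrite area_subgraph; [|exact: measurable_rate|exact: rate_ge0].
rewrite integral_rate// leeD2l//.
have mP := mean_count_cumulative w; have m0 := mean_count0 w.
have mE x : 0 <= x -> extend0 (mean_count ^~ w) x = mean_count x w.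
  by move=> x0; rewrite /extend0 (max_idPr x0).
apply: (convolution_stieltjes_le mf f0 fneg' fL) => // [|x /andP[x0 xt]].
  by rewrite -mE// extend0_ge0.
by rewrite extend0_ge0//= -(mE t)//; exact: mP.1.
Qed.

Lemma region_admissible j t : (j < N)%N -> 0 <= t -> admissible P G kap t j (region t).
Proof.
move=> jN t0; split.
- exact: predictable_region.
- move=> [w [s z]] [/= st /andP[z0 _]]; split => //; split => //=; rewrite in_itv//=.
  by rewrite z0.
- by move=> w; rewrite xsection_region -hs_count// ltry.
- by move=> w; rewrite xsection_region (le_lt_trans (area_region_lty w t0))// -EFinD ltry.
- have i := L1D (L1_cst P (mu * t)) (L1Zl Lam (mean_count_L1 t0)).
  apply: le_lt_trans (integrable_lty measurableT i).
  apply: ge0_le_integral_any => w _; first by [].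
  by rewrite xsection_region; exact: area_region_lty.
Qed.

Lemma sec_mass_region j t w : (j < N)%N -> 0 <= t -> sec_mass kap j (region t) w = Y j t w.
Proof. by move=> jN t0; rewrite sec_mass.unlock xsection_region -hs_count. Qed.

Definition cum_rate t w := sec_area (region t) w.

Lemma cum_rateE t w : 0 <= t -> ((cum_rate t w)%:E = (mu * t)%:E +
   \int[leb]_v ((f v)%:E * (extend0 (mean_count ^~ w) (t - v))%:E))%E.
Proof.
move=> t0; have aC := region_admissible hN t0.
rewrite (sec_areaE aC) xsection_region area_subgraph ?integral_rate//.
- exact: measurable_rate.
- exact: rate_ge0.
Qed.

Let aC j t : (j < N)%N -> 0 <= t -> admissible P G kap t j (region t).
Proof. by move=> jN t0; exact: region_admissible. Qed.

Lemma cum_rate_ge0 t w : 0 <= cum_rate t w.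
Proof. exact: sec_area_ge0. Qed.

Lemma cum_rate_L1 t : 0 <= t -> L1 P (cum_rate t).
Proof. by move=> t0; exact: (sec_area_L1 pd (aC hN t0)). Qed.

Lemma Ex_count j t : (j < N)%N -> 0 <= t -> Ex P (Y j t) = Ex P (cum_rate t).
Proof.
move=> jN t0; rewrite -(Ex_sec_mass pd (aC jN t0)).
by apply: eq_Ex => w; rewrite sec_mass_region.
Qed.

Lemma Ex_mean_count t : 0 <= t -> Ex P (mean_count t) = Ex P (cum_rate t).
Proof.
move=> t0; rewrite ExZl; last by apply: L1_sum => j; exact: hs_L1.
rewrite Ex_sum; last by move=> j; exact: hs_L1.
rewrite (eq_bigr (fun=> Ex P (cum_rate t))); last by move=> j _; rewrite Ex_count.
by rewrite sumr_const card_ord -[X in _ * X]mulr_natl mulrA mulVf ?mul1r// pnatr_eq0 -lt0n.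
Qed.

(** At each lag v the mean of [H] at t - v is at most b, and Tonelli integrates this against the
    kernel: a bound b becomes Lam b. *)
Lemma integral_past_le (H : Omega -> R -> R) t b :
  measurable_fun setT (fun p : Omega * measurableTypeR R => H p.1 p.2) ->
  (forall w x, 0 <= H w x) -> (forall w x, x < 0 -> H w x = 0) -> 0 <= b ->
  (forall x, (0 <= x <= t)%R -> \int[P]_w (H w x)%:E <= b%:E)%E ->
  (\int[P]_w \int[leb]_v ((f v)%:E * (H w (t - v))%:E) <= (Lam * b)%:E)%E.
Proof.
move=> mH H0 Hneg b0 Hb.
have mHv : measurable_fun setT (fun p : Omega * measurableTypeR R => (f p.2 * H p.1 (t - p.2))%:E).
  apply/measurable_EFinP; apply: measurable_funM.
    exact: (measurableT_comp mf (@measurable_snd _ _ Omega (measurableTypeR R))).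
  have ms : measurable_fun setT (fun p : Omega * measurableTypeR R =>
      (p.1, t - p.2) : Omega * measurableTypeR R).
    apply: measurable_fun_pair; first exact: measurable_fst.
    by apply: measurable_funB => //; exact: measurable_snd.
  exact: (measurableT_comp mH ms).
under eq_integral do under eq_integral do rewrite -EFinM.
rewrite (@fubini_tonelli _ _ _ _ R P leb _ mHv); last by move=> p; rewrite lee_fin mulr_ge0.
rewrite EFinM -fL muleC -ge0_integralZl//; last 2 first.
- by apply/measurable_EFinP.
- by move=> v _; rewrite lee_fin.
apply: ge0_le_integral_any => v _.
  by apply: integral_ge0 => w _; rewrite lee_fin mulr_ge0.
have [v0|v0] := ltP v 0.
  rewrite integral0_eq => [|w _]; first by rewrite mule_ge0 ?lee_fin.
  by rewrite fneg' ?mul0r.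
have mHw : measurable_fun setT (fun w => H w (t - v)).
  exact: (measurableT_comp mH (measurable_pair2 (t - v : measurableTypeR R))).
under eq_integral do rewrite /= EFinM.
rewrite ge0_integralZl; last 4 first.
- exact: measurableT.
- by apply/measurable_EFinP.
- by move=> w _; rewrite lee_fin.
- by rewrite lee_fin.
rewrite muleC; apply: lee_wpmul2r; first by rewrite lee_fin.
have [tv|tv] := leP 0 (t - v); first by rewrite Hb// tv gerBl.
by rewrite integral0_eq ?lee_fin// => w _; rewrite Hneg.
Qed.

Let mean_count_neg w x : x < 0 -> extend0 (mean_count ^~ w) x = 0.
Proof. by move=> x0; rewrite /extend0 (max_idPl (ltW x0)) mean_count0. Qed.

Let mean_countE w x : 0 <= x -> extend0 (mean_count ^~ w) x = mean_count x w.
Proof. by move=> x0; rewrite /extend0 (max_idPr x0). Qed.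

Lemma mean_count_ge0 w x : 0 <= x -> 0 <= mean_count x w.
Proof.
move=> x0; rewrite -mean_countE//; apply: extend0_ge0; first exact: mean_count_cumulative.
exact: mean_count0.
Qed.

Let joint_mean_count :
  measurable_fun setT (fun p : Omega * measurableTypeR R => extend0 (mean_count ^~ p.1) p.2).
Proof.
apply: measurable_cumulative_process; first exact: mean_count_cumulative.
by move=> t t0; exact: (L1_measurable (mean_count_L1 t0)).
Qed.

(** The mean count and the cumulated intensity have the same expectation, so a bound b on it
    improves to mu t + Lam b. The contraction starts from the finiteness of expectations required of
    the processes. *)
Lemma Ex_mean_count_le t : 0 <= t ->
  forall x, 0 <= x <= t -> Ex P (mean_count x) <= mu * t / (1 - Lam).
Proof.
move=> t0; apply: (@contraction_bound _ _ t (Ex P (mean_count t))).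
- by rewrite Lam_lt1 (kernel_mass_ge0 f0 fL).
- by rewrite mulr_ge0// ltW.
- by apply: Ex_ge0 => w; exact: mean_count_ge0.
- move=> b b0 Hb x /andP[x0 xt]; rewrite Ex_mean_count//.
  have c1 := cum_rate_L1 x0; have d1 := L1B c1 (L1_cst P (mu * x)).
  rewrite -(subrK (mu * x) (Ex P (cum_rate x))) -{1}(Ex_cst P (mu * x)) -ExB//; last exact: L1_cst.
  rewrite addrC; apply: lerD; first by rewrite ler_pM2l.
  rewrite -lee_fin (ExE d1).
  under eq_integral do rewrite EFinB cum_rateE// addeAC subee// add0e.
  apply: (@integral_past_le (fun w => extend0 (mean_count ^~ w)) x) => //.
  + move=> w y; apply: extend0_ge0; [exact: mean_count_cumulative|exact: mean_count0].
  + move=> y /andP[y0 yx].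
    under eq_integral do rewrite mean_countE//.
    by rewrite -(ExE (mean_count_L1 y0)) lee_fin Hb// y0 (le_trans yx).
- move=> x /andP[x0 xt]; apply: le_Ex; [exact: mean_count_L1|exact: mean_count_L1|].
  move=> w; rewrite -!mean_countE//.
  exact: (mean_count_cumulative w).1.
Qed.

Variable m : R -> R.
Hypotheses (mP : is_cumulative m) (m0 : m 0 = 0)
  (mE : forall t, 0 <= t -> ((m t)%:E =
     (mu * t)%:E + \int[leb]_v ((f v)%:E * (extend0 m (t - v))%:E))%E)
  (m_le : forall t, 0 <= t -> m t <= mu / (1 - Lam) * t).

Local Notation a0 := (mu / (1 - Lam)).

Let a0_ge0 : 0 <= a0. Proof. by rewrite divr_ge0 ?subr_ge0// ltW. Qed.

Let extend0m x : 0 <= x -> extend0 m x = m x.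
Proof. by move=> x0; rewrite /extend0 (max_idPr x0). Qed.

Let m_ge0 x : 0 <= x -> 0 <= m x.
Proof. by move=> x0; rewrite -extend0m//; exact: extend0_ge0. Qed.

Let past (u : R -> R) t : \bar R := (\int[leb]_v ((f v)%:E * (u (t - v))%:E))%E.

Let mpast (u : R -> R) t : measurable_fun setT u ->
  measurable_fun setT (fun v => (f v)%:E * (u (t - v))%:E)%E.
Proof.
move=> mu'; apply/measurable_EFinP; apply: measurable_funM => //.
by apply: measurableT_comp => //; exact: measurable_funB.
Qed.

Let past_le (u1 u2 : R -> R) t : measurable_fun setT u1 -> measurable_fun setT u2 ->
  (forall v, 0 <= u1 v) -> (forall v, 0 <= u2 v) ->
  (past u1 t <= past u2 t + past (fun v => `|u1 v - u2 v|)%R t)%E.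
Proof.
move=> mu1 mu2 u10 u20.
have m12 : measurable_fun setT (fun v => `|u1 v - u2 v|).
  by apply: measurableT_comp => //; exact: measurable_funB.
rewrite /past -ge0_integralD//; last 4 first.
- by move=> v _; rewrite mule_ge0// lee_fin.
- exact: mpast.
- by move=> v _; rewrite mule_ge0// lee_fin.
- exact: (mpast t m12).
apply: ge0_le_integral_any => v _; first by rewrite mule_ge0// lee_fin.
rewrite -!EFinM -EFinD lee_fin -mulrDr ler_wpM2l// -lerBlDl.
by rewrite ler_norm.
Qed.

Let mem0 := measurable_extend0 mP.
Let mYe w := measurable_extend0 (mean_count_cumulative w).
Let Ye_ge0 w x : 0 <= extend0 (mean_count ^~ w) x.
Proof. by apply: extend0_ge0; [exact: mean_count_cumulative|exact: mean_count0]. Qed.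
Let me_ge0 x : 0 <= extend0 m x. Proof. exact: extend0_ge0. Qed.

(** Both quantities solve the same affine equation, so mu t cancels and the discrepancy of the past
    remains. The integrals being extended numbers, the triangle inequality is used in additive form,
    once in each direction. *)
Lemma cum_rate_dist w t : 0 <= t -> (`|cum_rate t w - m t|%:E <= \int[leb]_v
  ((f v)%:E * (`|extend0 (mean_count ^~ w) (t - v) - extend0 m (t - v)|)%:E))%E.
Proof.
move=> t0; have e1 := cum_rateE w t0; have e2 := mE t0.
have h1 := past_le t (mYe w) mem0 (Ye_ge0 w) me_ge0.
have h2 := past_le t mem0 (mYe w) me_ge0 (Ye_ge0 w).
have k1 : ((cum_rate t w)%:E <= (m t)%:E +
    past (fun v => `|extend0 (mean_count ^~ w) v - extend0 m v|)%R t)%E.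
  by rewrite e1 e2 -addeA leeD2l.
have k2 : ((m t)%:E <= (cum_rate t w)%:E +
    past (fun v => `|extend0 m v - extend0 (mean_count ^~ w) v|)%R t)%E.
  by rewrite e1 e2 -addeA leeD2l.
have [mc|cm] := leP (m t) (cum_rate t w).
  by rewrite ger0_norm ?subr_ge0// EFinB leeBlDl.
rewrite ltr0_norm ?subr_lt0// opprB EFinB leeBlDl//; apply: (le_trans k2).
by rewrite leeD2l// le_eqVlt; apply/orP; left; apply/eqP; apply: eq_integral => v _; rewrite distrC.
Qed.

Lemma Ex_cum_rate_dist x t b : 0 <= x <= t -> 0 <= b ->
  (forall y, 0 <= y <= t -> Ex P (fun w => `|mean_count y w - m y|) <= b) ->
  Ex P (fun w => `|cum_rate x w - m x|) <= Lam * b.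
Proof.
move=> /andP[x0 xt] b0 Hb.
have i1 : L1 P (fun w => `|cum_rate x w - m x|).
  by apply/L1_norm/L1B; [exact: cum_rate_L1|exact: L1_cst].
rewrite -lee_fin (ExE i1); apply: le_trans.
  by apply: ge0_le_integral_any => w _; [rewrite lee_fin|exact: cum_rate_dist].
apply: (@integral_past_le (fun w y => `|extend0 (mean_count ^~ w) y - extend0 m y|) x) => //.
- apply: measurableT_comp => //; apply: measurable_funB => //.
  exact: (measurableT_comp mem0 (@measurable_snd _ _ Omega (measurableTypeR R))).
- by move=> w y y0; rewrite mean_count_neg// /extend0 (max_idPl (ltW y0)) m0 subrr normr0.
- move=> y /andP[y0 yx].
  have i2 : L1 P (fun w => `|mean_count y w - m y|).
    by apply/L1_norm/L1B; [exact: mean_count_L1|exact: L1_cst].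
  under eq_integral do rewrite mean_countE// extend0m//.
  by rewrite -(ExE i2) lee_fin Hb// y0 (le_trans yx).
Qed.

Lemma Ex_cum_rate_le x t : 0 <= x <= t -> Ex P (cum_rate x) <= a0 * t.
Proof.
move=> /[dup] xt /andP[x0 _]; rewrite -Ex_mean_count// [a0 * t]mulrAC.
by apply: Ex_mean_count_le => //; case/andP: xt => /le_trans; apply.
Qed.

(** The average of N orthogonal terms has variance at most a0 t / N, and e = sqrt N / sqrt t is of
    the order of the inverse standard deviation. *)
Lemma Ex_mean_compensated x t : 0 < t -> 0 <= x <= t ->
  Ex P (fun w => `|mean_count x w - cum_rate x w|) <=
  (a0 + 1) / 2 * (Num.sqrt t / Num.sqrt N%:R).
Proof.
move=> t0 /[dup] xt /andP[x0 _].
set s := Num.sqrt t; set r := Num.sqrt N%:R.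
have s0 : 0 < s by rewrite sqrtr_gt0.
have r0 : 0 < r by rewrite sqrtr_gt0 ltr0n.
have sE : t = s ^+ 2 by rewrite sqr_sqrtr// ltW.
have rE : N%:R = r ^+ 2 by rewrite sqr_sqrtr.
have orth (k l : 'I_N) : k != l -> (k : nat) != l \/ region x `&` region x = set0.
  by move=> kl; left.
have := Ex_norm_compensated pd (I := 'I_N) (i := fun k => k) (fun=> N%:R^-1)
  (C := fun=> region x) (e := r / s) (fun k => aC (ltn_ord k) x0) orth (divr_gt0 r0 s0).
have -> : Ex P (fun w => `|\sum_(k < N) N%:R^-1 *
    (sec_mass kap k (region x) w - sec_area (region x) w)|) =
    Ex P (fun w => `|mean_count x w - cum_rate x w|).
  apply: eq_Ex => w; congr (`|_|); rewrite -mulr_sumr sumrB mulrBr; congr (_ - _).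
    by congr (_ * _); apply: eq_bigr => k _; rewrite sec_mass_region.
  by rewrite sumr_const card_ord -[X in _ * X]mulr_natl mulrA mulVf ?mul1r// pnatr_eq0 -lt0n.
move=> /le_trans; apply; rewrite [(a0 + 1) / 2 * _]mulrAC ler_pM2r ?invr_gt0//.
rewrite sumr_const card_ord -[X in _ * X]mulr_natl rE.
have -> : (a0 + 1) * (s / r) =
    r / s * (r ^+ 2 * ((r ^+ 2)^-1 ^+ 2 * (a0 * s ^+ 2))) + (r / s)^-1.
  by field; rewrite !gt_eqF ?subr_gt0//.
rewrite lerD2r ler_pM2l ?divr_gt0// ler_pM2l ?exprn_gt0// ler_pM2l ?exprn_gt0 ?invr_gt0 ?exprn_gt0//.
by rewrite -sE; exact: Ex_cum_rate_le.
Qed.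

Lemma Ex_count_compensated j t : (j < N)%N -> 0 < t ->
  Ex P (fun w => `|Y j t w - cum_rate t w|) <= (a0 + 1) / 2 * Num.sqrt t.
Proof.
move=> jN t0; set s := Num.sqrt t.
have s0 : 0 < s by rewrite sqrtr_gt0.
have sE : t = s ^+ 2 by rewrite sqr_sqrtr// ltW.
have orth (k l : 'I_1) : k != l -> j != j \/ region t `&` region t = set0.
  by rewrite !ord1.
have := Ex_norm_compensated pd (I := 'I_1) (i := fun=> j) (fun=> 1)
  (C := fun=> region t) (e := s^-1) (fun=> aC jN (ltW t0)) orth.
rewrite invr_gt0 => /(_ s0).
have -> : Ex P (fun w => `|\sum_(k < 1) 1 *
    (sec_mass kap j (region t) w - sec_area (region t) w)|) =
    Ex P (fun w => `|Y j t w - cum_rate t w|).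
  by apply: eq_Ex => w; rewrite big_ord1 mul1r sec_mass_region// ltW.
move=> /le_trans; apply; rewrite big_ord1 invrK expr1n mul1r [(a0 + 1) / 2 * _]mulrAC ler_pM2r ?invr_gt0//.
rewrite mulrDl mul1r lerD2r ler_pdivrMl// mulrCA -expr2 -sE.
by apply: Ex_cum_rate_le; rewrite lexx ltW.
Qed.

(** The compensated part is of order sqrt (t / N), and the rest is at most Lam times a bound on the
    same distance over [[0, t]], so the contraction applies. It starts from 2 a0 t, the sum of the
    bounds on the two means. *)
Lemma Ex_mean_dist x t : 0 < t -> 0 <= x <= t ->
  Ex P (fun w => `|mean_count x w - m x|) <=
  (a0 + 1) / 2 * (Num.sqrt t / Num.sqrt N%:R) / (1 - Lam).
Proof.
move=> t0; move: x.
apply: (@contraction_bound _ _ t (a0 * t + a0 * t)).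
- by rewrite Lam_lt1 (kernel_mass_ge0 f0 fL).
- by rewrite mulr_ge0// ?divr_ge0 ?addr_ge0 ?sqrtr_ge0.
- by rewrite addr_ge0// mulr_ge0// ltW.
- move=> b b0 Hb x /[dup] xt /andP[x0 xt'].
  have i1 : L1 P (fun w => `|mean_count x w - cum_rate x w|).
    by apply/L1_norm/L1B; [exact: mean_count_L1|exact: cum_rate_L1].
  have i2 : L1 P (fun w => `|cum_rate x w - m x|).
    by apply/L1_norm/L1B; [exact: cum_rate_L1|exact: L1_cst].
  have i3 : L1 P (fun w => `|mean_count x w - m x|).
    by apply/L1_norm/L1B; [exact: mean_count_L1|exact: L1_cst].
  apply: (@le_trans _ _ (Ex P (fun w => `|mean_count x w - cum_rate x w| + `|cum_rate x w - m x|))).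
    apply: le_Ex => //; first exact: L1D.
    by move=> w; rewrite (le_trans _ (ler_normD _ _))// addrA subrK.
  by rewrite ExD// lerD// ?Ex_mean_compensated// (Ex_cum_rate_dist xt).
- move=> x /[dup] xt /andP[x0 xt'].
  have i3 : L1 P (fun w => `|mean_count x w - m x|).
    by apply/L1_norm/L1B; [exact: mean_count_L1|exact: L1_cst].
  apply: (@le_trans _ _ (Ex P (fun w => mean_count x w + m x))).
    apply: le_Ex => //; first by apply: L1D; [exact: mean_count_L1|exact: L1_cst].
    by move=> w; rewrite (le_trans (ler_normB _ _))// !ger0_norm ?m_ge0 ?mean_count_ge0.
  rewrite ExD//; [|exact: mean_count_L1|exact: L1_cst].
  rewrite Ex_cst lerD//; first by rewrite Ex_mean_count// Ex_cum_rate_le.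
  by rewrite (le_trans (m_le x0))// ler_wpM2l.
Qed.

Lemma Ex_cum_rate_dev t : 0 < t ->
  Ex P (fun w => `|cum_rate t w - m t|) <=
  Lam * ((a0 + 1) / 2 * (Num.sqrt t / Num.sqrt N%:R) / (1 - Lam)).
Proof.
move=> t0; apply: (@Ex_cum_rate_dist t t); first by rewrite lexx ltW.
  rewrite divr_ge0 ?subr_ge0 ?(ltW Lam_lt1)//.
  by rewrite mulr_ge0// ?divr_ge0 ?addr_ge0 ?sqrtr_ge0.
by move=> y; exact: Ex_mean_dist.
Qed.

Lemma Ex_count_dist j t : (j < N)%N -> 0 < t ->
  Ex P (fun w => `|Y j t w - m t|) <= (a0 + 1) / 2 / (1 - Lam) * Num.sqrt t.
Proof.
move=> jN t0; have t0' := ltW t0.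
have i1 : L1 P (fun w => `|Y j t w - cum_rate t w|).
  by apply/L1_norm/L1B; [exact: hs_L1|exact: cum_rate_L1].
have i2 : L1 P (fun w => `|cum_rate t w - m t|).
  by apply/L1_norm/L1B; [exact: cum_rate_L1|exact: L1_cst].
have i3 : L1 P (fun w => `|Y j t w - m t|).
  by apply/L1_norm/L1B; [exact: hs_L1|exact: L1_cst].
apply: (@le_trans _ _ (Ex P (fun w => `|Y j t w - cum_rate t w| + `|cum_rate t w - m t|))).
  apply: le_Ex => //; first exact: L1D.
  by move=> w; rewrite (le_trans _ (ler_normD _ _))// addrA subrK.
rewrite ExD//; apply: le_trans (lerD (Ex_count_compensated jN t0) (Ex_cum_rate_dev t0)) _.
have r1 : 1 <= Num.sqrt (N%:R : R) by rewrite -[X in X <= _]sqrtr1 ler_wsqrtr// ler1n.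
have L0 : 0 <= Lam := kernel_mass_ge0 f0 fL.
(* The constant comes from 1 + Lam / (1 - Lam) = 1 / (1 - Lam); then 1 / sqrt N is bounded by 1. *)
have -> : (a0 + 1) / 2 / (1 - Lam) * Num.sqrt t = (a0 + 1) / 2 * Num.sqrt t +
    Lam * ((a0 + 1) / 2 * Num.sqrt t / (1 - Lam)).
  by field; rewrite gt_eqF// subr_gt0.
rewrite lerD2l ler_wpM2l// ler_pM2r ?invr_gt0 ?subr_gt0// ler_wpM2l//.
  by rewrite divr_ge0// addr_ge0.
by rewrite ler_pdivrMr ?(lt_le_trans ltr01)// ler_peMr// sqrtr_ge0.
Qed.

(** * Distance between the random rate and the limit rate *)

Definition limit_rate_of s := mu + fine (convolution f (stieltjes m) s).

Local Notation lim_rate := limit_rate_of.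

Lemma lim_rate_ge0 s : 0 <= lim_rate s.
Proof. by rewrite addr_ge0 ?(ltW hmu)// fine_ge0// convolution_ge0. Qed.

Lemma measurable_lim_rate : measurable_fun setT lim_rate.
Proof.
apply: measurable_funD => //; apply: measurableT_comp => //.
exact: measurable_convolution_stieltjes.
Qed.

Lemma area_limit t : 0 <= t -> (m t)%:E = area (subgraph lim_rate t).
Proof.
move=> t0; rewrite area_subgraph; [|exact: measurable_lim_rate|exact: lim_rate_ge0].
under eq_integral do rewrite EFinD.
rewrite ge0_integralD; [|exact: measurable_itv|by move=> s _; rewrite lee_fin ltW|by []
  |by move=> s _; rewrite lee_fin fine_ge0// convolution_ge0|]; last first.
  apply/measurable_EFinP; apply: measurable_funTS; apply: measurableT_comp => //.
  exact: measurable_convolution_stieltjes.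
by rewrite integral_cst_itv// (integral_fine_convolution mf f0 fneg' fL _ mP m0) mE.
Qed.

(** The points of the region whose lag to s falls in [B], a level set of the step part of the
    kernel. For [B] made of positive lags, these points precede s. *)
Definition level_region (B : set R) t s : set (Omega * (R * R)) :=
  region t `&` [set p | 0 < p.2.1 /\ B (s - p.2.1)].

Lemma xsection_level_region B t s w : (forall v, B v -> 0 < v) ->
  xsection (level_region B t s) w = subgraph (rate w) t `&` [set p | B (s - p.1)].
Proof.
move=> B0; apply/seteqP; split => p; rewrite /xsection/= inE.
  by move=> [h [_ Bp]].
by move=> [h Bp]; split => //; split => //; case: h => /andP[].
Qed.

Lemma level_region_admissible (B : set R) j t s : (j < N)%N -> 0 <= t -> measurable B ->
  (forall v, B v -> 0 < v) -> admissible P G kap t j (level_region B t s).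
Proof.
move=> jN t0 mB B0; have [pC sC mC aC' EC] := aC jN t0.
have sub w : xsection (level_region B t s) w `<=` xsection (region t) w.
  by rewrite xsection_level_region// xsection_region; exact: subIsetl.
have mx w : measurable (xsection (level_region B t s) w).
  rewrite xsection_level_region//; apply: measurableI; last exact: measurable_past_set.
  by apply: measurable_subgraph; exact: measurable_rate.
have mx' w : measurable (xsection (region t) w).
  by rewrite xsection_region; apply: measurable_subgraph; exact: measurable_rate.
split.
- exact: (@measurableI _ TP _ _ pC (predictable_time_set fil (measurable_past_set s mB))).
- by move=> p [] /sC.
- by move=> w; apply: le_lt_trans (mC w); apply: le_measure; rewrite ?inE.
- by move=> w; apply: le_lt_trans (aC' w); apply: le_measure; rewrite ?inE.
- apply: le_lt_trans EC; apply: ge0_le_integral_any => w _ //.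
  by apply: le_measure; rewrite ?inE.
Qed.

Definition level_dev B t s w := N%:R^-1 *
  \sum_(j < N) (sec_mass kap j (level_region B t s) w - sec_area (level_region B t s) w).

(** Here e is sqrt N, with no tuning in t: the extra 1 is harmless, because the bound will be
    integrated over s in []0, t]], where it yields t. *)
Lemma Ex_level_dev (B : set R) t s : 0 <= t -> measurable B -> (forall v, B v -> 0 < v) ->
  Ex P (fun w => `|level_dev B t s w|) <=
  (Ex P (sec_area (level_region B t s)) + 1) / (2 * Num.sqrt N%:R).
Proof.
move=> t0 mB B0; set r := Num.sqrt N%:R.
have r0 : 0 < r by rewrite sqrtr_gt0 ltr0n.
have rE : N%:R = r ^+ 2 by rewrite sqr_sqrtr.
have orth (k l : 'I_N) : k != l -> (k : nat) != l \/
    level_region B t s `&` level_region B t s = set0.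
  by move=> kl; left.
have := Ex_norm_compensated pd (I := 'I_N) (i := fun k => k) (fun=> N%:R^-1)
  (C := fun=> level_region B t s) (e := r)
  (fun k => level_region_admissible s (ltn_ord k) t0 mB B0) orth r0.
have -> : Ex P (fun w => `|\sum_(k < N) N%:R^-1 *
    (sec_mass kap k (level_region B t s) w - sec_area (level_region B t s) w)|) =
    Ex P (fun w => `|level_dev B t s w|).
  by apply: eq_Ex => w; rewrite -mulr_sumr.
move=> /le_trans; apply.
rewrite sumr_const card_ord -[(_ * _) *+ N]mulr_natl rE.
rewrite le_eqVlt; apply/orP; left; apply/eqP; field; exact: lt0r_neq0.
Qed.

Let joint_conv (g : R -> R) j : measurable_fun setT g -> (forall v, 0 <= g v) ->
  (forall v, v <= 0 -> g v = 0) ->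
  measurable_fun setT (fun p : Omega * measurableTypeR R =>
    convolution g (stieltjes (Y j ^~ p.1)) p.2).
Proof.
move=> mg g0 gneg.
have h := predictable_convolution_path j mg g0 gneg.
have h' : measurable_fun setT (fun p : Omega * (R * R) =>
    convolution g (stieltjes (Y j ^~ p.1)) p.2.1).
  move=> _ A mA; rewrite setTI; apply: (measurable_predictable fil).
  by have := h measurableT A mA; rewrite setTI.
have mi : measurable_fun setT (fun p : Omega * measurableTypeR R => (p.1, (p.2, 0)) : Omega * (R * R)).
  apply: measurable_fun_pair; first exact: measurable_fst.
  by apply: measurable_fun_pair; [exact: measurable_snd|exact: measurable_cst].
exact: (measurableT_comp h' mi).
Qed.

Let joint_rate : measurable_fun setT (fun p : Omega * measurableTypeR R => rate p.1 p.2).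
Proof.
apply: measurable_funD => //; apply: measurable_funM => //.
apply: measurable_sum => j; apply: measurableT_comp => //.
exact: joint_conv.
Qed.

Let indic_ge0 (B : set R) v : 0 <= \1_B v :> R.
Proof. by rewrite indicE. Qed.

Let indic_neg (B : set R) v : (forall v, B v -> 0 < v) -> v <= 0 -> \1_B v = 0 :> R.
Proof. by move=> B0 v0; rewrite indicE memNset// => /B0; rewrite ltNge v0. Qed.

Lemma level_mass (B : set R) j t s w : (j < N)%N -> s <= t -> 0 <= t -> measurable B ->
  (forall v, B v -> 0 < v) ->
  ((sec_mass kap j (level_region B t s) w)%:E = convolution \1_B (stieltjes (Y j ^~ w)) s)%E.
Proof.
move=> jN st t0 mB B0; rewrite (sec_massE (level_region_admissible s jN t0 mB B0)).
rewrite xsection_level_region//.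
rewrite (@convolution_subgraph _ (kap j w) (rate w) (measurable_rate w) _ \1_B s t)//.
- by rewrite (integral_indic_past _ (measurable_rate w)).
- exact: hs_cumulative.
- by move=> x x0; rewrite hs_count.
- by move=> v; exact: indic_neg.
Qed.

Lemma level_area (B : set R) t s w : 0 <= t -> measurable B -> (forall v, B v -> 0 < v) ->
  ((sec_area (level_region B t s) w)%:E =
   \int[leb]_(u in `]0%R, t]) ((\1_B (s - u))%:E * (rate w u)%:E))%E.
Proof.
move=> t0 mB B0; rewrite (sec_areaE (level_region_admissible s hN t0 mB B0)).
rewrite xsection_level_region//.
rewrite -(@integral_subgraph _ (rate w) (measurable_rate w) (rate_ge0 w)
  (fun u => (\1_B (s - u))%:E) t); last 2 first.
- apply/measurable_EFinP; apply: (measurableT_comp (measurable_indic mB)).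
  exact: measurable_funB.
- by move=> u; rewrite lee_fin indic_ge0.
by rewrite (integral_indic_past _ (measurable_rate w)).
Qed.

Let joint_area (B : set R) t : 0 <= t -> measurable B -> (forall v, B v -> 0 < v) ->
  measurable_fun setT (fun p : Omega * measurableTypeR R =>
    (sec_area (level_region B t p.2) p.1)%:E).
Proof.
move=> t0 mB B0.
pose H (q : (Omega * measurableTypeR R) * measurableTypeR R) : \bar R :=
  (\1_(`]0, t]%classic : set (measurableTypeR R)) q.2 *
     (\1_B (q.1.2 - q.2) * rate q.1.1 q.2))%:E.
have mH : measurable_fun setT H.
  apply/measurable_EFinP; apply: measurable_funM.
    apply: (measurableT_comp (measurable_indic (measurable_itv `]0, t]))).
    exact: measurable_snd.
  apply: measurable_funM.
    apply: (measurableT_comp (measurable_indic mB)); apply: measurable_funB.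
      exact: (measurableT_comp (@measurable_snd _ _ Omega (measurableTypeR R)) measurable_fst).
    exact: measurable_snd.
  have mi : measurable_fun setT (fun q : (Omega * measurableTypeR R) * measurableTypeR R =>
      (q.1.1, q.2) : Omega * measurableTypeR R).
    apply: measurable_fun_pair; last exact: measurable_snd.
    exact: (measurableT_comp (@measurable_fst _ _ Omega (measurableTypeR R)) measurable_fst).
  exact: (measurableT_comp joint_rate mi).
have H0 q : (0 <= H q)%E by rewrite lee_fin !mulr_ge0// ?indicE// rate_ge0.
have := @measurable_fun_fubini_tonelli_F _ _ _ _ R leb H mH H0.
apply: eq_measurable_fun => p _; rewrite level_area// [RHS]integral_mkcond.
apply: eq_integral => u _; rewrite /fubini_F/H/patch/= indicE.
by case: ifPn => _; rewrite ?mul1r ?mul0r.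
Qed.

(** Integrating over s spreads each unit of intensity over a set of lags of length beta, so the
    total is at most beta times the cumulated intensity at t. *)
Lemma integral_level_area (B : set R) (beta : R) t : 0 <= t -> measurable B -> (forall v, B v -> 0 < v) ->
  leb B = beta%:E ->
  (\int[leb]_(s in `]0%R, t]) (Ex P (sec_area (level_region B t s)))%:E <=
   (beta * (a0 * t))%:E)%E.
Proof.
move=> t0 mB B0 Bb.
have E s : ((Ex P (sec_area (level_region B t s)))%:E =
    \int[P]_w (sec_area (level_region B t s) w)%:E)%E.
  by apply: ExE; exact: (sec_area_L1 pd (level_region_admissible s hN t0 mB B0)).
under eq_integral do rewrite E.
have mJ := joint_area t0 mB B0.
apply: (@le_trans _ _ (\int[leb]_s \int[P]_w (sec_area (level_region B t s) w)%:E)%E).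
  apply: ge0_subset_integral => //.
  - exact: (@measurable_fun_fubini_tonelli_G _ _ Omega (measurableTypeR R) R P _ mJ
      (fun p => sec_area_ge0 _ _)).
  - by move=> s _; apply: integral_ge0 => w _; rewrite lee_fin sec_area_ge0.
rewrite -(@fubini_tonelli _ _ Omega (measurableTypeR R) R P leb _ mJ); last first.
  by move=> p; rewrite lee_fin sec_area_ge0.
have c1 := cum_rate_L1 t0.
apply: (@le_trans _ _ (\int[P]_w (beta%:E * (cum_rate t w)%:E))%E).
  apply: ge0_le_integral_any => w _.
    by apply: integral_ge0 => s _; rewrite lee_fin sec_area_ge0.
  under eq_integral do rewrite /= level_area// integral_mkcond.
  pose g (u : R) : \bar R := ((\1_(`]0, t]%classic : set R) u * rate w u))%:E.
  have mg : measurable_fun setT g.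
    apply/measurable_EFinP; apply: measurable_funM; last exact: measurable_rate.
    exact: (measurable_indic (measurable_itv `]0, t])).
  have g0 u : (0 <= g u)%E by rewrite lee_fin mulr_ge0 ?indic_ge0 ?rate_ge0.
  have mB1 : measurable_fun setT (\1_B : R -> R) by exact: measurable_indic.
  have Bi : (\int[leb]_v (\1_B v)%:E = beta%:E)%E by rewrite integral_indic// setIT.
  have := integral_convolution_density mB1 (indic_ge0 B) Bi mg g0.
  rewrite (sec_areaE (aC hN t0)) xsection_region.
  rewrite area_subgraph; [|exact: measurable_rate|exact: rate_ge0].
  have -> : (\int[leb]_u g u = \int[leb]_(u in `]0%R, t]) (rate w u)%:E)%E.
    rewrite [RHS]integral_mkcond; apply: eq_integral => u _.
    by rewrite /g /patch indicE; case: ifPn => _; rewrite ?mul1r ?mul0r.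
  move=> <-; rewrite le_eqVlt; apply/orP; left; apply/eqP.
  apply: eq_integral => s _; apply: eq_integral => u _; rewrite /g /patch !indicE.
  by case: ifPn => _; rewrite ?mul1r// mul0r mule0.
have be0 : 0 <= beta by rewrite -lee_fin -Bb.
rewrite ge0_integralZl; [|by []|exact: measurable_int c1|by move=> w _; rewrite lee_fin cum_rate_ge0|by rewrite lee_fin].
rewrite -(ExE c1) -EFinM lee_fin ler_wpM2l//; apply: Ex_cum_rate_le.
by rewrite t0 lexx.
Qed.

(** Joint measurability is read on the convolution with the indicator of [B]. The mass of the level
    region is identified with it for s <= t, hence the indicator of []0, t]]. *)
Let joint_dev (B : set R) t : 0 <= t -> measurable B -> (forall v, B v -> 0 < v) ->
  measurable_fun setT (fun p : Omega * measurableTypeR R =>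
    (\1_(`]0, t]%classic : set (measurableTypeR R)) p.2 * `|level_dev B t p.2 p.1|)%:E).
Proof.
move=> t0 mB B0; pose I : set (measurableTypeR R) := `]0, t]%classic.
have mI : measurable I by exact: measurable_itv.
have mI2 : measurable_fun setT (fun p : Omega * measurableTypeR R => \1_I p.2 : R).
  by apply: (measurableT_comp (measurable_indic mI)); exact: measurable_snd.
have h : measurable_fun setT (fun p : Omega * measurableTypeR R => \1_I p.2 *
   (N%:R^-1 * \sum_(j < N) (fine (convolution \1_B (stieltjes (Y j ^~ p.1)) p.2) -
       fine (sec_area (level_region B t p.2) p.1)%:E))).
  apply: measurable_funM => //; apply: measurable_funM => //.
  apply: measurable_sum => j; apply: measurable_funB; apply: measurableT_comp => //.
    apply: joint_conv; [exact: measurable_indic|exact: indic_ge0|].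
    by move=> v; exact: indic_neg.
  exact: joint_area.
apply/measurable_EFinP.
have := measurableT_comp (@normr_measurable R setT) h.
apply: eq_measurable_fun => -[w s] _ /=; rewrite normrM ger0_norm ?indicE//.
have [sI|sI] := boolP (s \in I); last by rewrite !mul0r.
rewrite !mul1r /level_dev; congr (`|_ * _|); apply: eq_bigr => j _; congr (_ - _).
move: sI; rewrite inE /I/= in_itv/= => /andP[_ st].
by rewrite -(level_mass w (ltn_ord j) st t0 mB B0).
Qed.

(** The bound is linear in t with a factor of order 1 / sqrt N. This frees the final limit from any
    relation between t and N. *)
Lemma level_dev_bound (B : set R) (beta : R) t : 0 <= t -> measurable B -> (forall v, B v -> 0 < v) ->
  leb B = beta%:E ->
  (\int[P]_w \int[leb]_(s in `]0%R, t]) (`|level_dev B t s w|)%:E <=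
   ((beta * (a0 * t) + t) / (2 * Num.sqrt N%:R))%:E)%E.
Proof.
move=> t0 mB B0 Bb; have mJ := joint_dev t0 mB B0.
pose I : set (measurableTypeR R) := `]0, t]%classic.
have r0 : 0 < 2 * Num.sqrt (N%:R : R) by rewrite mulr_gt0// sqrtr_gt0 ltr0n.
have e1 w : (\int[leb]_(s in `]0%R, t]) (`|level_dev B t s w|)%:E =
    \int[leb]_s (\1_I s * `|level_dev B t s w|)%:E)%E.
  rewrite integral_mkcond; apply: eq_integral => s _; rewrite /patch indicE.
  by case: ifPn => _; rewrite ?mul1r ?mul0r.
under eq_integral do rewrite e1.
rewrite (@fubini_tonelli _ _ Omega (measurableTypeR R) R P leb _ mJ); last first.
  by move=> p; rewrite lee_fin mulr_ge0// indicE.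
have aR s := level_region_admissible s hN t0 mB B0.
have aL s : L1 P (fun w => `|level_dev B t s w|).
  apply/L1_norm/L1Zl/L1_sum => j; apply: L1B; last exact: (sec_area_L1 pd (aR s)).
  exact: (sec_mass_L1 pd (level_region_admissible s (ltn_ord j) t0 mB B0)).
apply: (@le_trans _ _ (\int[leb]_(s in `]0%R, t])
   ((2 * Num.sqrt N%:R)^-1%:E * ((Ex P (sec_area (level_region B t s)))%:E + 1)))%E).
  rewrite [X in (_ <= X)%E]integral_mkcond; apply: ge0_le_integral_any => s _.
    by apply: integral_ge0 => w _; rewrite lee_fin mulr_ge0// indicE.
  rewrite /patch/= indicE; case: ifPn => sI; last first.
    by rewrite integral0_eq// => w _; rewrite mul0r.
  under eq_integral do rewrite mul1r.
  rewrite -(ExE (aL s)) -EFinD -EFinM lee_fin mulrC.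
  exact: Ex_level_dev.
have me : measurable_fun setT (fun s => (Ex P (sec_area (level_region B t s)))%:E).
  have := @measurable_fun_fubini_tonelli_G _ _ Omega (measurableTypeR R) R P _ (joint_area t0 mB B0)
    (fun p => sec_area_ge0 _ _).
  by apply: eq_measurable_fun => s _; rewrite (ExE (sec_area_L1 pd (aR s))).
have Ege s : (0 <= (Ex P (sec_area (level_region B t s)))%:E)%E.
  by rewrite lee_fin Ex_ge0// => w; exact: sec_area_ge0.
rewrite ge0_integralZl; [|exact: measurable_itv| | |by rewrite lee_fin invr_ge0 ltW]; last 2 first.
- by apply: emeasurable_funD => //; exact: measurable_funTS.
- by move=> s _; rewrite adde_ge0.
rewrite ge0_integralD; [|exact: measurable_itv|by []|exact: measurable_funTS|by []|by []].
rewrite [X in (_ <= X%:E)%E]mulrC EFinM; apply: lee_wpmul2l; first by rewrite lee_fin invr_ge0 ltW.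
rewrite EFinD; apply: leeD; first exact: integral_level_area.
by rewrite (@integral_cst_itv _ 1)// mul1r.
Qed.

Section kernel_split.
Variables (n : nat) (c beta : 'I_n -> R) (B : 'I_n -> set R) (r : R -> R) (rho : R).
Hypotheses (c0 : forall k, 0 <= c k) (mB : forall k, measurable (B k))
  (B0 : forall k v, B k v -> 0 < v) (Bb : forall k, leb (B k) = (beta k)%:E)
  (mr : measurable_fun setT r) (r0 : forall v, 0 <= r v)
  (fE : forall v, f v = \sum_k c k * \1_(B k) v + r v)
  (rI : (\int[leb]_v (r v)%:E = rho%:E)%E).

Let psi v := \sum_k c k * \1_(B k) v.

Let psi0 v : 0 <= psi v.
Proof. by apply: sumr_ge0 => k _; rewrite mulr_ge0// indic_ge0. Qed.

Let mpsi : measurable_fun setT psi.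
Proof.
apply: measurable_sum => k; apply: measurable_funM => //; exact: measurable_indic.
Qed.

Let rneg v : v <= 0 -> r v = 0.
Proof.
move=> v0; have := fE v; rewrite fneg// => /eqP; rewrite eq_sym paddr_eq0//; last exact: psi0.
by move=> /andP[_ /eqP].
Qed.

Let mpast_fst (F : R -> R) s : measurable_fun setT F ->
  measurable_fun setT (fun p : R * R => (F (s - p.1))%:E).
Proof.
move=> mF; apply/measurable_EFinP; apply: measurableT_comp => //.
by apply: measurable_funB => //; exact: measurable_fst.
Qed.

Let split_integral (kappa : {measure set (R * R)%type -> \bar R}) g s t :
  measurable_fun setT g -> (kappa (subgraph g t) < +oo)%E ->
  (\int[kappa]_(p in subgraph g t) (f (s - p.1))%:E =
   (\sum_k c k * fine (kappa (subgraph g t `&` [set p | B k (s - p.1)])))%:E +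
   \int[kappa]_(p in subgraph g t) (r (s - p.1))%:E)%E.
Proof.
move=> mg kf; rewrite -(integral_step_past mg s c0 mB kf).
under eq_integral do rewrite fE EFinD.
have mS := measurable_subgraph mg t.
rewrite ge0_integralD; [by []|exact: mS|by move=> p _; rewrite lee_fin psi0
  |by apply: measurable_funTS; exact: (mpast_fst s mpsi)
  |by move=> p _; rewrite lee_fin|by apply: measurable_funTS; exact: mpast_fst].
Qed.

Variable t : R.
Hypothesis t0 : 0 <= t.
Variable w : Omega.

Let I : set (measurableTypeR R) := `]0, t]%classic.
Let mI : measurable I. Proof. exact: measurable_itv. Qed.

Let clip (g : R -> R) (u : R) : \bar R := (\1_I u * g u)%:E.

Let mclip (g : R -> R) : measurable_fun setT g -> measurable_fun setT (clip g).
Proof.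
by move=> mg; apply/measurable_EFinP; apply: measurable_funM => //; exact: measurable_indic.
Qed.

Let clip0 (g : R -> R) u : (forall s, 0 <= g s) -> (0 <= clip g u)%E.
Proof. by move=> g0; rewrite lee_fin mulr_ge0// indic_ge0. Qed.

Let integral_clip (g : R -> R) : (\int[leb]_u clip g u = \int[leb]_(u in `]0%R, t]) (g u)%:E)%E.
Proof.
rewrite [RHS]integral_mkcond; apply: eq_integral => u _.
by rewrite /clip /patch indicE; case: ifPn => _; rewrite ?mul1r ?mul0r.
Qed.

Let dens (F g : R -> R) s : \bar R := (\int[leb]_u ((F (s - u))%:E * clip g u))%E.

Let dens_subgraph (F g : R -> R) s : measurable_fun setT F -> (forall v, 0 <= F v) ->
  measurable_fun setT g -> (forall v, 0 <= g v) ->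
  (\int[area]_(p in subgraph g t) (F (s - p.1))%:E = dens F g s)%E.
Proof.
move=> mF F0 mg g0.
rewrite (@integral_subgraph _ g mg g0 (fun u => (F (s - u))%:E) t); last 2 first.
- apply/measurable_EFinP; apply: measurableT_comp => //; exact: measurable_funB.
- by move=> u; rewrite lee_fin.
rewrite integral_mkcond; apply: eq_integral => u _; rewrite /clip /patch indicE.
by case: ifPn => _; rewrite ?mul1r// mul0r mule0.
Qed.

Let mdens (F g : R -> R) : measurable_fun setT F -> (forall v, 0 <= F v) ->
  measurable_fun setT g -> (forall v, 0 <= g v) -> measurable_fun setT (dens F g).
Proof.
move=> mF F0 mg g0.
have mm : measurable_fun setT (fun p : measurableTypeR R * measurableTypeR R =>
    (F (p.1 - p.2)%R)%:E * clip g p.2)%E.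
  apply: emeasurable_funM.
    apply/measurable_EFinP; apply: (measurableT_comp mF).
    by apply: measurable_funB; [exact: measurable_fst|exact: measurable_snd].
  exact: (measurableT_comp (mclip mg) (@measurable_snd _ _ (measurableTypeR R) (measurableTypeR R))).
apply: (measurable_fun_fubini_tonelli_F (m2 := leb) _ mm) => p.
by rewrite mule_ge0 ?clip0// lee_fin.
Qed.

Let dist s := `|rate w s - lim_rate s|.

Let mdist : measurable_fun setT dist.
Proof.
apply: measurableT_comp => //; apply: measurable_funB; first exact: measurable_rate.
exact: measurable_lim_rate.
Qed.

Let dist0 s : 0 <= dist s. Proof. exact: normr_ge0. Qed.

Let dens_le (g h : R -> R) s : measurable_fun setT g -> (forall v, 0 <= g v) ->
  measurable_fun setT h -> (forall v, 0 <= h v) -> (forall u, g u <= h u + dist u) ->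
  (dens f g s <= dens f h s + dens f dist s)%E.
Proof.
move=> mg g0 mh h0 gh.
have ms : measurable_fun setT (fun u : R => (f (s - u))%:E).
  by apply/measurable_EFinP; apply: measurableT_comp => //; exact: measurable_funB.
rewrite /dens -ge0_integralD; [|exact: measurableT
  |by move=> u _; apply: mule_ge0; [rewrite lee_fin|exact: clip0]
  |by apply: emeasurable_funM => //; exact: mclip
  |by move=> u _; apply: mule_ge0; [rewrite lee_fin|exact: clip0]
  |by apply: emeasurable_funM => //; exact: mclip].
apply: ge0_le_integral_any => u _; first by apply: mule_ge0; [rewrite lee_fin|exact: clip0].
rewrite -!EFinM -EFinD lee_fin -mulrDr ler_wpM2l// -mulrDr ler_wpM2l//.
Qed.

Let dev s := \sum_k c k * `|level_dev (B k) t s w|.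

Let conv_r s : \bar R := (N%:R^-1%:E * \sum_(j < N) convolution r (stieltjes (Y j ^~ w)) s)%E.

Let kap_lty j : (j < N)%N -> (kap j w (subgraph (rate w) t) < +oo)%E.
Proof. by move=> jN; rewrite -hs_count// ltry. Qed.

Let area_lty : (area (subgraph (rate w) t) < +oo)%E.
Proof. by rewrite (le_lt_trans (area_region_lty w t0))// -EFinD ltry. Qed.

Let secm j k s : sec_mass kap j (level_region (B k) t s) w =
  fine (kap j w (subgraph (rate w) t `&` [set p | B k (s - p.1)])).
Proof. by rewrite sec_mass.unlock xsection_level_region//; exact: B0. Qed.

Let seca k s : sec_area (level_region (B k) t s) w =
  fine (area (subgraph (rate w) t `&` [set p | B k (s - p.1)])).
Proof. by rewrite sec_area.unlock xsection_level_region//; exact: B0. Qed.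

Let p1 s := N%:R^-1 * \sum_(j < N) \sum_k c k * sec_mass kap j (level_region (B k) t s) w.
Let p2 s := \sum_k c k * sec_area (level_region (B k) t s) w.

Let p12 s : `|p1 s - p2 s| <= dev s.
Proof.
(* The areas are the same for all particles, so averaging over the N particles leaves them
   unchanged. *)
have -> : p1 s - p2 s = \sum_k c k * level_dev (B k) t s w.
  rewrite /p1 exchange_big/= mulr_sumr -sumrB; apply: eq_bigr => k _.
  rewrite /level_dev -mulr_sumr mulrCA -mulrBr; congr (_ * _).
  rewrite sumrB mulrBr; congr (_ - _).
  by rewrite sumr_const card_ord -[X in _ = _ * X]mulr_natl mulrA mulVf ?mul1r// pnatr_eq0 -lt0n.
apply: (le_trans (ler_norm_sum _ _ _)); apply: ler_sum => k _.
by rewrite normrM ger0_norm.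
Qed.

(** The step part against the points differs from the step part against the intensity by at most
    [dev]; the two remainders are kept; replacing the random rate by the limit one under the kernel
    costs the kernel against their distance. The convolutions are assumed finite, since [fine] would
    send an infinite one to 0. *)
Lemma pathwise_bound s : s <= t -> (\sum_(j < N) convolution f (stieltjes (Y j ^~ w)) s +
    convolution f (stieltjes m) s)%E \is a fin_num ->
  ((dist s)%:E <= (dev s)%:E + conv_r s + dens r (rate w) s + dens f dist s)%E.
Proof.
move=> st fin.
have cge (g : R -> R) nu : (forall v, 0 <= g v) -> (0 <= convolution g nu s)%E.
  by move=> g0; exact: convolution_ge0.
have sge : (0 <= \sum_(j < N) convolution f (stieltjes (Y j ^~ w)) s)%E.
  by apply: sume_ge0 => j _; exact: cge.
move: fin; rewrite ge0_fin_numE; last by rewrite adde_ge0 ?cge.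
move=> fin.
have Gfin : convolution f (stieltjes m) s \is a fin_num.
  by rewrite ge0_fin_numE ?cge// (le_lt_trans _ fin)// leeDr.
have Yfin (j : 'I_N) : convolution f (stieltjes (Y j ^~ w)) s \is a fin_num.
  rewrite ge0_fin_numE ?cge// (le_lt_trans _ fin)// (bigD1 j)//= -addeA leeDl//.
  by rewrite adde_ge0 ?cge//; apply: sume_ge0 => k _; exact: cge.
pose l := N%:R^-1 * \sum_(j < N) fine (convolution f (stieltjes (Y j ^~ w)) s).
pose g := fine (convolution f (stieltjes m) s).
have dE : dist s = `|l - g| by rewrite /dist /rate /limit_rate_of opprD addrACA subrr add0r.
have lE : l%:E = ((p1 s)%:E + conv_r s)%E.
  rewrite /l /p1 /conv_r !EFinM -muleDr; last 2 first.
  - by [].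
  - by apply: ge0_adde_def; rewrite ?inE ?lee_fin ?sumr_ge0//; [move=> j _; apply: sumr_ge0 => k _; rewrite mulr_ge0// sec_mass_ge0|apply: sume_ge0 => j _; exact: cge].
  congr (_ * _)%E; rewrite -!sumEFin -big_split/=; apply: eq_bigr => j _.
  rewrite fineK// (@convolution_subgraph _ (kap j w) (rate w) (measurable_rate w) (Y j ^~ w) f s t)//;
    [|exact: hs_cumulative|by move=> x x0; rewrite hs_count].
  rewrite (split_integral s (measurable_rate w) (kap_lty (ltn_ord j))).
  rewrite (@convolution_subgraph _ (kap j w) (rate w) (measurable_rate w) (Y j ^~ w) r s t)//;
    [|exact: hs_cumulative|by move=> x x0; rewrite hs_count].
  congr (_%:E + _)%E; apply: eq_bigr => k _; by rewrite secm.
have gE : g%:E = dens f lim_rate s.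
  rewrite /g fineK// (@convolution_subgraph _ area lim_rate measurable_lim_rate m f s t)//.
    by rewrite dens_subgraph//; [exact: measurable_lim_rate|exact: lim_rate_ge0].
  by move=> x x0; exact: area_limit.
have aE : (dens f (rate w) s = (p2 s)%:E + dens r (rate w) s)%E.
  rewrite -(@dens_subgraph f (rate w) s mf f0 (measurable_rate w) (rate_ge0 w)).
  rewrite -(@dens_subgraph r (rate w) s mr r0 (measurable_rate w) (rate_ge0 w)).
  rewrite (split_integral s (measurable_rate w) area_lty).
  by congr (_%:E + _)%E; apply: eq_bigr => k _; rewrite seca.
have d1 := @dens_le (rate w) lim_rate s (measurable_rate w) (rate_ge0 w) measurable_lim_rate lim_rate_ge0.
have d2 := @dens_le lim_rate (rate w) s measurable_lim_rate lim_rate_ge0 (measurable_rate w) (rate_ge0 w).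
have {}d1 : (dens f (rate w) s <= dens f lim_rate s + dens f dist s)%E.
  by apply: d1 => u; rewrite -lerBlDl ler_norm.
have {}d2 : (dens f lim_rate s <= dens f (rate w) s + dens f dist s)%E.
  by apply: d2 => u; rewrite -lerBlDl /dist distrC ler_norm.
have nonneg : [/\ (0 <= conv_r s)%E, (0 <= dens r (rate w) s)%E & (0 <= dens f dist s)%E].
  split.
  - by rewrite mule_ge0 ?lee_fin ?(ltW Ni)//; apply: sume_ge0 => j _; exact: cge.
  - by apply: integral_ge0 => u _; apply: mule_ge0; [by rewrite lee_fin|apply: clip0; exact: rate_ge0].
  - by apply: integral_ge0 => u _; apply: mule_ge0; [by rewrite lee_fin|exact: clip0].
have [n1 n2 n3] := nonneg.
have /andP[q1 q2] : (p1 s <= p2 s + dev s) && (p2 s <= p1 s + dev s).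
  by have := p12 s; rewrite ler_norml => /andP[h1 h2]; apply/andP; split; lra.
rewrite dE; exact: (two_sided_bound lE gE aE d1 d2 n1 n2 n3 q1 q2).
Qed.

End kernel_split.

Definition rate_dist t w := fine (\int[leb]_(s in `]0%R, t]) (`|rate w s - lim_rate s|)%:E)%E.

Let mdist w : measurable_fun setT (fun s => `|rate w s - lim_rate s|).
Proof.
apply: measurableT_comp => //; apply: measurable_funB; first exact: measurable_rate.
exact: measurable_lim_rate.
Qed.

Lemma rate_dist_le t w : 0 <= t ->
  (\int[leb]_(s in `]0%R, t]) (`|rate w s - lim_rate s|)%:E <= (cum_rate t w + m t)%:E)%E.
Proof.
move=> t0; rewrite EFinD area_limit// (sec_areaE (aC hN t0)) xsection_region.
rewrite !area_subgraph; [|exact: measurable_lim_rate|exact: lim_rate_ge0|exact: measurable_rate|exact: rate_ge0].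
rewrite -ge0_integralD; [|exact: measurable_itv
  |by move=> s _; rewrite lee_fin rate_ge0
  |by apply/measurable_EFinP; apply: measurable_funTS; exact: measurable_rate
  |by move=> s _; rewrite lee_fin lim_rate_ge0
  |by apply/measurable_EFinP; apply: measurable_funTS; exact: measurable_lim_rate].
apply: ge0_le_integral_any => s _; first by rewrite lee_fin.
by rewrite -EFinD lee_fin (le_trans (ler_normB _ _))// !ger0_norm ?rate_ge0// lim_rate_ge0.
Qed.

Lemma rate_distE t w : 0 <= t -> ((rate_dist t w)%:E =
  \int[leb]_(s in `]0%R, t]) (`|rate w s - lim_rate s|)%:E)%E.
Proof.
move=> t0; rewrite fineK// ge0_fin_numE; last by apply: integral_ge0 => s _; rewrite lee_fin.
by rewrite (le_lt_trans (rate_dist_le w t0))// ltry.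
Qed.

Lemma rate_dist_L1 t : 0 <= t -> L1 P (rate_dist t).
Proof.
move=> t0; apply: (L1_le _ _ (L1D (cum_rate_L1 t0) (L1_cst P (m t)))).
  apply: measurableT_comp => //.
  pose H (p : Omega * measurableTypeR R) : \bar R :=
    (\1_(`]0, t]%classic : set (measurableTypeR R)) p.2 * `|rate p.1 p.2 - lim_rate p.2|)%:E.
  have mH : measurable_fun setT H.
    apply/measurable_EFinP; apply: measurable_funM.
      apply: (measurableT_comp (measurable_indic (measurable_itv `]0, t]))).
      exact: measurable_snd.
    apply: measurableT_comp => //; apply: measurable_funB; first exact: joint_rate.
    exact: (measurableT_comp measurable_lim_rate (@measurable_snd _ _ Omega (measurableTypeR R))).
  have H0 q : (0 <= H q)%E by rewrite lee_fin mulr_ge0// indicE.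
  have := @measurable_fun_fubini_tonelli_F _ _ _ _ R leb H mH H0.
  apply: eq_measurable_fun => w _; rewrite [RHS]integral_mkcond.
  apply: eq_integral => s _; rewrite /H/patch/= indicE.
  by case: ifPn => _; rewrite ?mul1r ?mul0r.
move=> w; rewrite ger0_norm; last by rewrite fine_ge0// integral_ge0// => s _; rewrite lee_fin.
by rewrite -lee_fin rate_distE// rate_dist_le.
Qed.

(** When the pathwise bound is integrated over s, its last term is at most Lam times the left side
    and is absorbed there, [rate_dist] being integrable. The remainder counts twice, against the
    points and against the intensity, each time with mean at most rho a0 t. *)
Lemma Ex_rate_dist n (c beta : 'I_n -> R) (B : 'I_n -> set R) (r : R -> R) (rho t : R) :
  0 <= t -> (forall k, 0 <= c k) -> (forall k, measurable (B k)) ->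
  (forall k v, B k v -> 0 < v) -> (forall k, leb (B k) = (beta k)%:E) ->
  measurable_fun setT r -> (forall v, 0 <= r v) ->
  (forall v, f v = \sum_k c k * \1_(B k) v + r v) ->
  (\int[leb]_v (r v)%:E = rho%:E)%E ->
  (1 - Lam) * Ex P (rate_dist t) <=
  \sum_k c k * ((beta k * (a0 * t) + t) / (2 * Num.sqrt N%:R)) + 2 * rho * (a0 * t).
Proof.
move=> t0 c0 mB B0 Bb mr r0 fE rI.
have rneg v : v <= 0 -> r v = 0.
  move=> v0; have := fE v; rewrite fneg// => /eqP; rewrite eq_sym paddr_eq0//.
    by move=> /andP[_ /eqP].
  by apply: sumr_ge0 => k _; rewrite mulr_ge0// indic_ge0.
have rneg' v : v < 0 -> r v = 0 by move=> /ltW/rneg.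
have rho0 : 0 <= rho by rewrite -lee_fin -rI; apply: integral_ge0 => v _; rewrite lee_fin.
pose I : set (measurableTypeR R) := `]0, t]%classic.
have mI : measurable I by exact: measurable_itv.
have iRD := rate_dist_L1 t0.
have Lam0 : 0 <= Lam := kernel_mass_ge0 f0 fL.
pose J k w := (\int[leb]_(s in I) (`|level_dev (B k) t s w|)%:E)%E.
have mJ k : measurable_fun setT (J k).
  have := @measurable_fun_fubini_tonelli_F _ _ _ _ R leb _ (joint_dev t0 (mB k) (B0 k)) _.
  move=> /(_ (fun p => _)) h.
  have {}h := h (fun p => ltac:(by rewrite lee_fin mulr_ge0// indicE)).
  apply: eq_measurable_fun h => w _; rewrite /J [RHS]integral_mkcond.
  apply: eq_integral => s _; rewrite /patch/= indicE.
  by case: ifPn => _; rewrite ?mul1r ?mul0r.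
have J0 k w : (0 <= J k w)%E by apply: integral_ge0 => s _; rewrite lee_fin.
have mdev k w : measurable_fun I (fun s => (`|level_dev (B k) t s w|)%:E).
  have h := measurableT_comp (joint_dev t0 (mB k) (B0 k))
    (measurable_pair1 (w : Omega) : measurable_fun setT (fun s : measurableTypeR R => (w, s))).
  have {}h : measurable_fun I _ := measurable_funTS h.
  apply: eq_measurable_fun h => s sI /=.
  by rewrite indicE sI mul1r.
pose g w (u : R) : \bar R := ((\1_I u * rate w u)%:E).
have mg w : measurable_fun setT (g w).
  apply/measurable_EFinP; apply: measurable_funM; last exact: measurable_rate.
  exact: measurable_indic.
have g0 w u : (0 <= g w u)%E by rewrite lee_fin mulr_ge0 ?indic_ge0 ?rate_ge0.
pose gd w (u : R) : \bar R := ((\1_I u * `|rate w u - lim_rate u|)%:E).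
have mgd w : measurable_fun setT (gd w).
  apply/measurable_EFinP; apply: measurable_funM => //; exact: measurable_indic.
have gd0 w u : (0 <= gd w u)%E by rewrite lee_fin mulr_ge0 ?indic_ge0.
have clipE (h : R -> R) : (\int[leb]_u (\1_I u * h u)%:E = \int[leb]_(u in I) (h u)%:E)%E.
  rewrite [RHS]integral_mkcond; apply: eq_integral => u _.
  by rewrite /patch indicE; case: ifPn => _; rewrite ?mul1r ?mul0r.
have mden (F : R -> R) (G' : R -> \bar R) : measurable_fun setT F -> (forall v, 0 <= F v) ->
    measurable_fun setT G' -> (forall u, 0 <= G' u)%E ->
    measurable_fun setT (fun s : R => \int[leb]_u ((F (s - u)%R)%:E * G' u))%E.
  move=> mF F0 mG G0.
  have mm : measurable_fun setT (fun p : measurableTypeR R * measurableTypeR R =>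
      (F (p.1 - p.2)%R)%:E * G' p.2)%E.
    apply: emeasurable_funM.
      apply/measurable_EFinP; apply: (measurableT_comp mF).
      by apply: measurable_funB; [exact: measurable_fst|exact: measurable_snd].
    exact: (measurableT_comp mG (@measurable_snd _ _ (measurableTypeR R) (measurableTypeR R))).
  apply: (measurable_fun_fubini_tonelli_F (m2 := leb) _ mm) => p.
  by rewrite mule_ge0// lee_fin.
have den0 (F : R -> R) (G' : R -> \bar R) s : (forall v, 0 <= F v) -> (forall u, 0 <= G' u)%E ->
    (0 <= \int[leb]_u ((F (s - u))%:E * G' u))%E.
  by move=> F0 G0; apply: integral_ge0 => u _; rewrite mule_ge0 ?lee_fin.
have den_le (F : R -> R) (G' : R -> \bar R) kk : measurable_fun setT F -> (forall v, 0 <= F v) ->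
    (\int[leb]_v (F v)%:E = kk%:E)%E ->
    measurable_fun setT G' -> (forall u, 0 <= G' u)%E ->
    (\int[leb]_(s in I) \int[leb]_u ((F (s - u))%:E * G' u) <= kk%:E * \int[leb]_u G' u)%E.
  move=> mF F0 FI mG G0; rewrite -(integral_convolution_density mF F0 FI mG G0).
  apply: ge0_subset_integral => //; first exact: mden.
  by move=> s _; exact: den0.
have path w : ((1 - Lam)%:E * (rate_dist t w)%:E <=
    \sum_k (c k)%:E * J k w + (rho * mean_count t w + rho * cum_rate t w)%:E)%E.
  (* One function whose finiteness at s makes all the convolutions finite. Its integral over []0,
     t]] is finite, so the pathwise bound holds for almost every s. *)
  pose T s : \bar R := (\sum_(j < N) convolution f (stieltjes (Y j ^~ w)) s +
    convolution f (stieltjes m) s)%E.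
  have mcv (F : R -> R) j : measurable_fun setT F -> (forall v, 0 <= F v) ->
      measurable_fun setT (convolution F (stieltjes (Y j ^~ w))).
    by move=> mF F0; apply: measurable_convolution_stieltjes => //; exact: hs_cumulative.
  have mT : measurable_fun setT T.
    apply: emeasurable_funD; last exact: measurable_convolution_stieltjes.
    by apply: emeasurable_sum => j; exact: mcv.
  have cv0 (F : R -> R) nu s : (forall v, 0 <= F v) -> (0 <= convolution F nu s)%E.
    by move=> F0; exact: convolution_ge0.
  have T0 s : (0 <= T s)%E.
    by rewrite adde_ge0 ?cv0//; apply: sume_ge0 => j _; exact: cv0.
  have Tint : leb.-integrable I T.
    apply/integrableP; split; first exact: measurable_funTS.
    under eq_integral do rewrite gee0_abs//.
    rewrite ge0_integralD; [|by []|by move=> s _; apply: sume_ge0 => j _; exact: cv0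
      |by apply: measurable_funTS; apply: emeasurable_sum => j; exact: mcv
      |by move=> s _; exact: cv0
      |by apply: measurable_funTS; exact: measurable_convolution_stieltjes].
    rewrite lte_add_pinfty//; last exact: (integral_convolution_lty mf f0 fneg' fL).
    rewrite ge0_integral_sum; [|by []|by move=> j; apply: measurable_funTS; exact: mcv
      |by move=> j s _; exact: cv0].
    apply: lte_sum_pinfty => j _.
    by apply: (integral_convolution_lty mf f0 fneg' fL); [exact: hs_cumulative|exact: hs_0].
  pose E1 s : \bar R := (\sum_k (c k)%:E * (`|level_dev (B k) t s w|)%:E)%E.
  pose E2 s : \bar R := (N%:R^-1%:E * \sum_(j < N) convolution r (stieltjes (Y j ^~ w)) s)%E.
  pose E3 s : \bar R := (\int[leb]_u ((r (s - u))%:E * g w u))%E.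
  pose E4 s : \bar R := (\int[leb]_u ((f (s - u))%:E * gd w u))%E.
  have mE1 : measurable_fun I E1.
    by apply: emeasurable_sum => k; apply: emeasurable_funM => //; exact: mdev.
  have E10 s : (0 <= E1 s)%E by apply: sume_ge0 => k _; rewrite mule_ge0// lee_fin.
  have mE2 : measurable_fun setT E2.
    by apply: emeasurable_funM => //; apply: emeasurable_sum => j; exact: mcv.
  have E20 s : (0 <= E2 s)%E.
    by rewrite mule_ge0 ?lee_fin ?(ltW Ni)//; apply: sume_ge0 => j _; exact: cv0.
  have mE3 : measurable_fun setT E3 by exact: mden.
  have E30 s : (0 <= E3 s)%E by exact: den0.
  have mE4 : measurable_fun setT E4 by exact: mden.
  have E40 s : (0 <= E4 s)%E by exact: den0.
  have main : ((rate_dist t w)%:E <= \int[leb]_(s in I) (E1 s + E2 s + E3 s + E4 s))%E.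
    rewrite rate_distE//; apply: ae_ge0_le_integral => //.
    - by apply/measurable_EFinP; apply: measurable_funTS; exact: mdist.
    - move=> s _; apply: adde_ge0; last exact: E40.
      by apply: adde_ge0; [exact: adde_ge0|exact: E30].
    - by apply: emeasurable_funD; [apply: emeasurable_funD; [apply: emeasurable_funD|]|];
        try exact: measurable_funTS.
    - apply: filterS (integrable_ae mI Tint) => s h sI.
      have st : s <= t by move: sI; rewrite /I/= in_itv/= => /andP[].
      have := @pathwise_bound n c B r c0 mB B0 mr r0 fE t t0 w s st (h sI).
      by rewrite /= /E1 -sumEFin.
  rewrite ge0_integralD in main; [|by []|by move=> s _; apply: adde_ge0; [exact: adde_ge0|exact: E30]
    |by apply: emeasurable_funD; [apply: emeasurable_funD|]; try exact: measurable_funTS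
    |by []|exact: measurable_funTS].
  rewrite ge0_integralD in main; [|by []|by move=> s _; exact: adde_ge0
    |by apply: emeasurable_funD; try exact: measurable_funTS
    |by []|exact: measurable_funTS].
  rewrite ge0_integralD in main; [|by []|by []|by []|by []|exact: measurable_funTS].
  have b1 : (\int[leb]_(s in I) E1 s = \sum_k (c k)%:E * J k w)%E.
    rewrite ge0_integral_sum; [|by []|by move=> k; apply: emeasurable_funM => //; exact: mdev
      |by move=> k s _; rewrite mule_ge0// lee_fin].
    apply: eq_bigr => k _.
    by rewrite ge0_integralZl; [|by []|exact: mdev|by move=> s _; rewrite lee_fin|by rewrite lee_fin].
  have b2 : (\int[leb]_(s in I) E2 s <= (rho * mean_count t w)%:E)%E.
    rewrite ge0_integralZl; [|by []|by apply: measurable_funTS; apply: emeasurable_sum => j; exact: mcv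
      |by move=> s _; apply: sume_ge0 => j _; exact: cv0|by rewrite lee_fin ltW].
    rewrite /mean_count mulrCA EFinM; apply: lee_wpmul2l; first by rewrite lee_fin ltW.
    rewrite ge0_integral_sum; [|by []|by move=> j; apply: measurable_funTS; exact: mcv
      |by move=> j s _; exact: cv0].
    rewrite mulr_sumr -sumEFin; apply: lee_sum => j _.
    rewrite (integral_convolution_stieltjes mr r0 rneg' t (hs_cumulative hs j w) (hs_0 hs j w)).
    have YE x : 0 <= x -> extend0 (Y j ^~ w) x = Y j x w.
      by move=> x0; rewrite /extend0 (max_idPr x0).
    have Y0 x : 0 <= extend0 (Y j ^~ w) x.
      by apply: extend0_ge0; [exact: hs_cumulative|exact: hs_0].
    apply: (convolution_stieltjes_le mr r0 rneg' rI) => [|x /andP[x0 xt]|].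
    - by rewrite -YE.
    - by rewrite Y0/= -(YE t)//; apply: (hs_cumulative hs j w).1.
    - exact: hs_0.
  have b3 : (\int[leb]_(s in I) E3 s <= (rho * cum_rate t w)%:E)%E.
    apply: (le_trans (den_le r _ rho mr r0 rI (mg w) (g0 w))).
    rewrite EFinM (sec_areaE (aC hN t0)) xsection_region area_subgraph;
      [|exact: measurable_rate|exact: rate_ge0].
    by rewrite clipE.
  have b4 : (\int[leb]_(s in I) E4 s <= (Lam * rate_dist t w)%:E)%E.
    apply: (le_trans (den_le f _ Lam mf f0 fL (mgd w) (gd0 w))).
    by rewrite EFinM rate_distE// clipE.
  rewrite b1 in main.
  have fin := leeD (leeD (leeD (lexx (\sum_k (c k)%:E * J k w)%E) b2) b3) b4.
  rewrite -EFinM mulrBl mul1r EFinB leeBlDr//; apply: (le_trans (le_trans main fin)).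
  by rewrite [(_ + _ * cum_rate _ _)%:E]EFinD addeA.
have JE k : (\int[P]_w J k w <= ((beta k * (a0 * t) + t) / (2 * Num.sqrt N%:R))%:E)%E.
  exact: (level_dev_bound t0 (mB k) (B0 k) (Bb k)).
have i1 := mean_count_L1 t0; have i2 := cum_rate_L1 t0.
have i3 : L1 P (fun w => rho * mean_count t w + rho * cum_rate t w).
  by apply: L1D; exact: L1Zl.
rewrite -lee_fin EFinM (ExE iRD).
have L10 w : (0 <= (rate_dist t w)%:E)%E.
  by rewrite rate_distE// integral_ge0// => s _; rewrite lee_fin.
rewrite -ge0_integralZl; [|by []|exact: measurable_int iRD|by []|by rewrite lee_fin subr_ge0 ltW].
apply: (@le_trans _ _ (\int[P]_w (\sum_k (c k)%:E * J k w +
    (rho * mean_count t w + rho * cum_rate t w)%:E))%E).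
  apply: ge0_le_integral_any => w _; last exact: path.
  by rewrite mule_ge0// lee_fin subr_ge0 ltW.
rewrite ge0_integralD; [|by []|by move=> w _; apply: sume_ge0 => k _; rewrite mule_ge0// lee_fin
  |by apply: emeasurable_sum => k; apply: emeasurable_funM
  |by move=> w _; rewrite lee_fin addr_ge0// mulr_ge0// ?mean_count_ge0 ?cum_rate_ge0
  |exact: measurable_int i3].
rewrite EFinD; apply: leeD.
  rewrite ge0_integral_sum; [|by []|by move=> k; apply: emeasurable_funM
    |by move=> k w _; rewrite mule_ge0// lee_fin].
  rewrite -sumEFin; apply: lee_sum => k _.
  rewrite ge0_integralZl; [|by []|by []|by []|by rewrite lee_fin].
  by rewrite EFinM; apply: lee_wpmul2l; rewrite ?lee_fin.
rewrite -(ExE i3) lee_fin ExD; [|exact: L1Zl|exact: L1Zl].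
have e1 : Ex P (fun w => rho * mean_count t w) = rho * Ex P (mean_count t) by exact: ExZl.
have e2 : Ex P (fun w => rho * cum_rate t w) = rho * Ex P (cum_rate t) by exact: ExZl.
rewrite e1 e2 (Ex_mean_count t0).
have := @Ex_cum_rate_le t t; rewrite t0 lexx => /(_ isT) h.
by have := ler_wpM2l rho0 h; lra.
Qed.

Definition limit_region t : set (Omega * (R * R)) := [set p | 0 < p.2.1 /\ subgraph lim_rate t p.2].

Lemma xsection_limit_region t w : xsection (limit_region t) w = subgraph lim_rate t.
Proof.
apply/seteqP; split => p; rewrite /xsection/= inE; first by case.
by move=> h; split => //; case: h => /andP[].
Qed.

Hypothesis limit_fin : forall j w t, (kap j w (subgraph lim_rate t) < +oo)%E.

(** The two counts differ on the disjoint predictable regions where one rate exceeds the other,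
    taken with signs 1 and -1. The total area of these regions is the integral of the distance of
    the rates. *)
Lemma Ex_coupling j t e : (j < N)%N -> 0 <= t -> 0 < e ->
  Ex P (fun w => `|(Y j t w - cum_rate t w) -
    (fine (kap j w (subgraph lim_rate t)) - m t)|) <= (e * Ex P (rate_dist t) + e^-1) / 2.
Proof.
move=> jN t0 e0; have [pC sC mC aC' EC] := aC jN t0.
have mlim : measurable (subgraph lim_rate t) by apply: measurable_subgraph; exact: measurable_lim_rate.
have mrat w : measurable (subgraph (rate w) t) by apply: measurable_subgraph; exact: measurable_rate.
have alim : (area (subgraph lim_rate t) < +oo)%E by rewrite -area_limit// ltry.
have arat w : (area (subgraph (rate w) t) < +oo)%E.
  by rewrite -xsection_region -(sec_areaE (aC jN t0)) ltry.
have krat w : (kap j w (subgraph (rate w) t) < +oo)%E by rewrite -hs_count// ltry.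
have pD : predictable G (limit_region t) := predictable_time_set fil mlim.
pose C1 := region t `\` limit_region t; pose C2 := limit_region t `\` region t.
have x1 w : xsection C1 w = subgraph (rate w) t `\` subgraph lim_rate t.
  by rewrite /C1 xsectionD xsection_region xsection_limit_region.
have x2 w : xsection C2 w = subgraph lim_rate t `\` subgraph (rate w) t.
  by rewrite /C2 xsectionD xsection_region xsection_limit_region.
have sub (k : {measure set (R * R)%type -> \bar R}) (X Z : set (R * R)) :
    measurable X -> measurable Z -> (k (X `\` Z) <= k X)%E.
  by move=> mX mZ; apply: le_measure; rewrite ?inE//; exact: measurableD.
have ad1 : admissible P G kap t j C1.
  split.
  - exact: (@measurableD _ TP _ _ pC pD).
  - by move=> p [/sC].
  - by move=> w; apply: le_lt_trans (krat w); rewrite x1; exact: (sub (kap j w)).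
  - by move=> w; apply: le_lt_trans (arat w); rewrite x1; exact: (sub (@area R)).
  - apply: le_lt_trans EC; apply: ge0_le_integral_any => w _ //.
    by rewrite x1 xsection_region; exact: (sub (@area R)).
have ad2 : admissible P G kap t j C2.
  split.
  - exact: (@measurableD _ TP _ _ pD pC).
  - move=> [w [s z]] [[_ [/= st /andP[z0 _]]] _]; split => //; split => //=.
    by rewrite in_itv/= z0.
  - by move=> w; apply: le_lt_trans (limit_fin j w t); rewrite x2; exact: (sub (kap j w)).
  - by move=> w; apply: le_lt_trans alim; rewrite x2; exact: (sub (@area R)).
  - apply: (@le_lt_trans _ _ (\int[P]_w (m t)%:E)%E).
      by apply: ge0_le_integral_any => w _ //; rewrite x2 area_limit//; exact: (sub (@area R)).
    by rewrite -(ExE (L1_cst P (m t))) ltry.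
pose C (k : bool) := if k then C1 else C2.
have adC (k : bool) : admissible P G kap t j (C k) by case: k.
have orth (k l : bool) : k != l -> j != j \/ C k `&` C l = set0.
  by case: k; case: l => //= _; right; apply/seteqP; split => // p [[? ?] [? ?]].
have := Ex_norm_compensated pd (I := bool) (i := fun=> j) (fun k : bool => if k then 1 else -1)
  (C := C) (e := e) adC orth e0.
rewrite !big_bool/=.
(* The common part of the two regions cancels, in the counts as in the areas. *)
have split_fin (k : {measure set (R * R)%type -> \bar R}) (X Z : set (R * R)) :
    measurable X -> measurable Z -> (k X < +oo)%E -> (k Z < +oo)%E ->
    fine (k (X `\` Z)) - fine (k (Z `\` X)) = fine (k X) - fine (k Z).
  move=> mX mZ kX kZ.
  have fi (U : set (R * R)) : (k U < +oo)%E -> k U \is a fin_num by move=> h; rewrite ge0_fin_numE.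
  have mXZ := measurableI _ _ mX mZ.
  have kI : (k (X `&` Z) < +oo)%E.
    by apply: le_lt_trans kX; apply: le_measure; rewrite ?inE//; exact: subIsetl.
  have -> : k (X `\` Z) = (k X - k (X `&` Z))%E by exact: measureD.
  have -> : k (Z `\` X) = (k Z - k (X `&` Z))%E by rewrite [X `&` Z]setIC; apply: measureD.
  by rewrite !fineB ?fi//; lra.
have -> : Ex P (fun w => `|\sum_(k : bool) (if k then 1 else -1) *
    (sec_mass kap j (C k) w - sec_area (C k) w)|) =
    Ex P (fun w => `|(Y j t w - cum_rate t w) -
      (fine (kap j w (subgraph lim_rate t)) - m t)|).
  apply: eq_Ex => w; rewrite big_bool/= mul1r mulN1r; congr (`|_|).
  rewrite sec_mass.unlock sec_area.unlock x1 x2 -(sec_mass_region w jN t0) sec_mass.unlock.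
  rewrite /cum_rate sec_area.unlock xsection_region.
  have h1 := split_fin (kap j w) _ _ (mrat w) mlim (krat w) (limit_fin j w t).
  have h2 := split_fin area _ _ (mrat w) mlim (arat w) alim.
  have e3 : m t = fine (area (subgraph lim_rate t)) by rewrite -area_limit.
  by rewrite e3; lra.
move=> /le_trans; apply.
rewrite ler_pM2r ?invr_gt0// lerD2r ler_pM2l// sqrrN expr1n !mul1r.
have a1 := sec_area_L1 pd ad1; have a2 := sec_area_L1 pd ad2.
rewrite -ExD//; apply: le_Ex; [exact: L1D|exact: rate_dist_L1|move=> w].
rewrite -lee_fin EFinD (sec_areaE ad1) (sec_areaE ad2) x1 x2 rate_distE//.
(* The two subgraphs meet in the subgraph of the smaller rate. *)
pose mi s := Num.min (rate w s) (lim_rate s).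
have mmi : measurable_fun setT mi.
  by apply: measurable_minr; [exact: measurable_rate|exact: measurable_lim_rate].
have mi0 s : 0 <= mi s by rewrite le_min rate_ge0 lim_rate_ge0.
have area_diff (g h : R -> R) : measurable_fun setT g -> (forall s, 0 <= g s) ->
    measurable_fun setT h -> (area (subgraph g t) < +oo)%E -> (forall s, mi s <= g s) ->
    subgraph g t `&` subgraph h t = subgraph mi t ->
    (area (subgraph g t `\` subgraph h t) = \int[leb]_(s in `]0%R, t]) (g s - mi s)%:E)%E.
  move=> mg g0 mh gf mig gh.
  have mG := measurable_subgraph mg t; have mH := measurable_subgraph mh t.
  have -> : area (subgraph g t `\` subgraph h t) =
      (area (subgraph g t) - area (subgraph g t `&` subgraph h t))%E by exact: measureD.
  rewrite gh; have mM := measurable_subgraph mmi t.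
  have Mf : area (subgraph mi t) \is a fin_num.
    rewrite ge0_fin_numE//; apply: le_lt_trans gf; apply: le_measure; rewrite ?inE//.
    by rewrite -gh; exact: subIsetl.
  have Gf : area (subgraph g t) \is a fin_num by rewrite ge0_fin_numE.
  apply/eqP; rewrite sube_eq ?fin_num_adde_defl//.
  rewrite (area_subgraph mg g0) (area_subgraph mmi mi0) -ge0_integralD;
    [|exact: measurable_itv
     |by move=> s _; rewrite lee_fin subr_ge0
     |by apply/measurable_EFinP; apply: measurable_funTS; exact: measurable_funB
     |by move=> s _; rewrite lee_fin
     |by apply/measurable_EFinP; exact: measurable_funTS].
  by apply/eqP; apply: eq_integral => s _; rewrite -EFinD subrK.
have i1 : subgraph (rate w) t `&` subgraph lim_rate t = subgraph mi t.
  apply/seteqP; split => p; rewrite /subgraph/= /mi le_min.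
    by move=> [[-> /andP[-> ->]] [_ /andP[_ ->]]].
  by move=> [-> /andP[-> /andP[-> ->]]].
have i2 : subgraph lim_rate t `&` subgraph (rate w) t = subgraph mi t by rewrite setIC.
have l1 s : mi s <= rate w s by rewrite ge_min lexx.
have l2 s : mi s <= lim_rate s by rewrite ge_min lexx orbT.
rewrite (area_diff _ _ (measurable_rate w) (rate_ge0 w) measurable_lim_rate (arat w) l1 i1).
rewrite (area_diff _ _ measurable_lim_rate lim_rate_ge0 (measurable_rate w) alim l2 i2).
rewrite -ge0_integralD; [|exact: measurable_itv
  |by move=> s _; rewrite lee_fin subr_ge0 ge_min lexx
  |by apply/measurable_EFinP; apply: measurable_funTS; apply: measurable_funB => //; exact: measurable_rate
  |by move=> s _; rewrite lee_fin subr_ge0 ge_min lexx orbT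
  |by apply/measurable_EFinP; apply: measurable_funTS; apply: measurable_funB => //; exact: measurable_lim_rate].
apply: ge0_le_integral_any => s _.
  by rewrite -EFinD lee_fin addr_ge0// subr_ge0 ge_min lexx ?orbT.
rewrite -EFinD lee_fin /mi; case: (leP (rate w s) (lim_rate s)) => h.
  by rewrite ler0_norm ?subr_le0//; lra.
by rewrite gtr0_norm ?subr_gt0//; lra.
Qed.

End hawkes_system.

(** * From the evolution equation to systems of particles *)

Section hawkes_construction.
Context d (Omega : measurableType d) (R : realType) (P : probability Omega R).
Local Notation leb := (@lebesgue_measure R).
Variables (F : R -> set (set Omega)) (pi : nat -> R.-ker Omega ~> (R * R)%type)
  (mu Lambda : R) (h phi : R -> R) (m : R -> R).
Hypotheses (hF : filtration F) (hpi : iid_poisson_measures P F pi)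
  (hmu : 0 < mu) (hh : forall x : R, h x = mu + x)
  (phi_ge0 : forall s : R, 0 <= s -> 0 <= phi s)
  (phi_meas : measurable_fun (`[0, +oo[ : set R) phi)
  (hLambda : (\int[leb]_(s in `[0%R, +oo[) (phi s)%:E)%E = Lambda%:E)
  (Lambda_lt1 : Lambda < 1)
  (hm : mean_field_limit h phi m).

Local Notation f := (causal phi).
Local Notation lim := (limit_rate_of mu f m).

Let mf := measurable_causal phi_meas.
Let f0 := causal_ge0 phi_ge0.
Let fL := integral_causal phi_ge0 phi_meas hLambda.
Let mP : is_cumulative m. Proof. by apply: (@limit_cumulative R mu h phi m). Qed.
Let m0 : m 0 = 0. Proof. by apply: (@limit0 R h phi m). Qed.

Lemma poisson_ae_finite i U : measurable U -> U `<=` quadrant -> (area U < +oo)%E ->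
  {ae P, forall w, (pi i w U < +oo)%E}.
Proof.
move=> mU Uq Uf.
have i1 : P.-integrable setT (fun w => pi i w U).
  apply/integrableP; split; first exact: measurable_kernel.
  under eq_integral do rewrite gee0_abs//.
  by rewrite (poisson_measure_mean hpi i mU Uq Uf).
by apply: filterS (integrable_ae measurableT i1) => w /(_ I); rewrite ge0_fin_numE.
Qed.

Lemma poisson_ae_zero i U : measurable U -> U `<=` quadrant -> area U = 0%E ->
  {ae P, forall w, pi i w U = 0%E}.
Proof.
move=> mU Uq U0.
have mk : measurable_fun setT (fun w => pi i w U) by exact: measurable_kernel.
have : (\int[P]_w `|pi i w U| = 0)%E.
  under eq_integral do rewrite gee0_abs//.
  by rewrite (poisson_measure_mean hpi i mU Uq)// U0 ?ltry.
move=> /(ae_eq_integral_abs P measurableT mk); apply: filterS => w; exact.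
Qed.

Let box (n : nat) : set (R * R) := `[0, n%:R] `*` `[0, n%:R].
(** The evolution equation integrates over [[0, t]], time 0 included, whereas the regions start
    after 0. The difference lies on these segments, which have area 0 and so carry no points almost
    surely. *)
Let wall (n : nat) : set (R * R) := [set 0] `*` `[0, n%:R].

Let areaX (A B : set R) : measurable A -> measurable B ->
  area (A `*` B) = (leb A * leb B)%E.
Proof.
by move=> mA mB; exact: (@product_measure1E _ _ (measurableTypeR R) (measurableTypeR R) R leb leb A B mA mB).
Qed.

Let box_quad n : box n `<=` quadrant.
Proof. by move=> [s z] [/= ]; rewrite /quadrant/= !in_itv/= => /andP[-> _] /andP[-> _]. Qed.

Let wall_quad n : wall n `<=` quadrant.
Proof. by move=> [s z] [/= ->]; rewrite /quadrant/= !in_itv/= lexx => /andP[-> _]. Qed.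

Let mbox n : measurable (box n).
Proof. by apply: measurableX; exact: measurable_itv. Qed.

Let mwall n : measurable (wall n).
Proof. by apply: measurableX; [exact: measurable_set1|exact: measurable_itv]. Qed.

Let mlim : measurable_fun setT lim.
Proof. exact: (measurable_lim_rate mu mf f0 mP). Qed.

Let lim0 s : 0 <= lim s.
Proof. exact: (lim_rate_ge0 hmu f0). Qed.

Let alim n : (area (subgraph lim n%:R) < +oo)%E.
Proof.
rewrite -(@area_limit R mu Lambda f hmu mf f0 _ fL m mP m0)//.
- by rewrite ltry.
- by move=> v v0; rewrite /causal ltNge v0.
- by move=> t t0; apply: (@limit_convolution R mu Lambda h phi m).
Qed.

Let slim_quad n : subgraph lim n%:R `<=` quadrant.
Proof.
by move=> [s z] [/= /andP[s0 _] /andP[z0 _]]; rewrite /quadrant/= !in_itv/= z0 ltW.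
Qed.

Let mslim n : measurable (subgraph lim n%:R).
Proof. exact: measurable_subgraph. Qed.

Variables (N : nat) (Z : nat -> R -> Omega -> R).
Hypotheses (hN : (0 < N)%N) (hZ : mean_field_hawkes P F pi h phi N Z).

Lemma good_kernel_exists (good : set Omega) : measurable good -> P (~` good) = 0%E ->
  (forall i w T K, good w -> (pi i w (time_box T K) < +oo)%E) ->
  exists kap : nat -> R.-ker Omega ~> (R * R)%type,
    [/\ poisson_data P (completed P F) kap, forall i w, good w -> kap i w = pi i w
      & forall i w U, ~ good w -> kap i w U = 0%E].
Proof.
move=> mgood Pgood good_box; eexists; split.
- exact: (good_poisson_data hF hpi mgood Pgood good_box).
- by move=> i w gw /=; exact: good_kernelE.
- by move=> i w U ngw; rewrite /= /good_kernel memNset.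
Qed.

(** The almost sure properties gathered at one w, with integer sizes so that they are countably
    many. Elsewhere the system will be replaced by the empty one. *)
Let event w := [/\ forall i n, (pi i w (box n) < +oo)%E,
  forall i n, pi i w (wall n) = 0%E,
  forall i n, (pi i w (subgraph lim n%:R) < +oo)%E &
  forall (i : nat) (t : R), (i < N)%N -> 0 <= t ->
    (Z i t w)%:E = (\int[pi i w]_(p in `[0%R, t] `*` `[0%R, +oo[)
      (\1_[set q : R * R | (q.2 <= intensity h phi N Z w q.1)%R] p)%:E)%E].

Let event_ae : {ae P, forall w, event w}.
Proof.
have [_ _ _ h4] := hZ.
have h1 : {ae P, forall w, forall i n, (pi i w (box n) < +oo)%E}.
  apply: ae_foralln => i; apply: ae_foralln => n; apply: poisson_ae_finite => //.
  by rewrite areaX// !lebesgue_measure_itv/=; case: ifPn => _; rewrite -?EFinB -?EFinM ?mule0 ltry.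
have h2 : {ae P, forall w, forall i n, pi i w (wall n) = 0%E}.
  apply: ae_foralln => i; apply: ae_foralln => n; apply: poisson_ae_zero => //.
  rewrite areaX//; first by rewrite lebesgue_measure_set1 mul0e.
have h3 : {ae P, forall w, forall i n, (pi i w (subgraph lim n%:R) < +oo)%E}.
  by apply: ae_foralln => i; apply: ae_foralln => n; exact: poisson_ae_finite.
by apply: filterS (filterI h1 (filterI h2 (filterI h3 h4))) => w [? [? [? ?]]].
Qed.

(** Off [good] both the processes and the Poisson masses are set to 0, so the equation holds there
    trivially. The change is confined to a null set, which the completed filtration absorbs, so
    adaptedness is kept. *)
Lemma hawkes_system_exists : exists good : set Omega,
  exists kap : nat -> R.-ker Omega ~> (R * R)%type, exists Y : nat -> R -> Omega -> R,
  [/\ measurable good /\ P (~` good) = 0%E,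
      hawkes_system P (completed P F) kap mu f N Y,
      forall j t w, (j < N)%N -> good w -> Y j t w = Z j t w,
      (forall j w, good w -> kap j w = pi j w) /\
        (forall j w t, (kap j w (subgraph lim t) < +oo)%E)
    & forall j t, (j < N)%N -> 0 <= t -> measurable_fun setT (Z j t)].
Proof.
have [B [mB PB subB]] := event_ae.
pose good := ~` B; exists good.
have mgood : measurable good by exact: measurableC.
have Pgood : P (~` good) = 0%E by rewrite /good setCK.
have goodE w : good w -> event w.
  by move=> gw; apply: contrapT => nw; apply: gw; exact: subB.
pose Y j t w := if (w \in good) && (j < N)%N then Z j t w else 0.
have YE j t w : (j < N)%N -> good w -> Y j t w = Z j t w.
  by move=> jN gw; rewrite /Y mem_set// jN.
have Yout j t w : ~ good w \/ (N <= j)%N -> Y j t w = 0.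
  rewrite /Y => -[ngw|Nj]; first by rewrite memNset.
  by rewrite [(j < N)%N]ltnNge Nj andbF.
have [cadlagZ adZ EZ _] := hZ.
have [sF mF monF] := hF.
have good_box i w T K : good w -> (pi i w (time_box T K) < +oo)%E.
  move=> /goodE[h1 _ _ _]; pose n := (Num.trunc (Num.max `|T| `|K|)).+1.
  apply: le_lt_trans (h1 i n); apply: le_measure; rewrite ?inE.
  - by apply: measurableX; exact: measurable_itv.
  - exact: mbox.
  - move=> [s z] [/=]; rewrite !in_itv/= => /andP[s0 sT] /andP[z0 zK].
    have := truncnS_gt (Num.max `|T| `|K|); rewrite gt_max => /andP[nT nK].
    split => /=; rewrite in_itv/=.
      by rewrite (ltW s0)/=; apply: (le_trans sT); apply: (le_trans (ler_norm _)); exact: ltW.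
    by rewrite z0/=; apply: (le_trans zK); apply: (le_trans (ler_norm _)); exact: ltW.
have mZ j t : (j < N)%N -> 0 <= t -> measurable_fun setT (Z j t).
  move=> jN t0 _ A mA; rewrite setTI; apply: (mF t t0); apply: (adZ j jN t t0).
  by exists A => //; rewrite setTI.
have mY j t : 0 <= t -> measurable_fun setT (Y j t).
  move=> t0; have [jN|Nj] := ltnP j N; last first.
    rewrite (_ : Y j t = fun=> 0); first exact: measurable_cst.
    by apply/funext => w; rewrite Yout//; right.
  rewrite (_ : Y j t = fun w => \1_good w * Z j t w).
    by apply: measurable_funM; [exact: measurable_indic|exact: mZ].
  apply/funext => w; rewrite /Y jN andbT indicE; case: ifPn => _; by rewrite ?mul1r ?mul0r.
(* Monotonicity is not part of the definition of the process; it comes from the equation, as a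
   nonnegative function is integrated over increasing domains. *)
have Zmono j w s t : (j < N)%N -> good w -> 0 <= s -> s <= t -> Z j s w <= Z j t w.
  move=> jN /goodE[_ _ _ h4] s0 st; have t0 := le_trans s0 st.
  rewrite -lee_fin (h4 j s jN s0) (h4 j t jN t0) integral_mkcond [X in (_ <= X)%E]integral_mkcond.
  apply: ge0_le_integral_any => p _; rewrite /patch.
    by case: ifPn => // _; rewrite lee_fin indicE.
  case: ifPn => [|_]; last by case: ifPn => // _; rewrite lee_fin indicE.
  rewrite inE => -[/= p1 p2]; rewrite mem_set//; split => //=.
  by move: p1; rewrite !in_itv/= => /andP[-> /le_trans]; apply.
have wall_null j w : good w -> pi j w (\bigcup_n wall n) = 0%E.
  move=> /goodE[_ h2 _ _].
  apply/negligibleP; first by apply: bigcup_measurable => n _; exact: mwall.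
  by apply: negligible_bigcup => n; apply/negligibleP; [exact: mwall|exact: h2].
have Z0 j w : (j < N)%N -> good w -> Z j 0 w = 0.
  move=> jN gw; have [_ h2 _ h4] := goodE w gw; apply: EFin_inj; rewrite (h4 j 0 jN (lexx _)).
  have W : pi j w (`[0, 0] `*` `[0, +oo[) = 0%E.
    rewrite (_ : _ `*` _ = \bigcup_n wall n); first exact: wall_null.
    apply/seteqP; split => [[s z] [/=]|[s z] [n _] [/= ->]].
      rewrite !in_itv/= andbT => /andP[s0 s0'] z0; exists (Num.trunc z).+1 => //.
      split => /=; first by apply/eqP; rewrite eq_le s0 s0'.
      by rewrite in_itv/= z0 ltW ?truncnS_gt.
    by rewrite in_itv/= => /andP[z0 _]; split; rewrite /= in_itv/= ?lexx ?z0.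
  apply/eqP; rewrite eq_le; apply/andP; split; last first.
    by apply: integral_ge0 => p _; rewrite lee_fin indicE.
  apply: (@le_trans _ _ (\int[pi j w]_(p in `[0%R, 0%R] `*` `[0%R, +oo[) 1)%E).
    apply: ge0_le_integral_any => p _; first by rewrite lee_fin indicE.
    by rewrite lee_fin indicE lern1 leq_b1.
  rewrite integral_cst; last by apply: measurableX; exact: measurable_itv.
  by rewrite mul1e W.
have Ycum j w : is_cumulative (Y j ^~ w).
  have cst0 : is_cumulative (fun _ : R => 0 : R).
    by split => [x y _ //|x]; exact: cvg_cst.
  have [gw|ngw] := pselect (good w); last first.
    by rewrite (_ : Y j ^~ w = fun=> 0)//; apply/funext => t; rewrite Yout//; left.
  have [jN|Nj] := ltnP j N; last first.
    by rewrite (_ : Y j ^~ w = fun=> 0)//; apply/funext => t; rewrite Yout//; right.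
  rewrite (_ : Y j ^~ w = Z j ^~ w); last by apply/funext => t; rewrite YE.
  split => [x y xy|x].
    apply: Zmono => //; first by rewrite le_max lexx.
    by rewrite ge_max !le_max lexx xy orbT.
  have [x0|x0] := ltP x 0.
    apply: cvg_near_cst; near=> y.
    have y0 : y < 0 by near: y; exact: nbhs_right_lt.
    by rewrite /extend0 !(max_idPl _)// ltW.
  have [cr _] := cadlagZ j jN w.
  rewrite /extend0 (max_idPr x0); apply: cvg_trans (cr x x0); apply: near_eq_cvg.
  near=> y; have xy : x < y by near: y; exact: nbhs_right_gt.
  by rewrite (max_idPr _)// (le_trans x0)// ltW.
have YZfun j w : (j < N)%N -> good w -> (fun u => Z j u w) = Y j ^~ w.
  by move=> jN gw; apply/funext => u; rewrite YE.
have Y0 j w : Y j 0 w = 0.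
  have [gw|ngw] := pselect (good w); last by rewrite Yout//; left.
  have [jN|Nj] := ltnP j N; last by rewrite Yout//; right.
  by rewrite YE// Z0.
have Yge0 j t w : 0 <= t -> 0 <= Y j t w.
  move=> t0; have := extend0_ge0 t (Ycum j w) (Y0 j w).
  by rewrite /extend0 (max_idPr t0).
have [kap [kdata kE k0]] := good_kernel_exists mgood Pgood good_box.
exists kap, Y; split => //; last first.
  split => // j w t; have [gw|ngw] := pselect (good w); last by rewrite k0// ltry.
  rewrite kE//; have [_ _ h3 _] := goodE w gw; pose n := (Num.trunc `|t|).+1.
  apply: le_lt_trans (h3 j n); apply: le_measure; rewrite ?inE.
  - exact: measurable_subgraph.
  - exact: measurable_subgraph.
  - move=> p [/andP[p0 pt] pz]; split => //; rewrite p0/= (le_trans pt)//.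
    by rewrite (le_trans (ler_norm t))// ltW// truncnS_gt.
split => //.
- move=> j t t0 _ [A mA <-]; rewrite setTI; split.
    by have := mY j t t0 measurableT A mA; rewrite setTI.
  have [jN|Nj] := ltnP j N; last first.
    have [A0|A0] := pselect (A 0).
      exists setT; first exact: filtrationT.
      rewrite (_ : _ @^-1` _ = setT); first exact: null_symdiff_refl.
      by apply/seteqP; split => // w _ /=; rewrite Yout//; right.
    exists set0; first by have [] := sF t t0.
    rewrite (_ : _ @^-1` _ = set0); first exact: null_symdiff_refl.
    by apply/seteqP; split => // w /=; rewrite Yout//; right.
  (* The event of the original process belongs to [F t] and differs from the modified one only off
     [good]. *)
  exists (Z j t @^-1` A); first by apply: (adZ j jN t t0); exists A => //; rewrite setTI.
  exists (~` good); split => //; first exact: measurableC.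
  move=> w /= + gw; rewrite YE//; tauto.
- move=> j t t0; apply/integrableP; split; first exact/measurable_EFinP/mY.
  under eq_integral do rewrite /= ger0_norm ?Yge0//.
  have [jN|Nj] := ltnP j N; last first.
    by rewrite integral0_eq// => w _; rewrite Yout//; right.
  have := EZ j t jN t0; rewrite unlock.
  suff -> : (\int[P]_w (Y j t w)%:E = \int[P]_w (Z j t w)%:E)%E by [].
  apply: ae_eq_integral => //.
  + exact/measurable_EFinP/mY.
  + exact/measurable_EFinP/mZ.
  + by exists B; split => // w /= nw; apply: contrapT => nB; apply: nw => _; rewrite YE.
- move=> j w t jN t0.
  have [gw|ngw] := pselect (good w); last by rewrite Yout; [rewrite k0|left].
  rewrite YE// kE//; have [h1 h2 _ h4] := goodE w gw.
  have mr : measurable_fun setT (rate mu f N Y w).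
    apply: measurable_funD => //; apply: measurable_funM => //.
    apply: measurable_sum => k; apply: measurableT_comp => //.
    by apply: measurable_convolution_stieltjes.
  (* Leaving out the jump at s amounts to giving weight 0 to the lag 0, which is what [causal]
     does. *)
  have rE s : 0 <= s -> intensity h phi N Z w s = rate mu f N Y w s.
    move=> s0; rewrite /intensity hh /rate; congr (_ + _ * _); apply: eq_bigr => k _.
    rewrite (YZfun k w (ltn_ord k) gw); congr fine.
    transitivity (\int[stieltjes (Y k ^~ w)]_(u in `[0%R, s[) (f (s - u))%:E)%E.
      apply: eq_integral => u; rewrite inE/= in_itv/= => /andP[u0 us].
      by rewrite /causal subr_gt0 us.
    apply: (integral_stieltjes_positive (stieltjes_le0 (Ycum k w))).
    - exact: measurable_itv.
    - apply/measurable_EFinP; apply: measurableT_comp => //; exact: measurable_funB.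
    - by move=> u; rewrite lee_fin.
    - move=> u u0 /= /negP; rewrite in_itv/= (ltW u0)/= -leNgt => su.
      by rewrite /causal ltNge subr_le0 su.
  rewrite (h4 j t jN t0).
  pose E : set (R * R) := `[0, t] `*` `[0, +oo[.
  have mE : measurable E by apply: measurableX; exact: measurable_itv.
  pose D := [set q : R * R | q.2 <= rate mu f N Y w q.1].
  have mD : measurable D.
    have mg : measurable_fun setT (fun p : R * R => rate mu f N Y w p.1 - p.2).
      apply: measurable_funB; last exact: measurable_snd.
      exact: (measurableT_comp mr measurable_fst).
    have := mg measurableT _ (measurable_itv `[0, +oo[); rewrite setTI.
    by congr (measurable _); apply/seteqP; split => p /=; rewrite in_itv/= andbT subr_ge0.
  transitivity (\int[pi j w]_(p in E) (\1_D p)%:E)%E.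
    apply: eq_integral => p; rewrite inE => -[/= p1 p2]; rewrite !indicE; congr (_%:R%:E).
    congr nat_of_bool; apply/idP/idP; rewrite !inE /D/= rE//;
      by move: p1; rewrite in_itv/= => /andP[].
  rewrite integral_indic//.
  have mS := measurable_subgraph mr t.
  pose V : set (R * R) := \bigcup_n wall n.
  have mV : measurable V by apply: bigcup_measurable => n _; exact: mwall.
  have V0 : pi j w V = 0%E by exact: wall_null.
  (* The domain of the equation exceeds the subgraph by points at time 0 only, all contained in the
     null set [V]. *)
  apply/eqP; rewrite eq_le; apply/andP; split.
    apply: (@le_trans _ _ (pi j w (subgraph (rate mu f N Y w) t `|` V))).
      apply: le_measure; rewrite ?inE; [exact: measurableI|exact: measurableU|].
      move=> [s z] [Ds [/=]]; rewrite !in_itv/= andbT => /andP[s0 st] z0.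
      have [s0'|s0'] := ltP 0 s; first by left; split => /=; rewrite ?s0' ?st// z0.
      right; exists (Num.trunc z).+1 => //; split => /=.
        by apply/eqP; rewrite eq_le s0 s0'.
      by rewrite in_itv/= z0 ltW// truncnS_gt.
    apply: (le_trans (measureU2 _ _ _)) => //.
    by rewrite [X in (_ + X)%E](_ : _ = 0%E) ?adde0.
  apply: le_measure; rewrite ?inE; [exact: mS|exact: measurableI|].
  move=> [s z] [/= /andP[s0 st] /andP[z0 zr]]; split => //; split => /=; rewrite in_itv/=.
    by rewrite (ltW s0).
  by rewrite z0.
Unshelve. all: by end_near.
Qed.

End hawkes_construction.

(** * Growth of the limit *)

Section linear_growth.
Context {R : realType}.
Local Notation leb := (@lebesgue_measure R).
Variables (mu Lam : R) (h phi m : R -> R).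
Hypotheses (hmu : 0 < mu) (hh : forall x, h x = mu + x)
  (phi_ge0 : forall s, 0 <= s -> 0 <= phi s)
  (phi_meas : measurable_fun (`[0, +oo[ : set R) phi)
  (phi_int : (\int[leb]_(s in `[0%R, +oo[) (phi s)%:E)%E = Lam%:E)
  (Lam_lt1 : Lam < 1) (hm : mean_field_limit h phi m).

Local Notation f := (causal phi).
Let mf := measurable_causal phi_meas.
Let f0 := causal_ge0 phi_ge0.
Let fL := integral_causal phi_ge0 phi_meas phi_int.

Let m_ge t : 0 <= t -> mu * t <= m t.
Proof. by apply: (@limit_ge R mu Lam h phi m). Qed.

Let m_conv t : 0 <= t ->
  ((m t)%:E = (mu * t)%:E + \int[leb]_v ((f v)%:E * (extend0 m (t - v))%:E))%E.
Proof. by apply: (@limit_convolution R mu Lam h phi m). Qed.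

Let mP : is_cumulative m. Proof. by apply: (@limit_cumulative R mu h phi m). Qed.
Let m0 : m 0 = 0. Proof. by apply: (@limit0 R h phi m). Qed.

(** The mass of the kernel truncated at lag n. Bounded memory is what lets the lower bound on [m] be
    proved by induction on time. *)
Let Lam_n n := fine (\int[leb]_(v in `]-oo, n%:R]) (f v)%:E)%E.

Let tr (n : nat) : set (measurableTypeR R) := `]-oo, n%:R]%classic.

Let Lam_nE n : ((Lam_n n)%:E = \int[leb]_(v in tr n) (f v)%:E)%E.
Proof.
rewrite /Lam_n fineK// ge0_fin_numE; last by apply: integral_ge0 => v _; rewrite lee_fin.
apply: (@le_lt_trans _ _ Lam%:E); last by rewrite ltry.
rewrite -fL; apply: ge0_subset_integral => //; [exact/measurable_EFinP|by move=> v _; rewrite lee_fin].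
Qed.

Let Lam_n_ge0 n : 0 <= Lam_n n.
Proof. by rewrite -lee_fin Lam_nE; apply: integral_ge0 => v _; rewrite lee_fin. Qed.

Let Lam_n_le n : Lam_n n <= Lam.
Proof.
rewrite -lee_fin Lam_nE -fL; apply: ge0_subset_integral => //.
- exact: measurable_itv.
- exact/measurable_EFinP.
- by move=> v _; rewrite lee_fin.
Qed.

Let Lam_n_cvg : Lam_n n @[n --> \oo] --> Lam.
Proof.
apply/fine_cvg; rewrite -fL.
have E n : (\int[leb]_(v in `]-oo, n%:R]) (f v)%:E = \int[leb]_v (\1_(tr n) v * f v)%:E)%E.
  rewrite integral_mkcond; apply: eq_integral => v _.
  by rewrite /patch indicE; case: ifPn => _; rewrite ?mul1r ?mul0r.
under eq_fun do rewrite E.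
apply: monotone_integral_cvg.
- move=> n; apply/measurable_EFinP; apply: measurable_funM => //.
  by apply: measurable_indic; exact: measurable_itv.
- by move=> n v; rewrite lee_fin mulr_ge0// indicE.
- move=> v n k nk; rewrite lee_fin ler_wpM2r// !indicE ler_nat.
  case: (boolP (v \in tr n)) => //; rewrite inE /tr/= in_itv/= => vn.
  by rewrite mem_set//= in_itv/= (le_trans vn)// ler_nat.
- move=> v; apply/cvg_EFin; first exact: nearW.
  apply: cvg_near_cst; exists (Num.trunc `|v|).+1 => // n /= vn.
  rewrite indicE mem_set ?mul1r// /tr/= in_itv/= (le_trans (ler_norm v))//.
  by rewrite (le_trans (ltW (truncnS_gt _)))// ler_nat.
Qed.

Let extend0m x : 0 <= x -> extend0 m x = m x.
Proof. by move=> x0; rewrite /extend0 (max_idPr x0). Qed.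

(** Lags above n are dropped, and at the others m (x - v) is at least m (x - n). *)
Let step n x : 0 <= x -> mu * x + Lam_n n * extend0 m (x - n%:R) <= m x.
Proof.
move=> x0; rewrite -lee_fin m_conv// EFinD leeD2l// EFinM Lam_nE muleC.
have e0 v : 0 <= extend0 m v by exact: (extend0_ge0 _ mP m0).
rewrite -ge0_integralZl; [|exact: measurable_itv|apply: measurable_funTS; exact/measurable_EFinP
  |by move=> v _; rewrite lee_fin|by rewrite lee_fin].
rewrite integral_mkcond; apply: ge0_le_integral_any => v _; rewrite /patch; case: ifPn => //.
- by move=> _; rewrite mule_ge0// lee_fin.
- rewrite inE /tr/= in_itv/= => vn; rewrite muleC -!EFinM lee_fin ler_wpM2l//.
  by apply: mP.1; lra.
- by move=> _; rewrite mule_ge0// lee_fin.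
Qed.

(** A line of slope mu / (1 - Lam_n), lowered by a constant, is a subsolution of the truncated
    equation: the bound at x - n gives the bound at x. The induction advances by blocks of length n,
    hence n > 0; at negative times the line is below 0. *)
Let lower n : (0 < n)%N -> exists2 C, 0 <= C &
  forall x, 0 <= x -> mu / (1 - Lam_n n) * x - C <= m x.
Proof.
move=> n0; set q := Lam_n n; set an := mu / (1 - q).
have q1 : 0 < 1 - q by rewrite subr_gt0 (le_lt_trans (Lam_n_le n)).
have q0 : 0 <= q by exact: Lam_n_ge0.
have an0 : 0 <= an by rewrite divr_ge0// ltW.
have nR : 0 < n%:R :> R by rewrite ltr0n.
(* Chosen so that C (1 - q) = q an n, the cost of the delay n; the lowered line then reproduces
   itself exactly in [step]. *)
pose C := q * an * n%:R / (1 - q).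
have C0 : 0 <= C by rewrite /C divr_ge0 ?(ltW q1)// mulr_ge0 ?(ltW nR)// mulr_ge0.
exists C => //.
have CE : C * (1 - q) = q * an * n%:R by rewrite /C divfK// gt_eqF.
have anE : an * (1 - q) = mu by rewrite /an divfK// gt_eqF.
have H k : forall x, x < k%:R * n%:R -> an * x - C <= extend0 m x.
  elim: k => [|k IH] x xk.
    have x0 : x < 0 by rewrite mul0r in xk.
    rewrite /extend0 (max_idPl (ltW x0)) m0.
    have : an * x <= 0 by rewrite mulr_ge0_le0// ltW.
    lra.
  have [x0|x0] := leP 0 x; last first.
    rewrite /extend0 (max_idPl (ltW x0)) m0.
    have : an * x <= 0 by rewrite mulr_ge0_le0// ltW.
    lra.
  have xn : x - n%:R < k%:R * n%:R by rewrite -natr1 mulrDl mul1r in xk; lra.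
  rewrite extend0m//; apply: le_trans (step n x0); rewrite -/q.
  have := ler_wpM2l q0 (IH _ xn).
  have -> : mu * x = an * (1 - q) * x by rewrite anE.
  have : C * (1 - q) = q * an * n%:R by [].
  move=> e h2; have : q * (an * (x - n%:R) - C) = q * an * x - (q * an * n%:R) - q * C by ring.
  by rewrite -e => e2; rewrite e2 in h2; lra.
move=> x x0; rewrite -(extend0m x0); apply: (H (Num.trunc x).+1).
apply: (lt_le_trans (truncnS_gt x)).
by rewrite ler_peMr// ler1n.
Qed.

(** The upper bound is [limit_le]. For the lower one the truncated slopes tend to a0: half of the
    error e pays for the slope and half for the constant [C]. *)
Lemma limit_equivalent : m t / (mu / (1 - Lam) * t) @[t --> +oo] --> (1 : R).
Proof.
have L1' : 0 < 1 - Lam by rewrite subr_gt0.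
set a0 := mu / (1 - Lam); have a00 : 0 < a0 by rewrite divr_gt0.
apply/cvgrPdist_le => e e0.
have e2 : 0 < e / 2 * (1 - Lam) by rewrite mulr_gt0// divr_gt0.
have [n0 _ Hn] : \forall n \near \oo, Lam - e / 2 * (1 - Lam) < Lam_n n.
  by apply: (cvgr_gt Lam Lam_n_cvg); rewrite gtrBl.
pose n := n0.+1; have qn := Hn n (leqnSn n0).
have [C C0 HC] := @lower n isT.
set q := Lam_n n in qn HC.
have q1 : 0 < 1 - q by rewrite subr_gt0 (le_lt_trans (Lam_n_le n)).
near=> t.
have t0 : 0 < t by near: t; exact: nbhs_pinfty_gt.
have tC : 2 * C / (a0 * e) < t by near: t; apply: nbhs_pinfty_gt; exact: num_real.
have at0 : 0 < a0 * t by rewrite mulr_gt0.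
have up : m t <= a0 * t.
  by apply: (@limit_le R mu Lam h phi m) => //; exact: ltW.
have r1 : m t / (a0 * t) <= 1 by rewrite ler_pdivrMr// mul1r.
rewrite ger0_norm ?subr_ge0// lerBlDl -lerBlDr ler_pdivlMr//.
apply: le_trans (HC t (ltW t0)).
have Ce : C <= e / 2 * (a0 * t).
  have ae0 : 0 < a0 * e by exact: mulr_gt0.
  rewrite ltr_pdivrMr// in tC.
  have -> : e / 2 * (a0 * t) = t * (a0 * e) / 2 by field.
  by rewrite ler_pdivlMr// [C * 2]mulrC ltW.
(* As a0 (1 - q) = mu + a0 (Lam - q) is at most (1 + e / 2) mu, this reduces to (1 - e / 2) (1 + e /
   2) <= 1. *)
have : (1 - e / 2) * a0 <= mu / (1 - q).
  rewrite ler_pdivlMr//.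
  have qL := Lam_n_le n; rewrite -/q in qL.
  have aE : a0 * (1 - Lam) = mu by rewrite /a0 divfK// gt_eqF.
  have aD : a0 * (Lam - q) <= e / 2 * mu.
    rewrite -aE mulrCA ler_pM2l//; lra.
  have E : (1 - e / 2) * a0 * (1 - q) = (1 - e / 2) * (mu + a0 * (Lam - q)).
    by rewrite -aE; ring.
  rewrite E; have [x0|x0] := leP (1 - e / 2) 0.
    apply: (@le_trans _ _ 0); last exact: ltW.
    by apply: mulr_le0_ge0 => //; rewrite addr_ge0 ?(ltW hmu)// mulr_ge0 ?subr_ge0// ltW.
  apply: (@le_trans _ _ ((1 - e / 2) * (mu + e / 2 * mu))).
    by rewrite ler_pM2l// lerD2l.
  have : 0 <= (e / 2) ^+ 2 * mu by rewrite mulr_ge0 ?sqr_ge0 ?(ltW hmu).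
  lra.
move=> h1; have := ler_wpM2r (ltW t0) h1; lra.
Unshelve. all: by end_near.
Qed.

End linear_growth.

(** * Central limit theorem for Poisson laws *)

Section exponential_bounds.
Context {R : realType}.

(** Apply 1 + y <= exp y to y = 2 u^2 - u: the product (1 + u) (1 + y) = 1 + u^2 (1 + 2 u) is at
    least 1 when u >= - 1/2. *)
Lemma expR_le1D (u : R) : - 2^-1 <= u -> expR (u - 2 * u ^+ 2) <= 1 + u.
Proof.
move=> u2; rewrite -(opprK (u - _)) opprB expRN.
have q0 : 0 < 1 + (2 * u ^+ 2 - u) by nra.
have u1 : 0 < 1 + u by lra.
apply: (@le_trans _ _ (1 + (2 * u ^+ 2 - u))^-1).
  by rewrite lef_pV2 ?posrE ?expR_gt0// expR_ge1Dx.
rewrite -[X in X <= _]mul1r ler_pdivrMr//.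
have : 0 <= u ^+ 2 * (1 + 2 * u) by rewrite mulr_ge0 ?sqr_ge0//; lra.
nra.
Qed.

End exponential_bounds.

Section gaussian_cdf.
Context {R : realType}.
Local Notation leb := (@lebesgue_measure R).
Local Notation gauss := (@normal_prob R 0 1).
Local Notation peak := (@normal_peak R 1).

Definition gauss_cdf (x : R) : R := fine (gauss `]-oo, x]%classic).
Local Notation Phi := gauss_cdf.

Lemma gauss_pdfE (y : R) : normal_pdf 0 1 y = peak * expR (- (y ^+ 2 / 2)).
Proof.
rewrite normal_pdfE ?oner_eq0//= /normal_fun subr0 expr1n.
by congr (_ * expR _); rewrite mulNr.
Qed.

Lemma gauss_itv (x y : R) : x <= y -> gauss `]x, y]%classic = (Phi y - Phi x)%:E.
Proof.
move=> xy; have mI (b : itv_bound R) z : measurable [set` Interval b (BRight z)].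
  exact: measurable_itv.
have fin (A : set R) : measurable A -> gauss A \is a fin_num.
  by move=> mA; exact: fin_num_measure.
have U : gauss `]-oo, y]%classic = (gauss `]-oo, x]%classic + gauss `]x, y]%classic)%E.
  have -> : `]-oo, y]%classic = `]-oo, x]%classic `|` `]x, y]%classic :> set R.
    by rewrite -itv_bndbnd_setU// bnd_simp.
  apply: (@measureU _ _ _ gauss); try exact: mI.
  apply/seteqP; split => z //=; rewrite !in_itv/= => -[zx /andP[xz _]].
  by move: (le_lt_trans zx xz); rewrite ltxx.
rewrite /gauss_cdf U fineD ?fin//; try exact: mI.
by rewrite addrAC subrr add0r fineK// fin//; exact: mI.
Qed.

Lemma gauss_cdf_le (x y : R) : x <= y -> Phi x <= Phi y.
Proof.
by move=> xy; rewrite -subr_ge0 -lee_fin -gauss_itv.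
Qed.

Lemma gauss_cdf_ge0 x : 0 <= Phi x. Proof. by rewrite fine_ge0. Qed.

Lemma gauss_cdf_le1 x : Phi x <= 1.
Proof.
have mI : measurable (`]-oo, x]%classic : set R) by exact: measurable_itv.
rewrite -lee_fin /gauss_cdf fineK ?probability_le1//.
exact: (fin_num_measure gauss).
Qed.

Lemma gauss_cdf_bounds (x y c1 c2 : R) : x <= y -> 0 <= c1 ->
  (forall z, x <= z <= y -> c1 <= normal_pdf 0 1 z <= c2) ->
  c1 * (y - x) <= Phi y - Phi x <= c2 * (y - x).
Proof.
move=> xy c10 H.
have xyI z : `]x, y]%classic z -> x <= z <= y by rewrite /= in_itv/= => /andP[/ltW -> ->].
have mI : measurable (`]x, y]%classic : set (measurableTypeR R)) by exact: measurable_itv.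
have mp : measurable_fun (`]x, y]%classic : set (measurableTypeR R)) (fun z => (normal_pdf 0 1 z)%:E).
  by apply/measurable_EFinP; apply: measurable_funTS; exact: measurable_normal_pdf.
have le : leb `]x, y]%classic = (y - x)%:E.
  rewrite lebesgue_measure_itv/= lte_fin; case: ltP => [_|yx]; first by rewrite EFinB.
  have /eqP -> : y == x by rewrite eq_le yx xy.
  by rewrite subrr.
have cst c : (\int[leb]_(z in `]x, y]) c%:E = (c * (y - x))%:E)%E.
  by rewrite integral_cst// [X in (_ * X)%E](_ : _ = leb `]x, y]%classic)// le -EFinM.
rewrite -!lee_fin -gauss_itv// /normal_prob -!cst; apply/andP; split.
  apply: ge0_le_integral => //.
  by move=> z /xyI /H /andP[+ _]; rewrite lee_fin.
apply: ge0_le_integral => //.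
- by move=> z _; rewrite lee_fin normal_pdf_ge0.
- by move=> z /xyI /H /andP[_ +]; rewrite lee_fin.
Qed.

Lemma gauss_cdf_lip (x y : R) : x <= y -> Phi y - Phi x <= peak * (y - x).
Proof.
move=> xy; have h (z : R) : x <= z <= y -> 0 <= normal_pdf 0 1 z <= peak.
  by move=> _; rewrite normal_pdf_ge0 normal_pdf_ub ?oner_eq0.
by have /andP[] := gauss_cdf_bounds xy (lexx 0) h.
Qed.

(** The window is []1 - A, A]] rather than []- A, A]], because rounding - A up to the lattice may
    move it to the right by as much as 1. *)
Lemma gauss_cdf_tail (e : R) : 0 < e -> exists2 A0 : R, 0 < A0 & forall A, A0 <= A ->
  1 - e <= Phi A - Phi (1 - A).
Proof.
move=> e0.
pose F n := `](- n%:R : R), n%:R]%classic : set (measurableTypeR R).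
have mF n : measurable (F n) by exact: measurable_itv.
have FU : \bigcup_n F n = setT.
  apply/seteqP; split => // x _; exists (Num.trunc `|x|).+1 => //=.
  rewrite /F/= in_itv/=; have := truncnS_gt `|x|.
  by rewrite ltr_norml => /andP[-> /ltW].
have cv : gauss (F n) @[n --> \oo] --> gauss setT.
  rewrite -FU; apply: (@nondecreasing_cvg_mu _ _ _ gauss) => //.
    exact: bigcup_measurable.
  move=> k l kl; apply/subsetPset => x; rewrite /F/= !in_itv/= => /andP[h1 h2].
  by rewrite (le_trans h2) ?ler_nat// (le_lt_trans _ h1)// lerN2 ler_nat.
rewrite probability_setT in cv.
have c2 : fine (gauss (F n)) @[n --> \oo] --> (1 : R) by exact: fine_cvg cv.
have [n _ /(_ n (leqnn n))] : \forall n \near \oo, 1 - e < fine (gauss (F n)).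
  by apply: (cvgr_gt 1 c2); rewrite gtrBl.
have n0 : - n%:R <= n%:R :> R by rewrite (@le_trans _ _ 0)// oppr_le0.
rewrite /= /F (gauss_itv n0) => ne.
exists (n%:R + 1); first by rewrite ltr_wpDl.
move=> A nA; apply: (le_trans (ltW ne)); apply: lerB; apply: gauss_cdf_le; lra.
Qed.

End gaussian_cdf.

(** * Comparison of Poisson weights with Gaussian increments *)

Section poisson_local_limit.
Context {R : realType}.
Local Notation peak := (@normal_peak R 1).
Local Notation Phi := (@gauss_cdf R).
Variables (a B del : R).
Hypotheses (a0 : 0 < a) (B1 : 1 <= B) (del0 : 0 < del) (del2 : del ^+ 2 = a^-1).

Local Notation p k := (poisson_pmf a k).

Definition standardized (k : nat) : R := (k%:R - a) * del.
Local Notation x := standardized.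

Hypotheses (del1 : del <= 1) (Bdel : B * del <= 2^-1).

Lemma standardizedS k : x k.+1 = x k + del.
Proof. by rewrite /x -natr1; ring. Qed.

Lemma standardizedD k n : x (k + n) = x k + n%:R * del.
Proof. by rewrite /x natrD; ring. Qed.

Lemma standardized_le k l : (k <= l)%N -> x k <= x l.
Proof. by move=> kl; rewrite ler_pM2r// lerB// ler_nat. Qed.

Lemma poisson_pmf_gt0 k : 0 < p k.
Proof. by rewrite /poisson_pmf a0 !mulr_gt0 ?exprn_gt0 ?expR_gt0// ?invr_gt0 ltr0n fact_gt0. Qed.

Lemma poisson_pmf_step k : p k = p k.+1 * (1 + x k.+1 * del).
Proof.
have -> : 1 + x k.+1 * del = k.+1%:R / a.
  rewrite /x -mulrA -expr2 del2; field; exact: lt0r_neq0.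
rewrite /poisson_pmf a0 factS natrM invfM exprS; field.
by rewrite lt0r_neq0//= pnatr_eq0 -lt0n fact_gt0/= addrC natr1 pnatr_eq0.
Qed.

(** The Poisson weight divided by the shape of the Gaussian density. It is nearly constant over a
    window of standardized points, and the constant is never computed. *)
Definition tilted k : R := p k * expR (x k ^+ 2 / 2).
Local Notation b := tilted.

Lemma tilted_gt0 k : 0 < b k.
Proof. by rewrite mulr_gt0 ?expR_gt0// poisson_pmf_gt0. Qed.

Lemma tilted_step k : b k = b k.+1 * ((1 + x k.+1 * del) * expR (- (x k.+1 * del) + del ^+ 2 / 2)).
Proof.
rewrite /b poisson_pmf_step.
have -> : x k = x k.+1 - del by rewrite standardizedS addrK.
have -> : (x k.+1 - del) ^+ 2 / 2 = x k.+1 ^+ 2 / 2 + (- (x k.+1 * del) + del ^+ 2 / 2) by field.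
by rewrite expRD; ring.
Qed.

Let q := expR (2 * (B * del) ^+ 2).

(** With u = x del, the ratio of consecutive values is (1 + u) exp (- u + del^2 / 2), equal to 1 up
    to second order; |u| and del are both at most B del, hence the constant [q]. *)
Lemma tilted_step_bounds k : `|x k.+1| <= B -> b k <= q * b k.+1 /\ b k.+1 <= q * b k.
Proof.
move=> xB; rewrite tilted_step; set u := x k.+1 * del.
have uB : `|u| <= B * del by rewrite normrM (ger0_norm (ltW del0)) ler_pM2r.
have u2 : u ^+ 2 <= (B * del) ^+ 2.
  by rewrite -(real_normK (num_real u)) ler_pXn2r// nnegrE// (le_trans _ uB).
have dB : del ^+ 2 <= (B * del) ^+ 2.
  have d1 : del <= B * del by rewrite ler_peMl// ltW.
  by rewrite ler_pXn2r// nnegrE ?(ltW del0)// (le_trans (ltW del0)).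
have d2 : 0 <= del ^+ 2 by exact: sqr_ge0.
have uh : - 2^-1 <= u.
  by move: uB; rewrite ler_norml => /andP[+ _]; apply: le_trans; rewrite lerN2.
split.
  rewrite mulrC ler_pM2r ?tilted_gt0// expRD mulrA.
  have h1 : (1 + u) * expR (- u) <= 1 by rewrite expRN ler_pdivrMr ?expR_gt0// mul1r expR_ge1Dx.
  apply: (le_trans (ler_wpM2r (expR_ge0 _) h1)); rewrite mul1r ler_expR; lra.
rewrite mulrCA -[X in X <= _]mulr1 ler_pM2l ?tilted_gt0//.
have h2 := expR_le1D uh.
apply: (@le_trans _ _ (q * (expR (u - 2 * u ^+ 2) * expR (- u + del ^+ 2 / 2)))).
  by rewrite /q -!expRD -[X in X <= _]expR0 ler_expR; lra.
by rewrite ler_pM2l ?expR_gt0// ler_wpM2r// expR_ge0.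
Qed.

Lemma tilted_iter k n : `|x k| <= B -> `|x (k + n)| <= B ->
  b k <= q ^+ n * b (k + n)%N /\ b (k + n)%N <= q ^+ n * b k.
Proof.
have q0 : 0 < q := expR_gt0 _.
elim: n => [|n IH] xk xkn; first by rewrite addn0 expr0 !mul1r.
have xn : `|x (k + n)| <= B.
  move: xk xkn; rewrite !ler_norml => /andP[k1 _] /andP[_ k2].
  rewrite (le_trans k1) ?standardized_le ?leq_addr//=.
  by rewrite (le_trans _ k2)// standardized_le// leq_add2l.
have [h1 h2] := IH xk xn; rewrite addnS in xkn *.
have [s1 s2] := tilted_step_bounds xkn; split.
  by rewrite exprSr -mulrA (le_trans h1)// ler_pM2l ?exprn_gt0.
by rewrite exprS -mulrA (le_trans s2)// ler_pM2l.
Qed.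

(** A window of width 2 B contains at most 2 B / del steps, and [q] to that power is exp (4 B^3
    del). *)
Let Q := expR (4 * B ^+ 3 * del).

Lemma tilted_window k l : `|x k| <= B -> `|x l| <= B -> b k <= Q * b l.
Proof.
move=> xk xl; have q1 : 1 <= q by rewrite -expR0 ler_expR mulr_ge0// sqr_ge0.
have key n : n%:R * del <= 2 * B -> q ^+ n <= Q.
  move=> nB; rewrite -expRM_natl ler_expR.
  have -> : 4 * B ^+ 3 * del = (2 * B) * (2 * B ^+ 2 * del) by ring.
  have -> : n%:R * (2 * (B * del) ^+ 2) = (n%:R * del) * (2 * B ^+ 2 * del) by ring.
  have h : 0 <= 2 * B ^+ 2 * del.
    by apply: mulr_ge0; [apply: mulr_ge0 => //; exact: sqr_ge0|exact: ltW].
  by rewrite (ler_wpM2r h).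
move: (xk) (xl); rewrite !ler_norml => /andP[k1 k2] /andP[l1 l2].
have [kl|/ltnW lk] := leqP k l.
  move: xl; rewrite -(subnKC kl) => xl.
  have [h _] := tilted_iter xk xl; apply: (le_trans h).
  rewrite ler_pM2r ?tilted_gt0// key//.
  by have := standardizedD k (l - k); rewrite subnKC// => e; lra.
move: xk; rewrite -(subnKC lk) => xk.
have [_ h] := tilted_iter xl xk; apply: (le_trans h).
rewrite ler_pM2r ?tilted_gt0// key//.
by have := standardizedD l (k - l); rewrite subnKC// => e; lra.
Qed.

(** Over one cell z^2 / 2 moves by at most (B + 1) del, so this factor controls the oscillation of
    the Gaussian density. *)
Let E := expR ((B + 1) * del).

Lemma gauss_cell k : `|x k| <= B ->
  p k * (peak * del) <= b k * E * (Phi (x k.+1) - Phi (x k)) /\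
  b k * (Phi (x k.+1) - Phi (x k)) <= E * (p k * (peak * del)).
Proof.
move=> xB; have pk0 : 0 < peak by rewrite normal_peak_gt0// oner_eq0.
pose g := peak * expR (- (x k ^+ 2 / 2)).
have g0 : 0 < g by rewrite mulr_gt0 ?expR_gt0.
have pE : p k * peak = b k * g.
  by rewrite /b /g mulrACA -expRD subrr expR0 mulr1.
have sq z : x k <= z <= x k.+1 -> `|z ^+ 2 / 2 - x k ^+ 2 / 2| <= (B + 1) * del.
  rewrite standardizedS => /andP[z1 z2].
  have -> : z ^+ 2 / 2 - x k ^+ 2 / 2 = (z - x k) * ((z + x k) / 2) by field.
  rewrite normrM mulrC; apply: ler_pM => //.
    by move: xB del1; rewrite !ler_norml => /andP[b1 b2] d1; apply/andP; split; lra.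
  by rewrite ger0_norm ?subr_ge0// lerBlDl.
have xx : x k <= x k.+1 by rewrite standardized_le.
have E0 : 0 < E := expR_gt0 _.
have /andP[lo hi] : g / E * (x k.+1 - x k) <= Phi (x k.+1) - Phi (x k) <=
    g * E * (x k.+1 - x k).
  apply: gauss_cdf_bounds => //; first by rewrite divr_ge0// ltW.
  move=> z /sq; rewrite ler_norml => /andP[s1 s2]; rewrite gauss_pdfE /g -!mulrA.
  rewrite /E -expRN !ler_pM2l// -!expRD !ler_expR.
  by rewrite /standardized in s1 s2 *; apply/andP; split; lra.
have dE : x k.+1 - x k = del by rewrite standardizedS addrAC subrr add0r.
rewrite dE in lo hi; clearbody g.
have lo' : g * del <= E * (Phi (x k.+1) - Phi (x k)).
  by rewrite -ler_pdivrMl// mulrA [E^-1 * g]mulrC.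
have pg : p k * (peak * del) = b k * (g * del) by rewrite mulrA pE -mulrA.
rewrite pg; split.
  by rewrite -[b k * E * _]mulrA ler_pM2l ?tilted_gt0.
rewrite mulrCA ler_pM2l ?tilted_gt0//.
by have -> : E * (g * del) = g * E * del by ring.
Qed.

Let K := Q * E.

(** All the values [b k] are exchanged for a single reference [b r] at the cost of [Q]. Poisson and
    Gaussian masses are thus proportional up to the factor [K], with a ratio [beta] common to all
    windows within [[- B, B]]. *)
Lemma poisson_window k1 k2 : (k1 <= k2)%N -> `|x k1| <= B -> `|x k2| <= B ->
  forall r : nat, `|x r| <= B ->
  let beta := b r / (peak * del) in
  \sum_(k1 <= k < k2) p k <= beta * K * (Phi (x k2) - Phi (x k1)) /\
  beta * (Phi (x k2) - Phi (x k1)) <= K * \sum_(k1 <= k < k2) p k.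
Proof.
move=> k12 x1 x2 r xr beta.
have pd0 : 0 < peak * del by rewrite mulr_gt0// normal_peak_gt0// oner_eq0.
have bE : beta * (peak * del) = b r by rewrite /beta divfK// lt0r_neq0.
have tel : Phi (x k2) - Phi (x k1) = \sum_(k1 <= k < k2) (Phi (x k.+1) - Phi (x k)).
  by rewrite telescope_sumr.
have win k : (k1 <= k < k2)%N -> `|x k| <= B.
  move=> /andP[h1 h2]; move: x1 x2; rewrite !ler_norml => /andP[l1 _] /andP[_ l2].
  by rewrite (le_trans l1) ?(le_trans _ l2) ?standardized_le// ltnW.
have Pge k : 0 <= Phi (x k.+1) - Phi (x k) by rewrite subr_ge0 gauss_cdf_le// standardized_le.
have E0 : 0 < E := expR_gt0 _.
have Q0 : 0 < Q := expR_gt0 _.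
rewrite tel; split; rewrite !mulr_sumr; apply: ler_sum_nat => k kk.
  have [h _] := gauss_cell (win k kk).
  rewrite -(ler_pM2r pd0) (le_trans h)//.
  have -> : beta * K * (Phi (x k.+1) - Phi (x k)) * (peak * del) =
      Q * b r * E * (Phi (x k.+1) - Phi (x k)).
    by rewrite -bE /K; ring.
  by rewrite ler_wpM2r// ler_pM2r// tilted_window// win.
have [_ h] := gauss_cell (win k kk).
rewrite -(ler_pM2r pd0).
have -> : beta * (Phi (x k.+1) - Phi (x k)) * (peak * del) = b r * (Phi (x k.+1) - Phi (x k)).
  by rewrite -bE; ring.
apply: (@le_trans _ _ (Q * b k * (Phi (x k.+1) - Phi (x k)))).
  by rewrite ler_wpM2r// tilted_window// win.
by have := ler_wpM2l (ltW Q0) h; rewrite /K !mulrA.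
Qed.

End poisson_local_limit.

Section poisson_probability.
Context {R : realType}.
Local Notation Phi := (@gauss_cdf R).
Variable a : R.
Hypothesis a0 : 0 < a.

Let law : probability nat R := poisson_prob a 0%N.
Let del := (Num.sqrt a)^-1.
Local Notation x := (standardized a del).

Let del0 : 0 < del. Proof. by rewrite invr_gt0 sqrtr_gt0. Qed.

Let del2 : del ^+ 2 = a^-1. Proof. by rewrite exprVn sqr_sqrtr// ltW. Qed.

Lemma poisson_interval (k1 k2 : nat) : (k1 <= k2)%N ->
  law [set k | (k1 <= k < k2)%N] = (\sum_(k1 <= k < k2) poisson_pmf a k)%:E.
Proof.
move=> k12; rewrite -(subnKC k12); elim: (k2 - k1)%N => [|n IH].
  rewrite addn0 big_geq// (_ : mkset _ = set0) ?measure0//.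
  by apply/seteqP; split => // k /= /andP[h1 h2]; move: (leq_ltn_trans h1 h2); rewrite ltnn.
rewrite addnS big_nat_recr ?leq_addr//= EFinD -IH -(poisson_prob_pmf _ a0).
rewrite (_ : mkset _ = [set k | (k1 <= k < k1 + n)%N] `|` [set (k1 + n)%N]).
  apply: (@measureU _ _ _ law) => //.
  by apply/seteqP; split => // k [/= /andP[_ h] e]; move: h; rewrite e ltnn.
apply/seteqP; split => k /=.
  by rewrite ltnS [(k <= _)%N]leq_eqVlt => /andP[-> /predU1P[->|->]]; [right|left].
by move=> [/andP[-> /ltnW]|->]; rewrite ltnS// leq_addr leqnn.
Qed.

(** When a + v / del >= 0, the least integer whose standardized value exceeds v. *)
Definition first_above (v : R) : nat := (Num.trunc (a + v / del)).+1.

Lemma first_aboveP v k : 0 <= a + v / del -> (k < first_above v)%N = (x k <= v).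
Proof.
move=> v0; rewrite ltnS truncn_ge_nat// /standardized -lerBlDl.
by rewrite -ler_pdivlMr.
Qed.

Lemma first_above_bounds v : 0 <= a + v / del ->
  v < x (first_above v) /\ x (first_above v) <= v + del.
Proof.
move=> v0; split; first by rewrite ltNge -first_aboveP// ltnn.
rewrite /first_above standardizedS lerD2r -first_aboveP//.
Qed.

Lemma first_above_le u v : u <= v -> (first_above u <= first_above v)%N.
Proof.
move=> uv; rewrite /first_above ltnS; apply: le_truncn.
by rewrite lerD2l ler_pM2r// invr_gt0.
Qed.

Lemma poisson_standardized_itv c e : c <= e -> 0 <= a + c / del ->
  fine (law [set k | c < x k <= e]) =
  \sum_(first_above c <= k < first_above e) poisson_pmf a k.
Proof.
move=> ce c0; have e0 : 0 <= a + e / del.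
  by rewrite (le_trans c0)// lerD2l ler_pM2r// invr_gt0.
rewrite (_ : mkset _ = [set k | (first_above c <= k < first_above e)%N]).
  by rewrite poisson_interval// first_above_le.
by apply/seteqP; split => k /=; rewrite first_aboveP// leqNgt first_aboveP// -ltNge.
Qed.

Let L2_id : L2 law (fun k => k%:R) /\
  Ex law (fun k => k%:R) = a /\ Ex law (fun k => k%:R ^+ 2) = a + a ^+ 2.
Proof.
have mn : measurable_fun setT (fun k : nat => k%:R : R) by [].
have pw k : law [set j : nat | (j%:R : R)%:E = k%:R%:E] = poisson_prob a 0%N [set k].
  congr (law _); apply/seteqP; split => j /=; last by move=> ->.
  by move=> -[] /eqP; rewrite eqr_nat => /eqP.
have mE : measurable_fun setT (fun k : nat => (k%:R : R)%:E) by exact/measurable_EFinP.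
have m1 : (\int[law]_k (k%:R)%:E = a%:E)%E.
  rewrite (@integral_poisson _ _ _ law a (fun k => (k%:R)%:E) id)//; first exact: poisson_mean (ltW a0).
  exact: ltW.
have m2 : (\int[law]_k (k%:R ^+ 2)%:E = (a + a ^+ 2)%:E)%E.
  under eq_integral do rewrite expr2 EFinM.
  rewrite (@integral_poisson _ _ _ law a (fun k => (k%:R)%:E) (fun z => z * z)%E)//.
  - by rewrite (poisson_second_moment (ltW a0)) expr2.
  - exact: ltW.
  - exact: emeasurable_funM.
  - by move=> z z0; exact: mule_ge0.
have i1 : L1 law (fun k => k%:R).
  apply/integrableP; split => //; under eq_integral do rewrite /= ger0_norm//.
  by rewrite m1 ltry.
have i2 : L1 law (fun k => k%:R ^+ 2).
  apply/integrableP; split => //; under eq_integral do rewrite /= ger0_norm ?sqr_ge0//.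
  by rewrite m2 ltry.
split; [by split|split; apply: EFin_inj].
  by rewrite (ExE i1).
by rewrite (ExE i2).
Qed.

(** The indicator of the window is at least 1 - x^2 / A^2, and x^2 has mean 1. *)
Lemma poisson_chebyshev (A : R) : 0 < A ->
  1 - A ^- 2 <= fine (law [set k | - A < x k <= A]).
Proof.
move=> A0; have [l2 [e1 e2]] := L2_id; have i1 := L2_L1 l2; have [_ i2] := l2.
pose S := [set k | - A < x k <= A].
have mS : measurable S by [].
have vx : Ex law (fun k => x k ^+ 2) = 1.
  rewrite (@eq_Ex _ _ _ law _ (fun k => del ^+ 2 * k%:R ^+ 2 +
      (- (2 * a * del ^+ 2) * k%:R + (a * del) ^+ 2))); last first.
    by move=> k; rewrite /standardized; ring.
  have j1 : L1 law (fun k => - (2 * a * del ^+ 2) * k%:R) by exact: L1Zl.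
  rewrite ExD; [|exact: L1Zl|by apply: L1D => //; exact: L1_cst].
  rewrite ExD//; last exact: L1_cst.
  rewrite (ExZl _ i1) (ExZl _ i2) Ex_cst exprMn del2.
  rewrite [X in _ * X + _](_ : _ = a + a ^+ 2)// [X in _ + (_ * X + _)](_ : _ = a)//.
  by field; exact: lt0r_neq0.
have ix : L1 law (fun k => x k ^+ 2).
  rewrite (_ : (fun k => _) = (fun k => del ^+ 2 * k%:R ^+ 2 +
      (- (2 * a * del ^+ 2) * k%:R + (a * del) ^+ 2))); last first.
    by apply/funext => k; rewrite /standardized; ring.
  by apply: L1D; [exact: L1Zl|apply: L1D; [exact: L1Zl|exact: L1_cst]].
have iS : L1 law (\1_S : nat -> R).
  apply: (L1_le _ _ (L1_cst law 1)) => [|n]; first exact: measurable_indic.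
  by rewrite indicE ger0_norm// lern1 leq_b1.
have il : L1 law (fun k => 1 - A ^- 2 * x k ^+ 2).
  by apply: L1B; [exact: L1_cst|exact: L1Zl].
rewrite -(Ex_indic law mS).
have -> : 1 - A ^- 2 = Ex law (fun k => 1 - A ^- 2 * x k ^+ 2).
  by rewrite ExB; [|exact: L1_cst|exact: L1Zl]; rewrite Ex_cst ExZl// vx mulr1.
apply: le_Ex => // n; rewrite indicE.
have A2 : 0 < A ^+ 2 by rewrite exprn_gt0.
have [nS|nS] := boolP (n \in S).
  by rewrite gerBl mulr_ge0 ?sqr_ge0// invr_ge0 sqr_ge0.
rewrite subr_le0 ler_pdivlMl// mulr1.
move: nS; rewrite notin_setE /S/= => /negP; rewrite negb_and -leNgt -ltNge => /orP[xA|xA].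
  have Ax : A <= - x n by rewrite lerNr.
  by rewrite -(sqrrN (x n)) ler_pXn2r// nnegrE ?(ltW A0)// (le_trans (ltW A0)).
by rewrite ler_pXn2r ?(ltW xA)// nnegrE ?(ltW A0)// (le_trans (ltW A0))// ltW.
Qed.

End poisson_probability.

(** [b] is the unknown proportionality factor. The large window, of masses [SA] and [GA] both within
    n of 1, forces it to be close to 1, and then the masses [S] and [G] of any other window are
    close. *)
Lemma ratio_squeeze {R : realType} (n S SA G GA b K : R) : 0 < n -> n <= 2^-1 -> 0 <= b ->
  1 <= K -> K * K <= 1 + n -> S <= b * K * G -> b * G <= K * S ->
  SA <= b * K * GA -> b * GA <= K * SA -> 1 - n <= GA -> GA <= 1 -> 1 - n <= SA -> SA <= 1 ->
  0 <= G -> G <= 1 -> 0 <= S -> S <= 1 -> `|S - G| <= 2 * n.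
Proof.
move=> n0 n2 beta0 K1 K2 V1 V2 W1 W2 GA0 GA1 SAn SA1 G0 G1 S0 S1.
have K0 : 0 < K := lt_le_trans ltr01 K1.
have n1 : 0 <= 1 - n by lra.
have n1' : 0 <= 1 + n by lra.
have b1 : b * (1 - n) <= K.
  apply: (le_trans (ler_wpM2l beta0 GA0)); apply: (le_trans W2).
  by rewrite ler_piMr// ltW.
have b2 : b * K * (1 - n) <= 1 + n.
  by apply: le_trans K2; rewrite mulrAC ler_pM2r.
have bK0 : 0 <= b * K by rewrite mulr_ge0// ltW.
have b3 : 1 - n <= b * K.
  apply: (le_trans SAn); apply: (le_trans W1).
  by rewrite ler_piMr.
have u1 : S * (1 - n) <= (1 + n) * G.
  apply: (le_trans (ler_wpM2r n1 V1)); rewrite mulrAC.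
  by rewrite ler_wpM2r.
have u2 : (1 - n) * G <= (1 + n) * S.
  apply: (@le_trans _ _ (b * K * G)); first by rewrite ler_wpM2r.
  rewrite mulrAC mulrC; apply: (@le_trans _ _ (K * (K * S))); first by rewrite ler_pM2l.
  by rewrite mulrA ler_wpM2r.
have nS : n * S <= n by rewrite ler_piMr// ltW.
have nG : n * G <= n by rewrite ler_piMr// ltW.
by rewrite ler_norml; apply/andP; split; lra.
Qed.

Lemma squeeze_shift {R : realType} (S p1 p2 pc pe n : R) : 0 <= p1 - pc <= n ->
  0 <= p2 - pe <= n -> `|S - (p2 - p1)| <= 2 * n -> `|S - (pe - pc)| <= 3 * n.
Proof.
move=> /andP[lc1 lc2] /andP[le1 le2]; rewrite !ler_norml => /andP[s1 s2].
by apply/andP; split; lra.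
Qed.

Section poisson_limit.
Context {R : realType}.
Local Notation Phi := (@gauss_cdf R).
Local Notation peak := (@normal_peak R 1).

(** Masses of windows are proportional up to a factor close to 1, and a large window has almost full
    mass on both sides, by Chebyshev's inequality on the Poisson one; this normalises the factor. *)
Lemma poisson_clt (c e eps : R) : c <= e -> 0 < eps ->
  exists2 a1 : R, 0 < a1 & forall a, a1 <= a ->
    `|fine (poisson_prob a 0%N [set k | c < standardized a (Num.sqrt a)^-1 k <= e]) -
      (Phi e - Phi c)| <= eps.
Proof.
move=> ce eps0.
pose n := Num.min 2^-1 (eps / 3).
have n0 : 0 < n by rewrite lt_min invr_gt0 ltr0n divr_gt0.
have n2 : n <= 2^-1 by rewrite ge_min lexx.
have n3 : n <= eps / 3 by rewrite ge_min lexx orbT.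
have [A0 A00 tail] := gauss_cdf_tail n0.
(* Above A0 for the Gaussian tail, above 1 / n for Chebyshev's inequality, and large enough for c
   and e to lie in [[- A, A]]. *)
pose A := A0 + `|c| + `|e| + 1 + n^-1.
have ni : 0 < n^-1 by rewrite invr_gt0.
have c0 := normr_ge0 c; have e0 := normr_ge0 e.
have A1 : 1 <= A by rewrite /A; lra.
have AA0 : A0 <= A by rewrite /A; lra.
have An : n^-1 <= A by rewrite /A; lra.
have cA : - A <= c <= A by rewrite -ler_norml /A; lra.
have eA : - A <= e <= A by rewrite -ler_norml /A; lra.
have A0' : 0 < A := lt_le_trans ltr01 A1.
clearbody A.
(* The lattice point just above some v <= A stays below A + 1, since del <= 1. *)
pose B := A + 1; have B1 : 1 <= B by rewrite /B; lra.
have pk0 : 0 < peak by rewrite normal_peak_gt0// oner_eq0.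
pose C := 4 * B ^+ 3 + (B + 1).
have C0 : 0 < C by rewrite /C addr_gt0// ?mulr_gt0 ?exprn_gt0 ?ltr_wpDl; lra.
have ln0 : 0 < ln (1 + n) by rewrite ln_gt0// ltrDl.
(* In turn: B del <= 1 / 2 for the local comparison; peak del <= n for the effect of rounding on the
   Gaussian distribution function; K^2 = exp (2 C del) <= 1 + n. *)
pose d0 := Num.min (2 * B)^-1 (Num.min (n / peak) (ln (1 + n) / (2 * C))).
have d00 : 0 < d0.
  by rewrite !lt_min invr_gt0 !divr_gt0// ?mulr_gt0//; lra.
exists (d0^-1 ^+ 2); first by rewrite exprn_gt0// invr_gt0.
move=> a aa; set del := (Num.sqrt a)^-1.
have a0 : 0 < a by apply: lt_le_trans aa; rewrite exprn_gt0// invr_gt0.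
have del0 : 0 < del by rewrite invr_gt0 sqrtr_gt0.
have del2 : del ^+ 2 = a^-1 by rewrite exprVn sqr_sqrtr// ltW.
have deld : del <= d0.
  rewrite -(invrK d0) lef_pV2 ?posrE ?invr_gt0 ?sqrtr_gt0//.
  rewrite -(ger0_norm (ltW (_ : 0 < d0^-1))) ?invr_gt0// -sqrtr_sqr; exact: ler_wsqrtr.
have dB : del <= (2 * B)^-1 by rewrite (le_trans deld)// ge_min lexx.
have dp : del <= n / peak by rewrite (le_trans deld)// !ge_min lexx orbT.
have dC : del <= ln (1 + n) / (2 * C) by rewrite (le_trans deld)// !ge_min lexx !orbT.
have B20 : 0 < 2 * B by lra.
have Bdel2 : del * (2 * B) <= 1 by rewrite -ler_pdivlMr// mul1r.
have Bdel : B * del <= 2^-1 by lra.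
have del1 : del <= 1 by nra.
have inv : 2 * B <= del^-1 by rewrite -[2 * B]invrK lef_pV2 ?posrE// invr_gt0.
have aE : a = del^-1 * del^-1.
  by rewrite -expr2 exprVn del2 invrK.
have nonneg v : - A <= v <= A -> 0 <= a + v / del.
  move=> /andP[v1 v2]; rewrite aE -mulrDl mulr_ge0// ?invr_ge0 ?(ltW del0)//.
  by move: inv; rewrite /B; lra.
have fb v (vA : - A <= v <= A) := @first_above_bounds R a a0 v (nonneg v vA).
have Bw v : - A <= v <= A -> `|standardized a del (first_above a v)| <= B.
  move=> vA; have [b1 b2] := fb v vA; move: vA => /andP[v1 v2].
  by rewrite ler_norml /B; apply/andP; split; rewrite /del in del1 *; lra.
have mAA : - A <= - A <= A by lra.
have AAA : - A <= A <= A by lra.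
have PA := poisson_standardized_itv a0 (_ : - A <= A) (nonneg _ mAA).
have {}PA := PA (ltac:(lra) : - A <= A).
have Pc := poisson_standardized_itv a0 ce (nonneg _ cA).
have beta0 : 0 <= tilted a del (first_above a (- A)) / (peak * del).
  by rewrite divr_ge0 ?(ltW (tilted_gt0 _ _ _))// mulr_ge0// ltW.
have := @poisson_window R a B del a0 B1 del0 del2 del1 Bdel _ _
  (first_above_le a0 (ltac:(lra) : - A <= A)) (Bw _ mAA) (Bw _ AAA) _ (Bw _ mAA).
have := @poisson_window R a B del a0 B1 del0 del2 del1 Bdel _ _
  (first_above_le a0 ce) (Bw _ cA) (Bw _ eA) _ (Bw _ mAA).
rewrite /= -PA -Pc -/del.
set beta := _ / (peak * del) in beta0 *.
set K := expR _ * expR _.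
set S := fine _; set SA := fine _.
set x1 := standardized a del (first_above a c); set x2 := standardized a del (first_above a e).
set y1 := standardized a del (first_above a (- A)); set y2 := standardized a del (first_above a A).
move=> [V1 V2] [W1 W2].
have K1 : 1 <= K.
  have B0 : 0 <= B := le_trans ler01 B1.
  have h1 : 0 <= 4 * B ^+ 3 * del.
    exact: (mulr_ge0 (mulr_ge0 (ler0n R 4) (exprn_ge0 3 B0)) (ltW del0)).
  have h2 : 0 <= (B + 1) * del := mulr_ge0 (addr_ge0 B0 ler01) (ltW del0).
  by rewrite /K -expRD -[X in X <= _]expR0 ler_expR addr_ge0.
have K2 : K * K <= 1 + n.
  have n1 : 0 < 1 + n := addr_gt0 ltr01 n0.
  rewrite /K -!expRD -[X in _ <= X]lnK ?posrE// ler_expR.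
  have : del * (2 * C) <= ln (1 + n) by rewrite -ler_pdivlMr// mulr_gt0.
  apply: le_trans; rewrite le_eqVlt; apply/orP; left; apply/eqP; rewrite /C; ring.
have [bc1 bc2] := fb _ cA; have [be1 be2] := fb _ eA.
have [bm1 bm2] := fb _ mAA; have [bA1 bA2] := fb _ AAA.
rewrite -/del -/x1 in bc1 bc2; rewrite -/del -/x2 in be1 be2.
rewrite -/del -/y1 in bm1 bm2; rewrite -/del -/y2 in bA1 bA2.
have pd : peak * del <= n by rewrite mulrC -ler_pdivlMr.
have lipc : 0 <= Phi x1 - Phi c <= n.
  rewrite subr_ge0 gauss_cdf_le ?(ltW bc1)//= (le_trans (gauss_cdf_lip (ltW bc1)))//.
  by apply: le_trans pd; rewrite ler_pM2l// lerBlDl.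
have lipe : 0 <= Phi x2 - Phi e <= n.
  rewrite subr_ge0 gauss_cdf_le ?(ltW be1)//= (le_trans (gauss_cdf_lip (ltW be1)))//.
  by apply: le_trans pd; rewrite ler_pM2l// lerBlDl.
have GA : 1 - n <= Phi y2 - Phi y1.
  apply: (le_trans (tail A AA0)); apply: lerB; apply: gauss_cdf_le; first exact: ltW.
  by rewrite (le_trans bm2)// addrC lerD2r.
have x12 : x1 <= x2 by apply: standardized_le => //; exact: first_above_le.
have G0 : 0 <= Phi x2 - Phi x1 by rewrite subr_ge0 gauss_cdf_le.
have G1 : Phi x2 - Phi x1 <= 1.
  by rewrite lerBlDr (le_trans (gauss_cdf_le1 _))// lerDl gauss_cdf_ge0.
have GA1 : Phi y2 - Phi y1 <= 1.
  by rewrite lerBlDr (le_trans (gauss_cdf_le1 _))// lerDl gauss_cdf_ge0.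
have prob (U : set nat) : 0 <= fine (poisson_prob a 0%N U) <= 1.
  rewrite fine_ge0//= -lee_fin fineK; last exact: fin_num_measure.
  exact: (@probability_le1 _ _ _ (poisson_prob a 0%N)).
have /andP[S0 S1] : 0 <= S <= 1 by exact: prob.
have /andP[SA0 SA1] : 0 <= SA <= 1 by exact: prob.
have SAn : 1 - n <= SA.
  apply: le_trans (poisson_chebyshev a0 A0').
  rewrite lerD2l lerN2 -exprVn.
  have Ai : A^-1 <= n by rewrite -[n]invrK lef_pV2// posrE.
  have Ai0 : 0 < A^-1 by rewrite invr_gt0.
  have Ai1 : A^-1 <= 1 by rewrite invf_le1.
  by rewrite expr2 (le_trans _ Ai)// ler_piMr// ltW.
have sq := ratio_squeeze n0 n2 beta0 K1 K2 V1 V2 W1 W2 GA GA1 SAn SA1 G0 G1 S0 S1.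
apply: (@le_trans _ _ (3 * n)); last by rewrite mulrC -ler_pdivlMr.
exact: (squeeze_shift lipc lipe sq).
Qed.

End poisson_limit.

(** * Convergence in law by approximation *)

Section std_normal_product.
Context {R : realType}.

Lemma std_normal_rect n (B : 'I_n -> set R) : (forall i, measurable (B i)) ->
  std_normal n [set x | forall i, B i (tnth x i)] =
  (\prod_(i < n) (normal_prob 0 1 : set (measurableTypeR R) -> \bar R) (B i))%E.
Proof.
elim: n B => [|n IH] B mB.
  by rewrite big_ord0 /= diracE mem_set// => -[].
have mS : measurable [set x : n.-tuple R | forall i, B (lift ord0 i) (tnth x i)].
  rewrite (_ : mkset _ = \bigcap_(i in [set: 'I_n])
      ((fun x : n.-tuple R => tnth x i) @^-1` B (lift ord0 i))).
    apply: fin_bigcap_measurable => // i _.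
    by rewrite -[X in measurable X]setTI; exact: measurable_tnth.
  by apply/seteqP; split => x /= h i; [move=> _|]; exact: h.
rewrite big_ord_recl -(IH (fun i => B (lift ord0 i)))//.
rewrite /= /distribution /pushforward.
rewrite (_ : _ @^-1` _ = B ord0 `*` [set x | forall i, B (lift ord0 i) (tnth x i)]).
  exact: (@product_measure1E _ _ _ _ R (normal_prob 0 1 : probability (measurableTypeR R) R)
    (std_normal n) _ _ (mB ord0) mS).
apply/seteqP; split => [[x y] /= h|[x y] /= [h0 h] i].
  split; first by have := h ord0; rewrite /tcons (tnth_nth 0).
  by move=> i; have := h (lift ord0 i); rewrite /tcons [tnth _ (lift _ _)](tnth_nth 0)/= -tnth_nth.
have [->|[j ->]] : i = ord0 \/ exists j, i = lift ord0 j.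
  by case: (unliftP ord0 i) => [j ->|->]; [right; exists j|left].
- by rewrite /tcons (tnth_nth 0).
- by have := h j; rewrite /tcons [tnth _ (lift _ _)](tnth_nth 0)/= -tnth_nth.
Qed.

End std_normal_product.

(** * Grid approximation of continuous functions *)

Section continuous_on_boxes.
Context {R : realType} (l : nat).
Variable f : 'rV[R]_l.+1 -> R.
Hypothesis cf : continuous f.

(** Only x is confined to the box, as y will be a value that may leave it. Compactness of the box is
    used through a covering by neighbourhoods on which one radius dl works. *)
Lemma uniformly_continuous_box (A e : R) : 0 < e -> exists2 dl : R, 0 < dl &
  forall x y : 'rV[R]_l.+1, (forall i, `|x ord0 i| <= A) ->
    (forall i, `|x ord0 i - y ord0 i| <= dl) -> `|f x - f y| <= e.
Proof.
move=> e0; pose Pr dl (x : 'rV[R]_l.+1) := forall y : 'rV[R]_l.+1,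
  (forall i, `|x ord0 i - y ord0 i| <= dl) -> `|f x - f y| <= e.
pose Kb := [set v : 'rV[R]_l.+1 | forall i, `[- A, A]%classic (v ord0 i)].
have cI (i : 'I_l.+1) : compact (`[- A, A]%classic) by exact: segment_compact.
have cK : compact Kb by exact: (rV_compact cI).
have nc := (compact_near_coveringP Kb).1 cK.
have [|dl0 /= dl00 Hdl] := nc R (0^'+)%classic Pr _.
  move=> x Kx; have e2 : 0 < e / 2 by rewrite divr_gt0.
  have /cvgrPdist_lt/(_ _ e2) := @cf x; move=> /nbhs_ballP[r /= r0 Hr].
  have r2 : 0 < r / 2 by rewrite divr_gt0.
  exists (ball x (r / 2), [set dl | 0 < dl < r / 2]).
    split => /=; first exact: nbhsx_ballx.
    by near=> u; apply/andP; split; near: u; [exact: nbhs_right_gt|exact: nbhs_right_lt].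
  move=> [x' dl] /= [bx /andP[d0 dr]] y xy.
  have h1 : `|f x - f x'| < e / 2 by apply: Hr; apply: le_ball bx; lra.
  have h2 : `|f x - f y| < e / 2.
    apply: Hr; split => // i j; rewrite (ord1 i); suff : `|x ord0 j - y ord0 j| < r by [].
    have b : `|x ord0 j - x' ord0 j| < r / 2 by exact: (bx.2 ord0 j).
    rewrite (_ : x ord0 j - y ord0 j = (x ord0 j - x' ord0 j) + (x' ord0 j - y ord0 j)); last by ring.
    by apply: (le_lt_trans (ler_normD _ _)); have := xy j; lra.
  rewrite (_ : f x' - f y = (f x - f y) - (f x - f x')); last by ring.
  by apply: (le_trans (ler_normB _ _)); lra.
have d2 : 0 < dl0 / 2 by rewrite divr_gt0.
exists (dl0 / 2) => // x y xA xy.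
have b : `|0 - dl0 / 2| < dl0 by rewrite sub0r normrN gtr0_norm//; lra.
have Kx : Kb x by move=> i /=; rewrite in_itv/= -ler_norml.
exact: (Hdl _ b d2 x Kx y xy).
Unshelve. all: by end_near.
Qed.

(** Cells are numbered downwards from A: they are then closed on the right, as increments of a
    distribution function require, while the index of a point is still given by a truncation. *)
Definition grid_cell (A : R) (n : nat) (j : nat) : set R :=
  `]A - j.+1%:R * (2 * A / n%:R), A - j%:R * (2 * A / n%:R)]%classic.

Definition grid_point (A : R) (n : nat) (c : {ffun 'I_l.+1 -> 'I_n}) : 'rV[R]_l.+1 :=
  \row_i (A - (c i : nat)%:R * (2 * A / n%:R)).

Definition grid_step (A : R) (n : nat) (v : 'I_l.+1 -> R) : R :=
  \sum_(c : {ffun 'I_l.+1 -> 'I_n}) f (grid_point A c) * \prod_i \1_(grid_cell A n (c i)) (v i).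

Lemma grid_cell_inj (A : R) n j k x : 0 < A -> (0 < n)%N ->
  grid_cell A n j x -> grid_cell A n k x -> j = k.
Proof.
move=> A0 n0; rewrite /grid_cell/= !in_itv/=; set s := 2 * A / n%:R.
have s0 : 0 < s by rewrite divr_gt0 ?ltr0n// mulr_gt0.
move=> /andP[j1 j2] /andP[k1 k2].
have h1 : j%:R * s < k.+1%:R * s by lra.
have h2 : k%:R * s < j.+1%:R * s by lra.
by move: h1 h2; rewrite !ltr_pM2r// !ltr_nat !ltnS => jk kj; apply/eqP; rewrite eqn_leq jk kj.
Qed.

Lemma grid_cell_exists (A : R) n x : 0 < A -> (0 < n)%N -> - A < x <= A ->
  exists j : 'I_n, grid_cell A n j x.
Proof.
move=> A0 n0 /andP[xA Ax]; pose s := 2 * A / n%:R.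
have s0 : 0 < s by rewrite divr_gt0 ?ltr0n// mulr_gt0.
have nR : 0 < n%:R :> R by rewrite ltr0n.
have y0 : 0 <= (A - x) / s by rewrite divr_ge0 ?subr_ge0// ltW.
have /andP[t1 t2] := truncn_itv y0.
have tn : (Num.trunc ((A - x) / s) < n)%N.
  rewrite -(ltr_nat R) (le_lt_trans t1)// ltr_pdivrMr// /s mulrCA divff ?gt_eqF//; lra.
exists (Ordinal tn); rewrite /grid_cell/= in_itv/= -/s.
rewrite ler_pdivlMr// in t1; rewrite ltr_pdivrMr// in t2.
by apply/andP; split; lra.
Qed.

Lemma grid_step_in (A : R) n v : 0 < A -> (0 < n)%N -> (forall i, - A < v i <= A) ->
  exists y : 'rV[R]_l.+1, [/\ grid_step A n v = f y,
    forall i, `|y ord0 i - v i| <= 2 * A / n%:R & forall i, `|y ord0 i| <= A].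
Proof.
move=> A0 n0 vA; have s0 : 0 < 2 * A / n%:R by rewrite divr_gt0 ?ltr0n// mulr_gt0.
have /choice[c0 c0P] : forall i, exists j : 'I_n, grid_cell A n j (v i).
  by move=> i; exact: grid_cell_exists.
pose c := [ffun i => c0 i]; exists (grid_point A c); split.
- rewrite /grid_step (bigD1 c)//= [X in _ * X + _]big1 => [|i _]; last first.
    by rewrite indicE mem_set// ffunE; exact: c0P.
  rewrite mulr1 big1 ?addr0// => c' c'c; suff [i ic] : exists i, c' i != c i.
    rewrite (bigD1 i)//= indicE memNset ?mul0r ?mulr0// => vi.
    move: ic; rewrite -(inj_eq val_inj) => /eqP; apply.
    by apply: (grid_cell_inj A0 n0 vi); rewrite ffunE; exact: c0P.
  apply: contrapT => h; move: c'c => /eqP; apply; apply/ffunP => i.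
  by apply/eqP; apply: contrapT => /negP ic; apply: h; exists i.
- move=> i; rewrite mxE ffunE; have := c0P i; rewrite /grid_cell/= in_itv/= -natr1 mulrDl mul1r.
  by move=> /andP[h1 h2]; rewrite ger0_norm ?subr_ge0//; lra.
- move=> i; rewrite mxE ffunE ler_norml.
  have c1 : (c0 i)%:R * (2 * A / n%:R) <= 2 * A.
    rewrite mulrA ler_pdivrMr ?ltr0n// mulrC ler_pM2l ?mulr_gt0// ler_nat ltnW//.
  have c2 : 0 <= (c0 i)%:R * (2 * A / n%:R) by rewrite mulr_ge0// ltW.
  by apply/andP; split; lra.
Qed.

Lemma grid_step_out (A : R) n v : 0 < A -> (0 < n)%N -> (exists i, ~~ (- A < v i <= A)) ->
  grid_step A n v = 0.
Proof.
move=> A0 n0 [i vi]; rewrite /grid_step big1// => c _.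
rewrite (bigD1 i)//= indicE memNset ?mul0r ?mulr0//; rewrite /grid_cell/= in_itv/= => /andP[h1 h2].
move: vi => /negP; apply; have nR : 0 < n%:R :> R by rewrite ltr0n.
have c1 : (c i).+1%:R * (2 * A / n%:R) <= 2 * A.
  by rewrite mulrA ler_pdivrMr// mulrC ler_pM2l ?mulr_gt0// ler_nat.
have c2 : 0 <= (c i)%:R * (2 * A / n%:R) by rewrite mulr_ge0// divr_ge0// mulr_ge0// ltW.
by apply/andP; split; lra.
Qed.

Context d (Omega : measurableType d).

Lemma measurable_grid_step A n (X : 'I_l.+1 -> Omega -> R) :
  (forall i, measurable_fun setT (X i)) ->
  measurable_fun setT (fun w => grid_step A n (X ^~ w)).
Proof.
move=> mX; apply: measurable_sum => c; apply: measurable_funM => //.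
apply: measurable_prod => i _; apply: measurableT_comp => //.
by apply: measurable_indic; exact: measurable_itv.
Qed.

(** Grid functions depend on the coordinates through indicators only, and by continuity of [f] they
    converge to it pointwise. *)
Lemma measurable_row_continuous (X : 'I_l.+1 -> Omega -> R) :
  (forall i, measurable_fun setT (X i)) ->
  measurable_fun setT (fun w => f (\row_i X i w)).
Proof.
(* With half-width k + 1 and 2 (k + 1)^2 cells per side, the mesh is 1 / (k + 1). *)
move=> mX; apply: (@measurable_fun_cvg _ _ _ setT
  (fun k w => grid_step k.+1%:R (2 * k.+1 * k.+1)%N (X ^~ w))) => [k|w _].
  exact: measurable_grid_step.
apply/cvgrPdist_lt => e e0; pose x0 : 'rV[R]_l.+1 := \row_i X i w.
have /cvgrPdist_lt/(_ _ e0) := @cf x0; move=> /nbhs_ballP[r /= r0 Hr].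
pose T := \sum_i `|X i w| + r^-1.
exists (Num.trunc T).+1 => // k /= Tk.
have kT : T < k.+1%:R by apply: lt_trans (truncnS_gt T) _; rewrite ltr_nat.
have k0 : 0 < k.+1%:R :> R by rewrite ltr0n.
have XT i : `|X i w| < k.+1%:R.
  apply: le_lt_trans kT; rewrite /T (bigD1 i)//= -addrA lerDl addr_ge0//.
    by apply: sumr_ge0.
  by rewrite invr_ge0 ltW.
have vA i : - k.+1%:R < X i w <= k.+1%:R.
  by have := XT i; rewrite ltr_norml => /andP[-> /ltW->].
have n0 : (0 < 2 * k.+1 * k.+1)%N by [].
have [y [-> yX _]] := grid_step_in k0 n0 vA.
apply: Hr; split => // i j; rewrite (ord1 i); suff : `|x0 ord0 j - y ord0 j| < r by [].
rewrite mxE distrC; apply: le_lt_trans (yX j) _.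
have -> : 2 * k.+1%:R / (2 * k.+1 * k.+1)%:R = k.+1%:R^-1 :> R.
  by rewrite !natrM; field; rewrite gt_eqF.
rewrite invf_plt ?posrE//; apply: le_lt_trans kT; rewrite /T lerDr.
exact: sumr_ge0.
Qed.

End continuous_on_boxes.

Lemma cvgr_prod (R : realType) (T : Type) (F : set_system T) {FF : Filter F} (I : Type)
    (s : seq I) (f : I -> T -> R) (l : I -> R) :
  (forall k, f k x @[x --> F] --> l k) ->
  \prod_(k <- s) f k x @[x --> F] --> \prod_(k <- s) l k.
Proof.
move=> fl; elim: s => [|k s IH].
  by under eq_cvg do rewrite big_nil; rewrite big_nil; exact: cvg_cst.
by under eq_cvg do rewrite big_cons; rewrite big_cons; exact: cvgM.
Qed.

Lemma bernoulli_expr (R : realType) (x : R) n : 0 <= x <= 1 -> 1 - n%:R * x <= (1 - x) ^+ n.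
Proof.
move=> /andP[x0 x1]; elim: n => [|n IH]; first by rewrite mul0r subr0 expr0.
rewrite exprS; have h : 0 <= 1 - x by rewrite subr_ge0.
apply: le_trans (ler_wpM2l h IH); rewrite -natr1.
have : 0 <= n%:R * x ^+ 2 by rewrite mulr_ge0 ?sqr_ge0.
lra.
Qed.

Section grid_estimate.
Context d (T : measurableType d) (R : realType) (Q : probability T R) (l : nat).
Variables (f : 'rV[R]_l.+1 -> R) (M : R).
Hypotheses (cf : continuous f) (fM : forall x, `|f x| <= M).
Variables (U V : 'I_l.+1 -> T -> R).
Hypotheses (mU : forall i, measurable_fun setT (U i)) (mV : forall i, measurable_fun setT (V i)).

Let M0 : 0 <= M. Proof. exact: le_trans (normr_ge0 _) (fM 0). Qed.

Lemma bounded_row_L1 (W : 'I_l.+1 -> T -> R) : (forall i, measurable_fun setT (W i)) ->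
  L1 Q (fun w => f (\row_i W i w)).
Proof.
move=> mW; apply: (L1_le _ _ (L1_cst Q M)) => //; exact: measurable_row_continuous.
Qed.

Lemma grid_step_norm A n v : 0 < A -> (0 < n)%N -> `|grid_step f A n v| <= M.
Proof.
move=> A0 n0; have [vA|] := pselect (forall i, - A < v i <= A).
  by have [y [-> _ _]] := grid_step_in f A0 n0 vA.
move=> /existsNP[i /negP vi]; rewrite (grid_step_out f A0 n0)//; last by exists i.
by rewrite normr0.
Qed.

Lemma grid_step_L1 A n : 0 < A -> (0 < n)%N -> L1 Q (fun w => grid_step f A n (V ^~ w)).
Proof.
move=> A0 n0; apply: (L1_le _ _ (L1_cst Q M)); first exact: measurable_grid_step.
by move=> w; exact: grid_step_norm.
Qed.

Lemma measurable_rect (B : 'I_l.+1 -> set R) : (forall i, measurable (B i)) ->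
  measurable [set w | forall i, B i (V i w)].
Proof.
move=> mB; rewrite (_ : mkset _ = \bigcap_(i in [set: 'I_l.+1]) (V i @^-1` B i)).
  apply: fin_bigcap_measurable => // i _.
  by rewrite -[X in measurable X]setTI; exact: mV.
by apply/seteqP; split => x /= h i; [move=> _|]; exact: h.
Qed.

Lemma measurable_gap dl i : measurable [set w | dl < `|U i w - V i w|].
Proof.
have mn : measurable_fun setT (fun w => `|U i w - V i w|).
  by apply: measurableT_comp => //; exact: measurable_funB.
have := mn measurableT _ (measurable_itv `]dl, +oo[); rewrite setTI.
by congr (measurable _); apply/seteqP; split => w /=; rewrite in_itv/= andbT.
Qed.

(** When [V] is in the box and all gaps are at most dl / 2, the grid value is that of [f] at a point
    within dl of [U]; otherwise the difference is at most 2 M. Tightness is asked of [V] alone. *)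
Lemma grid_estimate A n dl e : 0 < A -> (0 < n)%N -> 0 <= e ->
  (forall x y : 'rV[R]_l.+1, (forall i, `|x ord0 i| <= A) ->
    (forall i, `|x ord0 i - y ord0 i| <= dl) -> `|f x - f y| <= e) ->
  2 * A / n%:R <= dl / 2 ->
  `|Ex Q (fun w => f (\row_i U i w)) - Ex Q (fun w => grid_step f A n (V ^~ w))| <=
  e + 2 * M * ((1 - fine (Q [set w | forall i, `]- A, A]%classic (V i w)])) +
    \sum_i fine (Q [set w | dl / 2 < `|U i w - V i w|])).
Proof.
move=> A0 n0 e0 unif ndl.
pose S := [set w | forall i, `]- A, A]%classic (V i w)].
pose G i := [set w | dl / 2 < `|U i w - V i w|].
have mS : measurable S.
  by apply: (measurable_rect (B := fun=> `]- A, A]%classic)) => i; exact: measurable_itv.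
have mG i : measurable (G i) by exact: measurable_gap.
have iI (D : set T) : measurable D -> L1 Q (\1_D : T -> R).
  move=> mD; apply: (L1_le _ _ (L1_cst Q 1)); first exact: measurable_indic.
  by move=> w; rewrite indicE ger0_norm// lern1 leq_b1.
have iU := bounded_row_L1 mU; have iV := grid_step_L1 A0 n0.
rewrite -ExB//; apply: (le_trans (norm_Ex (L1B iU iV))).
have iR1 : L1 Q (fun w => 1 - \1_S w + \sum_i \1_(G i) w).
  apply: L1D; first by apply: L1B; [exact: L1_cst|exact: iI].
  by apply: L1_sum => i; exact: iI.
apply: (@le_trans _ _ (Ex Q (fun w => e + 2 * M * (1 - \1_S w + \sum_i \1_(G i) w)))); last first.
  rewrite ExD; [|exact: L1_cst|exact: L1Zl].
  rewrite Ex_cst ExZl// ExD; [|by apply: L1B; [exact: L1_cst|exact: iI]|by apply: L1_sum => i; exact: iI].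
  rewrite ExB; [|exact: L1_cst|exact: iI].
  rewrite Ex_cst (Ex_indic Q mS) Ex_sum; last by move=> i; exact: iI.
  by under eq_bigr do rewrite (Ex_indic Q (mG _)).
apply: le_Ex.
- exact: L1_norm (L1B iU iV).
- by apply: L1D; [exact: L1_cst|exact: L1Zl].
move=> w; have s0 : 0 <= \sum_i \1_(G i) w :> R by apply: sumr_ge0 => i _; rewrite indicE.
have crude : `|f (\row_i U i w) - grid_step f A n (V ^~ w)| <= 2 * M.
  rewrite (le_trans (ler_normB _ _))// mulr2n mulrDl mul1r lerD//.
  exact: grid_step_norm.
have MM : 0 <= 2 * M by rewrite mulr_ge0.
have [wS|wS] := pselect (S w); last first.
  rewrite [\1_S w]indicE memNset// subr0; apply: (le_trans crude).
  apply: (@le_trans _ _ (2 * M * 1)); first by rewrite mulr1.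
  apply: (@le_trans _ _ (2 * M * (1 + \sum_i \1_(G i) w))); first by rewrite ler_wpM2l// lerDl.
  by rewrite lerDr.
have [[i wG]|nG] := pselect (exists i, G i w).
  apply: (le_trans crude); apply: (@le_trans _ _ (2 * M * 1)); first by rewrite mulr1.
  rewrite ler_wpDl// ler_wpM2l// (@le_trans _ _ (\sum_i \1_(G i) w))//.
    rewrite (bigD1 i)//= indicE mem_set// lerDl; apply: sumr_ge0 => k _; by rewrite indicE.
  by rewrite lerDr subr_ge0 indicE lern1 leq_b1.
have vA i : - A < V i w <= A by have := wS i; rewrite /= in_itv.
have [y [-> yV yA]] := grid_step_in f A0 n0 vA.
rewrite distrC (le_trans (unif y (\row_i U i w) yA _))//.
  move=> i; rewrite mxE (_ : y ord0 i - U i w = (y ord0 i - V i w) - (U i w - V i w)); last by ring.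
  rewrite (le_trans (ler_normB _ _))// (splitr dl) lerD//; first exact: le_trans (yV i) ndl.
  by rewrite leNgt; apply/negP => h; apply: nG; exists i.
rewrite lerDl mulr_ge0// addr_ge0// subr_ge0 indicE lern1 leq_b1//.
Qed.

(** The product formula on rectangles makes this expectation a polynomial in the one-dimensional
    cell masses, so the convergence of the latter is enough. *)
Lemma Ex_grid_step A n (q : 'I_l.+1 -> set R -> R) : 0 < A -> (0 < n)%N ->
  (forall B : 'I_l.+1 -> set R, (forall i, measurable (B i)) ->
    Q [set w | forall i, B i (V i w)] = (\prod_i q i (B i))%:E) ->
  Ex Q (fun w => grid_step f A n (V ^~ w)) =
  \sum_(c : {ffun 'I_l.+1 -> 'I_n}) f (grid_point A c) * \prod_i q i (grid_cell A n (c i)).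
Proof.
move=> A0 n0 Hq; rewrite /grid_step.
have mc (c : {ffun 'I_l.+1 -> 'I_n}) i : measurable (grid_cell A n (c i)) by exact: measurable_itv.
have pE (c : {ffun 'I_l.+1 -> 'I_n}) w : \prod_i \1_(grid_cell A n (c i)) (V i w) =
    \1_[set w | forall i, grid_cell A n (c i) (V i w)] w :> R.
  rewrite indicE; have [h|h] := pselect (forall i, grid_cell A n (c i) (V i w)).
    by rewrite mem_set// big1// => i _; rewrite indicE mem_set.
  rewrite memNset//; move/existsNP: h => [i hi].
  by rewrite (bigD1 i)//= indicE memNset ?mul0r.
have iI (D : set T) : measurable D -> L1 Q (\1_D : T -> R).
  move=> mD; apply: (L1_le _ _ (L1_cst Q 1)); first exact: measurable_indic.
  by move=> w; rewrite indicE ger0_norm// lern1 leq_b1.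
have mR (c : {ffun 'I_l.+1 -> 'I_n}) : measurable [set w | forall i, grid_cell A n (c i) (V i w)].
  by apply: (measurable_rect (B := fun i => grid_cell A n (c i))); exact: mc.
rewrite (@eq_Ex _ _ _ Q _ (fun w => \sum_(c : {ffun 'I_l.+1 -> 'I_n}) f (grid_point A c) *
   \1_[set w | forall i, grid_cell A n (c i) (V i w)] w)); last first.
  by move=> w; apply: eq_bigr => c _; rewrite pE.
rewrite Ex_sum; last by move=> c; apply: L1Zl; exact: iI.
apply: eq_bigr => c _; rewrite ExZl; last exact: iI.
by rewrite (Ex_indic Q (mR c)) (Hq (fun i => grid_cell A n (c i))).
Qed.

End grid_estimate.

(** [a] is the expectation and [b] its limit, [s1] and [s2] are their grid sums, [p] and [g] the
    probabilities of the box, [gp] the total probability of the gaps. The errors add up to 7 e /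
    12. *)
Lemma law_arith (R : realType) (M e a b s1 s2 g p gp : R) : 0 <= M -> 0 < e ->
  1 - g <= e / 12 / (2 * M + 1) -> `|b - s2| <= e / 12 + 2 * M * (1 - g) ->
  `|a - s1| <= e / 12 + 2 * M * (1 - p + gp) -> `|s2 - s1| <= e / 12 ->
  `|g - p| <= e / 12 / (2 * M + 1) -> `|0 - gp| <= e / 12 / (2 * M + 1) -> `|b - a| <= e.
Proof.
move=> M0 e0; set eM := e / 12 / (2 * M + 1) => box.
have M1 : 0 < 2 * M + 1 by rewrite ltr_wpDl// mulr_ge0.
have eME : (2 * M + 1) * eM = e / 12 by rewrite /eM mulrC divfK// gt_eqF.
have eM0 : 0 <= eM by rewrite !divr_ge0 ?ltW.
move=> estnu est; rewrite !ler_norml => /andP[p1 p2] /andP[p3 p4] /andP[p5 p6].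
have k1 : 2 * M * (1 - g) <= e / 12.
  rewrite -eME; apply: (@le_trans _ _ (2 * M * eM)); first by rewrite ler_wpM2l ?mulr_ge0.
  by rewrite ler_wpM2r// lerDl.
have k2 : 2 * M * (1 - p + gp) <= e / 4.
  apply: (@le_trans _ _ (2 * M * (3 * eM))); first by rewrite ler_wpM2l ?mulr_ge0//; lra.
  have : 2 * M * eM <= (2 * M + 1) * eM by rewrite ler_wpM2r// lerDl.
  rewrite eME; lra.
move: estnu est; rewrite !ler_norml => /andP[u1 u2] /andP[v1 v2].
by apply/andP; split; lra.
Qed.

Section law_limit.
Context d (Omega : measurableType d) (R : realType) (P : probability Omega R).
Context (I : Type) (F : set_system I) {FF : ProperFilter F} (l : nat).
Variables (X W : I -> 'I_l.+1 -> Omega -> R).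
Hypotheses (mX : \forall i \near F, forall k, measurable_fun setT (X i k))
  (mW : forall i k, measurable_fun setT (W i k))
  (W_indep : forall i (B : 'I_l.+1 -> set R), (forall k, measurable (B k)) ->
     P [set w | forall k, B k (W i k w)] = (\prod_k P [set w | B k (W i k w)])%E)
  (W_clt : forall k c e, c <= e ->
     fine (P [set w | c < W i k w <= e]) @[i --> F] --> gauss_cdf e - gauss_cdf c)
  (X_W : forall k dl, 0 < dl ->
     fine (P [set w | dl < `|X i k w - W i k w|]) @[i --> F] --> (0 : R)).

(** The expectation under [P] and the Gaussian one are replaced by grid sums, which are the same
    polynomial in cell masses. The box is fixed on the Gaussian side and transferred to [W] by
    convergence. Measurability of [X] is asked eventually, since particle k is constrained only when
    N > k. *)
Lemma cvg_in_law_approx : cvg_in_law P F (fun i w => \row_k X i k w) (std_normal l.+1).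
Proof.
move=> f cf [M fM].
have M0 : 0 <= M by exact: le_trans (normr_ge0 _) (fM 0).
pose gauss : set R -> R := fun B => fine ((normal_prob 0 1 : set (measurableTypeR R) -> \bar R) B).
pose nu := @std_normal R l.+1.
pose tn (k : 'I_l.+1) (x : l.+1.-tuple R) : R := tnth x k.
have mtn k : measurable_fun setT (tn k) by exact: measurable_tnth.
have gE (B : set R) : measurable B ->
    (normal_prob 0 1 : set (measurableTypeR R) -> \bar R) B = (gauss B)%:E.
  move=> mB; rewrite /gauss fineK//.
  exact: (@fin_num_measure _ _ _ (normal_prob 0 1 : probability (measurableTypeR R) R)).
have nuq (B : 'I_l.+1 -> set R) : (forall i, measurable (B i)) ->
    nu [set x | forall i, B i (tn i x)] = (\prod_i gauss (B i))%:E.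
  move=> mB; rewrite /nu std_normal_rect// -prodEFin; apply: eq_bigr => i _; exact: gE.
pose pp i k (B : set R) := fine (P [set w | B (W i k w)]).
have mWB i k (B : set R) : measurable B -> measurable [set w | B (W i k w)].
  by move=> mB; rewrite -[X in measurable X]setTI; exact: mW.
have Pq i (B : 'I_l.+1 -> set R) : (forall k, measurable (B k)) ->
    P [set w | forall k, B k (W i k w)] = (\prod_k pp i k (B k))%:E.
  move=> mB; rewrite W_indep// -prodEFin; apply: eq_bigr => k _.
  by rewrite /pp fineK// fin_num_measure//; exact: mWB.
have gitv c e : c <= e -> gauss `]c, e]%classic = gauss_cdf e - gauss_cdf c.
  by move=> ce; rewrite /gauss gauss_itv.
have pcvg k c e : c <= e -> pp i k `]c, e]%classic @[i --> F] --> gauss `]c, e]%classic.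
  move=> ce; rewrite gitv//; apply: cvg_trans (W_clt k ce); apply: near_eq_cvg.
  by apply: nearW => i; rewrite /pp; congr fine; congr (P _); apply/seteqP; split => w /=; rewrite in_itv.
have iE (i : I) : (forall k, measurable_fun setT (X i k)) ->
    'E_P[f \o (fun w => \row_k X i k w)]%E = (Ex P (fun w => f (\row_k X i k w)))%:E.
  by move=> mXi; rewrite unlock (ExE (bounded_row_L1 P cf fM mXi)).
have nE : (\int[nu]_x (f (\row_(j < l.+1) tnth x j))%:E)%E =
    (Ex nu (fun x => f (\row_k tn k x)))%:E.
  by rewrite (ExE (bounded_row_L1 nu cf fM mtn)).
rewrite nE.
suff main : Ex P (fun w => f (\row_k X i k w)) @[i --> F] --> Ex nu (fun x => f (\row_k tn k x)).
  apply: cvg_EFin; first by near=> i; rewrite iE//; near: i.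
  by apply: cvg_trans main; apply: near_eq_cvg; near=> i; rewrite /= iE//; near: i.
apply/cvgrPdist_le => e e0.
(* Each coordinate leaves the box with Gaussian probability at most eta, and Bernoulli's inequality
   adds this up over the l + 1 coordinates. *)
pose eta := e / 12 / (2 * M + 1) / l.+1%:R.
have M1 : 0 < 2 * M + 1 by rewrite ltr_wpDl// mulr_ge0.
have lR : 0 < l.+1%:R :> R by rewrite ltr0n.
have eta0 : 0 < eta by rewrite !divr_gt0.
have e12 : 0 < e / 12 by rewrite divr_gt0.
have mn0 : 0 < Num.min eta 1 :> R by rewrite lt_min eta0 ltr01.
have [A0 A00 tail] := gauss_cdf_tail mn0.
pose A := A0 + 1; have Apos : 0 < A by rewrite /A; lra.
have gA : 1 - Num.min eta 1 <= gauss `]- A, A]%classic.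
  have AA : - A <= A by lra.
  rewrite gitv//; apply: (le_trans (tail A _)); first by rewrite /A; lra.
  by rewrite lerB// gauss_cdf_le//; lra.
have g1 : gauss `]- A, A]%classic <= 1.
  have AA : - A <= A by lra.
  rewrite gitv// lerBlDr (le_trans (gauss_cdf_le1 _))// lerDl gauss_cdf_ge0//.
have box : 1 - \prod_(k < l.+1) gauss `]- A, A]%classic <= e / 12 / (2 * M + 1).
  rewrite prodr_const card_ord lerBlDr -lerBlDl.
  have m01 : 0 <= Num.min eta 1 <= 1 by rewrite (ltW mn0) ge_min lexx orbT.
  apply: (@le_trans _ _ ((1 - Num.min eta 1) ^+ l.+1)).
    apply: le_trans (bernoulli_expr l.+1 m01); rewrite lerD2l lerN2.
    apply: (@le_trans _ _ (l.+1%:R * eta)).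
      by rewrite ler_pM2l// ge_min lexx.
    by rewrite /eta mulrC divfK// gt_eqF.
  by rewrite lerXn2r ?nnegrE ?subr_ge0//; [case/andP: m01|rewrite (le_trans _ gA)// subr_ge0; case/andP: m01].
have [dl dl0 unif] := uniformly_continuous_box cf A e12.
pose n := (Num.trunc (4 * A / dl)).+1.
have n0 : (0 < n)%N by [].
have ndl : 2 * A / n%:R <= dl / 2.
  have nR : 0 < n%:R :> R by rewrite ltr0n.
  rewrite ler_pdivrMr//; have := truncnS_gt (4 * A / dl); rewrite ltr_pdivrMr// -/n => h; lra.
have estnu := @grid_estimate _ _ R nu l f M cf fM tn tn mtn mtn A n dl (e / 12) Apos n0 (ltW e12) unif ndl.
have nuBox : nu [set w | forall i, `]- A, A]%classic (tn i w)] =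
    (\prod_(i < l.+1) gauss `]- A, A]%classic)%:E.
  by apply: (nuq (fun=> `]- A, A]%classic)) => i; exact: measurable_itv.
rewrite nuBox in estnu.
have gap0 : \sum_(i < l.+1) fine (nu [set w | dl / 2 < `|tn i w - tn i w|]) = 0.
  apply: big1 => i _; rewrite (_ : mkset _ = set0) ?measure0//.
  by apply/seteqP; split => // w /=; rewrite subrr normr0 ltNge divr_ge0 ?ltW.
rewrite gap0 addr0 (@Ex_grid_step _ _ R nu l f tn mtn A n (fun=> gauss) Apos n0 nuq) in estnu.
have c1 : (\sum_(c : {ffun 'I_l.+1 -> 'I_n}) f (grid_point A c) *
      \prod_k pp i k (grid_cell A n (c k))) @[i --> F] -->
    (\sum_(c : {ffun 'I_l.+1 -> 'I_n}) f (grid_point A c) * \prod_(k < l.+1) gauss (grid_cell A n (c k))).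
  apply: cvgr_sum => c; apply: cvgM; first exact: cvg_cst.
  apply: cvgr_prod => k; apply: pcvg.
  rewrite lerD2l lerN2 ler_wpM2r ?divr_ge0 ?(ltW Apos)// ?mulr_ge0 ?(ltW Apos)// ler_nat.
  exact: leqnSn.
have c2 : (\prod_(k < l.+1) pp i k `]- A, A]%classic) @[i --> F] -->
    \prod_(k < l.+1) gauss `]- A, A]%classic.
  by apply: cvgr_prod => k; apply: pcvg; lra.
have c3 : (\sum_(k < l.+1) fine (P [set w | dl / 2 < `|X i k w - W i k w|])) @[i --> F] -->
    \sum_(k < l.+1) (0 : R).
  by apply: cvgr_sum => k; apply: X_W; rewrite divr_gt0.
rewrite big1// in c3.
have eM : 0 < e / 12 / (2 * M + 1) by rewrite divr_gt0.
move/cvgrPdist_le: c1 => /(_ _ e12) c1; move/cvgrPdist_le: c2 => /(_ _ eM) c2.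
move/cvgrPdist_le: c3 => /(_ _ eM) c3.
apply: filterS2 mX (filterI c1 (filterI c2 c3)) => i mXi [h1 [h2 h3]].
have est := @grid_estimate _ _ R P l f M cf fM (X i) (W i) mXi (mW i) A n dl (e / 12) Apos n0 (ltW e12) unif ndl.
rewrite (@Ex_grid_step _ _ R P l f (W i) (mW i) A n (pp i) Apos n0 (Pq i)) in est.
rewrite (Pq i (fun=> `]- A, A]%classic)) in est; last by move=> k; exact: measurable_itv.
exact: (law_arith M0 e0 box estnu est h1 h2 h3).
Unshelve. all: by end_near.
Qed.

End law_limit.

(** * Asymptotics of the Hawkes process *)

Section expectation_tools.
Context d (Omega : measurableType d) (R : realType) (P : probability Omega R).

Lemma Ex_ae_eq (good : set Omega) (f g : Omega -> R) : measurable good -> P (~` good) = 0%E ->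
  measurable_fun setT f -> L1 P g -> (forall w, good w -> f w = g w) ->
  L1 P f /\ Ex P f = Ex P g.
Proof.
move=> mgood Pgood mf ig fg; have mg := L1_measurable ig.
have nul (u v : Omega -> R) : (forall w, good w -> u w = v w) ->
    {ae P, forall w, setT w -> (u w)%:E = (v w)%:E}.
  move=> uv; exists (~` good); split => //; first exact: measurableC.
  by move=> w /= k gw; apply: k => _; rewrite uv.
have iL : L1 P f.
  apply/integrableP; split; first exact/measurable_EFinP.
  have /integrableP[_ k] := ig; apply: le_lt_trans k.
  rewrite le_eqVlt; apply/orP; left; apply/eqP; apply: ae_eq_integral => //.
  - by apply: measurableT_comp => //; exact/measurable_EFinP.
  - by apply: measurableT_comp => //; exact/measurable_EFinP.
  - by apply: (nul (fun w => `|f w|) (fun w => `|g w|)) => w gw; rewrite fg.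
split => //; apply: EFin_inj; rewrite !ExE//; apply: ae_eq_integral => //.
- exact/measurable_EFinP.
- exact/measurable_EFinP.
- exact: (nul f g).
Qed.

Lemma measurable_superlevel (g : Omega -> R) (a : R) : measurable_fun setT g ->
  measurable [set w | a < g w].
Proof.
move=> mg; have := mg measurableT _ (measurable_itv `]a, +oo[); rewrite setTI.
by congr (measurable _); apply/seteqP; split => w /=; rewrite in_itv/= andbT.
Qed.

Lemma markov_Ex (g : Omega -> R) (a : R) : 0 < a -> L1 P g -> (forall w, 0 <= g w) ->
  fine (P [set w | a < g w]) <= Ex P g / a.
Proof.
move=> a0 ig g0; set A := [set w | a < g w].
have mA : measurable A by exact: measurable_superlevel (L1_measurable ig).
rewrite ler_pdivlMr// -(Ex_indic P mA) mulrC.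
have iA : L1 P (\1_A : Omega -> R).
  apply: (L1_le _ _ (L1_cst P 1)); first exact: measurable_indic.
  by move=> w; rewrite indicE ger0_norm// lern1 leq_b1.
rewrite -ExZl//; apply: le_Ex => //; first exact: L1Zl.
move=> w; have [Aw|Aw] := pselect (A w); first by rewrite indicE mem_set// mulr1 ltW.
by rewrite indicE memNset// mulr0.
Qed.

End expectation_tools.

Lemma inv_sqrt_small (R : realType) (C e : R) : 0 <= C -> 0 < e ->
  exists t0 : R, forall t, t0 < t -> 0 < t /\ C / Num.sqrt t <= e.
Proof.
move=> C0 e0; exists (Num.max 0 ((C / e) ^+ 2)) => t; rewrite gt_max => /andP[t0 Ct]; split => //.
rewrite ler_pdivrMr ?sqrtr_gt0// mulrC -ler_pdivrMr//.
by rewrite -[C / e]ger0_norm ?divr_ge0 ?(ltW e0)// -sqrtr_sqr ler_wsqrtr// ltW.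
Qed.

Lemma near_prod_pinfty (R : realType) (t0 : R) (N0 : nat) :
  \forall tN \near filter_prod (pinfty_nbhs R) \oo, t0 < tN.1 /\ (N0 <= tN.2)%N.
Proof.
exists ([set t | t0 < t], [set N | (N0 <= N)%N]) => /=.
  by split; [exists t0; split => //; exact: num_real|exists N0].
by move=> [t N] [].
Qed.

Import HBNNSimple.

(** A simple function below [f] with almost the same integral. Its level set of value 0 is
    discarded, as it may have infinite measure or contain negative lags; a positive level lies where
    f > 0, hence at positive lags, and has finite measure because [f] is integrable. *)
Lemma kernel_decomposition (R : realType) (f : R -> R) (Lam rho0 : R) :
  measurable_fun setT f -> (forall v, 0 <= f v) -> (forall v, v <= 0 -> f v = 0) ->
  (\int[@lebesgue_measure R]_v (f v)%:E = Lam%:E)%E -> 0 < rho0 ->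
  exists (n : nat) (c beta : 'I_n -> R) (B : 'I_n -> set R) (r : R -> R) (rho : R),
  [/\ (forall k, 0 <= c k) /\ (forall k, measurable (B k)),
      (forall k v, B k v -> 0 < v) /\
        (forall k, @lebesgue_measure R (B k) = (beta k)%:E),
      measurable_fun setT r /\ (forall v, 0 <= r v),
      forall v, f v = \sum_k c k * \1_(B k) v + r v
    & (\int[@lebesgue_measure R]_v (r v)%:E)%E = rho%:E /\ rho <= rho0].
Proof.
move=> mf f0 fneg fL rho00; set leb := @lebesgue_measure R.
have [g gf gL] : exists2 g : {nnsfun measurableTypeR R >-> R},
    (forall v, g v <= f v) & ((Lam - rho0)%:E < \int[leb]_v (g v)%:E)%E.
  have : ((Lam - rho0)%:E < \int[leb]_v (f v)%:E)%E by rewrite fL lte_fin; lra.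
  rewrite ge0_integralTE//.
  move=> /ereal_sup_gt[_ [g /= gf <-] k]; exists g; first by move=> v; rewrite -lee_fin.
  by rewrite integralT_nnsfun.
have mg : measurable_fun setT g by exact: measurable_funP.
have g0 v : 0 <= g v by exact: fun_ge0.
pose s := fset_set (g @` setT).
pose sk (k : 'I_#|`s|) : R := s`_k.
have gE v : g v = \sum_(k < #|`s|) sk k * \1_(g @^-1` [set sk k]) v := fimfunEord g v.
pose c k := Num.max 0 (sk k).
pose B k : set R := if 0 < sk k then g @^-1` [set sk k] else set0.
have cB k v : c k * \1_(B k) v = sk k * \1_(g @^-1` [set sk k]) v.
  rewrite /c /B; case: ltP => [//|sn]; rewrite mul0r.
  have [->|s0] := eqVneq (sk k) 0; first by rewrite mul0r.
  rewrite indicE memNset ?mulr0// => /= gs; have := g0 v.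
  by rewrite gs leNgt lt_neqAle s0 sn.
have mpre k : measurable (g @^-1` [set sk k]).
  by rewrite -[X in measurable X]setTI; exact: mg.
have mB k : measurable (B k).
  by rewrite /B; case: ltP => _; [exact: mpre|exact: measurable0].
have B0 k v : B k v -> 0 < v.
  rewrite /B; case: ltP => [sp /= gv|_ []].
  by rewrite ltNge; apply/negP => /fneg fv; have := gf v; rewrite fv gv leNgt sp.
have Bf k : (leb (B k) < +oo)%E.
  rewrite /B; case: (ltP 0 (sk k)) => [sp|_]; last first.
    by have -> : leb set0 = 0%E; [exact: measure0|rewrite ltry].
  have k1 : ((sk k)%:E * leb (g @^-1` [set sk k]) <= Lam%:E)%E.
    have -> : leb (g @^-1` [set sk k]) = (\int[leb]_v (\1_(g @^-1` [set sk k]) v)%:E)%E.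
      by rewrite integral_indic ?setIT.
    rewrite -fL -ge0_integralZl;
      [|by []|by apply/measurable_EFinP; exact: measurable_indic
       |by move=> v _; rewrite lee_fin indicE|by rewrite lee_fin ltW].
    apply: ge0_le_integral_any => v _; first by rewrite -EFinM lee_fin mulr_ge0 ?(ltW sp)// indicE.
    rewrite -EFinM lee_fin; have [gv|gv] := pselect (g v = sk k).
      by rewrite indicE mem_set// mulr1 -gv.
    by rewrite indicE memNset// mulr0.
  by rewrite ltey; apply/eqP => e; move: k1; rewrite e gt0_muley ?lte_fin// leye_eq.
pose r v := f v - g v.
have mr : measurable_fun setT r by exact: measurable_funB.
have r0 v : 0 <= r v by rewrite subr_ge0.
have rfin : (\int[leb]_v (r v)%:E)%E \is a fin_num.
  rewrite ge0_fin_numE; last by apply: integral_ge0 => v _; rewrite lee_fin.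
  apply: (@le_lt_trans _ _ (\int[leb]_v (f v)%:E)%E); last by rewrite fL ltry.
  by apply: ge0_le_integral_any => v _; rewrite lee_fin// lerBlDr lerDl.
have gfin : (\int[leb]_v (g v)%:E)%E \is a fin_num.
  rewrite ge0_fin_numE; last by apply: integral_ge0 => v _; rewrite lee_fin.
  apply: (@le_lt_trans _ _ (\int[leb]_v (f v)%:E)%E); last by rewrite fL ltry.
  by apply: ge0_le_integral_any => v _; rewrite lee_fin.
have split_f : (Lam%:E = \int[leb]_v (r v)%:E + \int[leb]_v (g v)%:E)%E.
  rewrite -fL -ge0_integralD; [|by []|by move=> v _; rewrite lee_fin|exact/measurable_EFinP
    |by move=> v _; rewrite lee_fin|exact/measurable_EFinP].
  by apply: eq_integral => v _; rewrite -EFinD subrK.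
exists #|`s|, c, (fun k => fine (leb (B k))), B, r, (fine (\int[leb]_v (r v)%:E)%E).
split.
- by split => // k; rewrite le_max lexx.
- by split => // k; rewrite fineK// ge0_fin_numE.
- by [].
- by move=> v; under eq_bigr do rewrite cB; rewrite -gE addrC subrK.
- split; first by rewrite fineK.
  move: split_f gL; rewrite -(fineK rfin) -(fineK gfin) -EFinD lte_fin/= => -[->].
  by lra.
Qed.

Lemma ratio_arith (R : realType) (K u v q : R) : 0 <= K -> 0 < u -> 0 < q -> u * v <= q ->
  (q ^+ 2)^-1 * (K * v) <= K / u / q.
Proof.
move=> K0 u0 q0 uv; rewrite mulrC ler_pdivrMr ?exprn_gt0//.
have -> : K / u / q * q ^+ 2 = K * (q / u) by field; rewrite !gt_eqF.
by rewrite ler_wpM2l// ler_pdivlMr// mulrC.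
Qed.

Lemma ratio_arith2 (R : realType) (C u v q e : R) : 0 <= C -> 0 < u -> 0 < v -> 0 < e ->
  u * v <= q -> C / q / e <= C / u / e / v.
Proof.
move=> C0 u0 v0 e0 uv; have uv0 : 0 < u * v by rewrite mulr_gt0.
have -> : C / u / e / v = C / (u * v) / e by field; rewrite !gt_eqF.
by rewrite ler_wpM2r ?invr_ge0 ?(ltW e0)// ler_wpM2l// lef_pV2 ?posrE// (lt_le_trans uv0).
Qed.

Lemma level_arith (R : realType) (a t s c b : R) : 0 < s ->
  c * ((b * (a * t) + t) / (2 * s)) = c * ((b * a + 1) / 2) / s * t.
Proof. by move=> s0; field; rewrite gt_eqF. Qed.

Lemma rate_arith (R : realType) (X Ks rho a L eta t : R) : 0 < t -> 0 < L -> 0 < a ->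
  L * X <= Ks * t + 2 * rho * (a * t) -> Ks <= L * eta / 2 -> rho <= L * eta / (4 * a) ->
  X <= eta * t.
Proof.
move=> t0 L0 a0 k1 k2; rewrite ler_pdivlMr ?mulr_gt0// => k3.
rewrite -(ler_pM2l L0); apply: (le_trans k1).
have k4 : Ks * t <= L * eta / 2 * t by rewrite ler_wpM2r// ltW.
have k5 : rho * (4 * a) * t <= L * eta * t by rewrite ler_wpM2r// ltW.
by lra.
Qed.

Lemma coupling_arith (R : realType) (y X z : R) : 0 < y -> X <= y ^+ 2 ->
  z <= (y^-1 * X + (y^-1)^-1) / 2 -> z <= y.
Proof.
move=> y0 k1; rewrite invrK => k2; apply: (le_trans k2).
have k3 : y^-1 * X <= y^-1 * y ^+ 2 by rewrite ler_wpM2l// invr_ge0 ltW.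
have k4 : y^-1 * y ^+ 2 = y by field; rewrite gt_eqF.
by lra.
Qed.

Lemma deviation_arith (R : realType) (L b s r e x : R) : 0 <= s ->
  x <= L * (b * (s / r) / (1 - L)) -> L * (b / (1 - L)) / r <= e -> x <= e * s.
Proof.
move=> s0 k1 k2; apply: (le_trans k1); have := ler_wpM2r s0 k2.
by congr (_ <= _); set i := r^-1; set k := (1 - L)^-1; ring.
Qed.

Section hawkes_asymptotics.
Context d (Omega : measurableType d) (R : realType) (P : probability Omega R).
Variables (F : R -> set (set Omega)) (pi : nat -> R.-ker Omega ~> (R * R)%type)
  (mu Lambda : R) (h phi : R -> R) (m : R -> R) (Z : nat -> nat -> R -> Omega -> R).
Hypotheses (hF : filtration F) (hpi : iid_poisson_measures P F pi)
  (hmu : 0 < mu) (hh : forall x : R, h x = mu + x)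
  (phi_ge0 : forall s : R, 0 <= s -> 0 <= phi s)
  (phi_meas : measurable_fun (`[0, +oo[ : set R) phi)
  (hLambda :
     (\int[lebesgue_measure]_(s in `[0%R, +oo[) (phi s)%:E)%E = Lambda%:E)
  (Lambda_lt1 : Lambda < 1)
  (hm : mean_field_limit h phi m)
  (hZ : forall N, (1 <= N)%N -> mean_field_hawkes P F pi h phi N (Z N)).

Local Notation f := (causal phi).
Local Notation a0 := (mu / (1 - Lambda)).
Local Notation lim := (limit_rate_of mu f m).
Local Notation D := (subgraph lim).

Let mf := measurable_causal phi_meas.
Let f0 := causal_ge0 phi_ge0.
Let fL := integral_causal phi_ge0 phi_meas hLambda.
Let fneg v : v <= 0 -> f v = 0. Proof. by move=> v0; rewrite /causal ltNge v0. Qed.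
Let mP : is_cumulative m. Proof. by apply: (@limit_cumulative R mu h phi m). Qed.
Let m0 : m 0 = 0. Proof. by apply: (@limit0 R h phi m). Qed.
Let mE t : 0 <= t -> ((m t)%:E = (mu * t)%:E +
  \int[lebesgue_measure]_v ((f v)%:E * (extend0 m (t - v))%:E))%E.
Proof. by move=> t0; apply: (@limit_convolution R mu Lambda h phi m). Qed.
Let m_le t : 0 <= t -> m t <= a0 * t.
Proof. by move=> t0; apply: (@limit_le R mu Lambda h phi m). Qed.
Let L1' : 0 < 1 - Lambda. Proof. by rewrite subr_gt0. Qed.
Let a0_gt0 : 0 < a0. Proof. by rewrite divr_gt0. Qed.
Let m_ge t : 0 <= t -> mu * t <= m t.
Proof. by move=> t0; apply: (@limit_ge R mu Lambda h phi m). Qed.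

Let m_gt0 t : 0 < t -> 0 < m t.
Proof. by move=> t0; apply: lt_le_trans (m_ge (ltW t0)); rewrite mulr_gt0. Qed.
Let sqrt_m t : 0 < t -> Num.sqrt mu * Num.sqrt t <= Num.sqrt (m t).
Proof. by move=> t0; rewrite -sqrtrM ?(ltW hmu)// ler_wsqrtr// m_ge// ltW. Qed.

Let sys N (hN : (0 < N)%N) := hawkes_system_exists hF hpi hmu hh phi_ge0 phi_meas hLambda
  hm (hZ hN).

Let pos N j : (j < N)%N -> (0 < N)%N. Proof. exact: leq_ltn_trans. Qed.

Lemma particle_L1 N j t : (j < N)%N -> 0 <= t -> L1 P (Z N j t).
Proof.
move=> jN t0; have [good [kap [Y [[mg Pg] hs YZ _ mZ]]]] := sys (pos jN).
by have [] := Ex_ae_eq mg Pg (mZ j t jN t0) (hs_L1 hs j t0) (fun w gw => esym (YZ j t w jN gw)).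
Qed.

Lemma particle_dist N j t : (j < N)%N -> 0 < t ->
  Ex P (fun w => `|Z N j t w - m t|) <= (a0 + 1) / 2 / (1 - Lambda) * Num.sqrt t.
Proof.
move=> jN t0; have [good [kap [Y [[mg Pg] hs YZ _ mZ]]]] := sys (pos jN).
have mZ' : measurable_fun setT (fun w => `|Z N j t w - m t|).
  exact: (L1_measurable (L1_norm (L1B (particle_L1 jN (ltW t0)) (L1_cst P (m t))))).
have iY : L1 P (fun w => `|Y j t w - m t|).
  exact: (L1_norm (L1B (hs_L1 hs j (ltW t0)) (L1_cst P (m t)))).
have e w : good w -> `|Z N j t w - m t| = `|Y j t w - m t| by move=> gw; rewrite YZ.
have [_ ->] := Ex_ae_eq mg Pg mZ' iY e.
exact: (Ex_count_dist hs hmu (pos jN) mf f0 fneg fL Lambda_lt1 mP m0 mE m_le jN t0).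
Qed.

Lemma particle_ratio_dist : exists2 C, 0 <= C & forall N j t, (j < N)%N -> 0 < t ->
  L1 P (fun w => `|Z N j t w / m t - 1|) /\
  Ex P (fun w => `|Z N j t w / m t - 1|) <= C / Num.sqrt (m t).
Proof.
set K := (a0 + 1) / 2 / (1 - Lambda).
have K0 : 0 <= K by rewrite !divr_ge0 ?(ltW L1')// addr_ge0 ?(ltW a0_gt0).
(* Since m t >= mu t, the quotient sqrt t / m t is at most 1 / (sqrt mu sqrt (m t)). *)
exists (K / Num.sqrt mu); first by rewrite divr_ge0 ?sqrtr_ge0.
move=> N j t jN t0; have mt := m_gt0 t0.
have iZ : L1 P (fun w => `|Z N j t w - m t|).
  exact: (L1_norm (L1B (particle_L1 jN (ltW t0)) (L1_cst P (m t)))).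
have e w : `|Z N j t w / m t - 1| = (m t)^-1 * `|Z N j t w - m t|.
  transitivity `|(m t)^-1 * (Z N j t w - m t)|; first by congr `|_|; field; rewrite gt_eqF.
  by rewrite normrM gtr0_norm ?invr_gt0.
split.
  rewrite (_ : (fun w => `|_|) = (fun w => (m t)^-1 * `|Z N j t w - m t|)); first exact: L1Zl.
  exact/funext.
rewrite (@eq_Ex _ _ _ P _ _ e) ExZl//.
apply: (@le_trans _ _ ((m t)^-1 * (K * Num.sqrt t))).
  by rewrite ler_pM2l ?invr_gt0//; exact: particle_dist.
have := @ratio_arith R K (Num.sqrt mu) (Num.sqrt t) (Num.sqrt (m t)) K0.
by rewrite sqr_sqrtr ?(ltW mt)//; apply; rewrite ?sqrtr_gt0//; exact: sqrt_m.
Qed.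

(** The bound in mean does not involve N, so Markov's inequality bounds the whole supremum. *)
Lemma particle_ratio_uniform i eps : 0 < eps ->
  ereal_sup [set P [set w | eps < `|Z N i t w / m t - 1|]
            | N in [set N | (i < N)%N]] @[t --> +oo] --> 0%E.
Proof.
move=> eps0; have [C C0 HC] := particle_ratio_dist.
pose s t := ereal_sup [set P [set w | eps < `|Z N i t w / m t - 1|] | N in [set N | (i < N)%N]].
have bnd e : 0 < e -> \forall t \near +oo, (0 <= s t <= e%:E)%E.
  move=> e0; have C1 : 0 <= C / Num.sqrt mu / eps by rewrite !divr_ge0 ?sqrtr_ge0 ?(ltW eps0).
  have [t0 Ht] := inv_sqrt_small C1 e0; exists t0; split; first exact: num_real.
  move=> t /Ht[tp k]; apply/andP; split.
    apply: le_trans (ereal_sup_ubound _); last by exists i.+1 => /=.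
    exact: measure_ge0.
  apply: ge_ereal_sup => _ [N /= iN <-]; have [iL hE] := HC N i t iN tp.
  rewrite -[P _]fineK; last first.
    by apply: fin_num_measure; apply: measurable_superlevel; exact: L1_measurable iL.
  rewrite lee_fin; apply: (le_trans (markov_Ex eps0 iL (fun=> normr_ge0 _))).
  apply: le_trans k; apply: (@le_trans _ _ (C / Num.sqrt (m t) / eps)).
    by rewrite ler_wpM2r// invr_ge0 ltW.
  by apply: ratio_arith2; rewrite ?sqrtr_gt0//; exact: sqrt_m.
apply/fine_cvgP; split.
  by apply: filterS (bnd 1 ltr01) => t /andP[k1 k2]; rewrite ge0_fin_numE// (le_lt_trans k2)// ltry.
apply/cvgrPdist_le => e e0; apply: filterS (bnd e e0) => t /andP[k1 k2] /=.
rewrite sub0r normrN ger0_norm ?fine_ge0// -lee_fin fineK//.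
by rewrite ge0_fin_numE// (le_lt_trans k2)// ltry.
Qed.

Let mlim : measurable_fun setT lim.
Proof. exact: (measurable_lim_rate mu mf f0 mP). Qed.
Let mD t : measurable (D t). Proof. exact: measurable_subgraph. Qed.
Let Dq t : D t `<=` quadrant.
Proof.
by move=> [s z] [/= /andP[s0 _] /andP[z0 _]]; split; rewrite /= in_itv/= ?z0 ?(ltW s0).
Qed.
Let aD t : 0 <= t -> area (D t) = (m t)%:E.
Proof. by move=> t0; rewrite -(area_limit hmu mf f0 fneg fL mP m0 mE). Qed.

(** Counted in the original Poisson measure rather than in the modified kernel, so that the law and
    the independence are those given by the hypotheses. The mass is finite almost surely, so [fine]
    acts on a null set. *)
Let count j t w := fine (pi j w (D t)).

Let mcount j t : measurable_fun setT (count j t).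
Proof. by apply: measurableT_comp => //; exact: measurable_kernel. Qed.

Let count_L1 j t : 0 <= t -> L1 P (count j t).
Proof.
move=> t0; have fle (x : \bar R) : (0 <= x)%E -> ((fine x)%:E <= x)%E.
  by case: x => [r|_|] //=; rewrite leey.
apply/integrableP; split; first exact/measurable_EFinP.
apply: (@le_lt_trans _ _ (\int[P]_w pi j w (D t))%E).
  apply: ge0_le_integral_any => w _ //.
  by rewrite /= ger0_norm ?fine_ge0// fle.
by rewrite (poisson_measure_mean hpi)// aD// ltry.
Qed.

(** The threshold N0 depends on eps alone: the splitting of the kernel is chosen from eps, and N0
    from the splitting. The difference of the compensated counts and the deviation of the cumulated
    intensity take half of the bound each. *)
Lemma coupling_dist eps : 0 < eps -> exists N0 : nat, forall N j t, (N0 <= N)%N -> (j < N)%N ->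
  1 <= t -> Ex P (fun w => `|Z N j t w - count j t w|) <= eps * Num.sqrt t.
Proof.
move=> eps0; pose e2 := eps / 2; pose eta := e2 ^+ 2.
have e20 : 0 < e2 by rewrite divr_gt0.
have eta0 : 0 < eta by rewrite exprn_gt0.
(* With this remainder 2 rho a0 t is at most half of (1 - Lambda) eta t; the step part takes the
   other half through the choice of N0. *)
have rho00 : 0 < (1 - Lambda) * eta / (4 * a0) by apply: divr_gt0; apply: mulr_gt0.
have [n [c [beta [B [r [rho [[c0 mB] [B0 Bb] [mr r0] fE [rI rle]]]]]]]] :=
  kernel_decomposition mf f0 fneg fL rho00.
pose K := \sum_k c k * ((beta k * a0 + 1) / 2).
have beta0 k : 0 <= beta k by rewrite -lee_fin -Bb measure_ge0.
have K0 : 0 <= K.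
  apply: sumr_ge0 => k _; apply: mulr_ge0 => //; apply: divr_ge0 => //; apply: addr_ge0 => //.
  by apply: mulr_ge0 => //; exact: ltW.
have Lam0 : 0 <= Lambda by exact: (kernel_mass_ge0 f0 fL).
pose K2 := Lambda * ((a0 + 1) / 2 / (1 - Lambda)).
have K20 : 0 <= K2 by rewrite mulr_ge0// !divr_ge0 ?(ltW L1')// addr_ge0 ?(ltW a0_gt0).
have Le0 : 0 < (1 - Lambda) * eta / 2 by rewrite divr_gt0 ?mulr_gt0.
have [t1 H1] := inv_sqrt_small K0 Le0; have [t2 H2] := inv_sqrt_small K20 e20.
exists (Num.trunc (Num.max t1 t2)).+1 => N j t N0N jN t1'.
have t0 : 0 < t by rewrite (lt_le_trans ltr01).
have NR : (Num.trunc (Num.max t1 t2)).+1%:R <= N%:R :> R by rewrite ler_nat.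
have := lt_le_trans (truncnS_gt (Num.max t1 t2)) NR.
rewrite gt_max => /andP[/H1[_ {}H1] /H2[_ {}H2]].
have hN := pos jN; have [good [kap [Y [[mg Pg] hs YZ [kE kfin] mZ]]]] := sys hN.
have st0 : 0 < Num.sqrt t by rewrite sqrtr_gt0.
have sN0 : 0 < Num.sqrt N%:R :> R by rewrite sqrtr_gt0 ltr0n.
have h1 := Ex_rate_dist hs hmu hN mf f0 fneg fL Lambda_lt1 mP m0 mE
  (ltW t0) c0 mB B0 Bb mr r0 fE rI.
have sE : \sum_k c k * ((beta k * (a0 * t) + t) / (2 * Num.sqrt N%:R)) = K / Num.sqrt N%:R * t.
  by rewrite /K !mulr_suml; apply: eq_bigr => k _; exact: level_arith.
rewrite sE in h1; have h2 := rate_arith t0 L1' a0_gt0 h1 H1 rle.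
(* The mean area between the two rates is at most y^2, so that e = 1 / y makes the coupling bound at
   most y. *)
pose y := e2 * Num.sqrt t; have y0 : 0 < y by rewrite mulr_gt0.
have yE : y ^+ 2 = eta * t by rewrite exprMn sqr_sqrtr// ltW.
have yi : 0 < y^-1 by rewrite invr_gt0.
have h3 := Ex_coupling hs hmu hN mf f0 fneg fL mP m0 mE kfin jN (ltW t0) yi.
rewrite -yE in h2; have {}h3 := coupling_arith y0 h2 h3.
have h4 := Ex_cum_rate_dev hs hmu hN mf f0 fneg fL Lambda_lt1 mP m0 mE m_le t0.
have {}h4 := deviation_arith (ltW st0) h4 H2.
have mk : measurable_fun setT (fun w => fine (kap j w (D t))).
  by apply: measurableT_comp => //; exact: measurable_kernel.
have kec w : good w -> fine (kap j w (D t)) = count j t w by move=> gw; rewrite kE.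
have [ik _] := Ex_ae_eq mg Pg mk (count_L1 j (ltW t0)) kec.
have iY := hs_L1 hs j (ltW t0).
have ic := cum_rate_L1 hs hmu hN mf f0 fneg fL (ltW t0).
have im := L1_cst P (m t).
have mZk : measurable_fun setT (fun w => `|Z N j t w - count j t w|).
  exact: (L1_measurable (L1_norm (L1B (particle_L1 jN (ltW t0)) (count_L1 j (ltW t0))))).
have iYk : L1 P (fun w => `|Y j t w - fine (kap j w (D t))|) by exact: (L1_norm (L1B iY ik)).
have e w : good w -> `|Z N j t w - count j t w| = `|Y j t w - fine (kap j w (D t))|.
  by move=> gw; rewrite YZ// kec.
have [_ ->] := Ex_ae_eq mg Pg mZk iYk e.
have i1 := L1_norm (L1B (L1B iY ic) (L1B ik im)).
have i2 := L1_norm (L1B ic im).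
apply: (@le_trans _ _ (y + e2 * Num.sqrt t)); last by rewrite /y /e2; lra.
apply: le_trans (lerD h3 h4); rewrite -ExD//; apply: le_Ex => //; first exact: L1D.
move=> w; set q := fine _.
rewrite (_ : Y j t w - q = (Y j t w - cum_rate mu f N Y t w - (q - m t)) +
  (cum_rate mu f N Y t w - m t)); last by ring.
exact: ler_normD.
Qed.

Let stdized (x : \bar R) t : R := (fine x - m t) / Num.sqrt (m t).

Let mstd t : measurable_fun setT (stdized ^~ t).
Proof.
apply: measurable_funM => //; apply: measurable_funB => //; exact: measurable_fine.
Qed.

Let W (tN : R * nat) j w := stdized (pi j w (D tN.1)) tN.1.

Let mW tN j : measurable_fun setT (W tN j).
Proof. by apply: (measurableT_comp (mstd tN.1)); exact: measurable_kernel. Qed.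

Lemma standardized_independent tN l (B : 'I_l -> set R) : (forall k, measurable (B k)) ->
  P [set w | forall k : 'I_l, B k (W tN k w)] = (\prod_k P [set w | B k (W tN k w)])%E.
Proof.
move=> mB; have [_ ind] := hpi.
(* Independence is indexed by all integers and particles by ['I_l]. Quantifying over the particles
   of index i defines the event for every integer without choosing a particle. *)
pose E (i : nat) : set Omega := [set w | forall k : 'I_l, k = i :> nat -> B k (W tN k w)].
have EE (k : 'I_l) : E k = [set w | B k (W tN k w)].
  by apply/seteqP; split => w /=; [apply|move=> ? k' /val_inj ->].
pose J := seq_fset tt (iota 0 l).
have inJ i : (i \in J) = (i < l)%N by rewrite seq_fsetE mem_iota.
have EJ i : i \in J -> sigma_restr (pi i) quadrant (E i).
  rewrite inJ => il; pose k := Ordinal il.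
  have -> : E i = (pi i ^~ (D tN.1)) @^-1` ((stdized ^~ tN.1) @^-1` B k) by exact: (EE k).
  apply: sub_sigma_algebra; exists (D tN.1) => //.
  exists ((stdized ^~ tN.1) @^-1` B k); last by rewrite setTI.
  by rewrite -[X in measurable X]setTI; exact: mstd.
have := ind J E EJ.
have -> : \bigcap_(i in [set` J]) E i = [set w | forall k : 'I_l, B k (W tN k w)].
  apply/seteqP; split => w /= k1.
    by move=> k; apply: (k1 k _ k) => //=; rewrite inJ.
  by move=> i _ k _; exact: k1.
move=> ->; rewrite (perm_big (iota 0 l)); last first.
  by apply: uniq_perm; [exact: fset_uniq|exact: iota_uniq|exact: seq_fsetE].
rewrite (_ : iota 0 l = index_iota 0 l); last by rewrite /index_iota subn0.
by rewrite big_mkord; apply: eq_bigr => k _; rewrite EE.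
Qed.

(** Both sides are means of the same function of a variable with Poisson masses on the integers, one
    on [Omega] and one on nat, so [integral_poisson] expands them into the same series. *)
Lemma standardized_law tN k c e : 0 < tN.1 -> P [set w | c < W tN k w <= e] =
  poisson_prob (m tN.1) 0%N
    [set n | c < standardized (m tN.1) (Num.sqrt (m tN.1))^-1 n <= e].
Proof.
move=> t0; set t := tN.1 in t0 *; have mt := m_gt0 t0.
pose S : set (\bar R) := [set x | c < stdized x t <= e].
have mS : measurable S.
  have := mstd t measurableT (measurable_itv `]c, e]); rewrite setTI.
  by congr (measurable _); apply/seteqP; split => x /=; rewrite in_itv.
pose fs (x : \bar R) : \bar R := (\1_S x)%:E.
have mfs : measurable_fun setT fs by apply/measurable_EFinP; exact: measurable_indic.
have fs0 (x : \bar R) : (0 <= x)%E -> (0 <= fs x)%E by move=> _; rewrite lee_fin indicE.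
have indicI d' (T : measurableType d') (Q : probability T R) (X : T -> \bar R) :
    measurable_fun setT X -> (\int[Q]_w fs (X w) = Q (X @^-1` S))%E.
  move=> mX; rewrite -[in RHS](setIT (X @^-1` S)) -integral_indic//.
  by rewrite -[X in measurable X]setTI; exact: mX.
pose Xp w := pi k w (D t).
have mXp : measurable_fun setT Xp by exact: measurable_kernel.
have Xp0 w : (0 <= Xp w)%E by exact: measure_ge0.
have [/(_ k)[[law _] _ _] _] := hpi.
have Dfin : (area (D t) < +oo)%E by rewrite aD ?ltry// ltW.
have lawp n : P [set w | Xp w = n%:R%:E] = poisson_prob (m t) 0%N [set n].
  have k1 : P [set w | Xp w = n%:R%:E] = poisson_prob (fine (area (D t))) 0%N [set n].
    exact: (law (D t) (mD t) (@Dq t) Dfin n).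
  by rewrite k1 aD// ltW.
have e1 := @integral_poisson R _ _ P (m t) Xp fs (ltW mt) mXp mfs fs0 Xp0 lawp.
pose Xn (n : nat) : \bar R := n%:R%:E.
have mXn : measurable_fun setT Xn by [].
have Xn0 n : (0 <= Xn n)%E by rewrite lee_fin.
have lawn n : poisson_prob (m t) 0%N [set k | Xn k = n%:R%:E] = poisson_prob (m t) 0%N [set n].
  congr (poisson_prob _ _ _); apply/seteqP; split => i /=; last by move=> ->.
  by move=> e3; apply/eqP; rewrite -(eqr_nat R); apply/eqP; exact: (EFin_inj e3).
have e2 := @integral_poisson R _ _ (poisson_prob (m t) 0%N) (m t) Xn fs (ltW mt) mXn mfs fs0 Xn0 lawn.
have := indicI _ _ P Xp mXp; rewrite e1 -e2 (indicI _ _ _ Xn mXn) => <-.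
by [].
Qed.

Lemma fluctuations_cvg_in_law l : (1 <= l)%N ->
  cvg_in_law P (filter_prod (pinfty_nbhs R) \oo)
    (fun (tN : R * nat) w => \row_(i < l) (Num.sqrt (m tN.1) *
       (Z tN.2 (i : nat) tN.1 w / m tN.1 - 1)))
    (std_normal l).
Proof.
case: l => [//|l] _.
pose X (tN : R * nat) (k : 'I_l.+1) w :=
  Num.sqrt (m tN.1) * (Z tN.2 (k : nat) tN.1 w / m tN.1 - 1).
have mX : \forall tN \near filter_prod (pinfty_nbhs R) \oo,
    forall k, measurable_fun setT (X tN k).
  apply: filterS (near_prod_pinfty (0 : R) l.+1) => tN [t0 lN] k.
  have iZ := particle_L1 (leq_trans (ltn_ord k) lN) (ltW t0).
  apply: measurable_funM => //; apply: measurable_funB => //; apply: measurable_funM => //.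
  exact: L1_measurable iZ.
apply: (@cvg_in_law_approx _ _ _ P _ _ _ l X (fun tN k => W tN k) mX) => //.
- by move=> tN B mB; exact: standardized_independent.
- move=> k c e ce; apply/cvgrPdist_le => eps eps0.
  have [a1 a10 Ha] := poisson_clt ce eps0.
  apply: filterS (near_prod_pinfty (a1 / mu) 0%N) => tN [ta _].
  have t0 : 0 < tN.1 by apply: lt_trans ta; rewrite divr_gt0.
  rewrite distrC standardized_law//; apply: Ha; apply: le_trans (m_ge (ltW t0)).
  by move: ta; rewrite ltr_pdivrMr// mulrC => /ltW.
- move=> k dl dl0; apply/cvgrPdist_le => e e0.
  have mu0 : 0 < Num.sqrt mu by rewrite sqrtr_gt0.
  (* Markov's inequality will divide by dl and by sqrt (m t) >= sqrt mu sqrt t, which leaves e. *)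
  have eps0 : 0 < e * dl * Num.sqrt mu by rewrite !mulr_gt0.
  have [N0 HN] := coupling_dist eps0.
  apply: filterS (near_prod_pinfty (1 : R) (maxn N0 l.+1)) => -[t N] /= [t1].
  rewrite geq_max => /andP[N0N lN]; have t0 : 0 < t by exact: lt_trans t1.
  have kN := leq_trans (ltn_ord k) lN; have mt := m_gt0 t0.
  have sm0 : 0 < Num.sqrt (m t) by rewrite sqrtr_gt0.
  have XW w : `|X (t, N) k w - W (t, N) k w| =
      (Num.sqrt (m t))^-1 * `|Z N k t w - count k t w|.
    transitivity `|(Num.sqrt (m t))^-1 * (Z N k t w - count k t w)|; last first.
      by rewrite normrM gtr0_norm ?invr_gt0.
    congr `|_|; rewrite /X /W /stdized /count/=.
    have -> : Num.sqrt (m t) * (Z N k t w / m t - 1) = (Z N k t w - m t) / Num.sqrt (m t).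
      by rewrite -{2 3}(sqr_sqrtr (ltW mt)); field; rewrite gt_eqF.
    by field; rewrite gt_eqF.
  have iD : L1 P (fun w => (Num.sqrt (m t))^-1 * `|Z N k t w - count k t w|).
    exact: (L1Zl _ (L1_norm (L1B (particle_L1 kN (ltW t0)) (count_L1 k (ltW t0))))).
  rewrite sub0r normrN ger0_norm ?fine_ge0//.
  under eq_set do rewrite XW.
  apply: (le_trans (markov_Ex dl0 iD _)).
    by move=> w; rewrite mulr_ge0// invr_ge0 ltW.
  rewrite ExZl; last exact: (L1_norm (L1B (particle_L1 kN (ltW t0)) (count_L1 k (ltW t0)))).
  have := HN N k t N0N kN (ltW t1); have := sqrt_m t0.
  set q := Num.sqrt (m t) in sm0 *; set v := Num.sqrt t; set x := Ex P _ => k1 k2.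
  rewrite ler_pdivrMr// mulrC ler_pdivrMr//; apply: (le_trans k2).
  by rewrite -!mulrA ler_pM2l// ler_pM2l.
Qed.

End hawkes_asymptotics.

Theorem theorem10 (R : realType) (d : measure_display)
  (Omega : measurableType d) (P : probability Omega R)
  (F : R -> set (set Omega)) (pi : nat -> R.-ker Omega ~> (R * R)%type)
  (mu Lambda : R) (h phi : R -> R) (m : R -> R)
  (Z : nat -> nat -> R -> Omega -> R)
  (hF : filtration F)
  (hpi : iid_poisson_measures P F pi)
  (hmu : 0 < mu)
  (hh : forall x : R, h x = mu + x)
  (phi_ge0 : forall s : R, 0 <= s -> 0 <= phi s)
  (phi_meas : measurable_fun (`[0, +oo[ : set R) phi)
  (phi_sqr : forall T : R, 0 <= T ->
     (\int[lebesgue_measure]_(s in `[0%R, T]) (phi s ^+ 2)%:E < +oo)%E)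
  (hLambda :
     (\int[lebesgue_measure]_(s in `[0%R, +oo[) (phi s)%:E)%E = Lambda%:E)
  (Lambda_lt1 : Lambda < 1)
  (hm : mean_field_limit h phi m)
  (hZ : forall N, (1 <= N)%N -> mean_field_hawkes P F pi h phi N (Z N)) :
  m t / (mu / (1 - Lambda) * t) @[t --> +oo] --> (1 : R)
  /\
  (forall i : nat,
     (forall eps : R, 0 < eps ->
        ereal_sup [set P [set w | eps < `|Z N i t w / m t - 1|]
                  | N in [set N | (i < N)%N]] @[t --> +oo] --> 0%E) /\
     exists C : R, forall (N : nat) (t : R), (i < N)%N -> 0 < t ->
       ('E_P[fun w => (`|Z N i t w / m t - 1|)%R] <= (C / Num.sqrt (m t))%:E)%E)
  /\
  (forall l : nat, (1 <= l)%N ->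
     cvg_in_law P (filter_prod (pinfty_nbhs R) \oo)
       (fun (tN : R * nat) w =>
          \row_(i < l) (Num.sqrt (m tN.1) *
                        (Z tN.2 (i : nat) tN.1 w / m tN.1 - 1)))
       (std_normal l)).
Proof.
split; first exact: (limit_equivalent hmu hh phi_ge0 phi_meas hLambda Lambda_lt1 hm).
split; last exact: (fluctuations_cvg_in_law hF hpi hmu hh phi_ge0 phi_meas hLambda Lambda_lt1 hm hZ).
move=> i; split.
  exact: (particle_ratio_uniform hF hpi hmu hh phi_ge0 phi_meas hLambda Lambda_lt1 hm hZ).
have [C _ HC] := particle_ratio_dist hF hpi hmu hh phi_ge0 phi_meas hLambda Lambda_lt1 hm hZ.
exists C => N t iN t0; have [iL k] := HC N i t iN t0.
by rewrite unlock -(ExE iL) lee_fin.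
Qed.
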